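(* The $\mathfrak{sp}(4,\mathbb{C})$-module $(\rho'_2,\mathring{\mathcal{W}}'_{1/2})$ contains the invariant subspace $E$ equal to the $\mathbb{C}$-span of: $N(Z)^{k+\frac12}\mathbf{M}^0_0(Z)$ and $\mathbf{C}^m_{k+\frac12,l}(Z)$ with $k\in\mathbb{Z}$, $l\ge0$; and $N(Z)^{k+\frac12}\mathbf{T}^m_l(Z)$, $N(Z)^{k+\frac12}\mathbf{M}^m_l(Z)$ with $k\in\mathbb{Z}$, $l\ge0$, $-(l+1)\le k\le-1$ (all admissible $m$). The quotient $\mathring{\mathcal{W}}'_{1/2}/E$ decomposes into a direct sum of two irreducible modules, with $K$-types $$\mathbb{C}\text{-span}\{N(Z)^{k+\frac12}\mathbf{T}^m_l(Z),\ N(Z)^{k+\frac12}\mathbf{M}^m_{l+1}(Z):\ k\ge0,\ l\ge0\},$$ isomorphic to $(\pi_{dl},\mathcal{F}^+)\simeq(\pi_{dr},\mathcal{G}^+)$ as $\mathfrak{sp}(4,\mathbb{C})$-modules, and $$\mathbb{C}\text{-span}\{N(Z)^{k+\frac12}\mathbf{T}^m_l(Z),\ N(Z)^{k-\frac12}\mathbf{M}^m_{l+1}(Z):\ l\ge0,\ k\le-(l+2)\},$$ isomorphic to $(\pi_{dl},\mathcal{F}^-)\simeq(\pi_{dr},\mathcal{G}^-)$ as $\mathfrak{sp}(4,\mathbb{C})$-modules.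
   Context: $\mathfrak{sp}(4,\mathbb{C})=\{\begin{pmatrix} A & B \\ C & -A^T \end{pmatrix}:B^T=B,\,C^T=C\}\subset\mathfrak{gl}(4,\mathbb{C})$ ($2\times2$ blocks); $K$-types are with respect to the subalgebra $\{B=C=0\}$ (real form $\mathfrak{u}(2)$: $A^*=-A$). The module $\mathring{\mathcal{W}}'_{1/2}$. Let $Z=\begin{pmatrix} z_{11} & z_{12} \\ z_{12} & z_{22} \end{pmatrix}$ be a complex symmetric matrix, $z_{12}=it$, coordinates $z_{11},z_{22},t$, $N(Z)=\det Z=z_{11}z_{22}+t^2$, $\partial=\begin{pmatrix} \partial_{z_{11}} & -\frac i2\partial_t \\ -\frac i2\partial_t & \partial_{z_{22}} \end{pmatrix}$. $\mathring{\mathcal{W}}'_{1/2}=\mathrm{Sym}\otimes N(Z)^{1/2}\cdot\mathbb{C}[z_{11},z_{12},z_{22},N(Z)^{-1}]$, where $\mathrm{Sym}$ is the space of complex symmetric $2\times2$ matrices, with action $\rho'_2$: $A$ (meaning $\begin{pmatrix} A & 0 \\ 0 & -A^T \end{pmatrix}$): $F\mapsto-\mathrm{Tr}(AZ\partial+ZA^T\partial+2A)F+AF+FA^T$; $B$: $F\mapsto-\mathrm{Tr}(B\partial)F$; $C$: $F\mapsto\mathrm{Tr}(ZCZ\partial+2ZC)F-ZCF-FCZ$. Solid harmonics: $P^m_l(x)=\frac{(-1)^m}{2^ll!}(1-x^2)^{m/2}\frac{d^{l+m}}{dx^{l+m}}(x^2-1)^l$; for $l\ge0$, $|m|\le l$,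 $R^m_l(Z)$ is the homogeneous polynomial of degree $l$ in $z_{11},z_{22},t$ that for $z_{11}=z$, $z_{22}=\bar z$, $t\in\mathbb{R}$, $r=\sqrt{|z|^2+t^2}$ equals $r^l(z/|z|)^mP^m_l(t/r)$; $R^m_l=0$ if $|m|>l$ or $l<0$. Put $\mathbf{T}^m_l=\begin{pmatrix} R^{m+1}_l & i(l+m+1)R^m_l \\ i(l+m+1)R^m_l & -(l+m)(l+m+1)R^{m-1}_l \end{pmatrix}$ ($-l-1\le m\le l+1$), $\mathbf{M}^m_l=\begin{pmatrix} R^{m+1}_l & i m R^m_l \\ i m R^m_l & (l+m)(l-m+1)R^{m-1}_l \end{pmatrix}$ ($-l\le m\le l$), $\mathbf{B}^m_l=\begin{pmatrix} R^{m+1}_l & -i(l-m)R^m_l \\ -i(l-m)R^m_l & -(l-m)(l-m+1)R^{m-1}_l \end{pmatrix}$ ($-l+1\le m\le l-1$), $\mathbf{C}^m_{k+\frac12,l}=(2k+1)N(Z)^{k-\frac12}\mathbf{B}^m_{l+1}-2(k+l+1)N(Z)^{k+\frac12}\mathbf{T}^m_{l-1}$ ($k\in\mathbb{Z}$, $l\ge0$, $-l\le m\le l$; $\mathbf{T}_{-1}=0$). Doubly regular functions. Now let $Z=(z_{ij})$ be an arbitrary complex $2\times2$ matrix, $N(Z)=\det Z$, $\partial_{ij}=\partial/\partial z_{ij}$, $\partial=\begin{pmatrix} \partial_{11} & \partial_{21} \\ \partial_{12} & \partial_{22} \end{pmatrix}$, $\nabla^+=2\begin{pmatrix} \partial_{22}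 & -\partial_{21} \\ -\partial_{12} & \partial_{11} \end{pmatrix}$, $\mathbb{S}=\mathbb{C}^2$ (columns), $\mathbb{S}'=\mathbb{C}^2$ (rows), $\odot$ the symmetric part of the tensor product. $\mathcal{F}^+=\{f\in(\mathbb{S}\odot\mathbb{S})\otimes\mathbb{C}[z_{ij}]:(\nabla^+\otimes1)f=(1\otimes\nabla^+)f=0\}$, $\mathcal{F}^-=\{f\in(\mathbb{S}\odot\mathbb{S})\otimes\mathbb{C}[z_{ij},N(Z)^{-1}]:N(Z)^{-1}(Z^{-1}\otimes Z^{-1})f(Z^{-1})\in\mathcal{F}^+\}$, $\mathcal{G}^+=\{g\in(\mathbb{S}'\odot\mathbb{S}')\otimes\mathbb{C}[z_{ij}]:g\overleftarrow{(\nabla^+\otimes1)}=g\overleftarrow{(1\otimes\nabla^+)}=0\}$, $\mathcal{G}^-=\{g\in(\mathbb{S}'\odot\mathbb{S}')\otimes\mathbb{C}[z_{ij},N(Z)^{-1}]:N(Z)^{-1}g(Z^{-1})(Z^{-1}\otimes Z^{-1})\in\mathcal{G}^+\}$. $\mathfrak{gl}(4,\mathbb{C})\ni\begin{pmatrix} A & B \\ C & D \end{pmatrix}$ acts by $\pi_{dl}$: $A:f\mapsto-\mathrm{Tr}(AZ\partial)f$, $B:f\mapsto-\mathrm{Tr}(B\partial)f$, $C:f\mapsto\mathrm{Tr}(ZCZ\partial+CZ)f+(CZ\otimes1+1\otimes CZ)f$, $D:f\mapsto\mathrm{Tr}(ZD\partial+D)f+(D\otimes1+1\otimes D)f$; and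 by $\pi_{dr}$: $A:g\mapsto-\mathrm{Tr}(AZ\partial+A)g-g(A\otimes1+1\otimes A)$, $B:g\mapsto-\mathrm{Tr}(B\partial)g$, $C:g\mapsto\mathrm{Tr}(ZCZ\partial+ZC)g+g(ZC\otimes1+1\otimes ZC)$, $D:g\mapsto\mathrm{Tr}(ZD\partial)g$. These are restricted to $\mathfrak{sp}(4,\mathbb{C})$. *)

(* Defs.v *)
From HB Require Import structures.
From mathcomp Require Import all_boot all_order all_algebra.
From mathcomp Require Import generic_quotient ring_quotient.
From mathcomp Require Import boolp classical_sets functions.
From mathcomp Require Import mpoly.
From mathcomp Require Import ring.

Set Implicit Arguments.
Unset Strict Implicit.
Unset Printing Implicit Defensive.

Import Order.TTheory GRing.Theory Num.Theory.

Local Open Scope classical_set_scope.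
Local Open Scope ring_scope.

Section Subspaces.
Variables (C : fieldType) (V : lmodType C).

Definition lsubspace (U : set V) : Prop :=
  U 0 /\ forall a u v, U u -> U v -> U (a *: u + v).

Definition lspan (S : set V) : set V := smallest lsubspace S.

Lemma lspan_lsubspace S : lsubspace (lspan S).
Proof.
split=> [U [[U0 _] _] //|a u v Su Sv U [sU SU]].
by apply: sU.2; [apply: Su | apply: Sv].
Qed.

Definition dsum2 (U U1 U2 : set V) : Prop :=
  [/\ lsubspace U1, lsubspace U2,
      U = [set u | exists u1 u2, [/\ U1 u1, U2 u2 & u = u1 + u2]]
    & U1 `&` U2 = [set 0]].

(* U is the internal direct sum of the subspaces F j, for j in D. *)
Definition dsum (J : choiceType) (D : set J) (F : J -> set V) (U : set V) :=
  [/\ forall j, D j -> lsubspace (F j),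
      U = lspan (\bigcup_(j in D) F j)
    & forall (s : seq J) (u : J -> V), uniq s ->
        (forall j, j \in s -> D j /\ F j (u j)) ->
        \sum_(j <- s) u j = 0 -> forall j, j \in s -> u j = 0].

End Subspaces.

(* The quotient V / lspan S. *)
Section QuotientSpace.
Variables (C : fieldType) (V : lmodType C) (S : set V).

Definition span_pred : {pred V} := [pred v | `[< lspan S v >]].

Lemma span_predP v : reflect (lspan S v) (v \in span_pred).
Proof. exact: asboolP. Qed.

Lemma span_pred_zmod_closed : zmod_closed span_pred.
Proof.
have [S0 SD] := lspan_lsubspace S.
split=> [|u v /span_predP Su /span_predP Sv]; first exact/span_predP.
apply/span_predP; rewrite -[u - v]addrC -scaleN1r; exact: SD.
Qed.

HB.instance Definition _ :=
  GRing.isZmodClosed.Build V span_pred span_pred_zmod_closed.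

Definition quot : Type := Quotient.quot (span_pred : zmodClosed V).

HB.instance Definition _ := GRing.Zmodule.on quot.

Definition qpi (v : V) : quot :=
  (\pi_(Quotient.quot (span_pred : zmodClosed V)) v)%qT.
Definition qrepr (q : quot) : V :=
  repr (q : Quotient.quot (span_pred : zmodClosed V)).

Lemma qreprK q : qpi (qrepr q) = q.
Proof. exact: reprK. Qed.

Lemma qpi_eq u v : (qpi u = qpi v) <-> lspan S (u - v).
Proof.
split=> [/eqP|Suv].
  by rewrite -Quotient.idealrBE => /span_predP.
by apply/eqP; rewrite -Quotient.idealrBE; apply/span_predP.
Qed.

Lemma qpiD u v : qpi (u + v) = qpi u + qpi v.
Proof. exact: Quotient.pi_add. Qed.

Definition qscale (a : C) (q : quot) : quot := qpi (a *: qrepr q).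

Lemma qpiZ a v : qpi (a *: v) = qscale a (qpi v).
Proof.
apply/qpi_eq; rewrite -scalerBr -[_ *: _]addr0.
have [S0 SD] := lspan_lsubspace S.
by apply: (SD) => //; apply/qpi_eq; rewrite qreprK.
Qed.

Fact qscaleA a b q : qscale a (qscale b q) = qscale (a * b) q.
Proof. by rewrite -[q]qreprK -!qpiZ scalerA. Qed.
Fact qscale1 : left_id 1 qscale.
Proof. by move=> q; rewrite -[q]qreprK -qpiZ scale1r. Qed.
Fact qscaleDr : right_distributive qscale +%R.
Proof.
by move=> a p q; rewrite -[p]qreprK -[q]qreprK -qpiD -!qpiZ -qpiD scalerDr.
Qed.
Fact qscaleDl q : {morph qscale^~ q : a b / a + b}.
Proof. by move=> a b; rewrite -[q]qreprK -!qpiZ -qpiD scalerDl. Qed.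

HB.instance Definition _ := GRing.Zmodule_isLmodule.Build C quot
  qscaleA qscale1 qscaleDr qscaleDl.

End QuotientSpace.

(* A set g of 4 x 4 matrices in 2 x 2 blocks (in practice a Lie subalgebra)
   acting on an lmodType; the modules are subspaces of that lmodType. *)
Section LieModules.
Variables (C : fieldType) (g : set 'M[C]_(2 + 2)).

Definition submodule (V : lmodType C) (act : 'M[C]_(2 + 2) -> V -> V)
    (U : set V) : Prop :=
  lsubspace U /\ forall X u, g X -> U u -> U (act X u).

Definition irreducible_module (V : lmodType C)
    (act : 'M[C]_(2 + 2) -> V -> V) (U : set V) : Prop :=
  [/\ submodule act U, U <> [set 0]
    & forall U', submodule act U' -> U' `<=` U -> U' = [set 0] \/ U' = U].

Definition isomorphic_modules (V1 V2 : lmodType C)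
    (act1 : 'M[C]_(2 + 2) -> V1 -> V1) (U1 : set V1)
    (act2 : 'M[C]_(2 + 2) -> V2 -> V2) (U2 : set V2) : Prop :=
  submodule act1 U1 /\ submodule act2 U2 /\
  exists f : V1 -> V2,
    [/\ set_bij U1 U2 f,
        forall a u v, U1 u -> U1 v -> f (a *: u + v) = a *: f u + f v
      & forall X u, g X -> U1 u -> f (act1 X u) = act2 X (f u)].

End LieModules.

(* The action induced on V / lspan S; it is independent of the representatives
   on the image of any submodule containing lspan S when lspan S is invariant. *)
Definition qact (C : fieldType) (V : lmodType C) (S : set V)
    (act : 'M[C]_(2 + 2) -> V -> V) (X : 'M[C]_(2 + 2)) (q : quot S) : quot S :=
  qpi S (act X (qrepr q)).

Section SP4.
Variable C : fieldType.

Definition sp4 : set 'M[C]_(2 + 2) :=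
  [set X | [/\ (ursubmx X)^T = ursubmx X, (dlsubmx X)^T = dlsubmx X
             & drsubmx X = - (ulsubmx X)^T]].

Definition sp4_k : set 'M[C]_(2 + 2) :=
  [set X | [/\ sp4 X, ursubmx X = 0 & dlsubmx X = 0]].

(* The subspaces F j, for j in D, are the K-types of U. *)
Definition has_Ktypes (V : lmodType C) (act : 'M[C]_(2 + 2) -> V -> V)
    (J : choiceType) (D : set J) (F : J -> set V) (U : set V) : Prop :=
  dsum D F U /\ forall j, D j -> irreducible_module sp4_k act (F j).

End SP4.

Lemma quotient_rule (K : fieldType) (u v p q u' v' p' q' : K) :
  q != 0 -> v != 0 -> u * q = p * v ->
  u' * q + u * q' = p' * v + p * v' ->
  (u' * v - u * v') / v ^+ 2 = (p' * q - p * q') / q ^+ 2.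
Proof.
move=> q0 v0 e de; apply/eqP; rewrite eqr_div ?expf_neq0 // -subr_eq0.
have -> : (u' * v - u * v') * q ^+ 2 - (p' * q - p * q') * v ^+ 2 =
  q * v * (u' * q + u * q' - (p' * v + p * v'))
  - (u * q - p * v) * (q * v' + q' * v) by ring.
by rewrite e de !subrr mulr0 mul0r subr0.
Qed.

(* Rational functions in n variables; the algebras of polynomials and of
   polynomials in the variables and N(Z)^-1 are viewed inside this field. *)
Notation ratfun C n := {fraction {mpoly C[n]}}.

Section RationalFunctions.
Variables (C : numClosedFieldType) (n : nat).

Definition ofpoly (p : {mpoly C[n]}) : ratfun C n := FracField.tofrac p.
HB.instance Definition _ :=
  GRing.RMorphism.copy ofpoly (@FracField.tofrac {mpoly C[n]}).

Definition rcst (c : C) : ratfun C n := ofpoly c%:MP.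
Definition var (i : 'I_n) : ratfun C n := ofpoly 'X_i.

Definition rnum (x : ratfun C n) : {mpoly C[n]} := \n_(repr x).
Definition rden (x : ratfun C n) : {mpoly C[n]} := \d_(repr x).

Lemma rden_neq0 x : rden x != 0.
Proof. exact: denom_ratioP. Qed.

Lemma ofpoly_eq0 p : (ofpoly p == 0) = (p == 0).
Proof. exact: tofrac_eq0. Qed.

Lemma ratfunE x : x = ofpoly (rnum x) / ofpoly (rden x).
Proof.
apply: (canRL (mulfK _)); first by rewrite ofpoly_eq0 rden_neq0.
rewrite /ofpoly /rnum /rden -[x in x * _](@reprK _ _ x).
move: (repr x) => r.
rewrite !piE; apply/eqmodP.
rewrite /= FracField.equivfE /FracField.mulf.
rewrite !numden_Ratio ?mulf_neq0 ?oner_eq0 ?denom_ratioP //.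
by rewrite !mulr1 mulrC.
Qed.

(* The partial derivative with respect to the i-th variable. *)
Definition pd (i : 'I_n) (x : ratfun C n) : ratfun C n :=
  ofpoly ((rnum x)^`M(i) * rden x - rnum x * (rden x)^`M(i))
  / ofpoly (rden x) ^+ 2.

(* The definition is independent of the chosen numerator and denominator. *)
Lemma pdE i p q : q != 0 ->
  pd i (ofpoly p / ofpoly q) =
  ofpoly (p^`M(i) * q - p * q^`M(i)) / ofpoly q ^+ 2.
Proof.
move=> q0; set x := _ / _.
have a0 : ofpoly q != 0 by rewrite ofpoly_eq0.
have b0 : ofpoly (rden x) != 0 by rewrite ofpoly_eq0 rden_neq0.
have ofM u v : ofpoly (u * v) = ofpoly u * ofpoly v by exact: rmorphM.
have ofD u v : ofpoly (u + v) = ofpoly u + ofpoly v by exact: rmorphD.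
have ofB u v : ofpoly (u - v) = ofpoly u - ofpoly v by exact: rmorphB.
have e : rnum x * q = p * rden x.
  apply/eqP; rewrite -(tofrac_eq (rnum x * q)) -!/(ofpoly _) !ofM.
  by rewrite -(eqr_div _ _ b0 a0) -ratfunE.
have de : (rnum x)^`M(i) * q + rnum x * q^`M(i) =
          p^`M(i) * rden x + p * (rden x)^`M(i).
  by rewrite -!mderivM e.
move: e de => /(congr1 ofpoly) + /(congr1 ofpoly).
rewrite /pd !ofB !ofD !ofM.
move: (rnum x) (rden x) b0 => u v b0.
move: (ofpoly u) (ofpoly v) (ofpoly p) (ofpoly q) (ofpoly u^`M(i))
  (ofpoly v^`M(i)) (ofpoly p^`M(i)) (ofpoly q^`M(i)) a0 b0.
exact: quotient_rule.
Qed.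

(* x(w), the rational function w j being substituted for the j-th variable;
   it is meaningful when no nonzero polynomial vanishes at w, as is the case
   for the entries of Z^-1. *)
Definition rsubst (w : 'I_n -> (ratfun C n)) (x : ratfun C n) : ratfun C n :=
  mmap rcst w (rnum x) / mmap rcst w (rden x).

Definition is_poly (x : ratfun C n) : Prop := exists p, x = ofpoly p.

(* Membership in C[variables, d^-1]. *)
Definition is_poly_inv (d x : ratfun C n) : Prop :=
  exists p k, x = ofpoly p / d ^+ k.

(* 2 x 2 matrices of rational functions, as a vector space over C: 'M_2 itself
   is canonically a module over the field of rational functions. *)
Definition tens : Type := 'M[ratfun C n]_2.
HB.instance Definition _ := GRing.Zmodule.on tens.

Definition tens_scale (c : C) (F : tens) : tens :=
  (rcst c *: (F : 'M[ratfun C n]_2))%R.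
Fact tens_scaleA a b F : tens_scale a (tens_scale b F) = tens_scale (a * b) F.
Proof. by rewrite /tens_scale scalerA /rcst mpolyCM rmorphM. Qed.
Fact tens_scale1 : left_id 1 tens_scale.
Proof. by move=> F; rewrite /tens_scale /rcst rmorph1 scale1r. Qed.
Fact tens_scaleDr : right_distributive tens_scale +%R.
Proof. by move=> a F G; rewrite /tens_scale scalerDr. Qed.
Fact tens_scaleDl F : {morph tens_scale^~ F : a b / a + b}.
Proof. by move=> a b; rewrite /tens_scale /rcst mpolyCD rmorphD scalerDl. Qed.
HB.instance Definition _ := GRing.Zmodule_isLmodule.Build C tens
  tens_scaleA tens_scale1 tens_scaleDr tens_scaleDl.

End RationalFunctions.

Section Matrices2.
Variable n : nat.

Definition ent2 (T : Type) (a b c d : T) (i j : 'I_2) : T :=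
  if i == 0 then if j == 0 then a else b else if j == 0 then c else d.

Variable C : numClosedFieldType.

Definition cmx (A : 'M[C]_2) : 'M[ratfun C n]_2 := map_mx (@rcst C n) A.

(* A 2 x 2 matrix of operators on functions. *)
Definition opmx : Type := 'I_2 -> 'I_2 -> ratfun C n -> ratfun C n.

(* Tr(M D) F, the scalar operator Tr(M D) acting on each entry of F. *)
Definition trop (M : 'M[ratfun C n]_2) (D : opmx) (F : 'M[ratfun C n]_2) :
    'M[ratfun C n]_2 :=
  map_mx (fun x => \sum_i \sum_j M i j * D j i x) F.

End Matrices2.

(* Half-integer powers of N(Z) on symmetric matrices.  An element
   N(Z)^(1/2) G of W' is represented by G : tens C 3, i.e. N(Z)^(1/2) is a
   formal basis element on which derivations act by
   d (N^(1/2) x) = N^(1/2) (d x + 1/2 N^-1 (d N) x).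
   The variables 0, 1, 2 are z11, z22, t. *)
Section Symmetric.
Variable C : numClosedFieldType.

Definition Zs : 'M[ratfun C 3]_2 :=
  let z12 := rcst 3 'i * var C 2%:R in
  \matrix_(i, j) ent2 (var C 0) z12 z12 (var C 1) i j.
Definition Ns : ratfun C 3 := \det Zs.

Definition half_pd (i : 'I_3) (x : ratfun C 3) : ratfun C 3 :=
  pd i x + rcst 3 2^-1 * Ns^-1 * pd i Ns * x.

Definition dels : opmx 3 C :=
  let d12 x := - rcst 3 ('i / 2) * half_pd 2%:R x in
  ent2 (half_pd 0) d12 d12 (half_pd 1).

Definition W_half : set (tens C 3) :=
  [set F | (F : 'M_2)^T = F /\ forall i j, is_poly_inv Ns (F i j)].

Definition rho2_A (A : 'M[C]_2) (F : tens C 3) : tens C 3 :=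
  let A := cmx 3 A in
  - (trop (A *m Zs + Zs *m A^T) dels F + \tr (2 *: A) *: (F : 'M_2))
  + A *m F + F *m A^T.

Definition rho2_B (B : 'M[C]_2) (F : tens C 3) : tens C 3 :=
  - trop (cmx 3 B) dels F.

Definition rho2_C (D : 'M[C]_2) (F : tens C 3) : tens C 3 :=
  let D := cmx 3 D in
  trop (Zs *m D *m Zs) dels F + \tr (2 *: (Zs *m D)) *: (F : 'M_2)
  - Zs *m D *m F - F *m D *m Zs.

Definition rho2 (X : 'M[C]_(2 + 2)) (F : tens C 3) : tens C 3 :=
  rho2_A (ulsubmx X) F + rho2_B (ursubmx X) F + rho2_C (dlsubmx X) F.

Definition legendre (l : nat) (m : int) (x : C) : C :=
  (-1) ^ m / (2 ^+ l * l`!%:R) * sqrtC (1 - x ^+ 2) ^ m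
  * ((('X^2 - 1) ^+ l)^`(absz (l%:Z + m))).[x].

Definition is_solid_harmonic (l : nat) (m : int) (p : {mpoly C[3]}) : Prop :=
  p \is l.-homog /\
  forall z t : C, z != 0 -> t \is Num.real ->
    let r := sqrtC (`|z| ^+ 2 + t ^+ 2) in
    p.@[fun i => [:: z; z^*; t]`_i] =
      r ^+ l * (z / `|z|) ^ m * legendre l m (t / r).

(* is_solid_harmonic determines p, since the points (z, z^*, t) with z != 0
   are Zariski dense in C^3. *)
Definition solid_harmonic (l m : int) : {mpoly C[3]} :=
  if (0 <= l) && (`|m| <= l) then xget 0 (is_solid_harmonic `|l|%N m) else 0.

Definition Tmx (l m : int) : tens C 3 :=
  let R j := ofpoly (solid_harmonic l j) in
  let c := rcst 3 'i * (l + m + 1)%:~R * R m in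
  \matrix_(i, j) ent2 (R (m + 1)) c c
    (- ((l + m) * (l + m + 1))%:~R * R (m - 1)) i j.

Definition Mmx (l m : int) : tens C 3 :=
  let R j := ofpoly (solid_harmonic l j) in
  let c := rcst 3 'i * m%:~R * R m in
  \matrix_(i, j) ent2 (R (m + 1)) c c
    (((l + m) * (l - m + 1))%:~R * R (m - 1)) i j.

Definition Bmx (l m : int) : tens C 3 :=
  let R j := ofpoly (solid_harmonic l j) in
  let c := - (rcst 3 'i * (l - m)%:~R * R m) in
  \matrix_(i, j) ent2 (R (m + 1)) c c
    (- ((l - m) * (l - m + 1))%:~R * R (m - 1)) i j.

(* N(Z)^(k + 1/2) F; the factor N(Z)^(1/2) is implicit. *)
Definition Nhalf (k : int) (F : tens C 3) : tens C 3 :=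
  Ns ^ k *: (F : 'M_2).

(* C^m_(k + 1/2, l) *)
Definition Cmx (k l m : int) : tens C 3 :=
  (2 * k + 1)%:~R *: Nhalf (k - 1) (Bmx (l + 1) m)
  - (2 * (k + l + 1))%:~R *: Nhalf k (Tmx (l - 1) m).

Definition Tset (k l : int) : set (tens C 3) :=
  [set F | exists m, - l - 1 <= m <= l + 1 /\ F = Nhalf k (Tmx l m)].
Definition Mset (k l : int) : set (tens C 3) :=
  [set F | exists m, - l <= m <= l /\ F = Nhalf k (Mmx l m)].
Definition Cset (k l : int) : set (tens C 3) :=
  [set F | exists m, - l <= m <= l /\ F = Cmx k l m].

Definition E_gen : set (tens C 3) :=
  [set F | exists k, F = Nhalf k (Mmx 0 0)]
  `|` [set F | exists k l, 0 <= l /\ Cset k l F]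
  `|` [set F | exists k l,
         [/\ 0 <= l, - (l + 1) <= k <= -1 & (Tset k l `|` Mset k l) F]].

(* Each index (b, k, l) stands for one K-type, the span of the functions
   N(Z)^(k + 1/2) T^m_l if b, and N(Z)^(k + 1/2) M^m_(l+1), respectively
   N(Z)^(k - 1/2) M^m_(l+1), otherwise. *)
Definition Kindex : choiceType := (bool * int * int)%type.

Definition Dplus : set Kindex := [set j | 0 <= j.1.2 /\ 0 <= j.2].
Definition Kplus (j : Kindex) : set (tens C 3) :=
  let: (b, k, l) := j in if b then Tset k l else Mset k (l + 1).

Definition Dminus : set Kindex := [set j | 0 <= j.2 /\ j.1.2 <= - (j.2 + 2)].
Definition Kminus (j : Kindex) : set (tens C 3) :=
  let: (b, k, l) := j in if b then Tset k l else Mset (k - 1) (l + 1).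

End Symmetric.

(* Doubly regular functions.  A tensor sum_(a, b) f_ab e_a (x) e_b, in
   S (x) S or S' (x) S', is represented by the matrix f : tens C (2 * 2); it
   is in the symmetric part when f^T = f.  Thus (M (x) 1) f = M f,
   (1 (x) M) f = f M^T, and for rows g (M (x) 1) = M^T g,
   g (1 (x) M) = g M. *)
Section DoublyRegular.
Variable C : numClosedFieldType.
Local Notation F4 := (ratfun C (2 * 2)).

Definition Zg : 'M[F4]_2 := vec_mx (\row_k var C k).
Definition Ng : F4 := \det Zg.

Definition pdz (i j : 'I_2) : F4 -> F4 := pd (mxvec_index i j).

Definition delg : opmx (2 * 2) C := fun i j => pdz j i.

Definition nabla : opmx (2 * 2) C :=
  ent2 (fun x => 2 * pdz 1 1 x) (fun x => - (2 * pdz 1 0 x))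
       (fun x => - (2 * pdz 0 1 x)) (fun x => 2 * pdz 0 0 x).

(* f(Z^-1) *)
Definition at_inv (f : tens C (2 * 2)) : tens C (2 * 2) :=
  map_mx (rsubst (fun k => mxvec (invmx Zg) 0 k)) (f : 'M_2).

Definition Fplus : set (tens C (2 * 2)) :=
  [set f | [/\ (f : 'M_2)^T = f, forall a b, is_poly (f a b),
    forall a b, \sum_c nabla a c (f c b) = 0
    & forall a b, \sum_c nabla b c (f a c) = 0]].

Definition Fminus : set (tens C (2 * 2)) :=
  [set f | [/\ (f : 'M_2)^T = f, forall a b, is_poly_inv Ng (f a b)
    & Fplus (Ng^-1 *: (invmx Zg *m at_inv f *m (invmx Zg)^T))]].

Definition Gplus : set (tens C (2 * 2)) :=
  [set g | [/\ (g : 'M_2)^T = g, forall a b, is_poly (g a b),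
    forall a b, \sum_c nabla c a (g c b) = 0
    & forall a b, \sum_c nabla c b (g a c) = 0]].

Definition Gminus : set (tens C (2 * 2)) :=
  [set g | [/\ (g : 'M_2)^T = g, forall a b, is_poly_inv Ng (g a b)
    & Gplus (Ng^-1 *: ((invmx Zg)^T *m at_inv g *m invmx Zg))]].

Definition pi_dl (X : 'M[C]_(2 + 2)) (f : tens C (2 * 2)) : tens C (2 * 2) :=
  let A := cmx (2 * 2) (ulsubmx X) in
  let B := cmx (2 * 2) (ursubmx X) in
  let K := cmx (2 * 2) (dlsubmx X) in
  let D := cmx (2 * 2) (drsubmx X) in
  - trop (A *m Zg) delg f
  - trop B delg f
  + (trop (Zg *m K *m Zg) delg f + \tr (K *m Zg) *: (f : 'M_2)
     + K *m Zg *m f + f *m (K *m Zg)^T)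
  + (trop (Zg *m D) delg f + \tr D *: (f : 'M_2) + D *m f + f *m D^T).

Definition pi_dr (X : 'M[C]_(2 + 2)) (g : tens C (2 * 2)) : tens C (2 * 2) :=
  let A := cmx (2 * 2) (ulsubmx X) in
  let B := cmx (2 * 2) (ursubmx X) in
  let K := cmx (2 * 2) (dlsubmx X) in
  let D := cmx (2 * 2) (drsubmx X) in
  (- (trop (A *m Zg) delg g + \tr A *: (g : 'M_2)) - (A^T *m g + g *m A))
  - trop B delg g
  + (trop (Zg *m K *m Zg) delg g + \tr (Zg *m K) *: (g : 'M_2)
     + (Zg *m K)^T *m g + g *m (Zg *m K))
  + trop (Zg *m D) delg g.

End DoublyRegular.

(* Main.v *)
Require Import Defs.
From mathcomp Require Import all_boot all_order all_algebra.
From mathcomp Require Import boolp classical_sets functions reals.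
From mathcomp Require Import complex.
From HB Require Import structures.
From mathcomp Require Import generic_quotient ring_quotient mpoly ring zify.
Import Order.TTheory GRing.Theory Num.Theory.
Local Open Scope classical_set_scope.
Local Open Scope ring_scope.

Set Implicit Arguments.
Unset Strict Implicit.
Unset Printing Implicit Defensive.

(** Let e, f, h be the sl2-triple of the block A, d the action of the scalar A
and b, c the actions of E11 in the blocks B and C.  As R^m_l is a multiple of
e^(l+m) z22^l, every K-type is a string of e-translates of one vector killed by
f, and strings are separated by the eigenvalues of d, of the Casimir operator
and of h.  A subspace stable under e, f, d, b, c is a submodule, so everything
reduces to the expansion of b and c on the lowest vectors: some coefficients
vanish at the boundary of E and of the two families of K-types, and the others
connect all K-types of each family, whence irreducibility.

F+ is irreducible because a vector killed by the block B is constant, while on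
doubly regular functions E (E + 2), E the Euler operator, is a combination of
the operators of the block C composed with derivatives.  Two irreducible modules
with isomorphic lowest K-type are isomorphic: the submodule of the product
generated by the graph of the isomorphism of the lowest K-types is again a
graph.  F- is F+ twisted by the inversion Z |-> Z^-1, and G+, G- are obtained
from F+, F- by the transposition of Z. *)

(** * Calculus of rational functions *)

(** The obstacle is that the eigenvalues of d, Casimir and h do not separate the strings of W:
    N^(k+1/2) T_l and C_(k+1/2, l+1) are isomorphic K-types of the same degree. In the quotient by E
    every C vanishes, the labels become separated and arguments on eigenvalues apply; only the fact
    that the remaining lowest vectors lie outside E needs a comparison of matrix entries. The
    boundaries come from the half-integral exponents: in the expansions of b and c the factors 2k +
    odd never vanish, while k + l + 1 (for b) and k + 1 (for c) do, precisely at the lower and at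
    the upper boundary of E. For F+ the difficulty is that E (E + 2) involves the whole block C of
    gl(4), while sp(4) has only its symmetric part. The antisymmetric operator is recovered on
    constants, where it equals a combination of symmetric ones applied to other constants, and
    commutativity of the block C propagates this. The three actions are instances of one first order
    operator, whose symbol is the vector field of the fractional linear action on Z. *)

Section RatCalc.
Variables (C : numClosedFieldType) (n : nat).
Local Notation K := (ratfun C n).
Implicit Types x y : K.

HB.instance Definition _ := GRing.RMorphism.copy (@rcst C n) ((@ofpoly C n) \o (@mpolyC n C)).

End RatCalc.

Definition derivation (K : pzRingType) (D : K -> K) : Prop :=
  (forall x y, D (x + y) = D x + D y) /\ forall x y, D (x * y) = D x * y + x * D y.

Section RingDerivation.
Variables (K : pzRingType) (D : K -> K).
Hypothesis derD : derivation D.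

Lemma derD_add x y : D (x + y) = D x + D y. Proof. exact: derD.1. Qed.
Lemma derD_mul x y : D (x * y) = D x * y + x * D y. Proof. exact: derD.2. Qed.
Lemma derD0 : D 0 = 0.
Proof. by apply: (addrI (D 0)); rewrite -derD_add !addr0. Qed.
Lemma derDN x : D (- x) = - D x.
Proof. by apply: (addrI (D x)); rewrite -derD_add !subrr derD0. Qed.
Lemma derDB x y : D (x - y) = D x - D y.
Proof. by rewrite derD_add derDN. Qed.
Lemma derD1 : D 1 = 0.
Proof.
by apply: (addrI (D 1)); rewrite addr0 -{3}[1]mulr1 derD_mul mul1r mulr1.
Qed.
Lemma derD_sum (I : Type) (r : seq I) (P : pred I) F :
  D (\sum_(i <- r | P i) F i) = \sum_(i <- r | P i) D (F i).
Proof. exact: (big_morph D derD_add derD0). Qed.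
End RingDerivation.

Section Derivation.
Variables (K : fieldType) (D : K -> K).
Hypothesis derD : derivation D.

Lemma derDV x : D x^-1 = - (D x / x ^+ 2).
Proof.
have [->|x0] := eqVneq x 0; first by rewrite invr0 (derD0 derD) mul0r oppr0.
apply: (mulfI x0); apply: (addrI (D x * x^-1)).
rewrite -(derD_mul derD) mulfV // (derD1 derD); field; exact: x0.
Qed.
Lemma derD_div x y : y != 0 -> D (x / y) = (D x * y - x * D y) / y ^+ 2.
Proof. by move=> y0; rewrite (derD_mul derD) derDV; field; exact: y0. Qed.
Lemma derDX x n : D (x ^+ n.+1) = n.+1%:R * x ^+ n * D x.
Proof.
elim: n => [|n IH]; first by rewrite expr1 expr0 !mul1r.
by rewrite exprS (derD_mul derD) IH [x ^+ n.+1]exprS [n.+2%:R]mulrS; ring.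
Qed.
Lemma derDXz x (k : int) : x != 0 -> D (x ^ k) = k%:~R * (D x / x) * x ^ k.
Proof.
move=> x0; case: k => [[|n]|n].
- by rewrite expr0z (derD1 derD) !mul0r.
- rewrite -exprnP derDX exprS pmulrn; field; exact: x0.
rewrite -[x ^ Negz n]/(x ^- n.+1) derDV derDX NegzE intrN -pmulrn [x ^+ n.+1]exprS.
have := expf_neq0 n x0; move: (x ^+ n) => y y0.
by field; rewrite y0 x0.
Qed.
End Derivation.

Lemma derivation_comm (K : fieldType) (D E : K -> K) :
  derivation D -> derivation E -> derivation (fun x => D (E x) - E (D x)).
Proof.
move=> dD dE; split=> x y /=.
  by rewrite (derD_add dE) (derD_add dD) (derD_add dD) (derD_add dE); ring.
rewrite (derD_mul dE) (derD_mul dD) !(derD_add dE) !(derD_add dD).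
by rewrite !(derD_mul dE) !(derD_mul dD); ring.
Qed.

Lemma mnm_ind n (P : 'X_{1..n} -> Prop) :
  P 0%MM -> (forall i m, P m -> P (U_(i) + m)%MM) -> forall m, P m.
Proof.
move=> P0 PS m; move: {-1}(mdeg m) (erefl (mdeg m)) => d.
elim: d m => [|d IH] m md; first by move/eqP: md; rewrite mdeg_eq0 => /eqP ->.
have [i mi] : exists i, m i != 0%N.
  apply/existsP; apply/contra_eqT: md; rewrite negb_exists => /forallP m0.
  suff -> : m = 0%MM by rewrite mdeg0.
  by apply/mnmP => i; rewrite mnm0E; apply/eqP; have := m0 i; rewrite negbK.
have le : (U_(i) <= m)%MM.
  by apply/mnm_lepP => j; rewrite mnm1E; case: (eqVneq i j) => [<-|//]; rewrite lt0n.
rewrite -(submK le) addmC; apply: PS; apply: IH; apply: succn_inj.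
by rewrite -md -[in RHS](submK le) mdegD mdeg1 addn1.
Qed.

Lemma quotient_derD (K : fieldType) (p q p' q' dp dq dp' dq' : K) :
  q != 0 -> q' != 0 ->
  ((dp * q' + p * dq' + (dp' * q + p' * dq)) * (q * q')
    - (p * q' + p' * q) * (dq * q' + q * dq')) / (q * q') ^+ 2
  = (dp * q - p * dq) / q ^+ 2 + (dp' * q' - p' * dq') / q' ^+ 2.
Proof. by move=> q0 q'0; field; rewrite q0 q'0. Qed.

Lemma quotient_derM (K : fieldType) (p q p' q' dp dq dp' dq' : K) :
  q != 0 -> q' != 0 ->
  ((dp * p' + p * dp') * (q * q') - p * p' * (dq * q' + q * dq')) / (q * q') ^+ 2
  = (dp * q - p * dq) / q ^+ 2 * (p' / q')
    + p / q * ((dp' * q' - p' * dq') / q' ^+ 2).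
Proof. by move=> q0 q'0; field; rewrite q0 q'0. Qed.

Lemma quotient_chain (K : fieldType) (p q dp dq d : K) : q != 0 ->
  (dp * d * q - p * (dq * d)) / q ^+ 2 = (dp * q - p * dq) / q ^+ 2 * d.
Proof. by move=> q0; field. Qed.

Section ChainRule.
Variables (C R : comNzRingType) (n : nat) (f : {rmorphism C -> R}) (w : 'I_n -> R).
Variable D : R -> R.
Hypothesis (dD : derivation D) (Df : forall c, D (f c) = 0).
Local Notation mw := (mmap f w).

Lemma der_mmap p : D (mw p) = \sum_j mw p^`M(j) * D (w j).
Proof.
elim/mpolyind: p => [|c m p _ _ IH].
  by rewrite mmap0 (derD0 dD) big1 // => j _; rewrite mderiv0 mmap0 mul0r.
rewrite mmapD (derD_add dD) IH.
under [RHS]eq_bigr do rewrite mderivD mmapD mulrDl.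
rewrite big_split /=; congr (_ + _).
rewrite mmapZ (derD_mul dD) Df mul0r add0r.
under [RHS]eq_bigr do rewrite mderivZ mmapZ -mulrA.
rewrite -mulr_sumr; congr (_ * _).
elim/mnm_ind: m => [|i m' IHm]; last first.
  have mX k : mw 'X_k = w k by rewrite mmapX mmap1U.
  rewrite mpolyXD rmorphM (derD_mul dD) IHm /= mX.
  under [RHS]eq_bigr do rewrite mderivM mmapD !rmorphM mulrDl /= mX.
  rewrite big_split /=; congr (_ + _); last first.
    by rewrite (big_distrr (w i)) /=; apply: eq_bigr => j _; rewrite mulrA.
  rewrite (bigD1 i) //= big1 ?addr0; last first.
    move=> j ji; rewrite mderivX mnm1E eq_sym (negbTE ji) scale0r mmap0.
    by rewrite !mul0r.
  rewrite mderivX mnm1E eqxx scale1r.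
  have -> : (U_(i) - U_(i) = 0 :> 'X_{1..n})%MM.
    by apply/mnmP => k; rewrite mnmBE subnn mnm0E.
  by rewrite mpolyX0 rmorph1 mul1r mulrC.
rewrite mpolyX0 rmorph1 (derD1 dD) big1 // => j _.
by rewrite -mpolyC1 mderivC mmap0 mul0r.
Qed.
End ChainRule.

(** In characteristic zero a nonzero polynomial has an iterated derivative that is a nonzero
    constant. This replaces degree arguments three times: for the injectivity of substitutions, for
    Zariski density, and for functions with zero gradient. *)
Lemma mderiv_closed_eq0 (F : numDomainType) n (P : {mpoly F[n]} -> Prop) :
  (forall p i, P p -> P p^`M(i)) -> (forall c, P c%:MP -> c = 0) ->
  forall p, P p -> p = 0.
Proof.
move=> Pd PC.
suff H k : forall p, (forall m, p@_m != 0 -> (mdeg m < k)%N) -> P p -> p = 0.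
  move=> p; apply: (H (msize p)) => m; rewrite -mcoeff_msupp.
  exact: msize_mdeg_lt.
elim: k => [|k IH] p pk Pp.
  by apply/mpolyP => m; rewrite mcoeff0; apply/eqP/contraT => /pk.
have dp i : p^`M(i) = 0.
  apply: IH (Pd _ i Pp) => m.
  rewrite mcoeff_deriv => H; have : p@_(m + U_(i)) != 0.
    by apply: contraNneq H => ->; rewrite mul0rn.
  by move/pk; rewrite mdegD mdeg1 addn1.
have pE : p = (p@_0)%:MP.
  apply/mpolyP => m; rewrite mcoeffC.
  have [->|m0] := eqVneq m 0%MM; first by rewrite mulr1.
  have [i mi] : exists i, m i != 0%N.
    apply/existsP; apply: contraNT m0; rewrite negb_exists => /forallP m0.
    by apply/eqP/mnmP => i; rewrite mnm0E; apply/eqP; have := m0 i; rewrite negbK.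
  have := congr1 (mcoeff (m - U_(i))) (dp i).
  rewrite mcoeff_deriv mcoeff0 submK; last first.
    by apply/mnm_lepP => j; rewrite mnm1E; case: (eqVneq i j) => [<-|//]; rewrite lt0n.
  by move=> /eqP; rewrite mulrn_eq0 /= => /eqP ->; rewrite mulr0.
by rewrite pE in Pp *; rewrite (PC _ Pp) mpolyC0.
Qed.

Section RatCalc.
Variables (C : numClosedFieldType) (n : nat).
Local Notation K := (ratfun C n).
Local Notation ofp := (@ofpoly C n).
Local Notation pd := (@pd C n).
Implicit Types x y : K.

Lemma ofpD : {morph ofp : p q / p + q}. Proof. exact: rmorphD. Qed.
Lemma ofpM : {morph ofp : p q / p * q}. Proof. exact: rmorphM. Qed.
Lemma ofpN : {morph ofp : p / - p}. Proof. exact: rmorphN. Qed.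
Lemma ofpB : {morph ofp : p q / p - q}. Proof. exact: rmorphB. Qed.
Lemma ofp1 : ofp 1 = 1. Proof. exact: rmorph1. Qed.
Lemma ofp0 : ofp 0 = 0. Proof. exact: rmorph0. Qed.
Lemma ofpX k : {morph ofp : p / p ^+ k}. Proof. exact: rmorphXn. Qed.
Lemma ofp_inj : injective ofp. Proof. by move=> p q /eqP; rewrite tofrac_eq => /eqP. Qed.
Lemma ofpC (c : C) : ofp c%:MP = rcst n c. Proof. by []. Qed.
Lemma ofpXi i : ofp 'X_i = var C i. Proof. by []. Qed.

Lemma ratP x : exists p q, q != 0 /\ x = ofp p / ofp q.
Proof. by exists (rnum x), (rden x); rewrite rden_neq0 -ratfunE. Qed.

Lemma pd_ofp i p : pd i (ofp p) = ofp p^`M(i).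
Proof.
rewrite -[ofp p]divr1 -ofp1 pdE ?oner_eq0 // ofp1 expr1n divr1.
by rewrite mulr1 -mpolyC1 mderivC mulr0 subr0.
Qed.

Lemma pd_derivation i : derivation (pd i).
Proof.
split=> x y; have [p [q [q0 ->]]] := ratP x; have [p' [q' [q'0 ->]]] := ratP y;
  (have Q0 : ofp q != 0 by rewrite ofpoly_eq0);
  (have Q'0 : ofp q' != 0 by rewrite ofpoly_eq0).
  rewrite (addf_div _ _ Q0 Q'0) -!ofpM -ofpD (pdE i _ (mulf_neq0 q0 q'0)).
  rewrite (pdE i _ q0) (pdE i _ q'0) mderivD !mderivM !(ofpD, ofpB, ofpN, ofpM).
  exact (quotient_derD _ _ _ _ _ _ Q0 Q'0).
rewrite mulf_div -!ofpM (pdE i _ (mulf_neq0 q0 q'0)) (pdE i _ q0) (pdE i _ q'0).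
rewrite !mderivM !(ofpD, ofpB, ofpN, ofpM).
exact (quotient_derM _ _ _ _ _ _ Q0 Q'0).
Qed.

Lemma pd_rcst i (c : C) : pd i (rcst n c) = 0.
Proof. by rewrite pd_ofp mderivC ofp0. Qed.

Lemma pd_var i j : pd i (var C j) = (i == j)%:R.
Proof.
rewrite pd_ofp mderivX mnm1E.
case: eqVneq => [->|ji]; last by rewrite scale0r ofp0.
rewrite scale1r -ofp1; congr ofp; rewrite -mpolyX0; congr mpolyX.
by apply/mnmP => k; rewrite mnmBE subnn mnm0E.
Qed.

(** The commutator is a derivation that vanishes on polynomials, hence on fractions. *)
Lemma pd_comm i j x : pd i (pd j x) = pd j (pd i x).
Proof.
have dE := derivation_comm (pd_derivation i) (pd_derivation j).
set E := fun x => _ in dE; apply/eqP; rewrite -subr_eq0 -/(E x); apply/eqP.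
have Ep p : E (ofp p) = 0 by rewrite /E !pd_ofp mderiv_comm subrr.
have [p [q [q0 ->]]] := ratP x.
by rewrite (derD_div dE) ?ofpoly_eq0 // !Ep mul0r mulr0 subrr mul0r.
Qed.

Lemma rcst_eq0 (c : C) : (rcst n c == 0) = (c == 0).
Proof. by rewrite ofpoly_eq0 mpolyC_eq0. Qed.

Lemma rcstD (a b : C) : rcst n (a + b) = rcst n a + rcst n b.
Proof. exact: (rmorphD (@rcst C n)). Qed.
Lemma rcstM (a b : C) : rcst n (a * b) = rcst n a * rcst n b.
Proof. exact: (rmorphM (@rcst C n)). Qed.
Lemma rcstN (a : C) : rcst n (- a) = - rcst n a.
Proof. exact: (rmorphN (@rcst C n)). Qed.
Lemma rcst1 : rcst n (1 : C) = 1.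
Proof. exact: (rmorph1 (@rcst C n)). Qed.
Lemma rcst0 : rcst n (0 : C) = 0.
Proof. exact: (rmorph0 (@rcst C n)). Qed.
Lemma rcst_nat k : rcst n (k%:R : C) = k%:R.
Proof. exact: (rmorph_nat (@rcst C n)). Qed.
Lemma rcst_int k : rcst n (k%:~R : C) = k%:~R.
Proof. exact: (rmorph_int (@rcst C n)). Qed.
Lemma rcstV (a : C) : rcst n a^-1 = (rcst n a)^-1.
Proof. exact: (fmorphV (@rcst C n)). Qed.

Section Subst.
Variable w : 'I_n -> K.
Local Notation mw := (mmap (@rcst C n) w).

Lemma mwD : {morph mw : p q / p + q}. Proof. exact: mmapD. Qed.
Lemma mwB : {morph mw : p q / p - q}. Proof. exact: mmapB. Qed.
Lemma mwM : {morph mw : p q / p * q}. Proof. exact: rmorphM. Qed.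
Lemma mwXn k : {morph mw : p / p ^+ k}. Proof. exact: rmorphXn. Qed.
Lemma mwC (c : C) : mw c%:MP = rcst n c. Proof. exact: mmapC. Qed.
Lemma mwX i : mw 'X_i = w i. Proof. by rewrite mmapX mmap1U. Qed.

Lemma der_mw (D : K -> K) p : derivation D -> (forall c : C, D (rcst n c) = 0) ->
  D (mw p) = \sum_j mw p^`M(j) * D (w j).
Proof. by move=> dD Dc; exact (der_mmap (f := @rcst C n) w dD Dc p). Qed.

(* The derivations dual to the w j exist when the Jacobian of w is invertible. *)
Hypothesis wdual : forall k, exists D, [/\ derivation D,
  forall c : C, D (rcst n c) = 0 & forall j, D (w j) = (j == k)%:R].

(** The derivation dual to [w i], applied to p(w) = 0, shows that the i-th partial derivative of p
    vanishes at w too, so the polynomials vanishing at w are closed under derivatives. This makes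
    [rsubst] independent of the chosen fraction. *)
Lemma mw_eq0 p : mw p = 0 -> p = 0.
Proof.
apply: (mderiv_closed_eq0 (P := fun p => mw p = 0)) => {}p.
  move=> i p0; have [D [dD Dc Dw]] := wdual i.
  have := der_mw p dD Dc; rewrite p0 (derD0 dD) (bigD1 i) //= big1 ?addr0.
    by rewrite Dw eqxx mulr1 => <-.
  by move=> j ji; rewrite Dw (negbTE ji) mulr0.
by rewrite mwC => /eqP; rewrite rcst_eq0 => /eqP.
Qed.

Lemma mw_neq0 p : p != 0 -> mw p != 0.
Proof. by apply: contraNneq => /mw_eq0 ->. Qed.

Lemma rsubst_div p q : q != 0 -> rsubst w (ofp p / ofp q) = mw p / mw q.
Proof.
move=> q0; rewrite /rsubst; set x := ofp p / ofp q; set u := rnum x.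
set v := rden x.
have v0 : v != 0 by exact: rden_neq0.
have E : mw u * mw q = mw p * mw v.
  rewrite -(mwM u q) -(mwM p v); congr mw.
  apply: ofp_inj; rewrite (ofpM u) (ofpM p).
  have Q0 : ofp q != 0 by rewrite ofpoly_eq0.
  have V0 : ofp v != 0 by rewrite ofpoly_eq0.
  apply/eqP; rewrite -(eqr_div _ _ V0 Q0); apply/eqP.
  exact (esym (ratfunE x)).
by apply/eqP; rewrite (eqr_div _ _ (mw_neq0 v0) (mw_neq0 q0)); apply/eqP.
Qed.

Lemma rsubst_ofp p : rsubst w (ofp p) = mw p.
Proof.
rewrite -[ofp p]divr1 -ofp1 rsubst_div ?oner_eq0 //.
by rewrite rmorph1 divr1.
Qed.
Lemma rsubst_rcst (c : C) : rsubst w (rcst n c) = rcst n c.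
Proof. by rewrite rsubst_ofp mwC. Qed.
Lemma rsubst_var i : rsubst w (var C i) = w i.
Proof. by rewrite rsubst_ofp mwX. Qed.

Lemma rsubst_add : {morph rsubst w : x y / x + y}.
Proof.
move=> x y; have [p [q [q0 ->]]] := ratP x; have [p' [q' [q'0 ->]]] := ratP y.
have Q0 : ofp q != 0 by rewrite ofpoly_eq0.
have Q'0 : ofp q' != 0 by rewrite ofpoly_eq0.
rewrite (addf_div _ _ Q0 Q'0) -!ofpM -ofpD (rsubst_div _ (mulf_neq0 q0 q'0)).
rewrite (rsubst_div _ q0) (rsubst_div _ q'0) mwD !mwM.
by rewrite (addf_div _ _ (mw_neq0 q0) (mw_neq0 q'0)).
Qed.
Lemma rsubst_mul : {morph rsubst w : x y / x * y}.
Proof.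
move=> x y; have [p [q [q0 ->]]] := ratP x; have [p' [q' [q'0 ->]]] := ratP y.
rewrite mulf_div -!ofpM (rsubst_div _ (mulf_neq0 q0 q'0)).
by rewrite (rsubst_div _ q0) (rsubst_div _ q'0) !mwM mulf_div.
Qed.

Lemma der_rsubst (D : K -> K) x : derivation D -> (forall c : C, D (rcst n c) = 0) ->
  D (rsubst w x) = \sum_j rsubst w (pd j x) * D (w j).
Proof.
move=> dD Dc; have [p [q [q0 ->]]] := ratP x.
have Q0 := mw_neq0 q0.
rewrite (rsubst_div _ q0) (derD_div dD _ Q0) !(der_mw _ dD Dc).
have sE j : rsubst w (pd j (ofp p / ofp q)) =
    (mw p^`M(j) * mw q - mw p * mw q^`M(j)) / mw q ^+ 2.
  rewrite (pdE j p q0) -ofpX (rsubst_div _ (expf_neq0 2 q0)).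
  by rewrite mwXn mwB (mwM _ q) (mwM p).
under [RHS]eq_bigr => j _ do rewrite sE.
rewrite mulr_suml mulr_sumr -sumrB mulr_suml; apply: eq_bigr => j _.
exact (quotient_chain _ _ _ _ Q0).
Qed.
End Subst.

(** Serves to check on the variables alone that inversion and transposition of Z are involutions and
    commute. *)
Lemma rmorph_rat_eq (f g : K -> K) :
  {morph f : x y / x + y} -> {morph f : x y / x * y} -> f 1 = 1 ->
  {morph g : x y / x + y} -> {morph g : x y / x * y} -> g 1 = 1 ->
  (forall c : C, f (rcst n c) = g (rcst n c)) ->
  (forall i, f (var C i) = g (var C i)) -> f =1 g.
Proof.
move=> fD fM f1 gD gM g1 fgc fgv x.
have f0 : f 0 = 0 by apply: (addrI (f 0)); rewrite -fD !addr0.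
have g0 : g 0 = 0 by apply: (addrI (g 0)); rewrite -gD !addr0.
have fgp p : f (ofp p) = g (ofp p).
  elim/mpolyind: p => [|c m p _ _ IH]; first by rewrite ofp0 f0 g0.
  rewrite ofpD fD gD IH -mul_mpolyC ofpM fM gM fgc; congr (_ * _ + _).
  elim/mnm_ind: m => [|i m' IHm]; first by rewrite mpolyX0 ofp1 f1 g1.
  by rewrite mpolyXD ofpM fM gM IHm fgv.
have nz h y : {morph h : x y / x * y} -> h 1 = 1 -> y != 0 -> h y * h y^-1 = 1 :> K.
  by move=> hM h1 y0; rewrite -hM mulfV.
have [p [q [q0 ->]]] := ratP x.
have q0' : ofp q != 0 by rewrite ofpoly_eq0.
rewrite fM gM fgp; congr (_ * _).
have fq := nz f _ fM f1 q0'; have gq := nz g _ gM g1 q0'.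
have gq0 : g (ofp q) != 0 
  by apply/eqP => gq0; move/eqP: gq; rewrite gq0 mul0r eq_sym oner_eq0.
by apply: (mulfI gq0); rewrite gq -fgp fq.
Qed.
End RatCalc.
Arguments pd_derivation {C n} i.

(** * Linear algebra of eigenvectors and strings *)

Section LinearAlgebra.
Variables (C : fieldType) (V : lmodType C).
Implicit Types (U S : set V) (u v : V).

Lemma lsub0 U : lsubspace U -> U 0. Proof. by case. Qed.
Lemma lsubZ U a u : lsubspace U -> U u -> U (a *: u).
Proof. by move=> [U0 UD] Uu; rewrite -[_ *: _]addr0; exact: UD. Qed.
Lemma lsubD U u v : lsubspace U -> U u -> U v -> U (u + v).
Proof. by move=> [_ UD] Uu Uv; rewrite -[u]scale1r; exact: UD. Qed.
Lemma lsubN U u : lsubspace U -> U u -> U (- u).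
Proof. by move=> sU Uu; rewrite -scaleN1r; exact: lsubZ. Qed.
Lemma lsubB U u v : lsubspace U -> U u -> U v -> U (u - v).
Proof. by move=> sU Uu Uv; apply: lsubD => //; exact: lsubN. Qed.
Lemma lsub_sum U (I : eqType) (r : seq I) (F : I -> V) : lsubspace U ->
  (forall i, i \in r -> U (F i)) -> U (\sum_(i <- r) F i).
Proof.
move=> sU UF; rewrite big_seq; elim/big_ind: _ => [|u v|i /UF //].
  exact: lsub0.
exact: lsubD.
Qed.
Lemma lsubZr U a u : lsubspace U -> a != 0 -> U (a *: u) -> U u.
Proof. by move=> sU a0 /(lsubZ a^-1 sU); rewrite scalerA mulVf // scale1r. Qed.

Lemma lspan_gen S u : S u -> lspan S u. Proof. by move=> Su U [_]; apply. Qed.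
Lemma lspan_min S U : lsubspace U -> S `<=` U -> lspan S `<=` U.
Proof. by move=> sU SU u; apply. Qed.
Lemma lspan_mono S S' : S `<=` lspan S' -> lspan S `<=` lspan S'.
Proof. by move=> SS; apply: lspan_min => //; exact: lspan_lsubspace. Qed.

Lemma lspan_famP (J : eqType) (D : set J) (w : J -> V) u :
  lspan [set x | exists j, D j /\ x = w j] u ->
  exists (s : seq J) (c : J -> C),
    [/\ uniq s, forall j, j \in s -> D j & u = \sum_(j <- s) c j *: w j].
Proof.
move: u; apply: lspan_min => [|_ [j [Dj ->]]]; last first.
  exists [:: j], (fun=> 1); split=> // [k|]; first by rewrite inE => /eqP ->.
  by rewrite big_seq1 scale1r.
split; first by exists [::], (fun=> 0); rewrite big_nil.
move=> a u v [s [c [us sD ->]]] [t [d [ut tD ->]]].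
exists (undup (s ++ t)),
  (fun j => (if j \in s then a * c j else 0) + (if j \in t then d j else 0)).
split=> [|j|]; first exact: undup_uniq.
  by rewrite mem_undup mem_cat => /orP[/sD|/tD].
under [RHS]eq_bigr do rewrite scalerDl; rewrite big_split /=.
have H (r : seq J) (b : J -> C) : uniq r -> {subset r <= s ++ t} ->
    \sum_(j <- undup (s ++ t)) (if j \in r then b j else 0) *: w j =
    \sum_(j <- r) b j *: w j.
  move=> ur rst; rewrite (bigID (mem r)) /= [X in _ + X]big1 ?addr0; last first.
    by move=> j /negbTE ->; rewrite scale0r.
  under eq_bigr => j jr do rewrite jr.
  rewrite -big_filter; apply: perm_big; apply: uniq_perm => //.
    by rewrite filter_uniq // undup_uniq.
  move=> j; rewrite mem_filter mem_undup /=.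
  by apply/andP/idP => [[]|jr] //; split=> //; exact: rst.
rewrite !H //; try by move=> j jr; rewrite mem_cat jr ?orbT.
by rewrite scaler_sumr; congr (_ + _); apply: eq_bigr => j _; rewrite scalerA.
Qed.

End LinearAlgebra.

Section JointEigen.
Variables (C : fieldType) (V : lmodType C) (A : Type) (J : eqType).
Variables (phi : A -> V -> V) (lam : J -> A -> C).
Hypothesis phiP : forall a c u v, phi a (c *: u + v) = c *: phi a u + phi a v.
Implicit Types (D : set J) (U : set V).

Definition joint_eigen j u := forall a, phi a u = lam j a *: u.

Definition separated D :=
  forall j k, D j -> D k -> j != k -> exists a, lam j a != lam k a.

Let phi0 a : phi a 0 = 0.
Proof.
by apply: (addrI (phi a 0)); rewrite addr0 -[X in X + _]scale1r -phiP scaler0 addr0.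
Qed.

Lemma phiZ a c u : phi a (c *: u) = c *: phi a u.
Proof. by rewrite -[c *: u]addr0 phiP phi0 addr0. Qed.

(** Induction on the number of components: for an operator separating j0 from j1, subtracting its
    eigenvalue at j1 kills the component j1 and multiplies the component j0 by a nonzero scalar. *)
Lemma eigen_component D U (s : seq J) (u : J -> V) : separated D ->
  lsubspace U -> (forall a x, U x -> U (phi a x)) -> uniq s ->
  (forall j, j \in s -> D j /\ joint_eigen j (u j)) ->
  U (\sum_(j <- s) u j) -> forall j, j \in s -> U (u j).
Proof.
move=> sepD sU phiU us uE Us j0 j0s.
have [Dj0 Ej0] := uE _ j0s.
suff H (r : seq J) (v : J -> V) : joint_eigen j0 (v j0) ->
    (forall j, j \in r -> [/\ j != j0, D j & joint_eigen j (v j)]) ->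
    U (v j0 + \sum_(j <- r) v j) -> U (v j0).
  apply: (H (rem j0 s) u) => // [j|]; last first.
    by move: Us; rewrite (perm_big _ (perm_to_rem j0s)) big_cons.
  rewrite mem_rem_uniq // inE => /andP[jj0 js].
  by have [] := uE _ js.
elim: r v => [|j1 r IH] v vE0 vE Uv; first by rewrite big_nil addr0 in Uv.
have [j10 Dj1 Ej1] := vE j1 (mem_head _ _).
have j01 : j0 != j1 by rewrite eq_sym.
have [a ja] := sepD _ _ Dj0 Dj1 j01.
pose v' j := (lam j a - lam j1 a) *: v j.
suff : U (v' j0) by apply: lsubZr => //; rewrite subr_eq0.
apply: (IH v') => [b|j jr|].
- by rewrite phiZ vE0 !scalerA mulrC.
- have [] := vE j _; first by rewrite inE jr orbT.
  by move=> ? ? Ej; split=> // b; rewrite phiZ Ej !scalerA mulrC.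
have -> : v' j0 + \sum_(j <- r) v' j =
    phi a (v j0 + \sum_(j <- j1 :: r) v j)
    - lam j1 a *: (v j0 + \sum_(j <- j1 :: r) v j).
  have -> : phi a (v j0 + \sum_(j <- j1 :: r) v j) =
      lam j0 a *: v j0 + \sum_(j <- j1 :: r) lam j a *: v j.
    rewrite -[v j0]scale1r phiP vE0 !scale1r; congr (_ + _).
    rewrite (big_morph (phi a) (id1 := 0) (op1 := +%R)) ?phi0 //; last first.
      by move=> x y; rewrite -[x in LHS]scale1r phiP scale1r.
    by apply: eq_big_seq => j /vE[_ _ ->].
  rewrite scalerDr opprD addrACA -scalerBl; congr (_ + _).
  rewrite scaler_sumr -sumrB !big_cons subrr add0r.
  by apply: eq_bigr => j _; rewrite -scalerBl.
by apply: lsubB => //; [exact: phiU | exact: lsubZ].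
Qed.

Lemma lsub_eq0 : lsubspace [set (0 : V)].
Proof. by split=> // a u v -> ->; rewrite scaler0 addr0. Qed.

Lemma eigen_independent D (s : seq J) (u : J -> V) : separated D ->
  uniq s -> (forall j, j \in s -> D j /\ joint_eigen j (u j)) ->
  \sum_(j <- s) u j = 0 -> forall j, j \in s -> u j = 0.
Proof.
move=> sepD us uE u0; apply: (eigen_component (U := [set 0]) sepD) => //.
  exact: lsub_eq0.
by move=> a x ->; exact: phi0.
Qed.

Lemma eigen_span_component D U (w : J -> V) u : separated D ->
  lsubspace U -> (forall a x, U x -> U (phi a x)) ->
  (forall j, D j -> joint_eigen j (w j)) ->
  lspan [set x | exists j, D j /\ x = w j] u -> U u -> u != 0 ->
  exists j, [/\ D j, U (w j) & w j != 0].
Proof.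
move=> sepD sU phiU wE /lspan_famP[s [c [us sD ->]]] Uu u0.
have cE j : j \in s -> D j /\ joint_eigen j (c j *: w j).
  move=> /sD Dj; split=> // a.
  by rewrite phiZ (wE j Dj) !scalerA mulrC.
have Uc := eigen_component sepD sU phiU us cE Uu.
have [j js cj] : exists2 j, j \in s & c j *: w j != 0.
  apply/hasP; apply: contraNT u0 => /hasPn nz.
  by apply/eqP; rewrite big_seq big1 // => j /nz; rewrite negbK => /eqP.
exists j; split; first exact: sD.
- apply: (lsubZr sU _ (Uc j js)).
  by apply: contraNneq cj => ->; rewrite scale0r.
- by apply: contraNneq cj => ->; rewrite scaler0.
Qed.

(** If u were in the span, -u placed beside its expansion would give a vanishing sum of separated
    eigenvectors, each of which is then zero. *)
Lemma eigen_notin_span D (w : J -> V) j u : separated D ->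
  (forall k, D k -> joint_eigen k (w k)) -> joint_eigen j u ->
  separated (D `|` [set j]) -> ~ D j ->
  lspan [set x | exists k, D k /\ x = w k] u -> u = 0.
Proof.
move=> sepD wE uE sepDj Dj /lspan_famP[s [c [us sD uS]]].
pose v k := if k == j then - u else c k *: w k.
have jns : j \notin s by apply/negP => /sD.
have H := @eigen_independent (D `|` [set j]) (j :: s) v sepDj.
have ujs : uniq (j :: s) by rewrite /= jns us.
have vE k : k \in j :: s -> (D `|` [set j]) k /\ joint_eigen k (v k).
  rewrite inE => /orP[/eqP ->|ks].
    split; [by right | move=> a; rewrite /v eqxx].
    by rewrite -scaleN1r phiZ uE !scalerA mulrC.
  split; [by left; exact: sD | move=> a; rewrite /v].
  case: eqVneq ks => [->|_ ks]; first by rewrite (negbTE jns).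
  by rewrite phiZ (wE k (sD k ks)) !scalerA mulrC.
have v0 : \sum_(k <- j :: s) v k = 0.
  rewrite big_cons /v eqxx {1}uS addrC; apply/eqP; rewrite subr_eq0; apply/eqP.
  by apply: eq_big_seq => k ks; case: eqVneq ks => [->|//]; rewrite (negbTE jns).
have := H ujs vE v0 j (mem_head _ _).
by rewrite /v eqxx => /eqP; rewrite oppr_eq0 => /eqP.
Qed.

End JointEigen.

Section Sl2String.
Variables (C : numFieldType) (V : lmodType C) (e f h : V -> V).
Hypothesis eP : forall c u v, e (c *: u + v) = c *: e u + e v.
Hypothesis fP : forall c u v, f (c *: u + v) = c *: f u + f v.
Hypothesis hP : forall c u v, h (c *: u + v) = c *: h u + h v.
Hypothesis ef : forall u, f (e u) = e (f u) - h u.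
Hypothesis he : forall u, h (e u) = e (h u) - 2 *: e u.

Let lin0 (g : V -> V) :
  (forall c u v, g (c *: u + v) = c *: g u + g v) -> g 0 = 0.
Proof.
by move=> gP; apply: (addrI (g 0)); rewrite addr0 -[X in X + _]scale1r -gP
  scaler0 addr0.
Qed.
Let linZ (g : V -> V) c u :
  (forall c u v, g (c *: u + v) = c *: g u + g v) -> g (c *: u) = c *: g u.
Proof. by move=> gP; rewrite -[c *: u]addr0 gP (lin0 gP) addr0. Qed.
Let linB (g : V -> V) u v :
  (forall c u v, g (c *: u + v) = c *: g u + g v) -> g (u - v) = g u - g v.
Proof. by move=> gP; rewrite addrC -scaleN1r gP scaleN1r addrC. Qed.

(** The relations make [e] lower the weight of [h] by 2, so a vector killed by [f] has the highest
    weight of its string. With H = h, F = e and E = -f this is the Casimir element H^2/4 + H/2 +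
    FE. *)
Definition casimir u := 4^-1 *: h (h u) + 2^-1 *: h u - e (f u).

Variables (v : V) (N : nat).
Hypothesis fv : f v = 0.
Hypothesis hv : h v = N%:R *: v.

Lemma h_string i : h (iter i e v) = (N%:R - 2 * i%:R) *: iter i e v.
Proof.
elim: i => [|i IH] /=; first by rewrite mulr0 subr0.
rewrite he IH (linZ _ _ eP) -scalerBl -[i.+1%:R]natr1; congr (_ *: _).
by ring.
Qed.

Lemma f_string i :
  f (iter i.+1 e v) = (i.+1%:R * (i%:R - N%:R)) *: iter i e v.
Proof.
elim: i => [|i IH].
  by rewrite /= ef fv (lin0 eP) hv sub0r -scaleNr mul1r sub0r.
rewrite iterS ef IH h_string (linZ _ _ eP) -iterS -scalerBl; congr (_ *: _).
by rewrite -[i.+2%:R]natr1 -[i.+1%:R]natr1; ring.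
Qed.

Lemma casimir_string i :
  casimir (iter i e v) = (N%:R / 2 * (N%:R / 2 + 1)) *: iter i e v.
Proof.
rewrite /casimir h_string (linZ _ _ hP) h_string !scalerA.
case: i => [|i].
  rewrite /= fv (lin0 eP) subr0 -scalerDl; congr (_ *: _).
  by field.
rewrite f_string (linZ _ _ eP) -iterS -scalerDl -scalerBl; congr (_ *: _).
by rewrite -[i.+1%:R]natr1; field.
Qed.

Hypothesis eNv : iter N.+1 e v = 0.

Lemma string_eq0 i : (N < i)%N -> iter i e v = 0.
Proof. by move=> /subnK <-; rewrite iterD eNv; elim: (i - _)%N => //= k ->; exact: lin0. Qed.

Definition string : set V := [set x | exists i, (i <= N)%N /\ x = iter i e v].

Lemma string_iter i : lspan string (iter i e v).
Proof.
have [iN|/string_eq0 ->] := leqP i N; first by apply: lspan_gen; exists i.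
exact: lsub0 (lspan_lsubspace _).
Qed.

Lemma lspan_lin (S U : set V) (g : V -> V) : lsubspace U ->
  (forall c u v, g (c *: u + v) = c *: g u + g v) ->
  (forall u, S u -> U (g u)) -> forall u, lspan S u -> U (g u).
Proof.
move=> sU gP SU; apply: lspan_min => //; split=> [|a x y Ux Uy].
  by rewrite (lin0 gP); exact: lsub0.
by rewrite gP; apply: sU.2.
Qed.

Lemma string_e u : lspan string u -> lspan string (e u).
Proof.
apply: lspan_lin => // [|_ [i [_ ->]]]; first exact: lspan_lsubspace.
by rewrite -iterS; exact: string_iter.
Qed.
Lemma string_h u : lspan string u -> lspan string (h u).
Proof.
apply: lspan_lin => // [|_ [i [_ ->]]]; first exact: lspan_lsubspace.
by rewrite h_string; exact: (lsubZ _ (lspan_lsubspace _) (string_iter _)).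
Qed.
Lemma string_f u : lspan string u -> lspan string (f u).
Proof.
apply: lspan_lin => // [|_ [[|i] [_ ->]]]; first exact: lspan_lsubspace.
  by rewrite /= fv; exact: lsub0 (lspan_lsubspace _).
by rewrite f_string; exact: (lsubZ _ (lspan_lsubspace _) (string_iter _)).
Qed.

(** The coefficient (i + 1)(i - N) of [f_string] is nonzero for i < N, so [f] leads back to the
    start of the string. *)
Lemma string_down (U : set V) i : lsubspace U -> (forall u, U u -> U (f u)) ->
  (i <= N)%N -> U (iter i e v) -> U v.
Proof.
move=> sU fU; elim: i => [|i IH] iN //= /fU.
rewrite -/(iter i.+1 e v) f_string => /(lsubZr sU) H; apply: IH; first exact: ltnW.
by apply: H; rewrite mulf_neq0 // ?pnatr_eq0 // subr_eq0 eqr_nat ltn_eqF.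
Qed.

Lemma string_up (U : set V) : lsubspace U -> (forall u, U u -> U (e u)) ->
  U v -> lspan string `<=` U.
Proof.
move=> sU eU Uv; apply: lspan_min => // _ [i [_ ->]].
by elim: i => //= i; exact: eU.
Qed.

Lemma string_neq0 i : v != 0 -> (i <= N)%N -> iter i e v != 0.
Proof.
move=> v0 iN; apply: contraNneq v0 => vi.
apply/eqP; apply: (string_down (U := [set 0]) _ _ iN) => //.
  exact: lsub_eq0.
by move=> u ->; exact: lin0.
Qed.

(** The weights N - 2i are distinct, so a nonzero stable subspace contains a vector of the string;
    [f] brings it back to v, and [e] then produces the whole string. *)
Lemma string_irreducible (U : set V) : lsubspace U ->
  (forall u, U u -> U (e u)) -> (forall u, U u -> U (f u)) ->
  (forall u, U u -> U (h u)) -> U `<=` lspan string ->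
  U = [set 0] \/ U = lspan string.
Proof.
move=> sU eU fU hU US.
have [[u Uu /eqP u0]|U0] := pselect (exists2 u, U u & u <> 0); last first.
  left; apply/seteqP; split=> u; last by move=> ->; exact: lsub0.
  by move=> Uu; apply: contrapT => u0; apply: U0; exists u.
right; apply/seteqP; split=> //; apply: string_up => //.
pose D := [set i | (i <= N)%N].
pose w i := iter i e v.
pose lam i (a : unit) : C := N%:R - 2 * i%:R.
have sepD : separated lam D.
  move=> i j _ _ ij; exists tt; rewrite /lam.
  apply: contraNneq ij => /addrI/oppr_inj/mulfI H.
  by rewrite -(eqr_nat C) H ?pnatr_eq0.
have [] := @eigen_span_component _ _ unit nat (fun=> h) lam (fun=> hP) D U w u
  sepD sU (fun=> hU) _ _ Uu u0.
- by move=> i _ a; rewrite h_string.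
- exact: US.
by move=> i [iN Ui _]; exact: (string_down sU fU iN Ui).
Qed.
End Sl2String.

(** * Isomorphism of irreducible modules from an isomorphism of their lowest K-types *)

Section LowestWeight.
Variables (C : fieldType) (g : set 'M[C]_(2 + 2)) (gk gn gp : set 'M[C]_(2 + 2)).
Variables (V1 V2 : lmodType C).
Variables (act1 : 'M[C]_(2 + 2) -> V1 -> V1) (act2 : 'M[C]_(2 + 2) -> V2 -> V2).
(** [gn], [gk], [gp] are the lowering, degree-preserving and raising parts of g; [L1], [L2] are the
    lowest K-types, and [H1], [H2] the parts of higher degree, which receive everything that raising
    produces. *)
Variables (U1 L1 H1 : set V1) (U2 L2 H2 : set V2) (phi : V1 -> V2).

Definition lie_module (V : lmodType C) (act : 'M[C]_(2 + 2) -> V -> V) (U : set V) :=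
  [/\ forall X a u v, g X -> act X (a *: u + v) = a *: act X u + act X v,
      forall X Y u, g X -> g Y -> act (X + Y) u = act X u + act Y u
    & forall X Y u, g X -> g Y -> U u ->
        act X (act Y u) = act Y (act X u) + act (X *m Y - Y *m X) u].

Hypothesis gk_sub : gk `<=` g.
Hypothesis gn_sub : gn `<=` g.
Hypothesis gp_sub : gp `<=` g.
Hypothesis g_dec : forall X, g X ->
  exists X1 X2 X3, [/\ gn X1, gk X2, gp X3 & X = X1 + X2 + X3].
Hypothesis gaddr : forall X Y, g X -> g Y -> g (X + Y).
Hypothesis gkp : forall X Y, gk X -> gp Y -> gp (X *m Y - Y *m X).
Hypothesis gnp : forall X Y, gn X -> gp Y -> gk (X *m Y - Y *m X).
Hypothesis (M1 : lie_module act1 U1) (M2 : lie_module act2 U2).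
Hypothesis (irr1 : irreducible_module g act1 U1).
Hypothesis (irr2 : irreducible_module g act2 U2).
Hypothesis (LU1 : L1 `<=` U1) (sL1 : lsubspace L1).
Hypothesis (sH1 : lsubspace H1) (sH2 : lsubspace H2).
Hypothesis (LH1 : forall u, L1 u -> H1 u -> u = 0).
Hypothesis (LH2 : forall u, L1 u -> H2 (phi u) -> u = 0).
Hypothesis (L1n0 : exists2 u, L1 u & u <> 0).
Hypothesis (phiL : forall u, L1 u -> L2 (phi u)).
Hypothesis (LU2 : L2 `<=` U2).
Hypothesis (phiP : forall a u v, L1 u -> L1 v -> phi (a *: u + v) = a *: phi u + phi v).
Hypothesis (kL1 : forall X u, gk X -> L1 u -> L1 (act1 X u)).
Hypothesis (phik : forall X u, gk X -> L1 u -> phi (act1 X u) = act2 X (phi u)).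
Hypothesis (nL1 : forall X u, gn X -> L1 u -> act1 X u = 0).
Hypothesis (nL2 : forall X u, gn X -> L2 u -> act2 X u = 0).
Hypothesis (pH1 : forall X u, gp X -> U1 u -> H1 (act1 X u)).
Hypothesis (pH2 : forall X u, gp X -> U2 u -> H2 (act2 X u)).

(* The graph of the isomorphism: the submodule of U1 x U2 generated by the
   graph of phi, which by the PBW argument is generated by gp alone. *)
Inductive graph : V1 -> V2 -> Prop :=
| graph_base u : L1 u -> graph u (phi u)
| graph_lin a u v u' v' : graph u u' -> graph v v' ->
    graph (a *: u + v) (a *: u' + v')
| graph_act X u u' : gp X -> graph u u' -> graph (act1 X u) (act2 X u').

Let act1D X a u v : g X -> act1 X (a *: u + v) = a *: act1 X u + act1 X v.
Proof. by case: M1 => H _ _; exact: H. Qed.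
Let act2D X a u v : g X -> act2 X (a *: u + v) = a *: act2 X u + act2 X v.
Proof. by case: M2 => H _ _; exact: H. Qed.
Let sU1 : submodule g act1 U1. Proof. by case: irr1. Qed.
Let sU2 : submodule g act2 U2. Proof. by case: irr2. Qed.

Let graph00 : graph 0 0.
Proof.
have := graph_base (lsub0 sL1).
by move=> H; have := graph_lin (-1) H H; rewrite !scaleN1r !addNr.
Qed.
Let graphD u v u' v' : graph u u' -> graph v v' -> graph (u + v) (u' + v').
Proof. by move=> H1' H2'; rewrite -[u]scale1r -[u']scale1r; exact: graph_lin. Qed.

Lemma graph_sub u w : graph u w -> U1 u /\ U2 w.
Proof.
elim=> {u w} [u Lu|a u v u' v' _ [Uu Uu'] _ [Uv Uv']|X u u' pX _ [Uu Uu']].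
- by split; [exact: LU1 | exact/LU2/phiL].
- by split; [exact: sU1.1.2 | exact: sU2.1.2].
- by split; [apply: sU1.2 | apply: sU2.2] => //; exact: gp_sub.
Qed.

(** Induction on the generation of the pair: past a raising Y one has XY = YX + [X, Y], and [X, Y]
    is again in [gp]. *)
Lemma graph_k X u w : gk X -> graph u w -> graph (act1 X u) (act2 X w).
Proof.
move=> kX guw; elim: guw X kX => {u w} [u Lu|a u v u' v' _ IHu _ IHv|Y u u' pY guu' IH] X kX.
- by rewrite -phik //; apply: graph_base; exact: kL1.
- have gX := gk_sub kX; rewrite act1D // act2D //.
  by apply: graph_lin; [exact: IHu | exact: IHv].
have [Uu Uu'] := graph_sub guu'.
have [_ _ Lie1] := M1; have [_ _ Lie2] := M2.
rewrite (Lie1 X Y u (gk_sub kX) (gp_sub pY) Uu) (Lie2 X Y _ (gk_sub kX) (gp_sub pY) Uu').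
by apply: graphD; apply: graph_act => //; [exact: IH | exact: gkp].
Qed.

(** The base pairs are killed by [gn]; past a raising Y the bracket [X, Y] falls in [gk], where
    [graph_k] applies. *)
Lemma graph_n X u w : gn X -> graph u w -> graph (act1 X u) (act2 X w).
Proof.
move=> nX guw; elim: guw X nX => {u w} [u Lu|a u v u' v' _ IHu _ IHv|Y u u' pY guu' IH] X nX.
- by rewrite nL1 // nL2 //; exact: phiL.
- have gX := gn_sub nX; rewrite act1D // act2D //.
  by apply: graph_lin; [exact: IHu | exact: IHv].
have [Uu Uu'] := graph_sub guu'.
have [_ _ Lie1] := M1; have [_ _ Lie2] := M2.
rewrite (Lie1 X Y u (gn_sub nX) (gp_sub pY) Uu) (Lie2 X Y _ (gn_sub nX) (gp_sub pY) Uu').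
apply: graphD; first by apply: graph_act => //; exact: IH.
by apply: graph_k => //; exact: gnp.
Qed.

Lemma graph_g X u w : g X -> graph u w -> graph (act1 X u) (act2 X w).
Proof.
move=> /g_dec[X1 [X2 [X3 [n1 k2 p3 ->]]]] guw.
have [_ add1 _] := M1; have [_ add2 _] := M2.
have gX1 := gn_sub n1; have gX2 := gk_sub k2; have gX3 := gp_sub p3.
rewrite !add1 // ?add2 //; try exact: gaddr.
apply: graphD; last exact: graph_act.
by apply: graphD; [exact: graph_n | exact: graph_k].
Qed.

(** Modulo higher degree every pair is a base pair, because each raising step lands in [H1] and
    [H2]. This is what keeps the graph from filling the whole product. *)
Lemma graph_lowest u w : graph u w -> exists2 l, L1 l & H1 (u - l) /\ H2 (w - phi l).
Proof.
elim=> {u w} [u Lu|a u v u' v' _ [l Ll [? ?]] _ [m Lm [? ?]]|X u u' pX guu' _].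
- by exists u => //; rewrite !subrr; split; exact: lsub0.
- exists (a *: l + m); first exact: sL1.2.
  rewrite phiP //; split; rewrite opprD addrACA -scalerBr; [exact: sH1.2|exact: sH2.2].
have [Uu Uu'] := graph_sub guu'.
have phi0 : phi 0 = 0.
  have := phiP (-1) (lsub0 sL1) (lsub0 sL1).
  by rewrite scaler0 addr0 scaleN1r addNr.
exists 0; first exact: lsub0.
by rewrite phi0 !subr0; split; [exact: pH1 | exact: pH2].
Qed.

(** The partners of 0 form a submodule of [U2]. If it were all of [U2] it would contain [phi u0];
    the lowest component of the pair (0, phi u0) is 0, so [phi u0] would lie in [H2] and [u0] would
    be 0. *)
Lemma graph_inj u w w' : graph u w -> graph u w' -> w = w'.
Proof.
suff H : [set x | graph 0 x] = [set 0].
  move=> gw gw'; have := graph_lin (-1) gw' gw.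
  rewrite !scaleN1r addNr addrC => gww; apply/eqP; rewrite -subr_eq0; apply/eqP.
  suff : [set x | graph 0 x] (w - w') by rewrite H.
  exact: gww.
have subm : submodule g act2 [set x | graph 0 x].
  split; first split=> [|a x y gx gy]; first exact: graph00.
    by have := graph_lin a gx gy; rewrite /= scaler0 addr0.
  move=> X x gX /(graph_g gX) /=.
  by have := act1D (-1) 0 0 gX; rewrite scaler0 addr0 scaleN1r addNr => ->.
have [_ _ /(_ _ subm)[|//|E]] := irr2; first by move=> x /graph_sub[].
have [u0 Lu0 u00] := L1n0.
have : [set x | graph 0 x] (phi u0) by rewrite E; exact/LU2/phiL.
move=> /graph_lowest[l Ll [Hl Hl']].
have l0 : l = 0.
  by apply: LH1 => //; have := lsubN sH1 Hl; rewrite sub0r opprK.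
have phi0 : phi 0 = 0.
  have := phiP (-1) (lsub0 sL1) (lsub0 sL1).
  by rewrite scaler0 addr0 scaleN1r addNr.
by case: u00; apply: LH2 => //; rewrite l0 phi0 subr0 in Hl'.
Qed.

Lemma graph_inj' u u' w : graph u w -> graph u' w -> u = u'.
Proof.
suff H : [set x | graph x 0] = [set 0].
  move=> gw gw'; have := graph_lin (-1) gw' gw.
  rewrite !scaleN1r addNr addrC => gww; apply/eqP; rewrite -subr_eq0; apply/eqP.
  suff : [set x | graph x 0] (u - u') by rewrite H.
  exact: gww.
have subm : submodule g act1 [set x | graph x 0].
  split; first split=> [|a x y gx gy]; first exact: graph00.
    by have := graph_lin a gx gy; rewrite /= scaler0 addr0.
  move=> X x gX /(graph_g gX) /=.
  by have := act2D (-1) 0 0 gX; rewrite scaler0 addr0 scaleN1r addNr => ->.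
have [_ _ /(_ _ subm)[|//|E]] := irr1; first by move=> x /graph_sub[].
have [u0 Lu0 u00] := L1n0.
have : [set x | graph x 0] u0 by rewrite E; exact/LU1.
move=> /graph_lowest[l Ll [Hl Hl']].
have ul : u0 - l = 0.
  by apply: LH1 => //; rewrite -scaleN1r addrC; exact: sL1.2.
case: u00; apply/eqP; rewrite -[u0](subrK l) ul add0r; apply/eqP.
by apply: LH2 => //; have := lsubN sH2 Hl'; rewrite sub0r opprK.
Qed.

Lemma lowest_weight_iso : isomorphic_modules g act1 U1 act2 U2.
Proof.
split=> //; split=> //.
have dom : [set u | exists w, graph u w] = U1.
  have [_ _ /(_ [set u | exists w, graph u w])[||E|//]] := irr1.
  - split; first split; first by exists 0; exact: graph00.
      by move=> a u v [w gw] [w' gw']; exists (a *: w + w'); exact: graph_lin.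
    by move=> X u gX [w gw]; exists (act2 X w); exact: graph_g.
  - by move=> u [w /graph_sub[]].
  have [u0 Lu0 []] := L1n0.
  have : [set u | exists w, graph u w] u0 by exists (phi u0); exact: graph_base.
  by rewrite E.
have cod : [set w | exists u, graph u w] = U2.
  have [_ _ /(_ [set w | exists u, graph u w])[||E|//]] := irr2.
  - split; first split; first by exists 0; exact: graph00.
      by move=> a w w' [u gu] [u' gu']; exists (a *: u + u'); exact: graph_lin.
    by move=> X w gX [u gu]; exists (act1 X u); exact: graph_g.
  - by move=> w [u /graph_sub[]].
  have [u0 Lu0 u00] := L1n0; case: u00; apply: LH2 => //.
  have : [set w | exists u, graph u w] (phi u0) by exists u0; exact: graph_base.
  by rewrite E => ->; exact: lsub0.
pose F u := xget 0 [set w | graph u w].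
have FP u : U1 u -> graph u (F u).
  rewrite -dom => -[w gw]; exact: (xgetPex 0 (ex_intro _ w gw)).
exists F; split=> [|a u v Uu Uv|X u gX Uu].
- split=> [u /FP/graph_sub[] //|u v|w].
    rewrite !inE => Uu Uv Fuv; apply: (graph_inj' (FP _ Uu)).
    by rewrite Fuv; exact: FP.
  rewrite -cod => -[u gu]; exists u; first by have [] := graph_sub gu.
  exact: (graph_inj (FP u (graph_sub gu).1) gu).
- apply: (graph_inj (FP _ (sU1.1.2 a _ _ Uu Uv))).
  by apply: graph_lin; exact: FP.
- apply: (graph_inj (FP _ (sU1.2 _ _ gX Uu))).
  by apply: graph_g => //; exact: FP.
Qed.
End LowestWeight.

Lemma sum2 (V : nmodType) (F : 'I_2 -> V) : \sum_i F i = F 0 + F 1.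
Proof. by rewrite big_ord_recl big_ord1; congr (_ + F _); apply: val_inj. Qed.

Lemma ord2P (P : 'I_2 -> Prop) : P 0 -> P 1 -> forall i, P i.
Proof.
move=> P0 P1 [[|[|//]] Hi].
  by rewrite (_ : Ordinal Hi = 0) //; exact: val_inj.
by rewrite (_ : Ordinal Hi = 1) //; exact: val_inj.
Qed.

Lemma matrix2P (T : Type) (M N : 'M[T]_2) : M 0 0 = N 0 0 -> M 0 1 = N 0 1 ->
  M 1 0 = N 1 0 -> M 1 1 = N 1 1 -> M = N.
Proof.
by move=> ? ? ? ?; apply/matrixP; apply: ord2P; apply: ord2P.
Qed.

(** * First order operators with matrix coefficients *)

Section FirstOrder.
Variable K : fieldType.
Local Notation opmx := ('I_2 -> 'I_2 -> K -> K).
Variables (d t : opmx).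
Implicit Types (xi eta M N F : 'M[K]_2) (x y : K).

Definition dv xi (D : opmx) x : K := \sum_i \sum_j xi i j * D j i x.

(** E is D on functions carrying a formal factor, such as N^(1/2): coefficients are differentiated
    by D, the section itself by E. *)
Definition twisted_derivation (D E : K -> K) : Prop :=
  (forall x y, E (x + y) = E x + E y) /\ forall x y, E (x * y) = D x * y + x * E y.

Hypothesis dD : forall i j, derivation (d i j).
Hypothesis tD : forall i j, twisted_derivation (d i j) (t i j).
Hypothesis tC : forall i j k l x, t i j (t k l x) = t k l (t i j x).

Lemma dv_derivation xi : derivation (dv xi d).
Proof.
split=> x y; rewrite /dv !sum2.
  by rewrite !(derD_add (dD _ _)); ring.
by rewrite !(derD_mul (dD _ _)); ring.
Qed.

Lemma dv_twisted xi : twisted_derivation (dv xi d) (dv xi t).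
Proof.
have tDD i j x y : t i j (x + y) = t i j x + t i j y by case: (tD i j).
have tDM i j x y : t i j (x * y) = d i j x * y + x * t i j y by case: (tD i j).
split=> x y; rewrite /dv !sum2.
  by rewrite !tDD; ring.
by rewrite !tDM; ring.
Qed.

Lemma dv_comm xi eta x : dv xi t (dv eta t x) =
  dv eta t (dv xi t x)
  + dv (map_mx (dv xi d) eta - map_mx (dv eta d) xi) t x.
Proof.
have tDD i j u v : t i j (u + v) = t i j u + t i j v by case: (tD i j).
have tDM i j u v : t i j (u * v) = d i j u * v + u * t i j v by case: (tD i j).
rewrite /dv !sum2 !mxE !sum2 !tDD !tDM.
rewrite (tC 0 0 1 0) (tC 0 0 0 1) (tC 0 0 1 1) (tC 1 0 0 1) (tC 1 0 1 1) (tC 0 1 1 1).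
ring.
Qed.

(** Common form of the three actions: a vector field [xi], a multiplier M acting on both factors of
    the tensor, and [tau] times its trace. [tau] is -2 for [rho2] and 1 for [pi_dl] and [pi_dr]. *)
Definition Lop (tau : K) xi M F : 'M[K]_2 :=
  map_mx (dv xi t) F + (tau * \tr M) *: F + M *m F + F *m M^T.

Lemma Lop_comm tau xi M eta N F : (forall x, dv xi d (tau * x) = tau * dv xi d x) ->
  (forall x, dv eta d (tau * x) = tau * dv eta d x) ->
  Lop tau xi M (Lop tau eta N F) = Lop tau eta N (Lop tau xi M F)
  + Lop tau (map_mx (dv xi d) eta - map_mx (dv eta d) xi)
      (map_mx (dv xi d) N - map_mx (dv eta d) M + (M *m N - N *m M)) F.
Proof.
move=> txi teta.
have [aX mX] := dv_twisted xi; have [aE mE] := dv_twisted eta.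
have [aX' _] := dv_derivation xi; have [aE' _] := dv_derivation eta.
apply/matrixP => i j; rewrite /Lop /mxtrace; do 3!rewrite ?mxE ?sum2.
(* A twisted derivation treats the first factor as a coefficient and the second as a section, so the
   entries of F are moved to the second place. *)
rewrite ![F _ _ * _]mulrC !aX !aE !mX !mE !txi !teta !aX' !aE' dv_comm.
set w := dv (_ - _) t _.
ring.
Qed.
End FirstOrder.

Section Sp4Symbols.
Variable K : fieldType.
Implicit Types A B D Z : 'M[K]_2.

(** The vector field on Z of the fractional linear action of the block matrix (A, B; L, D), with the
    signs of the given representations; [nuX] is the attached multiplier. The two bracket lemmas
    below reproduce the matrix bracket, so that commutators of operators reduce to identities
    between 2 x 2 matrices. *)
Definition xiX Z A B L D := Z *m L *m Z + Z *m D - A *m Z - B.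
Definition nuX Z L D := L *m Z + D.

Lemma xiX_bracket Z A B L D A' B' L' D' (xi := xiX Z A B L D)
    (eta := xiX Z A' B' L' D') :
  xi *m L' *m Z + Z *m L' *m xi + xi *m D' - A' *m xi
  - (eta *m L *m Z + Z *m L *m eta + eta *m D - A *m eta) =
  xiX Z (A *m A' + B *m L' - (A' *m A + B' *m L))
    (A *m B' + B *m D' - (A' *m B + B' *m D))
    (L *m A' + D *m L' - (L' *m A + D' *m L))
    (L *m B' + D *m D' - (L' *m B + D' *m D)).
Proof.
rewrite /xi /eta /xiX; apply/matrixP => i j.
by do 6!rewrite ?mxE ?sum2; ring.
Qed.

Lemma nuX_bracket Z A B L D A' B' L' D' (xi := xiX Z A B L D)
    (eta := xiX Z A' B' L' D') :
  L' *m xi - L *m eta + (nuX Z L D *m nuX Z L' D' - nuX Z L' D' *m nuX Z L D) =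
  nuX Z (L *m A' + D *m L' - (L' *m A + D' *m L))
    (L *m B' + D *m D' - (L' *m B + D' *m D)).
Proof.
rewrite /xi /eta /xiX /nuX; apply/matrixP => i j.
by do 6!rewrite ?mxE ?sum2; ring.
Qed.
End Sp4Symbols.

Section BlockBracket.
Variable C : pzRingType.
Implicit Types X Y : 'M[C]_(2 + 2).
Lemma ulsub_mul X Y : ulsubmx (X *m Y) =
  ulsubmx X *m ulsubmx Y + ursubmx X *m dlsubmx Y.
Proof. by rewrite -{1}[X]submxK -{1}[Y]submxK mulmx_block block_mxKul. Qed.
Lemma ursub_mul X Y : ursubmx (X *m Y) =
  ulsubmx X *m ursubmx Y + ursubmx X *m drsubmx Y.
Proof. by rewrite -{1}[X]submxK -{1}[Y]submxK mulmx_block block_mxKur. Qed.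
Lemma dlsub_mul X Y : dlsubmx (X *m Y) =
  dlsubmx X *m ulsubmx Y + drsubmx X *m dlsubmx Y.
Proof. by rewrite -{1}[X]submxK -{1}[Y]submxK mulmx_block block_mxKdl. Qed.
Lemma drsub_mul X Y : drsubmx (X *m Y) =
  dlsubmx X *m ursubmx Y + drsubmx X *m drsubmx Y.
Proof. by rewrite -{1}[X]submxK -{1}[Y]submxK mulmx_block block_mxKdr. Qed.
End BlockBracket.

Section SymbolAction.
Variable K : fieldType.
Variables (d t : 'I_2 -> 'I_2 -> K -> K) (tau : K) (Z : 'M[K]_2).
Hypothesis dD : forall i j, derivation (d i j).
Hypothesis tD : forall i j, twisted_derivation (d i j) (t i j).
Hypothesis tC : forall i j k l x, t i j (t k l x) = t k l (t i j x).
Hypothesis dtau : forall i j, d i j tau = 0.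
Implicit Types (xi A B L D F : 'M[K]_2).

Definition cst_mx A := forall i j k l, d i j (A k l) = 0.

Lemma dv_cst xi x : (forall i j, d i j x = 0) -> dv xi d x = 0.
Proof. by move=> dx; rewrite /dv big1 // => i _; rewrite big1 // => j _; rewrite dx mulr0. Qed.

Lemma dv_tau xi x : dv xi d (tau * x) = tau * dv xi d x.
Proof.
by rewrite (derD_mul (dv_derivation dD xi)) (dv_cst xi dtau) mul0r add0r.
Qed.

Lemma dv_xiX xi A B L D : map_mx (dv xi d) Z = xi ->
  cst_mx A -> cst_mx B -> cst_mx L -> cst_mx D ->
  map_mx (dv xi d) (xiX Z A B L D) =
  xi *m L *m Z + Z *m L *m xi + xi *m D - A *m xi.
Proof.
have dd := dv_derivation dD xi.
move=> ZE cA cB cL cD.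
have zE i j : dv xi d (Z i j) = xi i j by rewrite -[in RHS]ZE mxE.
apply/matrixP => i j; rewrite /xiX; do 4!rewrite ?mxE ?sum2.
rewrite !(derDB dd, derD_add dd, derD_mul dd).
rewrite !(dv_cst xi (fun a b => cA a b _ _), dv_cst xi (fun a b => cB a b _ _)).
rewrite !(dv_cst xi (fun a b => cL a b _ _), dv_cst xi (fun a b => cD a b _ _)).
by rewrite !zE; ring.
Qed.

Lemma dv_nuX xi L D : map_mx (dv xi d) Z = xi -> cst_mx L -> cst_mx D ->
  map_mx (dv xi d) (nuX Z L D) = L *m xi.
Proof.
have dd := dv_derivation dD xi.
move=> ZE cL cD.
have zE i j : dv xi d (Z i j) = xi i j by rewrite -[in RHS]ZE mxE.
apply/matrixP => i j; rewrite /nuX; do 4!rewrite ?mxE ?sum2.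
rewrite !(derDB dd, derD_add dd, derD_mul dd).
rewrite !(dv_cst xi (fun a b => cL a b _ _), dv_cst xi (fun a b => cD a b _ _)).
by rewrite !zE; ring.
Qed.

Section Pair.
Variables (A B L D A' B' L' D' : 'M[K]_2).
Hypothesis (cA : cst_mx A) (cB : cst_mx B) (cL : cst_mx L) (cD : cst_mx D).
Hypothesis (cA' : cst_mx A') (cB' : cst_mx B') (cL' : cst_mx L') (cD' : cst_mx D').
Let xi := xiX Z A B L D.
Let eta := xiX Z A' B' L' D'.
Hypothesis (Zxi : map_mx (dv xi d) Z = xi) (Zeta : map_mx (dv eta d) Z = eta).

Let xi2 := xiX Z (A *m A' + B *m L' - (A' *m A + B' *m L))
    (A *m B' + B *m D' - (A' *m B + B' *m D))
    (L *m A' + D *m L' - (L' *m A + D' *m L))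
    (L *m B' + D *m D' - (L' *m B + D' *m D)).
Let nu2 := nuX Z (L *m A' + D *m L' - (L' *m A + D' *m L))
    (L *m B' + D *m D' - (L' *m B + D' *m D)).

Lemma nuX_act_comm F :
  Lop t tau xi (nuX Z L D) (Lop t tau eta (nuX Z L' D') F) =
  Lop t tau eta (nuX Z L' D') (Lop t tau xi (nuX Z L D) F) + Lop t tau xi2 nu2 F.
Proof.
rewrite (Lop_comm dD tD tC _ _ _ (dv_tau xi) (dv_tau eta)).
have -> : map_mx (dv xi d) eta - map_mx (dv eta d) xi = xi2.
  rewrite (dv_xiX Zxi cA' cB' cL' cD') (dv_xiX Zeta cA cB cL cD).
  exact: xiX_bracket.
rewrite (dv_nuX Zxi cL' cD') (dv_nuX Zeta cL cD).
have -> : L' *m xi - L *m eta + (nuX Z L D *m nuX Z L' D' - nuX Z L' D' *m nuX Z L D) =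
  nu2 by exact: nuX_bracket.
by [].
Qed.

(** The multiplier of [rho2] is contragredient, -nu^T; since M |-> -M^T respects commutators, the
    bracket of [nuX] carries over. *)
Lemma nuXT_act_comm F :
  Lop t tau xi (- (nuX Z L D)^T) (Lop t tau eta (- (nuX Z L' D')^T) F) =
  Lop t tau eta (- (nuX Z L' D')^T) (Lop t tau xi (- (nuX Z L D)^T) F)
  + Lop t tau xi2 (- nu2^T) F.
Proof.
have dNT xi' M : map_mx (dv xi' d) (- M^T) = - (map_mx (dv xi' d) M)^T.
  by apply/matrixP => i j; rewrite !mxE (derDN (dv_derivation dD xi')).
rewrite (Lop_comm dD tD tC _ _ _ (dv_tau xi) (dv_tau eta)).
have -> : map_mx (dv xi d) eta - map_mx (dv eta d) xi = xi2.
  rewrite (dv_xiX Zxi cA' cB' cL' cD') (dv_xiX Zeta cA cB cL cD).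
  exact: xiX_bracket.
rewrite !dNT (dv_nuX Zxi cL' cD') (dv_nuX Zeta cL cD).
have -> : - (L' *m xi)^T - - (L *m eta)^T +
    (- (nuX Z L D)^T *m - (nuX Z L' D')^T - - (nuX Z L' D')^T *m - (nuX Z L D)^T)
    = - nu2^T.
  have := nuX_bracket Z A B L D A' B' L' D'; rewrite -/nu2 => <-.
  rewrite !mulNmx !mulmxN !opprK -!trmx_mul.
  apply/matrixP => i j; rewrite !mxE.
  by set a := \sum_k _; set b := \sum_k _; set p := \sum_k _; set q := \sum_k _; ring.
by [].
Qed.
End Pair.
End SymbolAction.

Section TwistedPair.
Variables (K : fieldType) (D E : K -> K) (c u : K).
Hypothesis (dD : derivation D) (dE : derivation E) (DE : forall x, D (E x) = E (D x)).
Hypothesis (u0 : u != 0) (Dc : D c = 0) (Ec : E c = 0).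
(** Adding c dlog u keeps the derivations commuting because dlog u is closed. The case of interest
    is u = N(Z), c = 1/2. *)
Lemma log_twist_comm x :
  D (E x + c * u^-1 * E u * x) + c * u^-1 * D u * (E x + c * u^-1 * E u * x) =
  E (D x + c * u^-1 * D u * x) + c * u^-1 * E u * (D x + c * u^-1 * D u * x).
Proof.
rewrite !(derD_add dD) !(derD_add dE) !(derD_mul dD) !(derD_mul dE).
rewrite !(derDV dD) !(derDV dE) Dc Ec !DE; field; exact: u0.
Qed.
End TwistedPair.

Lemma log_twist_derivation (K : fieldType) (D : K -> K) (c : K) :
  derivation D -> twisted_derivation D (fun x => D x + c * x).
Proof.
move=> dD; split=> x y; first by rewrite (derD_add dD); ring.
by rewrite (derD_mul dD); ring.
Qed.

Section LopLinear.
Variable K : fieldType.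
Variables (d t : 'I_2 -> 'I_2 -> K -> K) (tau : K) (Z : 'M[K]_2).
Hypothesis tD : forall i j, twisted_derivation (d i j) (t i j).
Implicit Types (xi M F : 'M[K]_2).

Lemma Lop_linear xi M c F G : (forall i j, d i j c = 0) ->
  Lop t tau xi M (c *: F + G) = c *: Lop t tau xi M F + Lop t tau xi M G.
Proof.
move=> dc.
have tDD i j x y : t i j (x + y) = t i j x + t i j y by case: (tD i j).
have tDM i j x y : t i j (x * y) = d i j x * y + x * t i j y by case: (tD i j).
apply/matrixP => i j; rewrite /Lop /dv; do 3!rewrite ?mxE ?sum2.
by rewrite !tDD !tDM !dc; ring.
Qed.

Lemma Lop_addX xi xi' M M' F :
  Lop t tau (xi + xi') (M + M') F = Lop t tau xi M F + Lop t tau xi' M' F.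
Proof.
apply/matrixP => i j; rewrite /Lop /dv /mxtrace; do 3!rewrite ?mxE ?sum2.
by ring.
Qed.

Lemma xiXD A B L D A' B' L' D' : xiX Z (A + A') (B + B') (L + L') (D + D') =
  xiX Z A B L D + xiX Z A' B' L' D'.
Proof.
by apply/matrixP => i j; rewrite /xiX; do 3!rewrite ?mxE ?sum2; ring.
Qed.
Lemma nuXD L D L' D' : nuX Z (L + L') (D + D') = nuX Z L D + nuX Z L' D'.
Proof.
by apply/matrixP => i j; rewrite /nuX; do 3!rewrite ?mxE ?sum2; ring.
Qed.

Lemma LopE xi M F : Lop t tau xi M F =
  map_mx (dv xi t) F + (tau * \tr M) *: F + M *m F + F *m M^T.
Proof. by []. Qed.

Lemma dv_add xi xi' F :
  map_mx (dv (xi + xi') t) F = map_mx (dv xi t) F + map_mx (dv xi' t) F.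
Proof. by apply/matrixP => i j; rewrite !mxE /dv !sum2 !mxE; ring. Qed.
Lemma dv_opp xi F : map_mx (dv (- xi) t) F = - map_mx (dv xi t) F.
Proof. by apply/matrixP => i j; rewrite !mxE /dv !sum2 !mxE; ring. Qed.
End LopLinear.

Lemma rho2_Lop_eq (K : fieldType) (t : 'I_2 -> 'I_2 -> K -> K) (Z A B L F : 'M[K]_2) :
  Z^T = Z -> L^T = L ->
  - (map_mx (dv (A *m Z + Z *m A^T) t) F + \tr (2 *: A) *: F) + A *m F + F *m A^T
  + - map_mx (dv B t) F
  + (map_mx (dv (Z *m L *m Z) t) F + \tr (2 *: (Z *m L)) *: F
     - Z *m L *m F - F *m L *m Z) =
  Lop t (- 2) (xiX Z A B L (- A^T)) (- (nuX Z L (- A^T))^T) F.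
Proof.
move=> ZT LT; rewrite LopE /xiX /nuX !dv_add !dv_opp mulmxN.
rewrite !dv_opp.
have -> : - (L *m Z + - A^T)^T = A - Z *m L.
  by rewrite linearD /= trmx_mul ZT LT linearN /= trmxK opprD opprK addrC.
have -> : (A - Z *m L)^T = A^T - L *m Z.
  by rewrite linearB /= trmx_mul ZT LT.
rewrite !mulmxBl !mulmxBr -!mulmxA.
have -> : \tr (A - Z *m L) = \tr A - \tr (Z *m L) by exact: raddfB.
rewrite !mxtraceZ; move: (\tr A) (\tr (Z *m L)) => a b.
move: (A *m F) (F *m A^T) (Z *m (L *m F)) (F *m (L *m Z)) => P Q R S.
move: (map_mx _ F) (map_mx _ F) (map_mx _ F) (map_mx _ F) => M1 M2 M3 M4.
by apply/matrixP => i j; rewrite !mxE; ring.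
Qed.

(** * The action rho'_2 in coordinates *)

Section RhoW.
Variable C : numClosedFieldType.
Local Notation K := (ratfun C 3).
Local Notation Zs := (@Zs C).
Local Notation Ns := (@Ns C).
Local Notation pd := (@pd C 3).
Local Notation rcst := (@rcst C 3).
Local Notation hpd := (@half_pd C).

(** The derivatives on functions without the factor N^(1/2): they differentiate the coefficients in
    [Lop], while [dels] differentiates the section. *)
Definition del0 : 'I_2 -> 'I_2 -> K -> K :=
  let d12 x := - rcst ('i / 2) * pd 2%:R x in ent2 (pd 0) d12 d12 (pd 1).

Lemma del0_00 x : del0 0 0 x = pd 0 x. Proof. by []. Qed.
Lemma del0_01 x : del0 0 1 x = - rcst ('i / 2) * pd 2%:R x. Proof. by []. Qed.
Lemma del0_10 x : del0 1 0 x = - rcst ('i / 2) * pd 2%:R x. Proof. by []. Qed.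
Lemma del0_11 x : del0 1 1 x = pd 1 x. Proof. by []. Qed.
Definition del0E := (del0_00, del0_01, del0_10, del0_11).

Lemma Zs00 : Zs 0 0 = var C 0. Proof. by rewrite mxE. Qed.
Lemma Zs11 : Zs 1 1 = var C 1. Proof. by rewrite mxE. Qed.
Lemma Zs01 : Zs 0 1 = rcst 'i * var C 2%:R. Proof. by rewrite mxE. Qed.
Lemma Zs10 : Zs 1 0 = rcst 'i * var C 2%:R. Proof. by rewrite mxE. Qed.
Lemma ZsT : Zs^T = Zs.
Proof. by apply: matrix2P; rewrite mxE // Zs01 Zs10. Qed.

Lemma det2 (R : comPzRingType) (M : 'M[R]_2) :
  \det M = M 0 0 * M 1 1 - M 0 1 * M 1 0.
Proof.
have l1 : lift (0 : 'I_2) (0 : 'I_1) = 1 by exact: val_inj.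
have l0 : lift (1 : 'I_2) (0 : 'I_1) = 0 by exact: val_inj.
rewrite (expand_det_row _ 0) sum2 /cofactor !det_mx11 !mxE !l1 !l0 /=.
by rewrite expr0 expr1 mul1r mulN1r mulrN.
Qed.

Lemma rcst_ii : rcst 'i * rcst 'i = -1.
Proof. by rewrite -rcstM mulCii rcstN rcst1. Qed.

Lemma NsE : Ns = var C 0 * var C 1 + var C 2%:R * var C 2%:R.
Proof.
rewrite /Defs.Ns det2 Zs00 Zs11 Zs01 Zs10 mulrACA rcst_ii.
by rewrite mulN1r opprK.
Qed.

Lemma Ns_neq0 : Ns != 0.
Proof.
rewrite NsE -!ofpXi -!ofpM -ofpD ofpoly_eq0; apply/negP => /eqP /mpolyP.
move/(_ (U_(0%R) + U_(1%R))%MM).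
rewrite mcoeffD -!mpolyXD !mcoeffX eqxx mcoeff0.
case: eqP => [/mnmP/(_ 0)|_ /eqP]; last by rewrite addr0 oner_eq0.
by rewrite !mnmDE !mnm1E.
Qed.

Lemma var_neq0 n (i : 'I_n) : var C i != 0.
Proof.
rewrite -ofpXi ofpoly_eq0; apply/negP => /eqP /mpolyP /(_ U_(i)%MM).
by rewrite mcoeffX eqxx mcoeff0 => /eqP; rewrite oner_eq0.
Qed.

Lemma half_pd_comm i j x : hpd i (hpd j x) = hpd j (hpd i x).
Proof.
exact (log_twist_comm (pd_derivation i) (pd_derivation j) (pd_comm i j) Ns_neq0
  (pd_rcst i _) (pd_rcst j _) x).
Qed.

Lemma half_pd_twisted i : twisted_derivation (pd i) (hpd i).
Proof. exact: (log_twist_derivation _ (pd_derivation i)). Qed.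

Lemma half_pdZ i (c : C) x : hpd i (rcst c * x) = rcst c * hpd i x.
Proof. by case: (half_pd_twisted i) => _ ->; rewrite pd_rcst mul0r add0r. Qed.

Lemma del0_der i j : derivation (del0 i j).
Proof.
have d12 : derivation (fun x => - rcst ('i / 2) * pd 2%:R x).
  have [aD mD] := pd_derivation (C := C) (2%:R : 'I_3).
  split=> x y; first by rewrite aD mulrDr.
  by rewrite mD mulrDr mulrA [in X in _ + X]mulrCA.
move: i j; apply: ord2P; apply: ord2P => //; exact: pd_derivation.
Qed.

Lemma dels_twisted i j : twisted_derivation (del0 i j) (@dels C i j).
Proof.
have d12 : twisted_derivation (fun x => - rcst ('i / 2) * pd 2%:R x)
    (fun x => - rcst ('i / 2) * hpd 2%:R x).
  have [aD mD] := half_pd_twisted (2%:R : 'I_3).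
  split=> x y; first by rewrite aD mulrDr.
  by rewrite mD mulrDr mulrA [in X in _ + X]mulrCA.
move: i j; apply: ord2P; apply: ord2P => //; exact: half_pd_twisted.
Qed.

Lemma del0_rcst i j (c : C) : del0 i j (rcst c) = 0.
Proof.
by move: i j; apply: ord2P; apply: ord2P; rewrite del0E pd_rcst ?mulr0.
Qed.

Lemma dels_comm i j k l x : @dels C i j (@dels C k l x) = @dels C k l (@dels C i j x).
Proof.
have E i' j' : exists a b, forall y, @dels C i' j' y = rcst a * hpd b y.
  move: i' j'; apply: ord2P; apply: ord2P.
  - by exists 1, 0 => y; rewrite rcst1 mul1r.
  - by exists (- ('i / 2)), 2%:R => y; rewrite rcstN.
  - by exists (- ('i / 2)), 2%:R => y; rewrite rcstN.
  - by exists 1, 1 => y; rewrite rcst1 mul1r.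
have [a [b E1]] := E i j; have [a' [b' E2]] := E k l.
by rewrite !(E1, E2) !half_pdZ half_pd_comm mulrCA.
Qed.

(** Z has three independent entries. For symmetric [xi] each of the two off-diagonal terms
    contributes half of the off-diagonal entry, because (-i/2) i = 1/2. *)
Lemma del0_Zs (xi : 'M[K]_2) : xi^T = xi -> map_mx (dv xi del0) Zs = xi.
Proof.
move=> xiT; have x10 : xi 1 0 = xi 0 1 by rewrite -[in LHS]xiT mxE.
have c12 : - rcst ('i / 2) * rcst 'i = rcst 2^-1.
  by rewrite -rcstN -rcstM mulNr mulrAC mulCii mulN1r opprK.
have half x : x * rcst 2^-1 + x * rcst 2^-1 = x.
  rewrite -mulrDr -rcstD (_ : 2^-1 + 2^-1 = 1) ?rcst1 ?mulr1 //.
  by field.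
apply: matrix2P; rewrite mxE /dv !sum2 !del0E ?Zs00 ?Zs01 ?Zs10 ?Zs11.
all: rewrite ?(derD_mul (pd_derivation _)) ?pd_rcst ?pd_var /=.
all: rewrite ?(mulr0, mul0r, addr0, add0r, mulr1) ?c12 ?x10 ?half //.
Qed.

End RhoW.

Section TrSub.
Variable R : pzRingType.
Lemma trB m n (A B : 'M[R]_(m, n)) : (A - B)^T = A^T - B^T. Proof. exact: raddfB. Qed.
Lemma trD m n (A B : 'M[R]_(m, n)) : (A + B)^T = A^T + B^T. Proof. exact: raddfD. Qed.
Lemma trN m n (A : 'M[R]_(m, n)) : (- A)^T = - A^T. Proof. exact: raddfN. Qed.
Implicit Types X Y : 'M[R]_(2 + 2).
Lemma ulsubB X Y : ulsubmx (X - Y) = ulsubmx X - ulsubmx Y.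
Proof. by apply/matrixP => i j; rewrite !mxE. Qed.
Lemma ursubB X Y : ursubmx (X - Y) = ursubmx X - ursubmx Y.
Proof. by apply/matrixP => i j; rewrite !mxE. Qed.
Lemma dlsubB X Y : dlsubmx (X - Y) = dlsubmx X - dlsubmx Y.
Proof. by apply/matrixP => i j; rewrite !mxE. Qed.
Lemma drsubB X Y : drsubmx (X - Y) = drsubmx X - drsubmx Y.
Proof. by apply/matrixP => i j; rewrite !mxE. Qed.
Lemma ulsubD X Y : ulsubmx (X + Y) = ulsubmx X + ulsubmx Y.
Proof. by apply/matrixP => i j; rewrite !mxE. Qed.
Lemma ursubD X Y : ursubmx (X + Y) = ursubmx X + ursubmx Y.
Proof. by apply/matrixP => i j; rewrite !mxE. Qed.
Lemma dlsubD X Y : dlsubmx (X + Y) = dlsubmx X + dlsubmx Y.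
Proof. by apply/matrixP => i j; rewrite !mxE. Qed.
Lemma drsubD X Y : drsubmx (X + Y) = drsubmx X + drsubmx Y.
Proof. by apply/matrixP => i j; rewrite !mxE. Qed.
End TrSub.

Lemma xiX_sym (K : fieldType) (Z A B L : 'M[K]_2) : Z^T = Z -> B^T = B -> L^T = L ->
  (xiX Z A B L (- A^T))^T = xiX Z A B L (- A^T).
Proof.
move=> ZT BT LT; rewrite /xiX.
rewrite !(trB, trD) !trmx_mul ZT BT LT trN trmxK mulmxN mulNmx mulmxA.
by apply/matrixP => i j; rewrite !mxE; do ![set x := \sum_k _]; ring.
Qed.

Section Cmx.
Variables (C : numClosedFieldType) (n : nat).
Implicit Types A B : 'M[C]_2.
Lemma cmxD A B : cmx n (A + B) = cmx n A + cmx n B.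
Proof. by apply/matrixP => i j; rewrite !mxE rcstD. Qed.
Lemma cmxN A : cmx n (- A) = - cmx n A.
Proof. by apply/matrixP => i j; rewrite !mxE rcstN. Qed.
Lemma cmxB A B : cmx n (A - B) = cmx n A - cmx n B.
Proof. by rewrite cmxD cmxN. Qed.
Lemma cmxM A B : cmx n (A *m B) = cmx n A *m cmx n B.
Proof. by apply/matrixP => i j; rewrite !mxE !sum2 !mxE rcstD !rcstM. Qed.
Lemma cmxT A : (cmx n A)^T = cmx n A^T.
Proof. by apply/matrixP => i j; rewrite !mxE. Qed.
Lemma tens_scaleE (a : C) (F : tens C n) : a *: F = (rcst n a *: (F : 'M_2)) :> 'M_2.
Proof. by []. Qed.
End Cmx.

Lemma tens_addE (C : numClosedFieldType) n (F G : tens C n) : F + G = ((F : 'M_2) + (G : 'M_2)) :> 'M_2.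
Proof. by []. Qed.
Section Rho2.
Variable C : numClosedFieldType.
Local Notation K := (ratfun C 3).
Local Notation Zs := (@Zs C).
Local Notation cmx := (@cmx 3 C).
Implicit Types X Y : 'M[C]_(2 + 2).

Definition xiS X : 'M[K]_2 :=
  xiX Zs (cmx (ulsubmx X)) (cmx (ursubmx X)) (cmx (dlsubmx X)) (cmx (drsubmx X)).
Definition nuS X : 'M[K]_2 := nuX Zs (cmx (dlsubmx X)) (cmx (drsubmx X)).

Lemma rho2_Lop X (F : tens C 3) : sp4 X ->
  rho2 X F = Lop (@dels C) (- 2) (xiS X) (- (nuS X)^T) F.
Proof.
case=> _ LT DE.
have LT' : (cmx (dlsubmx X))^T = cmx (dlsubmx X) by rewrite cmxT LT.
rewrite /xiS /nuS DE cmxN -cmxT.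
exact (rho2_Lop_eq (@dels C) (cmx (ulsubmx X)) (cmx (ursubmx X)) F (ZsT C) LT').
Qed.

Lemma cmx_cst A : cst_mx (@del0 C) (cmx A).
Proof. by move=> i j k l; rewrite mxE del0_rcst. Qed.

Lemma xiS_sym X : sp4 X -> (xiS X)^T = xiS X.
Proof.
case=> BT LT DE; rewrite /xiS DE cmxN -cmxT.
have LT' : (cmx (dlsubmx X))^T = cmx (dlsubmx X) by rewrite cmxT LT.
have BT' : (cmx (ursubmx X))^T = cmx (ursubmx X) by rewrite cmxT BT.
exact: (xiX_sym _ (ZsT C) BT' LT').
Qed.

Lemma sp4_bracket X Y : sp4 X -> sp4 Y -> sp4 (X *m Y - Y *m X).
Proof.
move=> [BT LT DE] [BT' LT' DE'].
split; rewrite ?ursubB ?dlsubB ?drsubB ?ulsubB ?ursub_mul ?dlsub_mul ?drsub_mul ?ulsub_mul DE DE'.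
- rewrite !(trB, trD, trN, trmx_mul) !trmxK BT BT' !mulNmx !mulmxN.
  by apply/matrixP => i j; rewrite !mxE; do ![set x := \sum_k _]; ring.
- rewrite !(trB, trD, trN, trmx_mul) !trmxK LT LT' !mulNmx !mulmxN.
  by apply/matrixP => i j; rewrite !mxE; do ![set x := \sum_k _]; ring.
- rewrite !(trB, trD, trN, trmx_mul) BT BT' LT LT' !mulNmx !mulmxN !opprK.
  by apply/matrixP => i j; rewrite !mxE; do ![set x := \sum_k _]; ring.
Qed.

Lemma sp4D X Y : sp4 X -> sp4 Y -> sp4 (X + Y).
Proof.
move=> [BT LT DE] [BT' LT' DE'].
by split; rewrite ?ursubD ?dlsubD ?drsubD ?ulsubD !trD ?BT ?BT' ?LT ?LT' // DE DE' opprD.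
Qed.

Lemma rho2_lie (U : set (tens C 3)) : lie_module (@sp4 C) (@rho2 C) U.
Proof.
have c2 i j : @del0 C i j (- 2) = 0.
  have -> : (- 2 : K) = rcst 3 (- 2 : C) by rewrite rcstN rcst_nat.
  exact: del0_rcst.
split=> [X a u v sX|X Y u sX sY|X Y u sX sY _].
- rewrite !rho2_Lop // !tens_scaleE.
  exact (@Lop_linear K _ _ _ (@dels_twisted C) _ _ _ u v (fun i j => del0_rcst i j a)).
- have sXY : sp4 (X + Y) by exact: sp4D.
  rewrite !rho2_Lop // /xiS /nuS ulsubD ursubD dlsubD drsubD !cmxD xiXD nuXD.
  rewrite trD [- (_^T + _)]opprD -/(nuS X) -/(nuS Y) -/(xiS X) -/(xiS Y).
  exact (Lop_addX (@dels C) (- 2) (xiS X) (xiS Y) (- (nuS X)^T) (- (nuS Y)^T) u).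
have sXY := sp4_bracket sX sY.
rewrite !rho2_Lop //.
have E := nuXT_act_comm (@del0_der C) (@dels_twisted C) (@dels_comm C) c2
  (cmx_cst (ulsubmx X)) (cmx_cst (ursubmx X)) (cmx_cst (dlsubmx X)) (cmx_cst (drsubmx X))
  (cmx_cst (ulsubmx Y)) (cmx_cst (ursubmx Y)) (cmx_cst (dlsubmx Y)) (cmx_cst (drsubmx Y))
  (del0_Zs (xiS_sym sX)) (del0_Zs (xiS_sym sY)) u.
have xE : xiS (X *m Y - Y *m X) = xiX Zs
  (cmx (ulsubmx X) *m cmx (ulsubmx Y) + cmx (ursubmx X) *m cmx (dlsubmx Y)
   - (cmx (ulsubmx Y) *m cmx (ulsubmx X) + cmx (ursubmx Y) *m cmx (dlsubmx X)))
  (cmx (ulsubmx X) *m cmx (ursubmx Y) + cmx (ursubmx X) *m cmx (drsubmx Y)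
   - (cmx (ulsubmx Y) *m cmx (ursubmx X) + cmx (ursubmx Y) *m cmx (drsubmx X)))
  (cmx (dlsubmx X) *m cmx (ulsubmx Y) + cmx (drsubmx X) *m cmx (dlsubmx Y)
   - (cmx (dlsubmx Y) *m cmx (ulsubmx X) + cmx (drsubmx Y) *m cmx (dlsubmx X)))
  (cmx (dlsubmx X) *m cmx (ursubmx Y) + cmx (drsubmx X) *m cmx (drsubmx Y)
   - (cmx (dlsubmx Y) *m cmx (ursubmx X) + cmx (drsubmx Y) *m cmx (drsubmx X))).
  rewrite /xiS ulsubB ursubB dlsubB drsubB !ulsub_mul !ursub_mul !dlsub_mul !drsub_mul.
  by rewrite !cmxB !cmxD !cmxM.
have nE : nuS (X *m Y - Y *m X) = nuX Zs
  (cmx (dlsubmx X) *m cmx (ulsubmx Y) + cmx (drsubmx X) *m cmx (dlsubmx Y)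
   - (cmx (dlsubmx Y) *m cmx (ulsubmx X) + cmx (drsubmx Y) *m cmx (dlsubmx X)))
  (cmx (dlsubmx X) *m cmx (ursubmx Y) + cmx (drsubmx X) *m cmx (drsubmx Y)
   - (cmx (dlsubmx Y) *m cmx (ursubmx X) + cmx (drsubmx Y) *m cmx (drsubmx X))).
  rewrite /nuS dlsubB drsubB !dlsub_mul !drsub_mul.
  by rewrite !cmxB !cmxD !cmxM.
rewrite xE nE; exact E.
Qed.
End Rho2.

Section SymTriples.
Variable K : fieldType.
Variables (I x y t : K) (d0 d1 d2 : K -> K).
Hypothesis (II : I * I = -1) (two : (2 : K) != 0).
Hypothesis (d0I : forall u, d0 (I * u) = I * d0 u) (d1I : forall u, d1 (I * u) = I * d1 u)
  (d2I : forall u, d2 (I * u) = I * d2 u).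

(** The off-diagonal entry carries the factor I, as z12 = i t does. On the triples (p, q, s) the
    operators below are then free of I. *)
Definition symK (p q s : K) : 'M[K]_2 := \matrix_(i, j) ent2 p (I * q) (I * q) s i j.
Definition mx2 (a b c d : K) : 'M[K]_2 := \matrix_(i, j) ent2 a b c d i j.
Let Z := symK x t y.
Let D : 'I_2 -> 'I_2 -> K -> K :=
  ent2 d0 (fun u => - (I / 2) * d2 u) (fun u => - (I / 2) * d2 u) d1.
Definition actK (A B L F : 'M[K]_2) :=
  Lop D (- 2) (xiX Z A B L (- A^T)) (- (nuX Z L (- A^T))^T) F.

Let D00 u : D 0 0 u = d0 u. Proof. by []. Qed.
Let D01 u : D 0 1 u = - (I / 2) * d2 u. Proof. by []. Qed.
Let D10 u : D 1 0 u = - (I / 2) * d2 u. Proof. by []. Qed.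
Let D11 u : D 1 1 u = d1 u. Proof. by []. Qed.
Let m00 a b c d : mx2 a b c d 0 0 = a. Proof. by rewrite mxE. Qed.
Let m01 a b c d : mx2 a b c d 0 1 = b. Proof. by rewrite mxE. Qed.
Let m10 a b c d : mx2 a b c d 1 0 = c. Proof. by rewrite mxE. Qed.
Let m11 a b c d : mx2 a b c d 1 1 = d. Proof. by rewrite mxE. Qed.
Let s00 a b c : symK a b c 0 0 = a. Proof. by rewrite mxE. Qed.
Let s01 a b c : symK a b c 0 1 = I * b. Proof. by rewrite mxE. Qed.
Let s10 a b c : symK a b c 1 0 = I * b. Proof. by rewrite mxE. Qed.
Let s11 a b c : symK a b c 1 1 = c. Proof. by rewrite mxE. Qed.

Let e00 (T : Type) (a b c d : T) : ent2 a b c d 0 0 = a. Proof. by []. Qed.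
Let e01 (T : Type) (a b c d : T) : ent2 a b c d 0 1 = b. Proof. by []. Qed.
Let e10 (T : Type) (a b c d : T) : ent2 a b c d 1 0 = c. Proof. by []. Qed.
Let e11 (T : Type) (a b c d : T) : ent2 a b c d 1 1 = d. Proof. by []. Qed.

Local Ltac go :=
  rewrite /actK /Lop /xiX /nuX; rewrite ?(trmx0, oppr0, mulmx0, mul0mx, add0r, subr0, addr0, sub0r);
  rewrite /Z; apply: matrix2P;
  do 3!rewrite ?mxE ?sum2 /dv /mxtrace; do 4!rewrite ?mxE ?sum2;
  rewrite ?(e00, e01, e10, e11, D00, D01, D10, D11) ?(d0I, d1I, d2I).

Lemma act_b2 p q s : actK 0 (mx2 0 0 0 1) 0 (symK p q s) =
  symK (- d1 p) (- d1 q) (- d1 s).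
Proof. by go; ring. Qed.

Lemma act_e p q s : I *: actK (mx2 0 0 1 0) 0 0 (symK p q s) =
  symK (2 * t * d1 p - x * d2 p) (2 * t * d1 q - x * d2 q + p)
       (2 * t * d1 s - x * d2 s - 2 * q).
Proof. by go; field: II. Qed.

Lemma act_f p q s : I *: actK (mx2 0 1 0 0) 0 0 (symK p q s) =
  symK (2 * t * d0 p - y * d2 p - 2 * q) (2 * t * d0 q - y * d2 q + s)
       (2 * t * d0 s - y * d2 s).
Proof. by go; field: II. Qed.

Lemma act_h p q s : actK (mx2 1 0 0 (-1)) 0 0 (symK p q s) =
  symK (2 * y * d1 p - 2 * x * d0 p + 2 * p) (2 * y * d1 q - 2 * x * d0 q)
       (2 * y * d1 s - 2 * x * d0 s - 2 * s).
Proof. by go; field: II. Qed.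

Lemma act_d p q s : actK (mx2 1 0 0 1) 0 0 (symK p q s) =
  symK (- 2 * (x * d0 p + y * d1 p + t * d2 p) - 2 * p)
       (- 2 * (x * d0 q + y * d1 q + t * d2 q) - 2 * q)
       (- 2 * (x * d0 s + y * d1 s + t * d2 s) - 2 * s).
Proof. by go; field: II. Qed.

Lemma act_c1 p q s : actK 0 0 (mx2 1 0 0 0) (symK p q s) =
  symK (x * x * d0 p + x * t * d2 p - t * t * d1 p)
       (x * x * d0 q + x * t * d2 q - t * t * d1 q + x * q - t * p)
       (x * x * d0 s + x * t * d2 s - t * t * d1 s + 2 * x * s + 2 * t * q).
Proof. by go; field: II. Qed.
End SymTriples.

(** * Expansions of b and c on the lowest vectors of the K-types *)

Section Triples.
Variable K : fieldType.
Variables (x y t : K) (d0 d1 d2 : K -> K).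
Hypothesis (dd0 : derivation d0) (dd1 : derivation d1) (dd2 : derivation d2).
Hypothesis (d0x : d0 x = 1) (d0y : d0 y = 0) (d0t : d0 t = 0).
Hypothesis (d1x : d1 x = 0) (d1y : d1 y = 1) (d1t : d1 t = 0).
Hypothesis (d2x : d2 x = 0) (d2y : d2 y = 0) (d2t : d2 t = 1).
Let N := x * y + t * t.
Hypothesis (N0 : N != 0) (y0 : y != 0) (two : (2 : K) != 0).

Definition hd (d : K -> K) u := d u + 2^-1 * N^-1 * d N * u.
Definition triple := (K * K * K)%type.

(** All vectors below are N^k y^m times a triple of polynomials, where y = z22 and m may be
    negative. Once this factor is pulled out, k and m enter only as scalars, and identities valid
    for all k and l become polynomial identities. *)
Definition mono (k m : int) (P : triple) : triple :=
  let w := N ^ k * y ^ m in (w * P.1.1, w * P.1.2, w * P.2).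

Definition eT (F : triple) : triple :=
  let g u := 2 * t * hd d1 u - x * hd d2 u in
  (g F.1.1, g F.1.2 + F.1.1, g F.2 - 2 * F.1.2).
Definition fT (F : triple) : triple :=
  let g u := 2 * t * hd d0 u - y * hd d2 u in
  (g F.1.1 - 2 * F.1.2, g F.1.2 + F.2, g F.2).
Definition hT (F : triple) : triple :=
  let g u := 2 * y * hd d1 u - 2 * x * hd d0 u in
  (g F.1.1 + 2 * F.1.1, g F.1.2, g F.2 - 2 * F.2).
Definition dT (F : triple) : triple :=
  let g u := - 2 * (x * hd d0 u + y * hd d1 u + t * hd d2 u) - 2 * u in
  (g F.1.1, g F.1.2, g F.2).
Definition bT (F : triple) : triple := (- hd d1 F.1.1, - hd d1 F.1.2, - hd d1 F.2).
Definition cT (F : triple) : triple :=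
  let g u := x * x * hd d0 u + x * t * hd d2 u - t * t * hd d1 u in
  (g F.1.1, g F.1.2 + x * F.1.2 - t * F.1.1, g F.2 + 2 * x * F.2 + 2 * t * F.1.2).

Lemma hd_mono d k m P : derivation d ->
  hd d (N ^ k * y ^ m * P) = N ^ k * y ^ m *
    (((2 * k%:~R + 1) / 2 * (d N / N) + m%:~R * (d y / y)) * P + d P).
Proof.
move=> dd; rewrite /hd !(derD_mul dd) (derDXz dd _ N0) (derDXz dd _ y0).
field; by rewrite two N0 y0.
Qed.

Let d0N : d0 N = y.
Proof. by rewrite /N (derD_add dd0) !(derD_mul dd0) d0x d0y d0t; ring. Qed.
Let d1N : d1 N = x.
Proof. by rewrite /N (derD_add dd1) !(derD_mul dd1) d1x d1y d1t; ring. Qed.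
Let d2N : d2 N = 2 * t.
Proof. by rewrite /N (derD_add dd2) !(derD_mul dd2) d2x d2y d2t; ring. Qed.

Lemma ysub1 m : y ^ m = y ^ (m - 1) * y.
Proof. by rewrite -{3}[y]expr1z -expfzDr // subrK. Qed.
Lemma Nsub1 m : N ^ m = N ^ (m - 1) * N.
Proof. by rewrite -{3}[N]expr1z -expfzDr // subrK. Qed.

Lemma tripleP (a b c a' b' c' : K) : a = a' -> b = b' -> c = c' ->
  (a, b, c) = (a', b', c').
Proof. by move=> -> -> ->. Qed.

Local Ltac mono_tac :=
  rewrite /mono /=; apply: tripleP; rewrite !hd_mono // ?(d0N, d1N, d2N, d0y, d1y, d2y).

Definition e0 u := 2 * t * d1 u - x * d2 u.
Definition f0 u := 2 * t * d0 u - y * d2 u.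

Lemma eT_mono k m P : eT (mono k m P) = mono k (m - 1)
  (y * e0 P.1.1 + 2 * t * m%:~R * P.1.1,
   y * e0 P.1.2 + 2 * t * m%:~R * P.1.2 + y * P.1.1,
   y * e0 P.2 + 2 * t * m%:~R * P.2 - 2 * y * P.1.2).
Proof.
case: P => [[p q] s]; rewrite /eT; mono_tac; rewrite [y ^ m]ysub1 /e0;
  by field; rewrite two N0 y0.
Qed.

Lemma fT_mono k m P : fT (mono k m P) = mono k m
  (f0 P.1.1 - 2 * P.1.2, f0 P.1.2 + P.2, f0 P.2).
Proof.
case: P => [[p q] s]; rewrite /fT; mono_tac; rewrite /f0;
  by field; rewrite two N0 y0.
Qed.

Lemma hT_mono k m P (g := fun u => 2 * y * d1 u - 2 * x * d0 u + 2 * m%:~R * u) :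
  hT (mono k m P) = mono k m (g P.1.1 + 2 * P.1.1, g P.1.2, g P.2 - 2 * P.2).
Proof.
case: P => [[p q] s]; rewrite /hT /g; mono_tac;
  by field; rewrite two N0 y0.
Qed.

Lemma dT_mono k m P (g := fun u => - 2 * (x * d0 u + y * d1 u + t * d2 u)
    - 2 * (2 * k%:~R + m%:~R + 2) * u) :
  dT (mono k m P) = mono k m (g P.1.1, g P.1.2, g P.2).
Proof.
case: P => [[p q] s]; rewrite /dT /g; mono_tac; rewrite /N;
  by field; rewrite two -/N N0 y0.
Qed.

Lemma bT_mono k m P (g := fun u => - (((2 * k%:~R + 1) / 2 * x * y + m%:~R * N) * u
    + N * y * d1 u)) :
  bT (mono k m P) = mono (k - 1) (m - 1) (g P.1.1, g P.1.2, g P.2).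
Proof.
case: P => [[p q] s]; rewrite /bT /g; mono_tac; rewrite [N ^ k]Nsub1 [y ^ m]ysub1;
  by field; rewrite two N0 y0.
Qed.

Lemma cT_mono k m P (g := fun u => ((2 * k%:~R + 1) / 2 * x * y - m%:~R * t * t) * u
    + y * (x * x * d0 u + x * t * d2 u - t * t * d1 u)) :
  cT (mono k m P) = mono k (m - 1) (g P.1.1, g P.1.2 + x * y * P.1.2 - t * y * P.1.1,
    g P.2 + 2 * x * y * P.2 + 2 * t * y * P.1.2).
Proof.
case: P => [[p q] s]; rewrite /cT /g; mono_tac; rewrite [y ^ m]ysub1 /N;
  by field; rewrite two -/N N0 y0.
Qed.

(** At the least admissible m the entries are multiples of R^(-l)_l = cst y^l and of its first
    translates; these are the resulting vectors up to a constant. [Clw] is written with N^(k-1), the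
    smaller of the two powers of N in C. *)
Definition Tlw k l := mono k l (1, 0, 0).
Definition Mlw k l := mono k (l - 1) (2 * t, - y, 0).
Definition Clw k l := mono (k - 1) (l - 1)
  (2 * l%:~R * t * t + (2 * k%:~R + 2 * l%:~R + 1) * x * y,
   (2 * k%:~R + 1) * t * y, (2 * k%:~R + 1) * y * y).

Definition tsc (c : K) (F : triple) : triple := (c * F.1.1, c * F.1.2, c * F.2).
Definition tadd (F G : triple) : triple := (F.1.1 + G.1.1, F.1.2 + G.1.2, F.2 + G.2).

Let e0_der : derivation e0.
Proof.
split=> u v; rewrite /e0.
  by rewrite (derD_add dd1) (derD_add dd2); ring.
by rewrite (derD_mul dd1) (derD_mul dd2); ring.
Qed.
Let e0x : e0 x = 0. Proof. by rewrite /e0 d1x d2x; ring. Qed.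
Let e0y : e0 y = 2 * t. Proof. by rewrite /e0 d1y d2y; ring. Qed.
Let e0t : e0 t = - x. Proof. by rewrite /e0 d1t d2t; ring. Qed.
Let der_int (d : K -> K) k : derivation d -> d (k%:~R) = 0.
Proof.
move=> dd; case: k => n.
  rewrite -pmulrn; elim: n => [|n IH]; first exact: derD0.
  by rewrite -natr1 (derD_add dd) IH (derD1 dd) addr0.
rewrite NegzE intrN (derDN dd) -pmulrn.
by elim: n => [|n IH]; rewrite ?(derD1 dd) ?oppr0 // -natr1 (derD_add dd) (derD1 dd) addr0.
Qed.
Let der_2 (d : K -> K) : derivation d -> d 2 = 0.
Proof. by move=> dd; exact: (der_int 2 dd). Qed.

Lemma mono_eq k k' m m' (a b c a' b' c' : K) : k = k' -> m = m' -> a = a' -> b = b' ->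
  c = c' -> mono k m (a, b, c) = mono k' m' (a', b', c').
Proof. by move=> -> -> -> -> ->. Qed.

Local Ltac der_simp dd := rewrite ?(derD_add dd, derDB dd, derDN dd, derD_mul dd)
  ?(derD0 dd, derD1 dd, der_int _ dd, der_2 dd).
Local Ltac e_tac := rewrite eT_mono; apply: mono_eq; rewrite /=; try lia;
  der_simp e0_der; rewrite ?(e0x, e0y, e0t) ?(intrB, intrD); ring.

Lemma e1T k l : eT (Tlw k l) = mono k (l - 1) (2 * t * l%:~R, y, 0).
Proof. by rewrite /Tlw; e_tac. Qed.
Lemma e2T k l : eT (eT (Tlw k l)) = mono k (l - 2)
  (2 * l%:~R * (2 * (l%:~R - 1) * t * t - x * y), 4 * l%:~R * t * y, - 2 * y * y).
Proof. by rewrite e1T; e_tac. Qed.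
Lemma e1M k l : eT (Mlw k l) = mono k (l - 2)
  (4 * (l%:~R - 1) * t * t - 2 * x * y, - 2 * (l%:~R - 1) * t * y, 2 * y * y).
Proof. by rewrite /Mlw; e_tac. Qed.
Lemma e2M k l : eT (eT (Mlw k l)) = mono k (l - 3)
  (8 * (l%:~R - 1) * (l%:~R - 2) * t * t * t - 12 * (l%:~R - 1) * x * y * t,
   2 * (l%:~R - 2) * y * (x * y - 2 * (l%:~R - 1) * t * t),
   (8 * l%:~R - 4) * t * y * y).
Proof. by rewrite e1M; e_tac. Qed.
Lemma e1C k l (a := 2 * k%:~R + 2 * l%:~R + 1) (b := 2 * k%:~R + 1) :
  eT (Clw k l) = mono (k - 1) (l - 2)
  (2 * l%:~R * (a - 2) * x * y * t + 4 * l%:~R * (l%:~R - 1) * t * t * t,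
   2 * l%:~R * x * y * y + 2 * l%:~R * (b + 1) * t * t * y,
   2 * l%:~R * b * t * y * y).
Proof. by rewrite /a /b /Clw; e_tac. Qed.
Lemma e2C k l (a := 2 * k%:~R + 2 * l%:~R + 1) (b := 2 * k%:~R + 1) :
  eT (eT (Clw k l)) = mono (k - 1) (l - 3)
  (2 * l%:~R * y * ((a - 2) * (2 * x * t * t - x * x * y) - 6 * (l%:~R - 1) * x * t * t)
   + 2 * t * (l%:~R - 2) * (2 * l%:~R * (a - 2) * x * y * t + 4 * l%:~R * (l%:~R - 1) * t * t * t),
   y * (8 * l%:~R * x * y * t + 2 * l%:~R * (b + 1) * (2 * t * t * t - 2 * x * y * t))
   + 2 * t * (l%:~R - 2) * (2 * l%:~R * x * y * y + 2 * l%:~R * (b + 1) * t * t * y)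
   + y * (2 * l%:~R * (a - 2) * x * y * t + 4 * l%:~R * (l%:~R - 1) * t * t * t),
   2 * l%:~R * b * y * (4 * t * t * y - x * y * y)
   + 2 * t * (l%:~R - 2) * (2 * l%:~R * b * t * y * y)
   - 2 * y * (2 * l%:~R * x * y * y + 2 * l%:~R * (b + 1) * t * t * y)).
Proof. by rewrite e1C /a /b; e_tac. Qed.

Lemma tsc_mono c k m (p q s : K) : tsc c (mono k m (p, q, s)) = mono k m (c * p, c * q, c * s).
Proof. by rewrite /tsc /mono /=; congr (_, _, _); rewrite mulrCA. Qed.
Lemma tadd_mono k m (p q s p' q' s' : K) : tadd (mono k m (p, q, s)) (mono k m (p', q', s')) =
  mono k m (p + p', q + q', s + s').
Proof. by rewrite /tadd /mono /= -!mulrDr. Qed.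
Lemma mono_N k m (p q s : K) : mono k m (p, q, s) = mono (k - 1) m (N * p, N * q, N * s).
Proof. by rewrite /mono /= [N ^ k]Nsub1; congr (_, _, _); ring. Qed.

Local Ltac bc_tac := rewrite /=; 
  der_simp dd0; der_simp dd1; der_simp dd2;
  rewrite ?(d0x, d0y, d0t, d1x, d1y, d1t, d2x, d2y, d2t).

(** The block B is a K-type of highest weight 2, so its product with a string of highest weight 2l +
    2 has components of highest weights 2l + 4, 2l + 2 and 2l. The result has weight 2l, which
    forces the powers 2, 1, 0 of e, and the degree fixes the exponents of N. Two strings of highest
    weight 2l occur, T_(l-1) and C_l. Denominators are cleared; the factor k + l + 1 of T_(l-1) is
    the source of the lower boundary of E. *)
Lemma bT_T k l (K0 := k%:~R : K) (L := l%:~R : K) :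
  tsc (- 4 * (L + 1) * (L + 2) * (2 * L + 3)) (bT (Tlw k l)) =
  tadd (tsc (- (2 * K0 + 1) * (L + 1)) (eT (eT (Tlw (k - 1) (l + 1)))))
  (tadd (tsc (- (2 * K0 + 1) * (2 * L + 3)) (eT (Mlw (k - 1) (l + 1))))
  (tadd (tsc (8 * L * (L + 2) * (L + 2) * (K0 + L + 1)) (Tlw k (l - 1)))
        (tsc (2 * (L + 2)) (Clw k l)))).
Proof.
rewrite e2T e1M /Tlw /Clw bT_mono.
rewrite (_ : l + 1 - 2 = l - 1); last by lia.
rewrite [mono k (l - 1) _]mono_N !tsc_mono !tadd_mono.
apply: mono_eq => //; bc_tac; rewrite ?(intrB, intrD) -/K0 -/L /N.
all: by field.
Qed.

Lemma bT_M k l (K0 := k%:~R : K) (L := l%:~R : K) :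
  tsc (- 4 * L * (L + 1) * (2 * L + 1)) (bT (Mlw k l)) =
  tadd (tsc (- (2 * K0 + 1) * L) (eT (eT (Mlw (k - 1) (l + 1)))))
  (tadd (tsc (- 8 * (2 * L + 1) * (K0 + L + 1)) (eT (Tlw k (l - 1))))
  (tadd (tsc (2 * (2 * L + 1)) (eT (Clw k l)))
        (tsc (8 * (L + 1) * (L * L - 1) * (K0 + L + 1)) (Mlw k (l - 1))))).
Proof.
rewrite e2M e1T e1C /Mlw bT_mono.
rewrite (_ : l + 1 - 3 = l - 2); last by lia.
rewrite (_ : l - 1 - 1 = l - 2); last by lia.
rewrite [mono k (l - 2) _]mono_N [mono k (l - 2) _]mono_N !tsc_mono !tadd_mono.
apply: mono_eq => //; bc_tac; rewrite ?(intrB, intrD) -/K0 -/L /N.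
all: by field.
Qed.

(** Only C occurs on the right, and likewise in [cT_C]: the C alone span an invariant subspace. *)
Lemma bT_C k l (K0 := k%:~R : K) (L := l%:~R : K) :
  tsc (- 4 * (L + 1) * (2 * L + 1)) (bT (Clw k l)) =
  tadd (tsc (- (2 * K0 + 1)) (eT (eT (Clw (k - 1) (l + 1)))))
       (tsc (8 * L * (L + 1) * (K0 + L + 1)) (Clw k (l - 1))).
Proof.
rewrite e2C /Clw bT_mono.
rewrite (_ : l + 1 - 3 = l - 2); last by lia.
rewrite (_ : l - 1 - 1 = l - 2); last by lia.
rewrite [mono (k - 1) (l - 2) _]mono_N !tsc_mono !tadd_mono.
apply: mono_eq => //; bc_tac; rewrite ?(intrB, intrD) -/K0 -/L /N.
all: by field.
Qed.

(** Same pattern with the degree raised by one. The factor k + 1 of T_(l-1) is the source of the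
    upper boundary of E; the factor 2k + 3 on the left clears a denominator. *)
Lemma cT_T k l (K0 := k%:~R : K) (L := l%:~R : K) :
  tsc (4 * (L + 1) * (L + 2) * (2 * L + 3) * (2 * K0 + 3)) (cT (Tlw k l)) =
  tadd (tsc (- (2 * K0 + 2 * L + 5) * (2 * K0 + 3) * (L + 1)) (eT (eT (Tlw k (l + 1)))))
  (tadd (tsc (- (2 * K0 + 1) * (2 * K0 + 3) * (2 * L + 3)) (eT (Mlw k (l + 1))))
  (tadd (tsc (8 * L * (L + 2) * (L + 2) * (K0 + 1) * (2 * K0 + 1)) (Tlw (k + 1) (l - 1)))
        (tsc (- 2 * (L + 2) * (2 * L + 1 - 2 * K0)) (Clw (k + 1) l)))).
Proof.
rewrite e2T e1M /Tlw /Clw cT_mono.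
rewrite (_ : l + 1 - 2 = l - 1); last by lia.
rewrite [mono (k + 1) (l - 1) _]mono_N.
rewrite (_ : k + 1 - 1 = k); last by lia.
rewrite !tsc_mono !tadd_mono.
apply: mono_eq => //; bc_tac; rewrite ?(intrB, intrD) -/K0 -/L /N.
all: by field.
Qed.

Lemma cT_M k l (K0 := k%:~R : K) (L := l%:~R : K) :
  tsc (4 * L * (L + 1) * (2 * L + 1) * (2 * K0 + 3)) (cT (Mlw k l)) =
  tadd (tsc (- (2 * K0 + 2 * L + 3) * (2 * K0 + 3) * L) (eT (eT (Mlw k (l + 1)))))
  (tadd (tsc (- 8 * (2 * L + 1) * (K0 + 1) * (2 * K0 + 2 * L + 3)) (eT (Tlw (k + 1) (l - 1))))
  (tadd (tsc (2 * (2 * L + 1) * (2 * K0 + 1)) (eT (Clw (k + 1) l)))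
        (tsc (8 * (L + 1) * (L * L - 1) * (2 * K0 + 3) * (K0 + 1)) (Mlw (k + 1) (l - 1))))).
Proof.
rewrite e2M e1T e1C /Mlw cT_mono.
rewrite (_ : l + 1 - 3 = l - 2); last by lia.
rewrite (_ : l - 1 - 1 = l - 2); last by lia.
rewrite [mono (k + 1) (l - 2) _]mono_N [mono (k + 1) (l - 2) _]mono_N.
rewrite (_ : k + 1 - 1 = k); last by lia.
rewrite !tsc_mono !tadd_mono.
apply: mono_eq => //; bc_tac; rewrite ?(intrB, intrD) -/K0 -/L /N.
all: by field.
Qed.

Lemma cT_C k l (K0 := k%:~R : K) (L := l%:~R : K) :
  tsc (4 * (L + 1) * (2 * L + 1)) (cT (Clw k l)) =
  tadd (tsc (- (2 * K0 + 2 * L + 1)) (eT (eT (Clw k (l + 1)))))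
       (tsc (8 * L * (L + 1) * K0) (Clw (k + 1) (l - 1))).
Proof.
rewrite e2C /Clw cT_mono.
rewrite (_ : l + 1 - 3 = l - 2); last by lia.
rewrite (_ : l - 1 - 1 = l - 2); last by lia.
rewrite (_ : k + 1 - 1 = k); last by lia.
rewrite [mono k (l - 2) _]mono_N !tsc_mono !tadd_mono.
apply: mono_eq => //; bc_tac; rewrite ?(intrB, intrD) -/K0 -/L /N.
all: by field.
Qed.

Local Ltac f_tac dd0' dd1' dd2' :=
  rewrite /=; apply: mono_eq => //; rewrite /f0; der_simp dd0'; der_simp dd1'; der_simp dd2';
  rewrite ?(d0x, d0y, d0t, d1x, d1y, d1t, d2x, d2y, d2t) ?(intrB, intrD); ring.

Lemma fT_T k l : fT (Tlw k l) = mono k l (0, 0, 0).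
Proof. by rewrite fT_mono; f_tac dd0 dd1 dd2. Qed.
Lemma fT_M k l : fT (Mlw k l) = mono k (l - 1) (0, 0, 0).
Proof. by rewrite fT_mono; f_tac dd0 dd1 dd2. Qed.
Lemma fT_C k l : fT (Clw k l) = mono (k - 1) (l - 1) (0, 0, 0).
Proof. by rewrite fT_mono; f_tac dd0 dd1 dd2. Qed.

Lemma hT_T k l : hT (Tlw k l) = tsc (2 * l%:~R + 2) (Tlw k l).
Proof. by rewrite tsc_mono hT_mono; f_tac dd0 dd1 dd2. Qed.
Lemma hT_M k l : hT (Mlw k l) = tsc (2 * l%:~R) (Mlw k l).
Proof. by rewrite tsc_mono hT_mono; f_tac dd0 dd1 dd2. Qed.
Lemma hT_C k l : hT (Clw k l) = tsc (2 * l%:~R) (Clw k l).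
Proof. by rewrite tsc_mono hT_mono; f_tac dd0 dd1 dd2. Qed.

Lemma dT_T k l : dT (Tlw k l) = tsc (- 2 * (2 * k%:~R + 1 + l%:~R) - 2) (Tlw k l).
Proof. by rewrite tsc_mono dT_mono; f_tac dd0 dd1 dd2. Qed.
Lemma dT_M k l : dT (Mlw k l) = tsc (- 2 * (2 * k%:~R + 1 + l%:~R) - 2) (Mlw k l).
Proof. by rewrite tsc_mono dT_mono; f_tac dd0 dd1 dd2. Qed.
Lemma dT_C k l : dT (Clw k l) = tsc (- 2 * (2 * k%:~R + l%:~R) - 2) (Clw k l).
Proof. by rewrite tsc_mono dT_mono; f_tac dd0 dd1 dd2. Qed.
End Triples.

Lemma ent2_00 (T : Type) (a b c d : T) : ent2 a b c d 0 0 = a. Proof. by []. Qed.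
Lemma ent2_01 (T : Type) (a b c d : T) : ent2 a b c d 0 1 = b. Proof. by []. Qed.
Lemma ent2_10 (T : Type) (a b c d : T) : ent2 a b c d 1 0 = c. Proof. by []. Qed.
Lemma ent2_11 (T : Type) (a b c d : T) : ent2 a b c d 1 1 = d. Proof. by []. Qed.
Definition ent2E := (ent2_00, ent2_01, ent2_10, ent2_11).

(** * A basis of sp(4) and its brackets *)

Section Basis.
Variable C : numClosedFieldType.
Implicit Types A B L : 'M[C]_2.
Definition spm A B L : 'M[C]_(2 + 2) := block_mx A B L (- A^T).
Lemma spm_sp4 A B L : B^T = B -> L^T = L -> sp4 (spm A B L).
Proof. by move=> BT LT; split; rewrite /spm ?block_mxKur ?block_mxKdl ?block_mxKdr ?block_mxKul. Qed.
Lemma mx2T (a b c d : C) : (mx2 a b c d)^T = mx2 a c b d.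
Proof. by apply: matrix2P; rewrite !mxE. Qed.
Definition eX := spm (mx2 0 0 1 0) 0 0.
Definition fX := spm (mx2 0 1 0 0) 0 0.
Definition hX := spm (mx2 1 0 0 (-1)) 0 0.
Definition dX := spm (mx2 1 0 0 1) 0 0.
(** [bX] and [cX] are the lowest weight elements of their blocks: they commute with [eX], and
    successive brackets with [fX] give the rest of the blocks. *)
Definition bX := spm 0 (mx2 0 0 0 1) 0.
Definition cX := spm 0 0 (mx2 1 0 0 0).
Lemma eX_sp4 : sp4 eX. Proof. by apply: spm_sp4; rewrite trmx0. Qed.
Lemma fX_sp4 : sp4 fX. Proof. by apply: spm_sp4; rewrite trmx0. Qed.
Lemma hX_sp4 : sp4 hX. Proof. by apply: spm_sp4; rewrite trmx0. Qed.
Lemma dX_sp4 : sp4 dX. Proof. by apply: spm_sp4; rewrite trmx0. Qed.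
Lemma bX_sp4 : sp4 bX. Proof. by apply: spm_sp4; rewrite ?trmx0 ?mx2T. Qed.
Lemma cX_sp4 : sp4 cX. Proof. by apply: spm_sp4; rewrite ?trmx0 ?mx2T. Qed.

Lemma spm_mul A B L A' B' L' : spm A B L *m spm A' B' L' =
  block_mx (A *m A' + B *m L') (A *m B' - B *m A'^T)
    (L *m A' - A^T *m L') (L *m B' + A^T *m A'^T).
Proof. by rewrite /spm mulmx_block !mulmxN !mulNmx opprK. Qed.

Lemma spm_bracket A B L A' B' L' (X := spm A B L) (Y := spm A' B' L') :
  X *m Y - Y *m X = block_mx
   (A *m A' + B *m L' - (A' *m A + B' *m L)) (A *m B' - B *m A'^T - (A' *m B - B' *m A^T))
   (L *m A' - A^T *m L' - (L' *m A - A'^T *m L))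
   (L *m B' + A^T *m A'^T - (L' *m B + A'^T *m A^T)).
Proof. by rewrite /X /Y !spm_mul opp_block_mx add_block_mx. Qed.

Lemma mx2M (a b c d a' b' c' d' : C) : mx2 a b c d *m mx2 a' b' c' d' =
  mx2 (a * a' + b * c') (a * b' + b * d') (c * a' + d * c') (c * b' + d * d').
Proof. by apply: matrix2P; rewrite !mxE sum2 !mxE. Qed.
Lemma mx2D (a b c d a' b' c' d' : C) : mx2 a b c d + mx2 a' b' c' d' =
  mx2 (a + a') (b + b') (c + c') (d + d').
Proof. by apply: matrix2P; rewrite !mxE. Qed.
Lemma mx2N (a b c d : C) : - mx2 a b c d = mx2 (- a) (- b) (- c) (- d).
Proof. by apply: matrix2P; rewrite !mxE. Qed.
Lemma mx2Z (r a b c d : C) : r *: mx2 a b c d = mx2 (r * a) (r * b) (r * c) (r * d).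
Proof. by apply: matrix2P; rewrite !mxE. Qed.
Lemma mx20 : mx2 0 0 0 0 = 0 :> 'M[C]_2.
Proof. by apply: matrix2P; rewrite !mxE. Qed.
Lemma mx2_eta A : A = mx2 (A 0 0) (A 0 1) (A 1 0) (A 1 1).
Proof. by apply: matrix2P; rewrite !mxE. Qed.

Definition mxsimp := (spm_bracket, mx2T, trmx0, mulmx0, mul0mx, mx2M, mx2N, mx2D,
  (oppr0, subr0, addr0, add0r, mulr0, mul0r, mulr1, mul1r)).

Lemma br_ef : eX *m fX - fX *m eX = - hX.
Proof.
rewrite /eX /fX /hX !mxsimp /spm opp_block_mx !mxsimp.
by congr block_mx; apply: matrix2P; rewrite !mxE ?ent2E; ring.
Qed.
Lemma br_he : hX *m eX - eX *m hX = - (eX + eX).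
Proof.
rewrite /eX /fX /hX !mxsimp /spm add_block_mx opp_block_mx !mxsimp.
by congr block_mx; apply: matrix2P; rewrite !mxE ?ent2E; ring.
Qed.
Lemma br_de : dX *m eX - eX *m dX = 0.
Proof.
rewrite /eX /dX !mxsimp -[RHS]submxK.
by congr block_mx; apply: matrix2P; rewrite !mxE ?ent2E; ring.
Qed.
Lemma br_be : bX *m eX - eX *m bX = 0.
Proof.
rewrite /eX /bX !mxsimp -[RHS]submxK.
by congr block_mx; apply: matrix2P; rewrite !mxE ?ent2E; ring.
Qed.
Lemma br_ce : cX *m eX - eX *m cX = 0.
Proof.
rewrite /eX /cX !mxsimp -[RHS]submxK.
by congr block_mx; apply: matrix2P; rewrite !mxE ?ent2E; ring.
Qed.
Definition bX1 := bX *m fX - fX *m bX.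
Definition bX2 := bX1 *m fX - fX *m bX1.
Definition cX1 := cX *m fX - fX *m cX.
Definition cX2 := cX1 *m fX - fX *m cX1.
Lemma bX1E : bX1 = spm 0 (- mx2 0 1 1 0) 0.
Proof.
rewrite /bX1 /bX /fX !mxsimp /spm !mxsimp.
by congr block_mx; apply: matrix2P; rewrite !mxE ?ent2E; ring.
Qed.
Lemma bX2E : bX2 = spm 0 (mx2 2 0 0 0) 0.
Proof.
rewrite /bX2 bX1E /bX /fX !mxsimp /spm !mxsimp.
by congr block_mx; apply: matrix2P; rewrite !mxE ?ent2E; ring.
Qed.
Lemma cX1E : cX1 = spm 0 0 (mx2 0 1 1 0).
Proof.
rewrite /cX1 /cX /fX !mxsimp /spm !mxsimp.
by congr block_mx; apply: matrix2P; rewrite !mxE ?ent2E; ring.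
Qed.
Lemma cX2E : cX2 = spm 0 0 (mx2 0 0 0 2).
Proof.
rewrite /cX2 cX1E /cX /fX !mxsimp /spm !mxsimp.
by congr block_mx; apply: matrix2P; rewrite !mxE ?ent2E; ring.
Qed.
End Basis.

(** * Modules over sp(4) *)

Section Sp4Module.
Variables (C : numClosedFieldType) (V : lmodType C).
Variable act : 'M[C]_(2 + 2) -> V -> V.
Hypothesis lieV : lie_module (@sp4 C) act setT.
Hypothesis actZ : forall (c : C) X u, sp4 X -> act (c *: X) u = c *: act X u.
Local Notation eX := (eX C).
Local Notation fX := (fX C).
Local Notation hX := (hX C).
Local Notation dX := (dX C).
Local Notation bX := (bX C).
Local Notation cX := (cX C).

(** The factor i makes [op_e] and [op_f] real in the coordinates z11, z22, t. It also changes the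
    sign of their bracket, which accounts for the form of [o_ef]. *)
Definition op_e u := 'i *: act eX u.
Definition op_f u := 'i *: act fX u.
Definition op_h u := act hX u.
Definition op_d u := act dX u.
Definition op_b u := act bX u.
Definition op_c u := act cX u.

Lemma op_eE u : op_e u = 'i *: act eX u. Proof. by []. Qed.
Lemma op_fE u : op_f u = 'i *: act fX u. Proof. by []. Qed.
Lemma op_hE u : op_h u = act hX u. Proof. by []. Qed.
Lemma op_dE u : op_d u = act dX u. Proof. by []. Qed.

Lemma sp4Z (c : C) X : sp4 X -> sp4 (c *: X).
Proof.
move=> [BT LT DE].
have s1 (M : 'M[C]_2) : (c *: M)^T = c *: M^T by apply/matrixP => i j; rewrite !mxE.
have ur : ursubmx (c *: X) = c *: ursubmx X by apply/matrixP => i j; rewrite !mxE.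
have dl : dlsubmx (c *: X) = c *: dlsubmx X by apply/matrixP => i j; rewrite !mxE.
have dr : drsubmx (c *: X) = c *: drsubmx X by apply/matrixP => i j; rewrite !mxE.
have ul : ulsubmx (c *: X) = c *: ulsubmx X by apply/matrixP => i j; rewrite !mxE.
by split; rewrite ?ur ?dl ?dr ?ul s1 ?BT ?LT // DE scalerN.
Qed.

Lemma act_lin X a u v : sp4 X -> act X (a *: u + v) = a *: act X u + act X v.
Proof. by case: lieV => H _ _; exact: H. Qed.
Lemma actD X Y u : sp4 X -> sp4 Y -> act (X + Y) u = act X u + act Y u.
Proof. by case: lieV => _ H _; exact: H. Qed.
Lemma act_br X Y u : sp4 X -> sp4 Y ->
  act X (act Y u) = act Y (act X u) + act (X *m Y - Y *m X) u.
Proof. by move=> sX sY; case: lieV => _ _ H; exact: H. Qed.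
Lemma act_N X u : sp4 X -> act (- X) u = - act X u.
Proof. by move=> sX; rewrite -[- X]scaleN1r actZ // scaleN1r. Qed.
Lemma act_0X u : act 0 u = 0.
Proof. by have := actZ 0 u (eX_sp4 C); rewrite !scale0r. Qed.
Lemma act_0 X : sp4 X -> act X 0 = 0.
Proof.
by move=> sX; have := act_lin (-1) 0 0 sX; rewrite scaler0 addr0 scaleN1r addNr.
Qed.
Lemma act_Z X a u : sp4 X -> act X (a *: u) = a *: act X u.
Proof. by move=> sX; rewrite -[a *: u]addr0 act_lin // act_0 // addr0. Qed.

Lemma op_e_lin c u v : op_e (c *: u + v) = c *: op_e u + op_e v.
Proof. by rewrite /op_e act_lin ?scalerDr; [rewrite !scalerA mulrC | exact: eX_sp4]. Qed.
Lemma op_f_lin c u v : op_f (c *: u + v) = c *: op_f u + op_f v.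
Proof. by rewrite /op_f act_lin ?scalerDr; [rewrite !scalerA mulrC | exact: fX_sp4]. Qed.
Lemma op_h_lin c u v : op_h (c *: u + v) = c *: op_h u + op_h v.
Proof. by rewrite /op_h act_lin //; exact: hX_sp4. Qed.
Lemma op_d_lin c u v : op_d (c *: u + v) = c *: op_d u + op_d v.
Proof. by rewrite /op_d act_lin //; exact: dX_sp4. Qed.
Lemma op_b_lin c u v : op_b (c *: u + v) = c *: op_b u + op_b v.
Proof. by rewrite /op_b act_lin //; exact: bX_sp4. Qed.
Lemma op_c_lin c u v : op_c (c *: u + v) = c *: op_c u + op_c v.
Proof. by rewrite /op_c act_lin //; exact: cX_sp4. Qed.

Lemma o_ef u : op_f (op_e u) = op_e (op_f u) - op_h u.
Proof.
rewrite /op_f /op_e !act_Z; try exact: eX_sp4; try exact: fX_sp4.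
rewrite !scalerA mulCii (act_br u (eX_sp4 C) (fX_sp4 C)) br_ef act_N; last exact: hX_sp4.
by rewrite !scaleN1r opprD opprK addrK.
Qed.
Lemma o_he u : op_h (op_e u) = op_e (op_h u) - 2 *: op_e u.
Proof.
rewrite /op_h /op_e act_Z; last exact: hX_sp4.
rewrite (act_br u (hX_sp4 C) (eX_sp4 C)) br_he act_N; last by apply: sp4D; exact: eX_sp4.
rewrite actD; try exact: eX_sp4.
by rewrite scalerBr scalerDr scaler_nat mulr2n.
Qed.
Lemma o_de u : op_d (op_e u) = op_e (op_d u).
Proof.
rewrite /op_d /op_e act_Z; last exact: dX_sp4.
by rewrite (act_br u (dX_sp4 C) (eX_sp4 C)) br_de act_0X addr0.
Qed.
Lemma o_be u : op_b (op_e u) = op_e (op_b u).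
Proof.
rewrite /op_b /op_e act_Z; last exact: bX_sp4.
by rewrite (act_br u (bX_sp4 C) (eX_sp4 C)) br_be act_0X addr0.
Qed.
Lemma o_ce u : op_c (op_e u) = op_e (op_c u).
Proof.
rewrite /op_c /op_e act_Z; last exact: cX_sp4.
by rewrite (act_br u (cX_sp4 C) (eX_sp4 C)) br_ce act_0X addr0.
Qed.

Lemma spm_eta (X : 'M[C]_(2 + 2)) : sp4 X -> X = spm (ulsubmx X) (ursubmx X) (dlsubmx X).
Proof. by case=> _ _ DE; rewrite /spm -DE submxK. Qed.

Lemma spm_split (A B L : 'M[C]_2) : spm A B L = spm A 0 0 + spm 0 B 0 + spm 0 0 L.
Proof.
rewrite /spm !add_block_mx trmx0 oppr0.
by rewrite !(addr0, add0r).
Qed.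

Lemma spmA_dec (A : 'M[C]_2) : spm A 0 0 =
  ((A 0 0 - A 1 1) / 2) *: hX + ((A 0 0 + A 1 1) / 2) *: dX
  + A 0 1 *: fX + A 1 0 *: eX.
Proof.
rewrite {1}[A]mx2_eta /hX /dX /fX /eX /spm !scale_block_mx !add_block_mx !mx2T.
by congr block_mx; apply: matrix2P; rewrite !mxE ?ent2E; field.
Qed.
Lemma spmB_dec (B : 'M[C]_2) : B^T = B -> spm 0 B 0 =
  B 1 1 *: bX - B 0 1 *: bX1 C + (B 0 0 / 2) *: bX2 C.
Proof.
move=> BT; have B10 : B 1 0 = B 0 1 by rewrite -[in LHS]BT mxE.
rewrite {1}[B]mx2_eta bX1E bX2E /bX /spm -scaleNr !scale_block_mx !add_block_mx B10.
by congr block_mx; apply: matrix2P; rewrite !mxE ?ent2E; field.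
Qed.
Lemma spmL_dec (B : 'M[C]_2) : B^T = B -> spm 0 0 B =
  B 0 0 *: cX + B 0 1 *: cX1 C + (B 1 1 / 2) *: cX2 C.
Proof.
move=> BT; have B10 : B 1 0 = B 0 1 by rewrite -[in LHS]BT mxE.
rewrite {1}[B]mx2_eta cX1E cX2E /cX /spm !scale_block_mx !add_block_mx B10.
by congr block_mx; apply: matrix2P; rewrite !mxE ?ent2E; field.
Qed.

Section Closed.
Variable U : set V.
Hypothesis sU : lsubspace U.
Hypothesis eU : forall u, U u -> U (op_e u).
Hypothesis fU : forall u, U u -> U (op_f u).
Hypothesis hU : forall u, U u -> U (op_h u).
Hypothesis dU : forall u, U u -> U (op_d u).

Lemma eX_closed u : U u -> U (act eX u).
Proof. by move=> /eU; exact: lsubZr sU (neq0Ci C). Qed.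
Lemma fX_closed u : U u -> U (act fX u).
Proof. by move=> /fU; exact: lsubZr sU (neq0Ci C). Qed.

Lemma sp4A_closed A u : U u -> U (act (spm A 0 0) u).
Proof.
move=> Uu; rewrite spmA_dec.
have sh := hX_sp4 C; have sd := dX_sp4 C; have se := eX_sp4 C; have sf := fX_sp4 C.
rewrite !actD; try by do ?[apply: sp4D]; apply: sp4Z.
rewrite !actZ //; apply: lsubD => //; last by apply: lsubZ => //; exact: eX_closed.
apply: lsubD => //; last by apply: lsubZ => //; exact: fX_closed.
by apply: lsubD => //; apply: lsubZ => //; [exact: hU | exact: dU].
Qed.

Lemma sp4k_closed X u : @sp4_k C X -> U u -> U (act X u).
Proof.
move=> [sX B0 L0] Uu; rewrite (spm_eta sX) B0 L0.
exact: sp4A_closed.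
Qed.

Lemma bracket_closed X Y : sp4 X -> sp4 Y -> (forall u, U u -> U (act X u)) ->
  (forall u, U u -> U (act Y u)) -> forall u, U u -> U (act (X *m Y - Y *m X) u).
Proof.
move=> sX sY XU YU u Uu.
have -> : act (X *m Y - Y *m X) u = act X (act Y u) - act Y (act X u).
  by rewrite (act_br u sX sY) addrAC subrr add0r.
by apply: lsubB => //; [apply: XU; exact: YU | apply: YU; exact: XU].
Qed.

Hypothesis bU : forall u, U u -> U (op_b u).
Hypothesis cU : forall u, U u -> U (op_c u).

Lemma bX1_sp4 : sp4 (bX1 C).
Proof. by apply: sp4_bracket; [exact: bX_sp4 | exact: fX_sp4]. Qed.
Lemma bX2_sp4 : sp4 (bX2 C).
Proof. by apply: sp4_bracket; [exact: bX1_sp4 | exact: fX_sp4]. Qed.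
Lemma cX1_sp4 : sp4 (cX1 C).
Proof. by apply: sp4_bracket; [exact: cX_sp4 | exact: fX_sp4]. Qed.
Lemma cX2_sp4 : sp4 (cX2 C).
Proof. by apply: sp4_bracket; [exact: cX1_sp4 | exact: fX_sp4]. Qed.

Lemma sp4B_closed B u : B^T = B -> U u -> U (act (spm 0 B 0) u).
Proof.
move=> BT Uu; rewrite spmB_dec //.
have s1 := bX1_sp4; have s2 := bX2_sp4; have s := bX_sp4 C; have sf := fX_sp4 C.
have U1 v : U v -> U (act (bX1 C) v).
  exact: (bracket_closed s sf bU fX_closed).
have U2 v : U v -> U (act (bX2 C) v).
  exact: (bracket_closed s1 sf U1 fX_closed).
rewrite -scaleNr !actD; try by do ?[apply: sp4D]; apply: sp4Z.
rewrite !actZ //; apply: lsubD => //; last by apply: lsubZ => //; exact: U2.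
by apply: lsubD => //; apply: lsubZ => //; [exact: bU | exact: U1].
Qed.
Lemma sp4L_closed B u : B^T = B -> U u -> U (act (spm 0 0 B) u).
Proof.
move=> BT Uu; rewrite spmL_dec //.
have s1 := cX1_sp4; have s2 := cX2_sp4; have s := cX_sp4 C; have sf := fX_sp4 C.
have U1 v : U v -> U (act (cX1 C) v).
  exact: (bracket_closed s sf cU fX_closed).
have U2 v : U v -> U (act (cX2 C) v).
  exact: (bracket_closed s1 sf U1 fX_closed).
rewrite !actD; try by do ?[apply: sp4D]; apply: sp4Z.
rewrite !actZ //; apply: lsubD => //; last by apply: lsubZ => //; exact: U2.
by apply: lsubD => //; apply: lsubZ => //; [exact: cU | exact: U1].
Qed.

Lemma sp4_closed X u : sp4 X -> U u -> U (act X u).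
Proof.
move=> sX Uu; rewrite (spm_eta sX) spm_split; have [BT LT _] := sX.
have sA : sp4 (spm (ulsubmx X) 0 0) by apply: spm_sp4; rewrite trmx0.
have sB : sp4 (spm 0 (ursubmx X) 0) by apply: spm_sp4; rewrite ?trmx0.
have sL : sp4 (spm 0 0 (dlsubmx X)) by apply: spm_sp4; rewrite ?trmx0.
rewrite !actD //; last exact: sp4D.
apply: lsubD => //; last exact: sp4L_closed.
by apply: lsubD => //; [exact: sp4A_closed | exact: sp4B_closed].
Qed.
End Closed.

Lemma submodule_ops U : submodule (@sp4 C) act U ->
  [/\ forall u, U u -> U (op_e u), forall u, U u -> U (op_f u), forall u, U u -> U (op_h u),
      forall u, U u -> U (op_d u) & (forall u, U u -> U (op_b u)) /\ forall u, U u -> U (op_c u)].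
Proof.
move=> [sU gU]; split=> [u|u|u|u|].
- by move=> Uu; apply: lsubZ => //; apply: gU => //; exact: eX_sp4.
- by move=> Uu; apply: lsubZ => //; apply: gU => //; exact: fX_sp4.
- by apply: gU; exact: hX_sp4.
- by apply: gU; exact: dX_sp4.
- by split=> u; apply: gU; [exact: bX_sp4 | exact: cX_sp4].
Qed.

Lemma submodule_k_ops U : submodule (@sp4_k C) act U ->
  [/\ forall u, U u -> U (op_e u), forall u, U u -> U (op_f u) & forall u, U u -> U (op_h u)].
Proof.
have k A : @sp4_k C (spm A 0 0).
  split; [by apply: spm_sp4; rewrite trmx0 | exact: block_mxKur | exact: block_mxKdl].
move=> [sU gU]; split=> u Uu.
- by apply: lsubZ => //; apply: gU => //; exact: k.
- by apply: lsubZ => //; apply: gU => //; exact: k.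
- by apply: gU => //; exact: k.
Qed.
End Sp4Module.

(** * Solid harmonics *)

Section Zariski.
Variables (C : numClosedFieldType) (n : nat).
Variables (S : ('I_n -> C) -> Prop) (W : ('I_n -> C) -> Prop).
Hypothesis S0 : exists v, S v.
Hypothesis SW : forall v w (k : nat), S v -> W w -> S (fun i => v i + k%:R * w i).
Hypothesis Wspan : forall d : 'I_n -> C,
  (forall w, W w -> \sum_i d i * w i = 0) -> forall i, d i = 0.

Lemma poly_nat_roots (h : {poly C}) : (forall k : nat, h.[k%:R] = 0) -> h = 0.
Proof.
move=> hk; apply/eqP; apply/contraT => h0.
pose rs := [seq (k%:R : C) | k <- iota 0 (size h)].
have r1 : all (root h) rs by apply/allP => _ /mapP[k _ ->]; rewrite rootE hk.
have r2 : uniq rs.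
  by rewrite map_inj_uniq ?iota_uniq // => a b /eqP; rewrite eqr_nat => /eqP.
by have := max_poly_roots h0 r1 r2; rewrite size_map size_iota ltnn.
Qed.

(** For v in S and w in W the one-variable polynomial p(v + X w) vanishes at all natural numbers,
    hence identically, and so does its derivative at 0. By [Wspan] all partial derivatives of p
    vanish on S, and [mderiv_closed_eq0] applies. *)
Lemma zariski_dense (p : {mpoly C[n]}) : (forall v, S v -> p.@[v] = 0) -> p = 0.
Proof.
apply: (mderiv_closed_eq0 (P := fun p => forall v, S v -> p.@[v] = 0)) => {p} [p i p0 v Sv|c].
  apply: (Wspan (d := fun i => p^`M(i).@[v])) => w Ww.
  pose u j := (v j)%:P + (w j)%:P * 'X : {poly C}.
  pose h := mmap (@polyC C) u p.
  have ev q (a : C) : (mmap (@polyC C) u q).[a] = q.@[fun i => v i + a * w i].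
    elim/mpolyind: q => [|c m q _ _ IH]; first by rewrite mmap0 horner0 meval0.
    rewrite mmapD mevalD hornerD IH mmapZ mevalZ hornerM hornerC; congr (_ * _ + _).
    elim/mnm_ind: m => [|j m IHm]; first by rewrite mpolyX0 rmorph1 meval1 hornerC.
    rewrite mpolyXD rmorphM mevalM hornerM -IHm /= mmapX mmap1U mevalXU; congr (_ * _).
    by rewrite /u !hornerE mulrC.
  have h0 : h = 0.
    by apply: poly_nat_roots => k; rewrite ev; apply: p0; exact: SW.
  have dd : derivation (fun q : {poly C} => q^`()).
    by split=> x y; rewrite ?derivD ?derivM.
  have := der_mmap (f := @polyC C) u dd (@derivC C) p.
  rewrite -/h h0 deriv0 => /(congr1 (fun q : {poly C} => q.[0])).
  rewrite horner0 horner_sum => E; rewrite [RHS]E.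
  apply: eq_bigr => j _; rewrite hornerM ev; congr (_ * _).
    by apply: meval_eq => k; rewrite mul0r addr0.
  by rewrite /u derivD derivC add0r derivM derivC derivX mul0r add0r mulr1 hornerC.
by case: S0 => v Sv /(_ _ Sv); rewrite mevalC.
Qed.
End Zariski.

Section HornerDerivation.
Variables (R : comNzRingType) (D : R -> R).
Hypothesis dD : derivation D.

Definition killed (q : {poly R}) := forall i, D q`_i = 0.

Lemma der_horner q t : killed q -> D q.[t] = q^`().[t] * D t.
Proof.
elim/poly_ind: q => [|q c IH] Dq.
  by rewrite deriv0 !horner0 (derD0 dD) mul0r.
have Dc : D c = 0 by have := Dq 0%N; rewrite coefD coefMX coefC add0r.
have {}IH : D q.[t] = q^`().[t] * D t.
  apply: IH => i; have := Dq i.+1; rewrite coefD coefMX coefC /= addr0 //.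
rewrite hornerMXaddC (derD_add dD) (derD_mul dD) IH Dc derivMXaddC.
by rewrite hornerD hornerMX addr0 mulrDl addrC mulrAC.
Qed.

Lemma killed_deriv q : killed q -> killed q^`().
Proof.
move=> Dq i; rewrite coef_deriv -mulr_natr (derD_mul dD) Dq mul0r add0r.
suff -> : D i.+1%:R = 0 by rewrite mulr0.
elim: i.+1 => [|k IH]; first exact: derD0.
by rewrite -natr1 (derD_add dD) IH (derD1 dD) addr0.
Qed.

Lemma killedM p q : killed p -> killed q -> killed (p * q).
Proof.
move=> Dp Dq i; rewrite coefM (derD_sum dD) big1 // => j _.
by rewrite (derD_mul dD) Dp Dq mul0r mulr0 addr0.
Qed.

(** With N = x y + t^2 killed by D, (x y)^l = (N - t^2)^l is a polynomial in t over the constants of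
    D, and there D acts as -x d/dt. Applied to powers of z22 this is Rodrigues' formula for the
    Legendre functions. *)
Lemma iter_der (x y t : R) l n : D x = 0 -> D t = - x -> D (x * y + t * t) = 0 ->
  x ^+ l * iter n D (y ^+ l) =
  (- x) ^+ n * ((((x * y + t * t)%:P - 'X ^+ 2) ^+ l)^`(n)).[t].
Proof.
move=> Dx Dt DN; set g := ((_ - 'X ^+ 2) ^+ l).
have kg m : killed (g^`(m)).
  elim: m => [|m IH]; last by rewrite derivnS; exact: killed_deriv.
  rewrite derivn0 /g; elim: l {g} => [|l IH] i.
    by rewrite expr0 coef1; case: (i == _); rewrite ?(derD1 dD) ?(derD0 dD).
  rewrite exprS; apply: killedM => // j; rewrite coefB coefC coefXn (derDB dD).
  by case: j => [|[|[|j]]] /=; rewrite ?(derD1 dD) ?(derD0 dD) ?DN subrr.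
elim: n => [|n IH].
  rewrite /= mul1r ?derivn0 /g horner_exp hornerD hornerN hornerXn hornerC.
  by rewrite -expr2 addrK exprMn.
have Dxl k : D (x ^+ k) = 0.
  by elim: k => [|k IHk]; rewrite ?(derD1 dD) // exprS (derD_mul dD) IHk Dx mul0r mulr0 addr0.
have Dxn k : D ((- x) ^+ k) = 0.
  by rewrite exprNn (derD_mul dD) Dxl mulr0 addr0 -signr_odd; case: odd;
    rewrite ?expr1 ?expr0 ?(derDN dD) (derD1 dD) ?oppr0 mul0r.
have := congr1 D IH; rewrite (derD_mul dD) Dxl mul0r add0r iterS => ->.
rewrite (derD_mul dD) Dxn mul0r add0r der_horner // Dt derivnS exprS.
by move: (_.[t]) => a; ring.
Qed.
End HornerDerivation.

Section SolidHarmonic.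
Variable C : numClosedFieldType.
Local Notation P3 := {mpoly C[3]}.

Definition ep (p : P3) : P3 := 2 * 'X_2%:R * p^`M(1) - 'X_0 * p^`M(2%:R).

Lemma epE p : ep p = 2 * 'X_2%:R * p^`M(1) - 'X_0 * p^`M(2%:R). Proof. by []. Qed.

Lemma ep_der : derivation ep.
Proof.
split=> p q; rewrite /ep.
  by rewrite !mderivD; ring.
by rewrite !mderivM; ring.
Qed.

Lemma mderivXi n (R : comNzRingType) (i j : 'I_n) :
  ('X_j : {mpoly R[n]})^`M(i) = (i == j)%:R.
Proof.
rewrite mderivX mnm1E eq_sym; case: eqVneq => [->|ji]; last by rewrite scale0r.
rewrite scale1r -mpolyX0; congr mpolyX.
by apply/mnmP => k; rewrite mnmBE subnn mnm0E.
Qed.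

Lemma ep0 : ep 'X_0 = 0.
Proof. by rewrite /ep !mderivXi !mulr0 subrr. Qed.
Lemma ep1 : ep 'X_1 = 2 * 'X_2%:R.
Proof. by rewrite /ep !mderivXi mulr1 mulr0 subr0. Qed.
Lemma ep2 : ep 'X_2%:R = - 'X_0.
Proof. by rewrite /ep !mderivXi mulr1 mulr0 sub0r. Qed.

(** Proportional to R^(n-l)_l. [ep] is the scalar part of the operator e, so solid harmonics are
    strings like the K-types. *)
Definition Rpoly n l : P3 := iter n ep ('X_1 ^+ l).
Definition Nm : P3 := 'X_0 * 'X_1 + 'X_2%:R * 'X_2%:R.

Lemma NmE : Nm = 'X_0 * 'X_1 + 'X_2%:R * 'X_2%:R. Proof. by []. Qed.

Lemma RpolyE n l : 'X_0 ^+ l * Rpoly n l =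
  (- 'X_0) ^+ n * (((Nm%:P - 'X ^+ 2) ^+ l)^`(n)).['X_2%:R].
Proof.
have epN : ep ('X_0 * 'X_1 + 'X_2%:R * 'X_2%:R) = 0.
  by rewrite (derD_add ep_der) !(derD_mul ep_der) ep0 ep1 ep2; ring.
exact (iter_der ep_der l n ep0 ep2 epN).
Qed.

Lemma derivn_small (R : nzRingType) (q : {poly R}) n : (size q <= n)%N -> q^`(n) = 0.
Proof.
move=> qn; apply/polyP => i; rewrite coef_derivn coef0 nth_default ?mul0rn //.
by apply: leq_trans qn _; rewrite leq_addr.
Qed.

(** (N - t^2)^l has degree 2l in t. *)
Lemma Rpoly_high n l : (2 * l < n)%N -> Rpoly n l = 0.
Proof.
move=> ln; have X0 : ('X_0 : P3) ^+ l != 0.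
  by rewrite expf_neq0 // -(tofrac_eq0 ('X_0 : P3)); exact: var_neq0.
apply: (mulfI X0); rewrite RpolyE mulr0 derivn_small ?horner0 ?mulr0 //.
apply: leq_trans ln; apply: leq_trans (size_poly_exp_leq _ _) _.
rewrite ltnS leq_mul2r; apply/orP; right.
have -> : (Nm%:P - 'X ^+ 2 : {poly P3}) = - ('X ^+ 2 - Nm%:P) by rewrite opprB.
by rewrite size_polyN size_XnsubC.
Qed.

Section Evaluation.
Variables (z t : C).
Hypothesis (z0 : z != 0) (tR : t \is Num.real).
Let v (i : 'I_3) : C := [:: z; z^*; t]`_i.
Let r := sqrtC (`|z| ^+ 2 + t ^+ 2).

Let rr : r ^+ 2 = z * z^* + t * t.
Proof. by rewrite sqrtCK normCK expr2. Qed.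
Let z_pos : 0 < `|z|. Proof. by rewrite normr_gt0. Qed.
Let rr_pos : 0 < `|z| ^+ 2 + t ^+ 2.
Proof. by rewrite ltr_wpDr ?exprn_gt0 // real_exprn_even_ge0. Qed.
Let r_pos : 0 < r. Proof. by rewrite sqrtC_gt0. Qed.
Let r0 : r != 0. Proof. by rewrite gt_eqF. Qed.

Lemma derivn_scale (q : {poly C}) (a : C) n :
  (q \Po (a *: 'X))^`(n) = a ^+ n *: (q^`(n) \Po (a *: 'X)).
Proof.
elim: n => [|n IH]; first by rewrite !derivn0 expr0 scale1r.
rewrite !derivnS IH derivZ deriv_comp derivZ derivX exprSr -scalerA; congr (_ *: _).
by rewrite -scalerAr mulr1.
Qed.

Lemma Rpoly_eval n l : z ^+ l * (Rpoly n l).@[v] =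
  (- z) ^+ n * ((-1) ^+ l * (r ^+ 2) ^+ l * r ^- n * (((('X ^+ 2 - 1) ^+ l)^`(n)).[t / r])).
Proof.
have vx0 : ('X_0 : P3).@[v] = z by rewrite mevalXU.
have vx1 : ('X_1 : P3).@[v] = z^* by rewrite mevalXU.
have vx2 : ('X_2%:R : P3).@[v] = t by rewrite mevalXU.
have := congr1 (meval v) (RpolyE n l).
rewrite !mevalM !rmorphXn rmorphN /= vx0 => ->; congr (_ * _).
rewrite -horner_map /= -derivn_map rmorphXn rmorphB /= map_polyC map_polyXn /=.
rewrite /Nm mevalD !mevalM vx0 vx1 vx2 -rr.
(* With t = r s one has r^2 - t^2 = -r^2 (s^2 - 1), which brings in the polynomial s^2 - 1 of the
   Legendre functions. *)
have -> : ((r ^+ 2)%:P - 'X ^+ 2 : {poly C}) =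
    (- r ^+ 2) *: (('X ^+ 2 - 1) \Po (r^-1 *: 'X)).
  rewrite comp_polyB -[1]/(1%:P) comp_polyC comp_Xn_poly exprZn scalerBr scalerA -!mul_polyC.
  by rewrite exprVn mulNr mulfV ?expf_neq0 // polyCN mulN1r mulr1 polyCN opprK addrC.
rewrite exprZn -rmorphXn /= derivnZ derivn_scale hornerZ hornerZ horner_comp hornerZ hornerX.
by rewrite [(- r ^+ 2) ^+ l]exprNn exprVn mulrA [r^-1 * t]mulrC.
Qed.

Lemma Rpoly_legendre l (m : int) : - l%:Z <= m ->
  ((2 ^+ l * l`!%:R)^-1 *: Rpoly (absz (l%:Z + m)) l).@[v] =
  r ^+ l * (z / `|z|) ^ m * legendre l m (t / r).
Proof.
move=> lm; rewrite mevalZ /legendre; set c := 2 ^+ l * _.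
have [n nE] : exists n : nat, l%:Z + m = n by exists (absz (l%:Z + m)); rewrite gez0_abs //; lia.
have mE : m = n%:Z - l%:Z by rewrite -nE; ring.
rewrite nE /=; set Q := _.[_].
have zl : z ^+ l != 0 by rewrite expf_neq0.
apply: (mulfI zl); rewrite mulrCA Rpoly_eval -/Q.
have -> : sqrtC (1 - (t / r) ^+ 2) = `|z| / r.
  have -> : 1 - (t / r) ^+ 2 = (`|z| / r) ^+ 2.
    rewrite !expr_div_n -[1](mulfV (expf_neq0 2 r0)) -mulrBl; congr (_ / _).
    by rewrite rr normCK [t ^+ 2]expr2 addrK.
  by rewrite sqrCK // divr_ge0 // ltW.
have N0 : `|z| != 0 by rewrite gt_eqF.
have m1 : (-1 : C) != 0 by rewrite oppr_eq0 oner_eq0.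
have zz0 : z / `|z| != 0 by rewrite mulf_neq0 ?invr_eq0.
have zr0 : `|z| / r != 0 by rewrite mulf_neq0 ?invr_eq0.
have ex (x : C) : x != 0 -> x ^ m = x ^+ n / x ^+ l.
  by move=> x0; rewrite mE expfzDr // -exprnP exprnN.
rewrite !ex // !expr_div_n [(- z) ^+ n]exprNn -[(r ^+ 2) ^+ l]exprM [(2 * l)%N]mulnC exprM [(r ^+ l) ^+ 2]expr2.
have s1 : (-1 : C) ^+ l != 0 by rewrite expf_neq0.
have n1 : (-1 : C) ^+ n * (-1) ^+ n = 1 by rewrite -expr2 -exprM mulnC exprM sqrrN expr1n expr1n.
have l1 : (-1 : C) ^+ l * (-1) ^+ l = 1 by rewrite -expr2 -exprM mulnC exprM sqrrN expr1n expr1n.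
have := expf_neq0 n r0; have := expf_neq0 l r0.
have := expf_neq0 n N0; have := expf_neq0 l N0.
move: s1 l1; have : c != 0.
  by rewrite mulf_neq0 ?expf_neq0 ?pnatr_eq0 // -lt0n fact_gt0.
move: ((-1) ^+ n) ((-1) ^+ l) (z ^+ n) (z ^+ l) zl (r ^+ n) (r ^+ l)
  (`|z| ^+ n) (`|z| ^+ l) => a b zn zl zl0 rn rl nn nl c0 b0 bb ? ? ? ?.
field: bb.
by do ?[apply/andP; split].
Qed.
End Evaluation.

Lemma mderiv_homog l (p : P3) i : p \is l.+1.-homog -> p^`M(i) \is l.-homog.
Proof.
move=> /dhomogP pl; apply/dhomogP => m; rewrite mcoeff_msupp mcoeff_deriv => mp.
have : (m + U_(i))%MM \in msupp p.
  by rewrite mcoeff_msupp; apply: contraNneq mp => ->; rewrite mul0rn.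
by move/pl; rewrite /= mdegD mdeg1 addn1 => -[].
Qed.
Lemma mderiv_homog0 (p : P3) i : p \is 0.-homog -> p^`M(i) = 0.
Proof.
move=> /dhomogP pl; apply/mpolyP => m; rewrite mcoeff0 mcoeff_deriv.
apply/eqP; rewrite mulrn_eq0 /=; apply/contraT => mp.
by have := pl (m + U_(i))%MM; rewrite mcoeff_msupp => /(_ mp) /=; rewrite mdegD mdeg1 addn1.
Qed.
Lemma homogX (i : 'I_3) : ('X_i : P3) \is 1.-homog.
Proof. by rewrite dhomogX /= mdeg1. Qed.

Lemma ep_homog l p : p \is l.-homog -> ep p \is l.-homog.
Proof.
case: l => [|l] pl.
  by rewrite /ep !mderiv_homog0 // !mulr0 subrr dhomog0.
rewrite /ep -mulrA mulr_natl -mulrnAr mulrnAr.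
rewrite -[l.+1]add1n rpredB ?rpredMn //; apply: dhomogM; rewrite ?homogX //; exact: mderiv_homog.
Qed.

Lemma Rpoly_homog n l : Rpoly n l \is l.-homog.
Proof.
elim: n => [|n IH]; last exact: ep_homog.
by rewrite /Rpoly /= -[X in X.-homog]mul1n; apply: dhomogMn; exact: homogX.
Qed.

Lemma solid_harmonic_unique l m (p q : P3) :
  is_solid_harmonic l m p -> is_solid_harmonic l m q -> p = q.
Proof.
move=> [_ pE] [_ qE]; apply/eqP; rewrite -subr_eq0; apply/eqP.
(* The points z = a + ib are taken with a > 0, so that z is nonzero and stays so after adding
   natural multiples of the directions in W, which shift a, b or t. *)
pose S (v : 'I_3 -> C) := exists a b t : C, [/\ a \is Num.real /\ 0 < a,
  b \is Num.real, t \is Num.real & [/\ v 0 = a + 'i * b, v 1 = a - 'i * b & v 2%:R = t]].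
pose W (w : 'I_3 -> C) := [\/ [/\ w 0 = 1, w 1 = 1 & w 2%:R = 0],
  [/\ w 0 = 'i, w 1 = - 'i & w 2%:R = 0] | [/\ w 0 = 0, w 1 = 0 & w 2%:R = 1]].
have sum3 (F : 'I_3 -> C) : \sum_i F i = F 0 + F 1 + F 2%:R.
  rewrite !big_ord_recl big_ord0 addr0 addrA.
  by congr (F _ + F _ + F _); apply: val_inj.
have ord3 (P : 'I_3 -> Prop) : P 0 -> P 1 -> P 2%:R -> forall i, P i.
  move=> P0 P1 P2 [[|[|[|//]]] Hi].
  - by rewrite (_ : Ordinal Hi = 0) //; exact: val_inj.
  - by rewrite (_ : Ordinal Hi = 1) //; exact: val_inj.
  - by rewrite (_ : Ordinal Hi = 2%:R) //; exact: val_inj.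
apply: (@zariski_dense C 3 S W).
- exists (fun i => if i == 2%:R then 0 else 1), 1, 0, 0.
  by split; rewrite ?real0 ?real1 // !mulr0 addr0 subr0.
- move=> v w k [a [b [t [[aR a0] bR tR [v0 v1 v2]]]]].
  have kR : (k%:R : C) \is Num.real by exact: realn.
  case=> -[w0 w1 w2]; rewrite /S v0 v1 v2 w0 w1 w2.
  + exists (a + k%:R), b, t; split=> //.
      by split; [exact: realD | rewrite ltr_wpDr].
    by split; ring.
  + exists a, (b + k%:R), t; split=> //; first exact: realD.
    by split; ring.
  + exists a, b, (t + k%:R); split=> //; first exact: realD.
    by split; ring.
- move=> d dW.
  have W1 : W (fun i => if i == 2%:R then 0 else 1) by apply: Or31.
  have W2 : W (fun i => if i == 2%:R then 0 else if i == 0 then 'i else - 'i) by apply: Or32.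
  have W3 : W (fun i => if i == 2%:R then 1 else 0) by apply: Or33.
  have := dW _ W1; have := dW _ W2; have := dW _ W3.
  rewrite !sum3 /= !(mulr0, mulr1, addr0, add0r) mulrN => d2 /eqP.
  rewrite -mulrBl mulf_eq0 (negbTE (neq0Ci C)) orbF subr_eq0 => /eqP d01.
  rewrite d01 -mulr2n => /eqP; rewrite mulrn_eq0 /= => /eqP d1.
  by apply: ord3 => //; rewrite d01.
move=> v [a [b [t [[aR a0] bR tR [v0 v1 v2]]]]].
have zc : (a + 'i * b)^* = a - 'i * b.
  by rewrite rmorphD rmorphM /= conjCi !conj_Creal // mulNr.
have z0 : a + 'i * b != 0.
  apply/eqP => /(congr1 (fun u => 'Re u)); rewrite Re_rect // raddf0.
  by move=> a00; rewrite a00 ltxx in a0.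
have vE : v =1 (fun i => [:: a + 'i * b; (a + 'i * b)^*; t]`_i).
  by apply: ord3; rewrite ?v0 ?v1 ?v2 ?zc.
by rewrite mevalB !(meval_eq _ vE) pE // qE // subrr.
Qed.

Definition cl l : C := (2 ^+ l * l`!%:R)^-1.

Lemma clE l : cl l = (2 ^+ l * l`!%:R)^-1. Proof. by []. Qed.

Lemma cl_neq0 l : cl l != 0.
Proof. by rewrite invr_eq0 mulf_neq0 ?expf_neq0 ?pnatr_eq0 // -lt0n fact_gt0. Qed.

(** For m > l both sides are zero, so the strings end where the harmonics do. *)
Lemma solid_harmonicE (l : nat) (m : int) : - l%:Z <= m ->
  solid_harmonic C l m = cl l *: Rpoly (absz (l%:Z + m)) l.
Proof.
move=> lm; rewrite /solid_harmonic /=.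
case: ifP => [ml|/negbT ml]; last first.
  rewrite Rpoly_high ?scaler0 //; lia.
apply: (@solid_harmonic_unique l m); last first.
  split; first by apply: dhomogZ; exact: Rpoly_homog.
  by move=> z t z0 tR; exact: Rpoly_legendre.
apply: (xgetPex 0); exists (cl l *: Rpoly (absz (l%:Z + m)) l).
split; first by apply: dhomogZ; exact: Rpoly_homog.
by move=> z t z0 tR; exact: Rpoly_legendre.
Qed.

Lemma solid_harmonic_out (l m : int) : ~~ ((0 <= l) && (`|m| <= l)) ->
  solid_harmonic C l m = 0.
Proof. by rewrite /solid_harmonic => /negbTE ->. Qed.
End SolidHarmonic.

Section ScaleLop.
Variable K : fieldType.
Lemma Lop_scaleX (t : 'I_2 -> 'I_2 -> K -> K) tau c (xi M F : 'M[K]_2) :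
  Lop t tau (c *: xi) (c *: M) F = c *: Lop t tau xi M F.
Proof.
apply/matrixP => i j; rewrite /Lop /dv /mxtrace; do 3!rewrite ?mxE ?sum2.
by ring.
Qed.
Lemma xiX_scale (Z A B L D : 'M[K]_2) c :
  xiX Z (c *: A) (c *: B) (c *: L) (c *: D) = c *: xiX Z A B L D.
Proof.
by apply/matrixP => i j; rewrite /xiX; do 3!rewrite ?mxE ?sum2; ring.
Qed.
Lemma nuX_scale (Z L D : 'M[K]_2) c : nuX Z (c *: L) (c *: D) = c *: nuX Z L D.
Proof.
by apply/matrixP => i j; rewrite /nuX; do 3!rewrite ?mxE ?sum2; ring.
Qed.
Lemma symK_scale (I N c p q q' s : K) : q' = I * q ->
  N *: (\matrix_(i, j) ent2 p q' q' s i j) = symK I (N * p) (N * q) (N * s).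
Proof. by move=> ->; apply: matrix2P; rewrite !mxE ?ent2E //; ring. Qed.
Lemma symKZ (I c p q s : K) : c *: symK I p q s = symK I (c * p) (c * q) (c * s).
Proof. by apply: matrix2P; rewrite !mxE ?ent2E //; ring. Qed.
Lemma symKD (I p q s p' q' s' : K) :
  symK I p q s + symK I p' q' s' = symK I (p + p') (q + q') (s + s').
Proof. by apply: matrix2P; rewrite !mxE ?ent2E //; ring. Qed.
End ScaleLop.

Section Tens3.
Variable C : numClosedFieldType.
Local Notation K := (ratfun C 3).
Local Notation Zs := (@Zs C).
Local Notation Ns := (@Ns C).
Local Notation cmx := (@cmx 3 C).
Local Notation rcst := (@rcst C 3).
Local Notation rho2 := (@rho2 C).
Local Notation x := (var C (0 : 'I_3)).
Local Notation y := (var C (1 : 'I_3)).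
Local Notation t := (var C (2%:R : 'I_3)).
Local Notation pd := (@pd C 3).

Lemma cmxZ c (A : 'M[C]_2) : cmx (c *: A) = rcst c *: cmx A.
Proof. by apply/matrixP => i j; rewrite !mxE rcstM. Qed.

Lemma rho2_scale (c : C) X (u : tens C 3) : sp4 X -> rho2 (c *: X) u = c *: rho2 X u.
Proof.
move=> sX; have scX := sp4Z c sX.
rewrite !rho2_Lop // tens_scaleE -Lop_scaleX.
have ur : ursubmx (c *: X) = c *: ursubmx X by apply/matrixP => i j; rewrite !mxE.
have dl : dlsubmx (c *: X) = c *: dlsubmx X by apply/matrixP => i j; rewrite !mxE.
have dr : drsubmx (c *: X) = c *: drsubmx X by apply/matrixP => i j; rewrite !mxE.
have ul : ulsubmx (c *: X) = c *: ulsubmx X by apply/matrixP => i j; rewrite !mxE.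
have -> : xiS (c *: X) = rcst c *: xiS X by rewrite /xiS ur dl dr ul !cmxZ xiX_scale.
have -> : - (nuS (c *: X))^T = rcst c *: - (nuS X)^T.
  rewrite /nuS dl dr !cmxZ nuX_scale; move: (nuX _ _ _) => M.
  by apply/matrixP => i j; rewrite !mxE mulrN.
by [].
Qed.

Definition symS (F : K * K * K) : tens C 3 := symK (rcst 'i) F.1.1 F.1.2 F.2.

Lemma symSZ (c : C) F : c *: symS F = symS (tsc (rcst c) F).
Proof. exact (symKZ (rcst 'i) (rcst c) F.1.1 F.1.2 F.2). Qed.
Lemma symSD F G : symS F + symS G = symS (tadd F G).
Proof. exact (symKD (rcst 'i) F.1.1 F.1.2 F.2 G.1.1 G.1.2 G.2). Qed.

Lemma cmx_mx2 (a b c d : C) : cmx (mx2 a b c d) = mx2 (rcst a) (rcst b) (rcst c) (rcst d).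
Proof. by apply: matrix2P; rewrite !mxE. Qed.
Lemma cmx0 : cmx 0 = 0.
Proof. by apply/matrixP => i j; rewrite !mxE rcst0. Qed.

Lemma ZsE : Zs = symK (rcst 'i) x t y.
Proof. by apply: matrix2P; rewrite !mxE. Qed.

Lemma two_neq0 : (2 : K) != 0.
Proof. by rewrite -(@rcst_nat C 3) rcst_eq0 pnatr_eq0. Qed.

Lemma hdE i u : half_pd i u = hd x y t (pd i) u.
Proof. by rewrite /half_pd /hd NsE rcstV rcst_nat. Qed.

Lemma rho2_actK (A B L : 'M[C]_2) (F : tens C 3) : B^T = B -> L^T = L ->
  rho2 (spm A B L) F =
  actK (rcst 'i) x y t (hd x y t (pd 0)) (hd x y t (pd 1)) (hd x y t (pd 2%:R))
    (cmx A) (cmx B) (cmx L) F.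
Proof.
move=> BT LT; rewrite rho2_Lop; last exact: spm_sp4.
rewrite /actK /xiS /nuS /spm block_mxKul block_mxKur block_mxKdl block_mxKdr cmxN -cmxT ZsE.
have -> : @dels C = ent2 (hd x y t (pd 0))
    (fun u => - (rcst 'i / 2) * hd x y t (pd 2%:R) u)
    (fun u => - (rcst 'i / 2) * hd x y t (pd 2%:R) u) (hd x y t (pd 1)).
  apply/funext => i; apply/funext => j; apply/funext => u.
  move: i j; apply: ord2P; apply: ord2P; rewrite /dels !ent2E.
  - exact (hdE 0 u).
  - by rewrite (hdE 2%:R u) rcstM rcstV rcst_nat.
  - by rewrite (hdE 2%:R u) rcstM rcstV rcst_nat.
  - exact (hdE 1 u).
reflexivity.
Qed.

Let hdI i u : hd x y t (pd i) (rcst 'i * u) = rcst 'i * hd x y t (pd i) u.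
Proof. by rewrite -!hdE half_pdZ. Qed.

Local Notation ii := (@rcst_ii C).

Lemma op_e_sym F : op_e rho2 (symS F) = symS (eT x y t (pd 1) (pd 2%:R) F).
Proof.
rewrite /op_e /eX rho2_actK ?trmx0 // cmx_mx2 cmx0 rcst0 rcst1.
exact (act_e x y t ii two_neq0 (hdI 0) (hdI 1) (hdI 2%:R) F.1.1 F.1.2 F.2).
Qed.
Lemma op_f_sym F : op_f rho2 (symS F) = symS (fT x y t (pd 0) (pd 2%:R) F).
Proof.
rewrite /op_f /fX rho2_actK ?trmx0 // cmx_mx2 cmx0 rcst0 rcst1.
exact (act_f x y t ii two_neq0 (hdI 0) (hdI 1) (hdI 2%:R) F.1.1 F.1.2 F.2).
Qed.
Lemma op_h_sym F : op_h rho2 (symS F) = symS (hT x y t (pd 0) (pd 1) F).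
Proof.
rewrite /op_h /hX rho2_actK ?trmx0 // cmx_mx2 cmx0 rcst0 rcstN rcst1.
exact (act_h x y t ii two_neq0 (hdI 0) (hdI 1) (hdI 2%:R) F.1.1 F.1.2 F.2).
Qed.
Lemma op_d_sym F : op_d rho2 (symS F) = symS (dT x y t (pd 0) (pd 1) (pd 2%:R) F).
Proof.
rewrite /op_d /dX rho2_actK ?trmx0 // cmx_mx2 cmx0 rcst0 rcst1.
exact (act_d x y t ii two_neq0 (hdI 0) (hdI 1) (hdI 2%:R) F.1.1 F.1.2 F.2).
Qed.
Lemma op_b_sym F : op_b rho2 (symS F) = symS (bT x y t (pd 1) F).
Proof.
rewrite /op_b /bX rho2_actK ?trmx0 ?mx2T // cmx_mx2 cmx0 rcst0 rcst1.
exact (act_b2 x y t (hdI 0) (hdI 1) (hdI 2%:R) F.1.1 F.1.2 F.2).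
Qed.
Lemma op_c_sym F : op_c rho2 (symS F) = symS (cT x y t (pd 0) (pd 1) (pd 2%:R) F).
Proof.
rewrite /op_c /cX rho2_actK ?trmx0 ?mx2T // cmx_mx2 cmx0 rcst0 rcst1.
exact (act_c1 x y t ii two_neq0 (hdI 0) (hdI 1) (hdI 2%:R) F.1.1 F.1.2 F.2).
Qed.
End Tens3.

(** * Strings of the K-types *)

Section Strings.
Variable C : numClosedFieldType.
Local Notation K := (ratfun C 3).
Local Notation Ns := (@Ns C).
Local Notation rcst := (@rcst C 3).
Local Notation rho2 := (@rho2 C).
Local Notation x := (var C (0 : 'I_3)).
Local Notation y := (var C (1 : 'I_3)).
Local Notation t := (var C (2%:R : 'I_3)).
Local Notation pd := (@pd C 3).
Local Notation N := (x * y + t * t).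

Lemma N_neq0 : N != 0. Proof. by rewrite -NsE Ns_neq0. Qed.
Local Notation y0 := (@var_neq0 C 3 1).
Lemma pd0x : pd 0 x = 1. Proof. by rewrite pd_var. Qed.
Lemma pd0y : pd 0 y = 0. Proof. by rewrite pd_var. Qed.
Lemma pd0t : pd 0 t = 0. Proof. by rewrite pd_var. Qed.
Lemma pd1x : pd 1 x = 0. Proof. by rewrite pd_var. Qed.
Lemma pd1y : pd 1 y = 1. Proof. by rewrite pd_var. Qed.
Lemma pd1t : pd 1 t = 0. Proof. by rewrite pd_var. Qed.
Lemma pd2x : pd 2%:R x = 0. Proof. by rewrite pd_var. Qed.
Lemma pd2y : pd 2%:R y = 0. Proof. by rewrite pd_var. Qed.
Lemma pd2t : pd 2%:R t = 1. Proof. by rewrite pd_var. Qed.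

Definition Tl k l : tens C 3 := symS (Tlw x y t k l).
Definition Ml k l : tens C 3 := symS (Mlw x y t k l).
Definition Cl k l : tens C 3 := symS (Clw x y t k l).
Local Notation e := (op_e rho2).
Local Notation f := (op_f rho2).
Local Notation h := (op_h rho2).
Local Notation d := (op_d rho2).
Local Notation b := (op_b rho2).
Local Notation c := (op_c rho2).

Definition rcst_simp := (@rcstD C 3, @rcstM C 3, @rcstN C 3, @rcst_nat C 3, @rcst_int C 3, @rcst1 C 3).

Lemma symS0 k m : symS (mono x y t k m (0, 0, 0)) = 0.
Proof.
have -> : mono x y t k m (0, 0, 0) = tsc 0 (0, 0, 0) by rewrite /mono /tsc /= !mulr0.
by rewrite -(rcst0 C 3) -symSZ scale0r.
Qed.

Lemma f_Tl k l : f (Tl k l) = 0.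
Proof. by rewrite op_f_sym (fT_T (pd_derivation 0) (pd_derivation 2%:R) pd0x pd0y pd0t pd2x pd2y pd2t N_neq0 y0 (two_neq0 C) k l) symS0. Qed.
Lemma f_Ml k l : f (Ml k l) = 0.
Proof. by rewrite op_f_sym (fT_M (pd_derivation 0) (pd_derivation 2%:R) pd0x pd0y pd0t pd2x pd2y pd2t N_neq0 y0 (two_neq0 C) k l) symS0. Qed.
Lemma f_Cl k l : f (Cl k l) = 0.
Proof. by rewrite op_f_sym (fT_C (pd_derivation 0) (pd_derivation 2%:R) pd0x pd0y pd0t pd2x pd2y pd2t N_neq0 y0 (two_neq0 C) k l) symS0. Qed.
Lemma h_Tl k l : h (Tl k l) = (2 * l%:~R + 2) *: Tl k l.
Proof.
rewrite op_h_sym symSZ !rcst_simp; congr symS.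
exact (hT_T (pd_derivation 0) (pd_derivation 1) pd0x pd0y pd0t pd1x pd1y pd1t N_neq0 y0 (two_neq0 C) k l).
Qed.
Lemma h_Ml k l : h (Ml k l) = (2 * l%:~R) *: Ml k l.
Proof.
rewrite op_h_sym symSZ !rcst_simp; congr symS.
exact (hT_M (pd_derivation 0) (pd_derivation 1) pd0x pd0y pd0t pd1x pd1y pd1t N_neq0 y0 (two_neq0 C) k l).
Qed.
Lemma h_Cl k l : h (Cl k l) = (2 * l%:~R) *: Cl k l.
Proof.
rewrite op_h_sym symSZ !rcst_simp; congr symS.
exact (hT_C (pd_derivation 0) (pd_derivation 1) pd0x pd0y pd0t pd1x pd1y pd1t N_neq0 y0 (two_neq0 C) k l).
Qed.
Lemma d_Tl k l : d (Tl k l) = (- 2 * (2 * k%:~R + 1 + l%:~R) - 2) *: Tl k l.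
Proof.
rewrite op_d_sym symSZ !rcst_simp; congr symS.
exact (dT_T (pd_derivation 0) (pd_derivation 1) (pd_derivation 2%:R) pd0x pd0y pd0t pd1x pd1y pd1t pd2x pd2y pd2t N_neq0 y0 (two_neq0 C) k l).
Qed.
Lemma d_Ml k l : d (Ml k l) = (- 2 * (2 * k%:~R + 1 + l%:~R) - 2) *: Ml k l.
Proof.
rewrite op_d_sym symSZ !rcst_simp; congr symS.
exact (dT_M (pd_derivation 0) (pd_derivation 1) (pd_derivation 2%:R) pd0x pd0y pd0t pd1x pd1y pd1t pd2x pd2y pd2t N_neq0 y0 (two_neq0 C) k l).
Qed.
Lemma d_Cl k l : d (Cl k l) = (- 2 * (2 * k%:~R + l%:~R) - 2) *: Cl k l.
Proof.
rewrite op_d_sym symSZ !rcst_simp; congr symS.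
exact (dT_C (pd_derivation 0) (pd_derivation 1) (pd_derivation 2%:R) pd0x pd0y pd0t pd1x pd1y pd1t pd2x pd2y pd2t N_neq0 y0 (two_neq0 C) k l).
Qed.

Lemma b_Tl k l (k' := k%:~R : C) (l' := l%:~R : C) :
  (- 4 * (l' + 1) * (l' + 2) * (2 * l' + 3)) *: b (Tl k l) =
  (- (2 * k' + 1) * (l' + 1)) *: e (e (Tl (k - 1) (l + 1)))
  + ((- (2 * k' + 1) * (2 * l' + 3)) *: e (Ml (k - 1) (l + 1))
  + ((8 * l' * (l' + 2) * (l' + 2) * (k' + l' + 1)) *: Tl k (l - 1)
  + (2 * (l' + 2)) *: Cl k l)).
Proof.
rewrite op_b_sym !op_e_sym !symSZ !symSD /k' /l' !rcst_simp; congr symS.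
exact (bT_T (pd_derivation 1) (pd_derivation 2%:R) pd1x pd1y pd1t pd2x pd2y pd2t N_neq0 y0 (two_neq0 C) k l).
Qed.

Lemma b_Ml k l (k' := k%:~R : C) (l' := l%:~R : C) :
  (- 4 * l' * (l' + 1) * (2 * l' + 1)) *: b (Ml k l) =
  (- (2 * k' + 1) * l') *: e (e (Ml (k - 1) (l + 1)))
  + ((- 8 * (2 * l' + 1) * (k' + l' + 1)) *: e (Tl k (l - 1))
  + ((2 * (2 * l' + 1)) *: e (Cl k l)
  + (8 * (l' + 1) * (l' * l' - 1) * (k' + l' + 1)) *: Ml k (l - 1))).
Proof.
rewrite op_b_sym !op_e_sym !symSZ !symSD /k' /l' !rcst_simp; congr symS.
exact (bT_M (pd_derivation 1) (pd_derivation 2%:R) pd1x pd1y pd1t pd2x pd2y pd2t N_neq0 y0 (two_neq0 C) k l).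
Qed.

Lemma b_Cl k l (k' := k%:~R : C) (l' := l%:~R : C) :
  (- 4 * (l' + 1) * (2 * l' + 1)) *: b (Cl k l) =
  (- (2 * k' + 1)) *: e (e (Cl (k - 1) (l + 1)))
  + (8 * l' * (l' + 1) * (k' + l' + 1)) *: Cl k (l - 1).
Proof.
rewrite op_b_sym !op_e_sym !symSZ !symSD /k' /l' !rcst_simp; congr symS.
exact (bT_C (pd_derivation 1) (pd_derivation 2%:R) pd1x pd1y pd1t pd2x pd2y pd2t N_neq0 y0 (two_neq0 C) k l).
Qed.

Lemma c_Tl k l (k' := k%:~R : C) (l' := l%:~R : C) :
  (4 * (l' + 1) * (l' + 2) * (2 * l' + 3) * (2 * k' + 3)) *: c (Tl k l) =
  (- (2 * k' + 2 * l' + 5) * (2 * k' + 3) * (l' + 1)) *: e (e (Tl k (l + 1)))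
  + ((- (2 * k' + 1) * (2 * k' + 3) * (2 * l' + 3)) *: e (Ml k (l + 1))
  + ((8 * l' * (l' + 2) * (l' + 2) * (k' + 1) * (2 * k' + 1)) *: Tl (k + 1) (l - 1)
  + (- 2 * (l' + 2) * (2 * l' + 1 - 2 * k')) *: Cl (k + 1) l)).
Proof.
rewrite op_c_sym !op_e_sym !symSZ !symSD /k' /l' !rcst_simp; congr symS.
exact (cT_T (pd_derivation 0) (pd_derivation 1) (pd_derivation 2%:R) pd0x pd0y pd0t pd1x pd1y pd1t pd2x pd2y pd2t N_neq0 y0 (two_neq0 C) k l).
Qed.

Lemma c_Ml k l (k' := k%:~R : C) (l' := l%:~R : C) :
  (4 * l' * (l' + 1) * (2 * l' + 1) * (2 * k' + 3)) *: c (Ml k l) =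
  (- (2 * k' + 2 * l' + 3) * (2 * k' + 3) * l') *: e (e (Ml k (l + 1)))
  + ((- 8 * (2 * l' + 1) * (k' + 1) * (2 * k' + 2 * l' + 3)) *: e (Tl (k + 1) (l - 1))
  + ((2 * (2 * l' + 1) * (2 * k' + 1)) *: e (Cl (k + 1) l)
  + (8 * (l' + 1) * (l' * l' - 1) * (2 * k' + 3) * (k' + 1)) *: Ml (k + 1) (l - 1))).
Proof.
rewrite op_c_sym !op_e_sym !symSZ !symSD /k' /l' !rcst_simp; congr symS.
exact (cT_M (pd_derivation 0) (pd_derivation 1) (pd_derivation 2%:R) pd0x pd0y pd0t pd1x pd1y pd1t pd2x pd2y pd2t N_neq0 y0 (two_neq0 C) k l).
Qed.

Lemma c_Cl k l (k' := k%:~R : C) (l' := l%:~R : C) :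
  (4 * (l' + 1) * (2 * l' + 1)) *: c (Cl k l) =
  (- (2 * k' + 2 * l' + 1)) *: e (e (Cl k (l + 1)))
  + (8 * l' * (l' + 1) * k') *: Cl (k + 1) (l - 1).
Proof.
rewrite op_c_sym !op_e_sym !symSZ !symSD /k' /l' !rcst_simp; congr symS.
exact (cT_C (pd_derivation 0) (pd_derivation 1) (pd_derivation 2%:R) pd0x pd0y pd0t pd1x pd1y pd1t pd2x pd2y pd2t N_neq0 y0 (two_neq0 C) k l).
Qed.
End Strings.

Section TripleShift.
Variable K : fieldType.
Variables (x y t : K) (d1 d2 : K -> K).
Hypothesis (dd1 : derivation d1) (dd2 : derivation d2).
Hypothesis (d1x : d1 x = 0) (d1y : d1 y = 1) (d1t : d1 t = 0).
Hypothesis (d2x : d2 x = 0) (d2y : d2 y = 0) (d2t : d2 t = 1).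
Local Notation N := (x * y + t * t).
Hypothesis (N0 : N != 0) (y0 : y != 0) (two : (2 : K) != 0).

Lemma eT_shift k p q s : eT x y t d1 d2 (N ^ k * p, N ^ k * q, N ^ k * s) =
  (N ^ k * e0 x t d1 d2 p, N ^ k * (e0 x t d1 d2 q + p), N ^ k * (e0 x t d1 d2 s - 2 * q)).
Proof.
have := eT_mono dd1 dd2 d1x d1y d1t d2x d2y d2t N0 y0 two k 0 (p, q, s).
rewrite /mono /= !expr0z sub0r !mulr1 => ->.
have yV : y ^ (-1) * y = 1 by rewrite exprN1 mulVf.
have E u : N ^ k * y ^ (-1) * (y * u) = N ^ k * u by rewrite -mulrA [y ^ (-1) * _]mulrA yV mul1r.
rewrite !mulr0z !mulr0 !mul0r !addr0 -!mulrDr E.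
by rewrite [2 * y * _]mulrAC [2 * _ * y]mulrC -mulrBr !E.
Qed.

Lemma int_combine (a b c : int) (r : K) : a - 2 * b = c ->
  a%:~R * r - 2 * (b%:~R * r) = c%:~R * r.
Proof. by move=> <-; rewrite intrB intrM mulrBl mulrA. Qed.
Lemma int_succ (a : int) (r : K) : a%:~R * r + r = (a + 1)%:~R * r.
Proof. by rewrite intrD mulrDl mul1r. Qed.

Lemma e0_yX l : e0 x t d1 d2 (y ^+ l) = 2 * t * (l%:R * y ^ (l%:Z - 1)).
Proof.
rewrite /e0; case: l => [|l].
  by rewrite expr0 (derD1 dd1) (derD1 dd2) mul0r !mulr0 subrr.
rewrite (derDX dd1) (derDX dd2) d1y d2y -[l.+1]addn1 PoszD addrK; rewrite -exprnP addn1; ring.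
Qed.
End TripleShift.

Section SolidStrings.
Variable C : numClosedFieldType.
Local Notation K := (ratfun C 3).
Local Notation Ns := (@Ns C).
Local Notation rcst := (@rcst C 3).
Local Notation rho2 := (@rho2 C).
Local Notation x := (var C (0 : 'I_3)).
Local Notation y := (var C (1 : 'I_3)).
Local Notation t := (var C (2%:R : 'I_3)).
Local Notation pd := (@pd C 3).
Local Notation N := (x * y + t * t).
Local Notation e := (op_e rho2).
Local Notation d0 := (e0 x t (pd 1) (pd 2%:R)).
Local Notation R l m := (@ofpoly C 3 (solid_harmonic C l m)).

Definition symR k (p q s : K) : tens C 3 := symS (N ^ k * p, N ^ k * q, N ^ k * s).

Lemma symRE k p q s : symR k p q s = symS (N ^ k * p, N ^ k * q, N ^ k * s). Proof. by []. Qed.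

Lemma e_symR k p q s : e (symR k p q s) = symR k (d0 p) (d0 q + p) (d0 s - 2 * q).
Proof.
rewrite op_e_sym; congr symS.
exact (eT_shift (pd_derivation 1) (pd_derivation 2%:R) (pd1x C) (pd1y C) (pd1t C)
  (pd2x C) (pd2y C) (pd2t C) (N_neq0 C) (@var_neq0 C 3 1) (two_neq0 C) k p q s).
Qed.

Lemma ofp_nat n k : @ofpoly C n k%:R = k%:R.
Proof. exact: (rmorph_nat (@ofpoly C n)). Qed.

Lemma ofp_ep p : @ofpoly C 3 (ep p) = d0 (ofpoly p).
Proof.
by rewrite /ep ofpB ofpM ofpM ofpM ofp_nat /e0 !pd_ofp.
Qed.

Lemma d0Z (c : C) u : d0 (rcst c * u) = rcst c * d0 u.
Proof.
rewrite /e0 (derD_mul (pd_derivation _)) (derD_mul (pd_derivation _)) !pd_rcst !mul0r !add0r.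
by rewrite mulrBr mulrCA [rcst _ * (x * _)]mulrCA.
Qed.

(** At m = -l - 1 the left side would be 0 and the right side R^(-l)_l, which is not. Whenever this
    index can occur, the coefficient in front has to vanish, as in [R_int] and [e_Gmx]. *)
Lemma R_succ (l : nat) (m : int) : - l%:Z <= m -> d0 (R l m) = R l (m + 1).
Proof.
move=> lm; rewrite !solid_harmonicE //; last by lia.
have -> : absz (l%:Z + (m + 1)) = (absz (l%:Z + m)).+1 by lia.
rewrite [Rpoly _ _.+1 l]/(ep (Rpoly _ _ _)) -!mul_mpolyC !ofpM ofp_ep ofpC.
exact: d0Z.
Qed.

Lemma R_out (l m : int) : ~~ ((0 <= l) && (`|m| <= l)) -> R l m = 0.
Proof. by move=> /solid_harmonic_out ->; rewrite ofp0. Qed.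

Lemma R_bot (l : nat) : R l (- l%:Z) = rcst (cl C l) * y ^+ l.
Proof.
rewrite solid_harmonicE // addrN /= -mul_mpolyC ofpM ofpC.
by rewrite /Rpoly /= ofpX.
Qed.

Lemma R_bot1 (l : nat) : R l (- l%:Z + 1) = rcst (cl C l) * (2 * t * (l%:R * y ^ (l%:Z - 1))).
Proof.
rewrite -R_succ // R_bot.
rewrite d0Z; congr (_ * _).
exact (e0_yX x t (pd_derivation 1) (pd_derivation 2%:R) (pd1y C) (pd2y C) l).
Qed.

Lemma R_int (l : nat) (m a : int) : a = 0 \/ - l%:Z <= m ->
  d0 (a%:~R * R l m) = a%:~R * R l (m + 1).
Proof.
rewrite -(rcst_int C 3) d0Z; case=> [->|lm]; first by rewrite mulr0z rcst0 !mul0r.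
by rewrite R_succ.
Qed.

(* Common shape of the matrices T, M, B. *)
Definition Gmx k (l : nat) m (a b : int) :=
  symR k (R l (m + 1)) (a%:~R * R l m) (b%:~R * R l (m - 1)).

(** The coefficients 1, a, b of R^(m+1), R^m, R^(m-1) obey a' = a + 1 and b' = b - 2a, a recursion
    that T, M and B all satisfy. *)
Lemma e_Gmx k l m a b a' b' : - l%:Z <= m + 1 -> a = 0 \/ - l%:Z <= m ->
  b = 0 \/ - l%:Z <= m - 1 -> a' = a + 1 -> b' = b - 2 * a ->
  e (Gmx k l m a b) = Gmx k l (m + 1) a' b'.
Proof.
move=> lm lma lmb -> bE; rewrite /Gmx e_symR R_succ // R_int // R_int //.
rewrite (int_succ a) subrK addrK.
by rewrite (int_combine (R l m) (esym bE)).
Qed.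

Lemma sym_Nhalf k (F : tens C 3) (p q q' s : K) :
  F = \matrix_(i, j) ent2 p q' q' s i j -> q' = rcst 'i * q ->
  Nhalf k F = symR k p q s.
Proof.
move=> -> qE; rewrite /Nhalf NsE; exact (symK_scale (N ^ k) 0 p s qE).
Qed.

Lemma TmxE k (l : nat) m : Nhalf k (Tmx C l m) =
  Gmx k l m (l%:Z + m + 1) (- ((l%:Z + m) * (l%:Z + m + 1))).
Proof.
apply: sym_Nhalf; first by rewrite /Tmx -intrN.
by rewrite mulrA.
Qed.
Lemma MmxE k (l : nat) m : Nhalf k (Mmx C l m) =
  Gmx k l m m ((l%:Z + m) * (l%:Z - m + 1)).
Proof. by apply: sym_Nhalf; rewrite ?mulrA. Qed.
Lemma BmxE k (l : nat) m : Nhalf k (Bmx C l m) =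
  Gmx k l m (- (l%:Z - m)) (- ((l%:Z - m) * (l%:Z - m + 1))).
Proof.
apply: sym_Nhalf; first by rewrite /Bmx -intrN.
by rewrite mulrA intrN mulrN mulNr.
Qed.

Lemma e_Tmx k (l : nat) m : - l%:Z - 1 <= m ->
  e (Nhalf k (Tmx C l m)) = Nhalf k (Tmx C l (m + 1)).
Proof.
move=> lm; rewrite !TmxE; apply: e_Gmx; try lia.
have [lm1|lm1] := leP (- l%:Z) (m - 1); [by right | left].
have [->|->] : m = - l%:Z \/ m = - l%:Z - 1 by lia.
  by ring.
by ring.
Qed.
Lemma e_Mmx k (l : nat) m : - l%:Z <= m ->
  e (Nhalf k (Mmx C l m)) = Nhalf k (Mmx C l (m + 1)).
Proof.
move=> lm; rewrite !MmxE; apply: e_Gmx; try lia.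
have [lm1|lm1] := leP (- l%:Z) (m - 1); [by right | left].
have -> : m = - l%:Z by lia.
by ring.
Qed.
Lemma e_Bmx k (l : nat) m : - l%:Z + 1 <= m ->
  e (Nhalf k (Bmx C l m)) = Nhalf k (Bmx C l (m + 1)).
Proof. by move=> lm; rewrite !BmxE; apply: e_Gmx; try lia; right; lia. Qed.

Lemma symR0 k : symR k 0 0 0 = 0.
Proof.
have -> : symR k 0 0 0 = symS (mono x y t k 0 (0, 0, 0)).
  by rewrite /symR /mono /= !mulr0.
exact: symS0.
Qed.

Lemma Tmx_top k (l : nat) : Nhalf k (Tmx C l (l%:Z + 2)) = 0.
Proof.
by rewrite TmxE /Gmx !R_out ?mulr0 ?symR0 //; lia.
Qed.
Lemma Mmx_top k (l : nat) : Nhalf k (Mmx C l (l%:Z + 1)) = 0.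
Proof.
rewrite MmxE /Gmx !(R_out (m := _ + 1)) ?mulr0 //; try lia.
by rewrite (_ : (l%:Z + (l%:Z + 1)) * _ = 0) ?mulr0z ?mul0r ?symR0 //; ring.
Qed.
Lemma Bmx_top k (l : nat) : Nhalf k (Bmx C l l%:Z) = 0.
Proof.
rewrite BmxE /Gmx R_out; last by lia.
by rewrite !(subrr, mul0r, oppr0, mulr0z) symR0.
Qed.
Lemma Tmx_neg k m : Nhalf k (Tmx C (-1) m) = 0.
Proof.
have -> : Tmx C (-1) m = 0 :> 'M_2.
  by apply: matrix2P; rewrite /Tmx !mxE ?ent2E !R_out ?mulr0.
by rewrite /Nhalf scaler0.
Qed.
End SolidStrings.

Section TripleBase.
Variable K : fieldType.
Variables (x y t : K).
Local Notation N := (x * y + t * t).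
Lemma Tbase k (l : nat) (c : K) :
  (N ^ k * (c * y ^+ l), N ^ k * 0, N ^ k * 0) = tsc c (Tlw x y t k l) :> triple K.
Proof. by rewrite /tsc /Tlw /mono /= -exprnP; apply: tripleP; ring. Qed.
Lemma Mbase k (l : nat) (c : K) : y != 0 ->
  (N ^ k * (c * (2 * t * (l%:R * y ^ (l%:Z - 1)))), N ^ k * (- l%:R * (c * y ^+ l)),
   N ^ k * 0) = tsc (c * l%:R) (Mlw x y t k l) :> triple K.
Proof.
move=> y0; rewrite /tsc /Mlw /mono /=.
by apply: tripleP; rewrite ?[y ^+ l]exprnP ?(ysub1 y0 l); ring.
Qed.
Variables (d1 d2 : K -> K).
Hypothesis (dd1 : derivation d1) (dd2 : derivation d2).
Hypothesis (d1x : d1 x = 0) (d1y : d1 y = 1) (d1t : d1 t = 0).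
Hypothesis (d2x : d2 x = 0) (d2y : d2 y = 0) (d2t : d2 t = 1).
Hypothesis (N0 : N != 0) (y0 : y != 0) (two : (2 : K) != 0).
Local Notation d0 := (e0 x t d1 d2).

Lemma e0_2yX (l : nat) : d0 (2 * t * (l.+1%:R * y ^ (l.+1%:Z - 1))) =
  2 * l.+1%:R * (2 * l%:R * t * t - x * y) * y ^ (l%:Z - 1).
Proof.
have E : l.+1%:Z - 1 = l by lia.
rewrite E /e0 !(derD_mul dd1) !(derD_mul dd2) (derDXz dd1 _ y0) (derDXz dd2 _ y0).
have dn (d : K -> K) m : derivation d -> d m%:R = 0.
  by move=> dd; elim: m => [|m IH]; rewrite ?(derD0 dd) // -natr1 (derD_add dd) IH (derD1 dd) addr0.
rewrite !(dn d1) // !(dn d2) // d1y d2y d1t d2t (ysub1 y0 l).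
by field.
Qed.

Lemma Cbase k (l : nat) (c c1 : K) (a := 2 * k%:~R + 1 : K) (b := 2 * (k%:~R + l%:R + 1) : K) :
  c = c1 * (2 * l.+1%:R) ->
  (a * (N ^ (k - 1) * (c1 * (2 * l.+1%:R * (2 * l%:R * t * t - x * y) * y ^ (l%:Z - 1))))
     - b * (N ^ k * (c * (2 * l%:R) * y ^ (l%:Z - 1))),
   a * (N ^ (k - 1) * (- (2 * l%:R + 1) * (c1 * (2 * t * (l.+1%:R * y ^ (l.+1%:Z - 1)))))) - b * 0,
   a * (N ^ (k - 1) * (- ((2 * l%:R + 1) * (2 * l%:R + 2)) * (c1 * y ^+ l.+1))) - b * 0) =
  tsc (- (2 * l%:R + 1) * c) (Clw x y t k l) :> triple K.
Proof.
move=> ->; rewrite /tsc /Clw /mono /= /a /b.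
have E : l.+1%:Z - 1 = l by lia.
have l1 : (l.+1%:R : K) = l%:R + 1 by rewrite natr1.
rewrite E exprS exprnP (Nsub1 N0 k) (ysub1 y0 l) l1 -!pmulrn.
by apply: tripleP; ring.
Qed.
End TripleBase.

Section SolidBases.
Variable C : numClosedFieldType.
Local Notation K := (ratfun C 3).
Local Notation rcst := (@rcst C 3).
Local Notation rho2 := (@rho2 C).
Local Notation x := (var C (0 : 'I_3)).
Local Notation y := (var C (1 : 'I_3)).
Local Notation t := (var C (2%:R : 'I_3)).
Local Notation pd := (@pd C 3).
Local Notation N := (x * y + t * t).
Local Notation e := (op_e rho2).
Local Notation d0 := (e0 x t (pd 1) (pd 2%:R)).
Local Notation R l m := (@ofpoly C 3 (solid_harmonic C l m)).
Local Notation cl := (cl C).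

Lemma Tmx_base k (l : nat) : Nhalf k (Tmx C l (- l%:Z - 1)) = cl l *: Tl C k l.
Proof.
rewrite TmxE /Gmx subrK R_bot.
have -> : l%:Z + (- l%:Z - 1) + 1 = 0 by ring.
rewrite mulr0 oppr0 mulr0z !mul0r symSZ.
congr symS; exact (Tbase x y t k l (rcst (cl l))).
Qed.

Lemma Mmx_base k (l : nat) : Nhalf k (Mmx C l (- l%:Z)) = (cl l * l%:R) *: Ml C k l.
Proof.
rewrite MmxE /Gmx R_bot1 R_bot addrN mul0r mulr0z mul0r intrN -pmulrn symSZ.
rewrite rcstM rcst_nat.
congr symS; exact (Mbase x t k l (rcst (cl l)) (@var_neq0 C 3 1)).
Qed.

Lemma cl_succ l : cl l = cl l.+1 * (2 * l.+1%:R).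
Proof.
rewrite !clE exprS factS natrM; field.
by rewrite expf_neq0 ?pnatr_eq0 // addrC natr1 pnatr_eq0 -lt0n fact_gt0.
Qed.

Lemma R2_bot (l : nat) : R l.+1 (- l%:Z + 1) =
  rcst (cl l.+1) * (2 * l.+1%:R * (2 * l%:R * t * t - x * y) * y ^ (l%:Z - 1)).
Proof.
have -> : - l%:Z + 1 = - l.+1%:Z + 1 + 1 by lia.
rewrite -R_succ ?R_bot1 ?d0Z; last by lia.
congr (_ * _).
exact (e0_2yX (pd_derivation 1) (pd_derivation 2%:R) (pd1y C) (pd1t C) (pd2y C) (pd2t C) (N_neq0 C) (@var_neq0 C 3 1) (two_neq0 C) l).
Qed.

Lemma Tmx_base1 k (l : nat) : Nhalf k (Tmx C (l%:Z - 1) (- l%:Z)) =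
  symR k (rcst (cl l) * (2 * l%:R) * y ^ (l%:Z - 1)) 0 0.
Proof.
case: l => [|l].
  by rewrite Tmx_neg mulr0 mulr0 mul0r symR0.
have E : l.+1%:Z - 1 = l by lia.
rewrite E (_ : - l.+1%:Z = - l%:Z - 1); last by lia.
rewrite TmxE /Gmx subrK R_bot.
have -> : l%:Z + (- l%:Z - 1) + 1 = 0 by ring.
rewrite mulr0 oppr0 mulr0z !mul0r [cl l]cl_succ rcstM rcstM !rcst_nat.
by rewrite -exprnP.
Qed.

(** The scalar is visible in the last entry: there B has the coefficient -(2l + 1)(2l + 2), and 2 (l
    + 1) times the constant [cl] of l + 1 is that of l. *)
Lemma Cmx_base k (l : nat) : Cmx C k l (- l%:Z) = (- (2 * l%:R + 1) * cl l) *: Cl C k l.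
Proof.
rewrite /Cmx Tmx_base1.
have -> : l%:Z + 1 = l.+1 by lia.
rewrite BmxE /Gmx R2_bot.
have E1 : - l%:Z = - l.+1%:Z + 1 by lia.
have E2 : - l%:Z - 1 = - l.+1%:Z by lia.
have E3 := R_bot1 C l.+1; rewrite -E1 in E3.
rewrite E2 R_bot E3.
have F1 : - (l.+1%:Z - - l%:Z) = - (2 * l%:Z + 1) by lia.
have F2 : - ((l.+1%:Z - - l%:Z) * (l.+1%:Z - - l%:Z + 1)) = - ((2 * l%:Z + 1) * (2 * l%:Z + 2)) by lia.
rewrite F1 F2 -scaleNr !symSZ symSD.
rewrite [in RHS]rcstM !rcstN rcst_int rcst_int [rcst (_ + _)]rcstD [rcst (2 * _)]rcstM !rcst_nat rcst1.
have H : rcst (cl l) = rcst (cl l.+1) * (2 * l.+1%:R).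
  by rewrite cl_succ !rcstM !rcst_nat.
rewrite -(Cbase (N_neq0 C) (@var_neq0 C 3 1) (two_neq0 C) k H).
have I1 : ((2 * k + 1)%:~R : K) = 2 * k%:~R + 1 by rewrite intrD intrM.
have I2 : ((2 * (k + l%:Z + 1))%:~R : K) = 2 * (k%:~R + l%:R + 1).
  by rewrite intrM !intrD -pmulrn.
have I3 : ((- (2 * l%:Z + 1))%:~R : K) = - (2 * l%:R + 1).
  by rewrite intrN intrD intrM -pmulrn.
have I4 : ((- ((2 * l%:Z + 1) * (2 * l%:Z + 2)))%:~R : K) = - ((2 * l%:R + 1) * (2 * l%:R + 2)).
  by rewrite intrN intrM !intrD !intrM -!pmulrn.
rewrite I1 I2 I3 I4 /tadd /tsc /= !mulNr !mulr0.
reflexivity.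
Qed.

Lemma e_Z (c : C) u : e (c *: u) = c *: e u.
Proof. exact: (phiZ (phi := fun _ : unit => e) (fun _ => op_e_lin (rho2_lie setT)) tt). Qed.

Lemma iter_eZ (c : C) i u : iter i e (c *: u) = c *: iter i e u.
Proof. by elim: i => //= i ->; exact: e_Z. Qed.

Lemma Tmx_str k (l i : nat) :
  Nhalf k (Tmx C l (- l%:Z - 1 + i%:Z)) = cl l *: iter i e (Tl C k l).
Proof.
elim: i => [|i IH]; first by rewrite addr0 Tmx_base.
rewrite /= -e_Z -IH e_Tmx; last by lia.
by congr (Nhalf k (Tmx C l _)); lia.
Qed.
Lemma Mmx_str k (l i : nat) :
  Nhalf k (Mmx C l (- l%:Z + i%:Z)) = (cl l * l%:R) *: iter i e (Ml C k l).
Proof.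
elim: i => [|i IH]; first by rewrite addr0 Mmx_base.
rewrite /= -e_Z -IH e_Mmx; last by lia.
by congr (Nhalf k (Mmx C l _)); lia.
Qed.
Lemma e_Cmx k (l : nat) m : - l%:Z <= m -> e (Cmx C k l m) = Cmx C k l (m + 1).
Proof.
move=> lm; have lin := op_e_lin (@rho2_lie C setT).
have E1 : e (Nhalf (k - 1) (Bmx C (l%:Z + 1) m)) = Nhalf (k - 1) (Bmx C (l%:Z + 1) (m + 1)).
  have -> : l%:Z + 1 = l.+1 by lia.
  by apply: e_Bmx; lia.
have E2 : e (Nhalf k (Tmx C (l%:Z - 1) m)) = Nhalf k (Tmx C (l%:Z - 1) (m + 1)).
  case: l lm {E1} => [|l] lm.
    by rewrite !Tmx_neg -(scale0r 0) e_Z !scale0r.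
  have -> : l.+1%:Z - 1 = l by lia.
  by apply: e_Tmx; lia.
by rewrite /Cmx -!scaleNr lin e_Z E1 E2.
Qed.
Lemma Cmx_str k (l i : nat) :
  Cmx C k l (- l%:Z + i%:Z) = (- (2 * l%:R + 1) * cl l) *: iter i e (Cl C k l).
Proof.
elim: i => [|i IH]; first by rewrite addr0 Cmx_base.
rewrite /= -e_Z -IH e_Cmx; last by lia.
by congr (Cmx C k l _); lia.
Qed.

Lemma Tl_top k (l : nat) : iter (2 * l).+3 e (Tl C k l) = 0.
Proof.
have := Tmx_str k l (2 * l).+3.
have -> : - l%:Z - 1 + (2 * l).+3%:Z = l%:Z + 2 by lia.
rewrite Tmx_top => /esym/eqP; rewrite scaler_eq0 (negbTE (cl_neq0 C l)) /=.
by move/eqP.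
Qed.
Lemma Ml_top k (l : nat) : iter (2 * l).+3 e (Ml C k l.+1) = 0.
Proof.
have := Mmx_str k l.+1 (2 * l).+3.
have -> : - l.+1%:Z + (2 * l).+3%:Z = l.+1%:Z + 1 by lia.
rewrite Mmx_top => /esym/eqP; rewrite scaler_eq0 mulf_eq0 (negbTE (cl_neq0 C _)) /=.
by rewrite pnatr_eq0 /= => /eqP.
Qed.
End SolidBases.

Section OneEigen.
Variables (C : fieldType) (V : lmodType C) (phi : V -> V).
Hypothesis phiP : forall c u v, phi (c *: u + v) = c *: phi u + phi v.

Lemma lspanP (S : set V) u : lspan S u ->
  exists (s : seq V) (c : V -> C), [/\ uniq s, forall v, v \in s -> S v & u = \sum_(v <- s) c v *: v].
Proof.
move=> Su; apply: (lspan_famP (D := S) (w := id)).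
suff -> : [set x | exists j, S j /\ x = id j] = S by [].
by apply/seteqP; split=> [_ [j [Sj ->]]|v Sv] //; exists v.
Qed.

(** After subtraction of the part along the generators of eigenvalue [lam], the rest is again an
    eigenvector for [lam] but a combination of generators with other eigenvalues, hence zero. In
    contrast to [eigen_component], several generators may share an eigenvalue, as happens in E. *)
Lemma lspan_eigen (S : set V) (lam : C) u : (forall v, S v -> exists m, phi v = m *: v) ->
  phi u = lam *: u -> lspan S u -> lspan [set v | S v /\ phi v = lam *: v] u.
Proof.
have phi0 : phi 0 = 0.
  by apply: (addrI (phi 0)); rewrite addr0 -[X in X + _]scale1r -phiP scaler0 addr0.
have phiZ' a v : phi (a *: v) = a *: phi v by rewrite -[a *: v]addr0 phiP phi0 addr0.
have phiD v w : phi (v + w) = phi v + phi w by rewrite -[v]scale1r phiP !scale1r.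
have phi_sum (r : seq V) (F : V -> V) : phi (\sum_(v <- r) F v) = \sum_(v <- r) phi (F v).
  by rewrite (big_morph phi phiD phi0).
move=> SE uE /lspanP[s [c [us sS uS]]].
set G := (X in lspan X); have sG := lspan_lsubspace G.
pose good v := phi v == lam *: v.
pose a := \sum_(v <- [seq v <- s | good v]) c v *: v.
pose r := \sum_(v <- [seq v <- s | ~~ good v]) c v *: v.
have uar : u = a + r by rewrite uS /a /r !big_filter (bigID good).
have Ga : lspan G a.
  apply: lsub_sum => // v; rewrite mem_filter => /andP[/eqP gv vs].
  by apply: (lsubZ _ sG); apply: lspan_gen; split=> //; exact: sS.
have aE : phi a = lam *: a.
  rewrite phi_sum scaler_sumr; apply: eq_big_seq => v.
  by rewrite mem_filter => /andP[/eqP gv _]; rewrite phiZ' gv !scalerA mulrC.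
have rE : phi r = lam *: r.
  by apply: (addrI (phi a)); rewrite -phiD -uar uE uar aE scalerDr.
suff r0 : r = 0 by rewrite uar r0 addr0.
have H (L : seq V) (k : V -> C) : forall w, phi w = lam *: w ->
    (forall v, v \in L -> exists2 m, m != lam & phi v = m *: v) ->
    w = \sum_(v <- L) k v *: v -> w = 0.
  elim: L k => [|v0 L IH] k w wE LE wS; first by rewrite wS big_nil.
  have [m0 m0l v0E] := LE _ (mem_head _ _).
  have Ev v : v \in v0 :: L -> exists m, phi v = m *: v by move=> /LE[m _ ?]; exists m.
  pose mu v := xget 0 [set m | phi v = m *: v].
  have muE v : v \in v0 :: L -> phi v = mu v *: v.
    by move=> /Ev; exact: xgetPex.
  suff : (lam - m0) *: w = 0.
    by move/eqP; rewrite scaler_eq0 subr_eq0 eq_sym (negbTE m0l) => /eqP.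
  apply: (IH (fun v => k v * (mu v - m0))).
  - by rewrite phiZ' wE !scalerA mulrC.
  - by move=> v vL; apply: LE; rewrite inE vL orbT.
  rewrite scalerBl -wE wS phi_sum !big_cons phiZ' v0E scalerDr opprD addrACA.
  rewrite !scalerA mulrC subrr add0r scaler_sumr -sumrB; apply: eq_big_seq => v vL.
  rewrite phiZ' muE ?inE ?vL ?orbT // !scalerA -scalerBl; congr (_ *: _).
  by rewrite mulrBr [m0 * _]mulrC.
apply: (H _ c r rE _ erefl) => v; rewrite mem_filter => /andP[gv /sS/SE[m mE]].
by exists m => //; apply: contraNneq gv => ml; rewrite /good mE ml.
Qed.
End OneEigen.

Lemma iter_comm (T : Type) (e g : T -> T) : (forall u, g (e u) = e (g u)) ->
  forall i u, g (iter i e u) = iter i e (g u).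
Proof. by move=> ge; elim=> //= i IH u; rewrite ge IH. Qed.

Section StringSpans.
Variable C : numClosedFieldType.
Local Notation V := (tens C 3).
Local Notation rho2 := (@rho2 C).
Local Notation e := (op_e rho2).
Local Notation f := (op_f rho2).
Local Notation h := (op_h rho2).
Local Notation d := (op_d rho2).
Local Notation b := (op_b rho2).
Local Notation c := (op_c rho2).
Local Notation lie := (@rho2_lie C setT).

(** The label (tau, k, l) means T_l or M_(l+1); with this shift both strings have highest weight 2l
    + 2, and M_0, which is zero, has no label. *)
Definition lowv (a : bool * int * nat) : V :=
  let: (tau, k, l) := a in if tau then Tl C k l else Ml C k l.+1.

(** [lo] imposes the lower bound on k, namely -(l + 1) for T_l and -(l + 2) for M_(l+1); [up]
    imposes k <= -1. With both, [Pspan] is E; with one, it is the preimage of one summand of the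
    quotient; with none, it is W. One proof of invariance serves all four. *)
Definition allowed (lo up : bool) (a : bool * int * nat) : bool :=
  let: (tau, k, l) := a in
  (lo ==> (0 <= k + l%:Z + 1 + (~~ tau)%:R)) && (up ==> (k <= -1)).

Definition Pstr lo up : set V :=
  [set F | exists k (l i : nat), F = iter i e (Cl C k l)] `|`
  [set F | exists a i, allowed lo up a /\ F = iter i e (lowv a)].

Definition Pspan lo up : set V := lspan (Pstr lo up).

Lemma PspanS lo up : lsubspace (Pspan lo up). Proof. exact: lspan_lsubspace. Qed.

Lemma PspanC lo up k (l i : nat) : Pspan lo up (iter i e (Cl C k l)).
Proof. by apply: lspan_gen; left; exists k, l, i. Qed.
Lemma PspanT lo up a i : allowed lo up a -> Pspan lo up (iter i e (lowv a)).
Proof. by move=> aa; apply: lspan_gen; right; exists a, i. Qed.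

Lemma Pspan_cancel lo up (r : C) (u v : V) : r *: u = v -> r != 0 ->
  Pspan lo up v -> Pspan lo up u.
Proof. by move=> <- r0; exact: (lsubZr (PspanS lo up) r0). Qed.

Lemma Pspan_cT lo up (r : C) a i : r = 0 \/ allowed lo up a ->
  Pspan lo up (r *: iter i e (lowv a)).
Proof.
case=> [->|aa]; first by rewrite scale0r; exact: lsub0 (PspanS _ _).
exact (lsubZ r (PspanS lo up) (@PspanT lo up a i aa)).
Qed.
Lemma Pspan_cC lo up (r : C) k (l i : nat) : Pspan lo up (r *: iter i e (Cl C k l)).
Proof. exact (lsubZ r (PspanS lo up) (@PspanC lo up k l i)). Qed.

Lemma Pspan_e lo up u : Pspan lo up u -> Pspan lo up (e u).
Proof.
apply: (lspan_lin (PspanS lo up) (op_e_lin lie)) => {}u [[k [l [i ->]]]|[a [i [aa ->]]]].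
  by rewrite -iterS; exact: PspanC.
by rewrite -iterS; exact: PspanT.
Qed.
Lemma Pspan_iter lo up i u : Pspan lo up u -> Pspan lo up (iter i e u).
Proof. by move=> Pu; elim: i => //= i; exact: Pspan_e. Qed.

Lemma natz (n : nat) : (n%:Z%:~R : C) = n%:R. Proof. by rewrite -pmulrn. Qed.

Lemma lowv_f a : f (lowv a) = 0.
Proof. by case: a => [[[] k] l] /=; rewrite ?f_Tl ?f_Ml. Qed.
Lemma lowv_h a : h (lowv a) = (2 * a.2).+2%:R *: lowv a.
Proof.
case: a => [[[] k] l] /=; rewrite ?h_Tl ?h_Ml; congr (_ *: _); rewrite natz.
  by rewrite -[(2 * l).+2]addn2 natrD natrM.
by rewrite -natrM mulnS.
Qed.
(** The degree of homogeneity in Z, with N^(1/2) counted. *)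
Definition deg (a : bool * int * nat) : int := 2 * a.1.2 + 1 + a.2%:Z + (~~ a.1.1)%:R.
Lemma lowv_d a : d (lowv a) = (- 2 * (deg a)%:~R - 2) *: lowv a.
Proof.
case: a => [[[] k] l] /=; rewrite ?d_Tl ?d_Ml /deg; congr (_ *: _) => /=.
  by rewrite addr0 !intrD intrM.
by rewrite !intrD intrM -[l.+1]addn1 PoszD intrD; ring.
Qed.
Lemma Cl_h k (l : nat) : h (Cl C k l) = (2 * l)%:R *: Cl C k l.
Proof. by rewrite h_Cl natz natrM. Qed.
Lemma lowv_top a : iter (2 * a.2).+3 e (lowv a) = 0.
Proof. by case: a => [[[] k] l] /=; [exact: Tl_top | exact: Ml_top]. Qed.

Lemma Pspan_f lo up u : Pspan lo up u -> Pspan lo up (f u).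
Proof.
have F := f_string (op_e_lin lie) (o_ef lie (@rho2_scale C)) (o_he lie (@rho2_scale C)).
apply: (lspan_lin (PspanS lo up) (op_f_lin lie)) => {}u [[k [l [[|i] ->]]]|[a [[|i] [aa ->]]]].
- by rewrite /= f_Cl; exact: lsub0 (PspanS _ _).
- by rewrite (F _ _ (f_Cl C k l) (Cl_h k l)); exact: Pspan_cC.
- by rewrite /= lowv_f; exact: lsub0 (PspanS _ _).
- by rewrite (F _ _ (lowv_f a) (lowv_h a)); apply: Pspan_cT; right.
Qed.
Lemma Pspan_h lo up u : Pspan lo up u -> Pspan lo up (h u).
Proof.
have F := h_string (op_e_lin lie) (o_he lie (@rho2_scale C)).
apply: (lspan_lin (PspanS lo up) (op_h_lin lie)) => {}u [[k [l [i ->]]]|[a [i [aa ->]]]].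
- by rewrite (F _ _ (Cl_h k l)); exact: Pspan_cC.
- by rewrite (F _ _ (lowv_h a)); apply: Pspan_cT; right.
Qed.
Lemma Pspan_d lo up u : Pspan lo up u -> Pspan lo up (d u).
Proof.
have F := iter_comm (o_de lie (@rho2_scale C)).
apply: (lspan_lin (PspanS lo up) (op_d_lin lie)) => {}u [[k [l [i ->]]]|[a [i [aa ->]]]].
- by rewrite F d_Cl iter_eZ; exact: Pspan_cC.
- by rewrite F lowv_d iter_eZ; apply: Pspan_cT; right.
Qed.

Lemma int_neq0 (m : int) : m != 0 -> (m%:~R : C) != 0.
Proof. by rewrite intr_eq0. Qed.

Lemma l_pos (l n : nat) : (0 < n)%N -> (l%:Z%:~R + n%:R : C) != 0.
Proof. by move=> n0; rewrite natz -natrD pnatr_eq0 -lt0n addn_gt0 n0 orbT. Qed.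
Lemma l2_pos (l n : nat) : (0 < n)%N -> (2 * l%:Z%:~R + n%:R : C) != 0.
Proof. by move=> n0; rewrite natz -natrM -natrD pnatr_eq0 -lt0n addn_gt0 n0 orbT. Qed.
(** This is where the half-integrality of the exponents enters: such factors vanish for no integer
    k. *)
Lemma k_odd (k : int) (n : nat) : odd n -> (2 * k%:~R + n%:R : C) != 0.
Proof.
move=> on; have -> : (2 * k%:~R + n%:R : C) = (2 * k + n%:Z)%:~R.
  by rewrite intrD intrM natz.
apply: int_neq0.
by apply/eqP => E; have := odd_double_half n; rewrite on; lia.
Qed.

Lemma nz_l1 (l : nat) : (l%:Z%:~R + 1 : C) != 0. Proof. exact (l_pos l (ltn0Sn 0)). Qed.
Lemma nz_l2 (l : nat) : (l%:Z%:~R + 2 : C) != 0. Proof. exact (l_pos l (ltn0Sn 1)). Qed.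
Lemma nz_2l1 (l : nat) : (2 * l%:Z%:~R + 1 : C) != 0. Proof. exact (l2_pos l (ltn0Sn 0)). Qed.
Lemma nz_2l3 (l : nat) : (2 * l%:Z%:~R + 3 : C) != 0. Proof. exact (l2_pos l (ltn0Sn 2)). Qed.
Lemma nz_2k3 (k : int) : (2 * k%:~R + 3 : C) != 0. Proof. exact: (k_odd k (n := 3)). Qed.
Lemma nz_4 : (4 : C) != 0. Proof. by rewrite pnatr_eq0. Qed.
Lemma nz_m4 : (- 4 : C) != 0. Proof. by rewrite oppr_eq0 pnatr_eq0. Qed.
Lemma nz_lS (l : nat) : (l.+1%:Z%:~R : C) != 0. Proof. by rewrite natz pnatr_eq0. Qed.
Definition nz := (nz_l1, nz_l2, nz_2l1, nz_2l3, nz_2k3, nz_4, nz_m4, nz_lS).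

(** No term raises k, so [up] is preserved. [lo] can fail only in the terms that keep k and lower l,
    or pass from M_l to T_(l-1); their factor k + l + 1, with l the actual index of T or M, vanishes
    exactly where the bound would be crossed. *)
Lemma Pspan_b lo up u : Pspan lo up u -> Pspan lo up (b u).
Proof.
have F := iter_comm (o_be lie (@rho2_scale C)).
have PD v w := @lsubD _ _ _ v w (PspanS lo up).
apply: (lspan_lin (PspanS lo up) (op_b_lin lie)) => {}u [[k [l [i ->]]]|[[[[] k] l] [i [aa ->]]]].
- rewrite F; apply: Pspan_iter; have E := @b_Cl C k l; apply: (Pspan_cancel E); clear E; first by rewrite !mulf_neq0 ?nz.
  apply: (PD).
    have -> : l%:Z + 1 = l.+1; [lia | exact: (@Pspan_cC lo up (- (2 * k%:~R + 1)) (k - 1) l.+1 2)].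
  case: l => [|l]; first by rewrite mulr0z mulr0 !mul0r scale0r; exact: lsub0 (PspanS _ _).
  have -> : l.+1%:Z - 1 = l; [lia | exact: (@Pspan_cC lo up _ _ _ 0)].
- rewrite F; apply: Pspan_iter; have E := @b_Tl C k l; apply: (Pspan_cancel E); clear E; first by rewrite !mulf_neq0 ?nz.
  have -> : l%:Z + 1 = l.+1 by lia.
  apply: (PD).
    apply: (@Pspan_cT lo up _ (true, k - 1, l.+1) 2 _); right.
    by move: aa; rewrite /allowed; destruct lo, up; lia.
  apply: (PD).
    apply: (@Pspan_cT lo up _ (false, k - 1, l) 1 _); right.
    by move: aa; rewrite /allowed; destruct lo, up; lia.
  apply: (PD); last exact: (@Pspan_cC lo up _ _ _ 0).
  case: l aa => [|l] aa; first by rewrite mulr0z mulr0 !mul0r scale0r; exact: lsub0 (PspanS _ _).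
  have -> : l.+1%:Z - 1 = l by lia.
  apply: (@Pspan_cT lo up _ (true, k, l) 0 _).
  have [->|kl] := eqVneq k (- l.+1%:Z - 1).
    by left; rewrite -intrD (_ : - l.+1%:Z - 1 + l.+1%:Z = -1) ?addNr ?mulr0 //; lia.
  by right; move: aa kl; rewrite /allowed; destruct lo, up; lia.
- rewrite F; apply: Pspan_iter; have E := @b_Ml C k l.+1; apply: (Pspan_cancel E); clear E; first by rewrite !mulf_neq0 ?nz.
  have -> : l.+1%:Z + 1 = l.+2 by lia.
  have -> : l.+1%:Z - 1 = l by lia.
  apply: (PD).
    apply: (@Pspan_cT lo up _ (false, k - 1, l.+1) 2 _); right.
    by move: aa; rewrite /allowed; destruct lo, up; lia.
  have K (r : C) : r * (k%:~R + l.+1%:Z%:~R + 1) = 0 \/ allowed lo up (true, k, l).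
    have [->|kl] := eqVneq k (- l%:Z - 1 - 1).
      by left; rewrite -intrD (_ : - l%:Z - 1 - 1 + l.+1%:Z = -1) ?addNr ?mulr0 //; lia.
    by right; move: aa kl; rewrite /allowed; destruct lo, up; lia.
  apply: (PD).
    exact: (@Pspan_cT lo up _ (true, k, l) 1 (K _)).
  apply: (PD); first exact: (@Pspan_cC lo up _ _ _ 1).
  (* For M_1 the last term would be a multiple of M_0; the factor l'^2 - 1 is then zero. *)
  case: l aa K => [|l] aa K.
    by rewrite mulr1z mulr1 subrr mulr0 !mul0r scale0r; exact: lsub0 (PspanS _ _).
  apply: (@Pspan_cT lo up _ (false, k, l) 0 _).
  have [H|H] := K (8 * (l.+2%:~R + 1) * (l.+2%:~R * l.+2%:~R - 1)); [by left | right].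
  by move: H; rewrite /allowed; destruct lo, up; lia.
Qed.

(** The quantity bounded by [lo] does not decrease. [up] can fail only in the terms with k + 1 in
    place of k, and their factor k + 1 vanishes at k = -1. *)
Lemma Pspan_c lo up u : Pspan lo up u -> Pspan lo up (c u).
Proof.
have F := iter_comm (o_ce lie (@rho2_scale C)).
have PD v w := @lsubD _ _ _ v w (PspanS lo up).
apply: (lspan_lin (PspanS lo up) (op_c_lin lie)) => {}u [[k [l [i ->]]]|[[[[] k] l] [i [aa ->]]]].
- rewrite F; apply: Pspan_iter; have E := @c_Cl C k l; apply: (Pspan_cancel E); clear E; first by rewrite !mulf_neq0 ?nz.
  apply: (PD).
    have -> : l%:Z + 1 = l.+1; [lia | exact: (@Pspan_cC lo up (- (2 * k%:~R + 2 * l%:Z%:~R + 1)) k l.+1 2)].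
  case: l => [|l]; first by rewrite mulr0z mulr0 !mul0r scale0r; exact: lsub0 (PspanS _ _).
  have -> : l.+1%:Z - 1 = l; [lia | exact: (@Pspan_cC lo up _ _ _ 0)].
- rewrite F; apply: Pspan_iter; have E := @c_Tl C k l; apply: (Pspan_cancel E); clear E; first by rewrite !mulf_neq0 ?nz.
  have -> : l%:Z + 1 = l.+1 by lia.
  apply: (PD).
    apply: (@Pspan_cT lo up _ (true, k, l.+1) 2 _); right.
    by move: aa; rewrite /allowed; destruct lo, up; lia.
  apply: (PD).
    apply: (@Pspan_cT lo up _ (false, k, l) 1 _); right.
    by move: aa; rewrite /allowed; destruct lo, up; lia.
  apply: (PD); last exact: (@Pspan_cC lo up _ _ _ 0).
  case: l aa => [|l] aa; first by rewrite mulr0z mulr0 !mul0r scale0r; exact: lsub0 (PspanS _ _).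
  have -> : l.+1%:Z - 1 = l by lia.
  apply: (@Pspan_cT lo up _ (true, k + 1, l) 0 _).
  have [->|kl] := eqVneq k (-1); first by left; rewrite addNr mulr0 mul0r.
  by right; move: aa kl; rewrite /allowed; destruct lo, up; lia.
- rewrite F; apply: Pspan_iter; have E := @c_Ml C k l.+1; apply: (Pspan_cancel E); clear E; first by rewrite !mulf_neq0 ?nz.
  have -> : l.+1%:Z + 1 = l.+2 by lia.
  have -> : l.+1%:Z - 1 = l by lia.
  apply: (PD).
    apply: (@Pspan_cT lo up _ (false, k, l.+1) 2 _); right.
    by move: aa; rewrite /allowed; destruct lo, up; lia.
  apply: (PD).
    apply: (@Pspan_cT lo up _ (true, k + 1, l) 1 _).
    have [->|kl] := eqVneq k (-1); first by left; rewrite addNr mulr0 mul0r.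
    by right; move: aa kl; rewrite /allowed; destruct lo, up; lia.
  apply: (PD); first exact: (@Pspan_cC lo up _ _ _ 1).
  case: l aa => [|l] aa.
    by rewrite mulr1z mulr1 subrr mulr0 !mul0r scale0r; exact: lsub0 (PspanS _ _).
  apply: (@Pspan_cT lo up _ (false, k + 1, l) 0 _).
  have [->|kl] := eqVneq k (-1); first by left; rewrite addNr mulr0.
  by right; move: aa kl; rewrite /allowed; destruct lo, up; lia.
Qed.

Lemma Pspan_submodule lo up : submodule (@sp4 C) rho2 (Pspan lo up).
Proof.
split=> [|X u sX]; first exact: PspanS.
apply: (sp4_closed lie (@rho2_scale C) (PspanS lo up)) => // {}u.
- exact: Pspan_e.
- exact: Pspan_f.
- exact: Pspan_h.
- exact: Pspan_d.
- exact: Pspan_b.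
- exact: Pspan_c.
Qed.
End StringSpans.

Section PolyInv.
Variable K : fieldType.
Lemma div_sum (N p q : K) (a b : nat) : N != 0 ->
  p / N ^+ a + q / N ^+ b = (p * N ^+ b + q * N ^+ a) / N ^+ (a + b).
Proof.
move=> N0; rewrite exprD; have := expf_neq0 a N0; have := expf_neq0 b N0.
move: (N ^+ a) (N ^+ b) => u v v0 u0.
by field; rewrite u0 v0.
Qed.
Lemma div_common (N p : K) (a n : nat) : N != 0 ->
  p / N ^+ a = N ^ (- (a + n)%:Z) * (p * N ^+ n).
Proof.
move=> N0; rewrite -invr_expz -exprnP exprD; have := expf_neq0 a N0; have := expf_neq0 n N0.
move: (N ^+ a) (N ^+ n) => u v v0 u0.
by field; rewrite u0 v0.
Qed.
Lemma symK_lin (I c N p q s p' q' s' : K) :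
  tadd (tsc c (N * p, N * q, N * s)) (N * p', N * q', N * s') =
  (N * (c * p + p'), N * (c * q + q'), N * (c * s + s')).
Proof. by rewrite /tadd /tsc /=; congr (_, _, _); ring. Qed.
Lemma symK_TM (N X Y Z l : K) :
  tadd (tsc (-1) (N * X, N * (- l * Y), N * (0 * Z))) (N * X, N * (1 * Y), N * (0 * Z)) =
  (N * 0, N * ((l + 1) * Y), N * 0).
Proof. by rewrite /tadd /tsc /=; congr (_, _, _); ring. Qed.
Lemma symK_TMB (N X Y Z l : K) :
  tadd (tadd (tsc l (N * X, N * (2 * Y), N * (- 2 * Z)))
    (tsc (- (2 * l + 1)) (N * X, N * ((1 - l) * Y), N * ((2 * l) * Z))))
    (tsc (l + 1) (N * X, N * (- (2 * l - 1) * Y), N * (- ((2 * l - 1) * (2 * l)) * Z))) =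
  (N * 0, N * 0, N * (- (2 * l * (2 * l + 1) * (l + 1)) * Z)).
Proof. by rewrite /tadd /tsc /=; congr (_, _, _); ring. Qed.
End PolyInv.

(** * The strings of T, M and C span the whole module *)

Section SolidSpan.
Variable C : numClosedFieldType.
Local Notation P3 := {mpoly C[3]}.
Local Notation Nm := (Nm C).
Local Notation ep := (@ep C).
Local Notation Rp n l := (Rpoly C n l).

(** Products of powers of N and solid harmonics: by the classical decomposition into harmonics they
    span all polynomials. *)
Definition Sset : set P3 := [set p | exists j n l : nat, p = Nm ^+ j * Rp n l].
Local Notation S := (lspan Sset).
Let sS : lsubspace S. Proof. exact: lspan_lsubspace. Qed.

Lemma ep_lin (c : C) (u v : P3) : ep (c *: u + v) = c *: ep u + ep v.
Proof.
rewrite !epE !mderivD !mderivZ -!mul_mpolyC; ring.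
Qed.
Lemma ep_Nm : ep Nm = 0.
Proof.
have [eD eM] := @ep_der C.
rewrite NmE eD !eM ep0 ep1 ep2; ring.
Qed.
Lemma ep_NmX j u : ep (Nm ^+ j * u) = Nm ^+ j * ep u.
Proof.
have [eD eM] := @ep_der C.
elim: j u => [|j IH] u; first by rewrite !expr0 !mul1r.
by rewrite exprS -mulrA eM ep_Nm mul0r add0r IH mulrA.
Qed.
Lemma S_Rp n l : S (Rp n l).
Proof. by apply: lspan_gen; exists 0, n, l; rewrite expr0 mul1r. Qed.
Lemma S_ep p : S p -> S (ep p).
Proof.
apply: (lspan_lin sS ep_lin) => {}p [j [n [l ->]]].
by rewrite ep_NmX; apply: lspan_gen; exists j, n.+1, l.
Qed.
Lemma mul_lin (r : P3) (c : C) (u v : P3) : r * (c *: u + v) = c *: (r * u) + r * v.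
Proof. by rewrite -!mul_mpolyC; ring. Qed.
Lemma S_Nm p j : S p -> S (Nm ^+ j * p).
Proof.
apply: (lspan_lin sS (@mul_lin (Nm ^+ j))) => {}p [i [n [l ->]]].
by rewrite mulrA -exprD; apply: lspan_gen; exists (j + i)%N, n, l.
Qed.

(** Stability under multiplication by a variable is checked on the powers of y = z22 and carried
    along the string by the derivation [ep], with ep x = 0, ep t = -x, ep y = 2t. *)
Lemma S_mul_Rp n l : [/\ S ('X_0 * Rp n l), S ('X_2%:R * Rp n l) & S ('X_1 * Rp n l)].
Proof.
have [eD eM] := @ep_der C.
have St (m : nat) : S ('X_2%:R * 'X_1 ^+ m).
  have : S (ep ('X_1 ^+ m.+1)) by exact: (S_Rp 1).
  have -> : ep ('X_1 ^+ m.+1) = (2 * m.+1%:R : C) *: ('X_2%:R * 'X_1 ^+ m).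
    rewrite -mul_mpolyC mpolyCM !mpolyC_nat.
    elim: m => [|m IH]; first by rewrite expr1 ep1 expr0; ring.
    by rewrite exprS eM IH ep1 -[m.+2%:R]natr1 exprS; ring.
  by apply: lsubZr => //; rewrite mulf_neq0 ?pnatr_eq0.
(* In ep (t y^(m+1)) = -x y^(m+1) + 2 (m + 1) t^2 y^m one substitutes t^2 = N - x y; what remains is
   a nonzero multiple of x y^(m+1). *)
have Sx (m : nat) : S ('X_0 * 'X_1 ^+ m).
  case: m => [|m].
    have := S_ep (St 0%N); rewrite !expr0 !mulr1 ep2 => /(lsubN sS).
    by rewrite opprK.
  have := S_ep (St m.+1).
  have -> : ep ('X_2%:R * 'X_1 ^+ m.+1) = - 'X_0 * 'X_1 ^+ m.+1 + 2 * m.+1%:R * ('X_2%:R * ('X_2%:R * 'X_1 ^+ m)).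
    rewrite eM ep2; congr (_ + _); elim: m => [|m IH]; first by rewrite expr1 ep1 expr0; ring.
    rewrite exprS eM ep1 mulrDr (_ : 'X_2%:R * ('X_1 * ep ('X_1 ^+ m.+1)) = 'X_1 * ('X_2%:R * ep ('X_1 ^+ m.+1))); last by ring.
    by rewrite IH -[m.+2%:R]natr1 exprS; ring.
  have -> : - 'X_0 * 'X_1 ^+ m.+1 + 2 * m.+1%:R * ('X_2%:R * ('X_2%:R * 'X_1 ^+ m)) =
     (- (2 * m.+1%:R + 1) : C) *: ('X_0 * 'X_1 ^+ m.+1) + (2 * m.+1%:R : C) *: (Nm ^+ 1 * Rp 0 m).
    rewrite -!mul_mpolyC mpolyCN mpolyCD mpolyCM !mpolyC_nat expr1 NmE /Rpoly /= exprS; ring.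
  move=> H; have H1 : S ((2 * m.+1%:R : C) *: (Nm ^+ 1 * Rp 0 m)).
    by apply: (lsubZ _ sS); apply: S_Nm; exact: S_Rp.
  have := lsubB sS H H1; rewrite addrK; apply: (lsubZr sS).
  by rewrite oppr_eq0 -natrM natr1 pnatr_eq0.
have SE : forall u, S u -> S (- u) by move=> u; exact: (lsubN sS).
elim: n => [|n [IHx IHt IHy]].
  split; [exact: Sx | exact: St | rewrite /Rpoly /= -exprS; exact: (S_Rp 0)].
rewrite [Rp n.+1 l]/(ep (Rp n l)).
have Hx : S ('X_0 * ep (Rp n l)).
  by have := S_ep IHx; rewrite eM ep0 mul0r add0r.
have Ht : S ('X_2%:R * ep (Rp n l)).
  have := lsubD sS (S_ep IHt) IHx; rewrite eM ep2.
  by have -> : - 'X_0 * Rp n l + 'X_2%:R * ep (Rp n l) + 'X_0 * Rp n l = 'X_2%:R * ep (Rp n l) by ring.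
split=> //.
have := lsubB sS (S_ep IHy) (lsubZ 2 sS IHt); rewrite eM ep1 -mul_mpolyC mpolyC_nat.
by have -> : 2 * 'X_2%:R * Rp n l + 'X_1 * ep (Rp n l) - 2 * ('X_2%:R * Rp n l) = 'X_1 * ep (Rp n l) by ring.
Qed.

Lemma S_mulX (i : 'I_3) p : S p -> S ('X_i * p).
Proof.
apply: (lspan_lin sS (@mul_lin 'X_i)) => {}p [j [n [l ->]]].
rewrite mulrCA; apply: S_Nm; have [Sx St Sy] := S_mul_Rp n l.
have [->|[->|->]] : i = 0 \/ i = 1 \/ i = 2%:R.
- by case: i => -[|[|[|//]]] ?; [left | right; left | right; right]; apply: val_inj.
- exact: Sx.
- exact: Sy.
- exact: St.
Qed.

Lemma solid_span (p : P3) : S p.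
Proof.
rewrite [p]mpolyE; apply: (lsub_sum sS) => m _; apply: (lsubZ _ sS).
elim/mnm_ind: m => [|i m IH]; last by rewrite mpolyXD; exact: S_mulX.
by rewrite mpolyX0; exact: (S_Rp 0 0).
Qed.
End SolidSpan.

Section WHalf.
Variable C : numClosedFieldType.
Local Notation K := (ratfun C 3).
Local Notation V := (tens C 3).
Local Notation rho2 := (@rho2 C).
Local Notation rcst := (@rcst C 3).
Local Notation ofp := (@ofpoly C 3).
Local Notation Ns := (@Ns C).
Local Notation x := (var C (0 : 'I_3)).
Local Notation y := (var C (1 : 'I_3)).
Local Notation t := (var C (2%:R : 'I_3)).
Local Notation N := (x * y + t * t).
Local Notation e := (op_e rho2).
Local Notation PI := (is_poly_inv Ns).
Local Notation symR := (@symR C).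
Local Notation P := (@Pspan C false false).
Local Notation W := (@W_half C).
Local Notation R l m := (@ofpoly C 3 (solid_harmonic C l m)).
Local Notation cl := (cl C).
Let sP : lsubspace P. Proof. exact: PspanS. Qed.

Lemma ofp_Nm : ofp (Nm C) = Ns.
Proof. by rewrite NsE /Nm ofpD !ofpM. Qed.
Lemma PI_ofp p : PI (ofp p).
Proof. by exists p, 0%N; rewrite expr0 divr1. Qed.
Lemma PI_mul u v : PI u -> PI v -> PI (u * v).
Proof.
move=> [p [a ->]] [q [b ->]]; exists (p * q), (a + b)%N.
by rewrite ofpM exprD invfM mulrACA.
Qed.
Lemma PI_add u v : PI u -> PI v -> PI (u + v).
Proof.
move=> [p [a ->]] [q [b ->]]; exists (p * Nm C ^+ b + q * Nm C ^+ a), (a + b)%N.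
rewrite ofpD !ofpM !ofpX ofp_Nm.
exact (div_sum (ofp p) (ofp q) a b (Ns_neq0 C)).
Qed.
Lemma PI_rcst c : PI (rcst c). Proof. exact: PI_ofp. Qed.
Lemma PI_int (a : int) : PI (a%:~R). Proof. by rewrite -(rcst_int C 3); exact: PI_rcst. Qed.
Lemma PI_Nz (k : int) : PI (N ^ k).
Proof.
rewrite -NsE; case: k => k.
  by rewrite -exprnP; have -> : Ns ^+ k = ofp (Nm C ^+ k); [rewrite ofpX ofp_Nm | exact: PI_ofp].
by rewrite NegzE -invr_expz -exprnP; exists 1, k.+1; rewrite ofp1 mul1r.
Qed.
Lemma W_symR k p q s : PI p -> PI q -> PI s -> W (symR k p q s).
Proof.
move=> Hp Hq Hs; split; first by apply: matrix2P; rewrite !mxE ?ent2E.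
have Hk u : PI u -> PI (N ^ k * u) by move=> Hu; apply: PI_mul => //; exact: PI_Nz.
have Hi u : PI u -> PI (rcst 'i * u) by move=> Hu; apply: PI_mul => //; exact: PI_rcst.
apply: ord2P; apply: ord2P; rewrite mxE ?ent2E /=.
- exact: Hk.
- by apply: Hi; exact: Hk.
- by apply: Hi; exact: Hk.
- exact: Hk.
Qed.
Lemma W_lsub : lsubspace W.
Proof.
split=> [|a F G [FT FP] [GT GP]].
  split=> [|i j]; first by rewrite trmx0.
  by rewrite mxE; exact: (PI_int 0).
rewrite tens_addE tens_scaleE; split=> [|i j]; last first.
  rewrite !mxE; apply: PI_add => //; apply: PI_mul => //; exact: PI_rcst.
by apply/matrixP => i j; rewrite !mxE -{1}FT -{1}GT !mxE.
Qed.
Lemma W_Gmx k l m a b : W (Gmx C k l m a b).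
Proof.
apply: W_symR; [exact: PI_ofp | |];
  by apply: PI_mul; [exact: PI_int | exact: PI_ofp].
Qed.

Lemma T_nz (l : nat) : cl l != 0. Proof. exact: cl_neq0. Qed.
Lemma M_nz (l : nat) : cl l.+1 * l.+1%:R != 0.
Proof. by rewrite mulf_neq0 ?cl_neq0 ?pnatr_eq0. Qed.
Lemma C_nz (l : nat) : - (2 * l%:R + 1) * cl l != 0.
Proof. by rewrite mulf_neq0 ?cl_neq0 // oppr_eq0 -natrM natr1 pnatr_eq0. Qed.

Lemma M_nz' (l : nat) : (l%:R + 1 : C) * cl l != 0.
Proof. by rewrite mulf_neq0 ?cl_neq0 // natr1 pnatr_eq0. Qed.

Lemma rscale (c : C) (u v : V) : u = c *: v -> c != 0 -> v = c^-1 *: u.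
Proof. by move=> -> c0; rewrite scalerA mulVf // scale1r. Qed.

Lemma W_Tl k l i : W (iter i e (Tl C k l%:Z)).
Proof.
rewrite (rscale (Tmx_str C k l i) (T_nz l)); apply: (lsubZ _ W_lsub).
by rewrite TmxE; exact: W_Gmx.
Qed.
Lemma W_Ml k l i : W (iter i e (Ml C k l.+1%:Z)).
Proof.
rewrite (rscale (Mmx_str C k l.+1 i) (M_nz l)); apply: (lsubZ _ W_lsub).
by rewrite MmxE; exact: W_Gmx.
Qed.
Lemma W_Cl k l i : W (iter i e (Cl C k l%:Z)).
Proof.
rewrite (rscale (Cmx_str C k l i) (C_nz l)); apply: (lsubZ _ W_lsub).
rewrite /Cmx -scaleNr; apply: (lsubD W_lsub); apply: (lsubZ _ W_lsub).
  have -> : l%:Z + 1 = l.+1 by lia.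
  by rewrite BmxE; exact: W_Gmx.
case: l => [|l]; first by rewrite Tmx_neg; exact: lsub0 W_lsub.
have -> : l.+1%:Z - 1 = l by lia.
by rewrite TmxE; exact: W_Gmx.
Qed.
Lemma Pspan_W lo up : Pspan lo up `<=` W.
Proof.
apply: lspan_min; first exact: W_lsub.
move=> _ [[k [l [i ->]]]|[[[[] k] l] [i [_ ->]]]].
- exact: W_Cl.
- exact: W_Tl.
- exact: W_Ml.
Qed.

Lemma P_T k (l : nat) m : - l%:Z - 1 <= m -> P (Nhalf k (Tmx C l m)).
Proof.
move=> lm; have -> : m = - l%:Z - 1 + (absz (m + l%:Z + 1))%:Z by lia.
rewrite Tmx_str; apply: (lsubZ _ sP).
by apply: (@PspanT C false false (true, k, l)).
Qed.
Lemma P_M k (l : nat) m : - l%:Z <= m -> P (Nhalf k (Mmx C l m)).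
Proof.
move=> lm; have -> : m = - l%:Z + (absz (m + l%:Z))%:Z by lia.
rewrite Mmx_str; case: l lm => [|l] lm.
  by rewrite mulr0 scale0r; exact: lsub0 sP.
apply: (lsubZ _ sP).
by apply: (@PspanT C false false (false, k, l)).
Qed.
Lemma P_C k (l : nat) m : - l%:Z <= m -> P (Cmx C k l m).
Proof.
move=> lm; have -> : m = - l%:Z + (absz (m + l%:Z))%:Z by lia.
by rewrite Cmx_str; apply: (lsubZ _ sP); exact: PspanC.
Qed.
(** B is recovered from C and T, since its coefficient 2 (k + 1) + 1 in C is odd, hence nonzero. *)
Lemma P_B k (l : nat) m : - l%:Z <= m -> P (Nhalf k (Bmx C l.+1 m)).
Proof.
move=> lm; apply: (lsubZr sP (a := (2 * (k + 1) + 1)%:~R)).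
  by rewrite intr_eq0; lia.
have := P_C (k + 1) lm; rewrite /Cmx addrK.
have -> : l%:Z + 1 = l.+1 by lia.
move=> H; rewrite -[X in P X](subrK ((2 * (k + 1 + l%:Z + 1))%:~R *: Nhalf (k + 1) (Tmx C (l%:Z - 1) m))).
apply: (lsubD sP H); apply: (lsubZ _ sP).
case: l lm {H} => [|l] lm; first by rewrite Tmx_neg; exact: lsub0 sP.
have -> : l.+1%:Z - 1 = l by lia.
by apply: P_T; lia.
Qed.

Lemma symR_lin k (c : C) p q s p' q' s' :
  c *: symR k p q s + symR k p' q' s' =
  symR k (rcst c * p + p') (rcst c * q + q') (rcst c * s + s').
Proof.
rewrite symSZ symSD; congr symS.
exact (symK_lin 0 (rcst c) (N ^ k) p q s p' q' s').
Qed.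
Lemma symRZ k (c : C) p q s :
  c *: symR k p q s = symR k (rcst c * p) (rcst c * q) (rcst c * s).
Proof. by rewrite -[LHS]addr0 -(symR0 C k) symR_lin !addr0. Qed.

Lemma P_low1 k (l : nat) : P (symR k (y ^+ l) 0 0).
Proof.
have := P_T k (l := l) (lexx (- l%:Z - 1)).
rewrite TmxE /Gmx subrK R_bot.
have -> : l%:Z + (- l%:Z - 1) + 1 = 0 by ring.
rewrite mulr0 oppr0 mulr0z !mul0r => H.
apply: (lsubZr sP (cl_neq0 C l)); rewrite symRZ.
by rewrite mulr0.
Qed.
(** At m = -l the difference T - M has only off-diagonal entries, multiples of (l + 1) R^(-l)_l. *)
Lemma P_low2 k (l : nat) : P (symR k 0 (y ^+ l) 0).
Proof.
have HT : P (Nhalf k (Tmx C l (- l%:Z))) by apply: P_T; lia.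
have HM : P (Nhalf k (Mmx C l (- l%:Z))) by apply: P_M.
have := lsubD sP (lsubZ (-1) sP HM) HT; rewrite TmxE MmxE /Gmx.
have -> : (l%:Z + - l%:Z + 1)%:~R = 1 :> K by rewrite subrr add0r.
have -> : (- ((l%:Z + - l%:Z) * (l%:Z + - l%:Z + 1)))%:~R = 0 :> K by rewrite subrr mul0r oppr0.
have -> : ((l%:Z + - l%:Z) * (l%:Z - - l%:Z + 1))%:~R = 0 :> K by rewrite subrr mul0r.
rewrite symSZ symSD rcstN rcst1.
have -> : (- l%:Z)%:~R = - l%:R :> K by rewrite intrN -pmulrn.
rewrite (symK_TM (N ^ k) (R l (- l%:Z + 1)) (R l (- l%:Z)) (R l (- l%:Z - 1)) l%:R) R_bot.
move=> H; apply: (lsubZr sP (M_nz' l)).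
rewrite symRZ !mulr0 rcstM -(mulrA _ (rcst (cl l))) rcstD rcst_nat rcst1.
exact: H.
Qed.
Let Pe k p q s : P (symR k p q s) ->
  P (symR k (e0 x t (pd 1) (pd 2%:R) p) (e0 x t (pd 1) (pd 2%:R) q + p) (e0 x t (pd 1) (pd 2%:R) s - 2 * q)).
Proof. by rewrite -e_symR; exact: Pspan_e. Qed.

Let d00 : e0 x t (pd 1) (pd 2%:R) 0 = 0.
Proof. by rewrite -(ofp0 C 3) -ofp_ep /ep !mderiv0 !mulr0 subrr. Qed.

Let d01 : e0 x t (pd 1) (pd 2%:R) 1 = 0.
Proof. by rewrite -(ofp1 C 3) -ofp_ep /ep -mpolyC1 !mderivC !mulr0 subrr ofp0. Qed.

(** For a positive degree L, the combination L T - (2L + 1) M + (L + 1) B at m = 1 - L cancels the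
    first two entries and leaves a multiple of R^(-L)_L. In degree 0 the entry comes from applying e
    to the second slot. *)
Lemma P_low3 k (l : nat) : P (symR k 0 0 (y ^+ l)).
Proof.
case: l => [|l].
  have := Pe (P_low2 k 0); rewrite expr0 d00 d01 addr0 sub0r mulr1 => H.
  apply: (lsubZr sP (a := - 2)); first by rewrite oppr_eq0 pnatr_eq0.
  by rewrite symRZ !mulr0 mulr1 rcstN rcst_nat.
have HT : P (Nhalf k (Tmx C l.+1 (- l%:Z))) by apply: P_T; lia.
have HM : P (Nhalf k (Mmx C l.+1 (- l%:Z))) by apply: P_M; lia.
have HB : P (Nhalf k (Bmx C l.+1 (- l%:Z))) by apply: P_B; lia.
set L : C := l.+1%:R.
have := lsubD sP (lsubD sP (lsubZ L sP HT) (lsubZ (- (2 * L + 1)) sP HM)) (lsubZ (L + 1) sP HB).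
rewrite TmxE MmxE BmxE /Gmx.
have -> : (l.+1%:Z + - l%:Z + 1)%:~R = 2 :> K by rewrite (_ : _ + 1 = 2) //; lia.
have -> : (- ((l.+1%:Z + - l%:Z) * (l.+1%:Z + - l%:Z + 1)))%:~R = - 2 :> K.
  by rewrite (_ : - _ = - 2) ?intrN //; lia.
have -> : (- l%:Z)%:~R = 1 - l.+1%:R :> K.
  by rewrite (_ : - l%:Z = 1 - l.+1%:Z) ?intrB -?pmulrn //; lia.
have -> : ((l.+1%:Z + - l%:Z) * (l.+1%:Z - - l%:Z + 1))%:~R = 2 * l.+1%:R :> K.
  by rewrite (_ : _ * _ = 2 * l.+1%:Z) ?intrM -?pmulrn //; lia.
have -> : (- (l.+1%:Z - - l%:Z))%:~R = - (2 * l.+1%:R - 1) :> K.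
  by rewrite (_ : - (_ - _) = - (2 * l.+1%:Z - 1)) ?intrN ?intrB ?intrM -?pmulrn //; lia.
have -> : (- ((l.+1%:Z - - l%:Z) * (l.+1%:Z - - l%:Z + 1)))%:~R = - ((2 * l.+1%:R - 1) * (2 * l.+1%:R)) :> K.
  by rewrite (_ : - (_ * _) = - ((2 * l.+1%:Z - 1) * (2 * l.+1%:Z))) ?intrN ?intrM ?intrB ?intrM -?pmulrn //; lia.
rewrite !symSZ !symSD.
have -> : rcst (- (2 * L + 1)) = - (2 * l.+1%:R + 1) by rewrite rcstN rcstD rcstM !rcst_nat rcst1.
have -> : rcst (L + 1) = l.+1%:R + 1 by rewrite rcstD rcst_nat rcst1.
have -> : rcst L = l.+1%:R by rewrite rcst_nat.
rewrite (symK_TMB (N ^ k) (R l.+1 (- l%:Z + 1)) (R l.+1 (- l%:Z)) (R l.+1 (- l%:Z - 1)) l.+1%:R).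
have -> : - l%:Z - 1 = - l.+1%:Z by lia.
rewrite R_bot => H.
apply: (lsubZr sP (a := - (2 * L * (2 * L + 1) * (L + 1)) * cl l.+1)).
  by rewrite mulf_neq0 ?cl_neq0 // oppr_eq0 /L -natrM !natr1 -!natrM pnatr_eq0.
rewrite symRZ !mulr0 rcstM -(mulrA _ (rcst (cl l.+1))).
have -> : rcst (- (2 * L * (2 * L + 1) * (L + 1))) = - (2 * l.+1%:R * (2 * l.+1%:R + 1) * (l.+1%:R + 1)).
  by rewrite rcstN !(rcstM, rcstD) rcst1 !rcst_nat.
exact: H.
Qed.
(** e sends (p, q, s) to (ep p, ep q + p, ep s - 2q): the third slot is stable by itself, and each
    of the other two is corrected by the next slot, already treated. *)
Lemma P_Rp k n l : [/\ P (symR k (ofp (Rpoly C n l)) 0 0),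
  P (symR k 0 (ofp (Rpoly C n l)) 0) & P (symR k 0 0 (ofp (Rpoly C n l)))].
Proof.
elim: n => [|n [IH1 IH2 IH3]].
  rewrite /Rpoly /= ofpX; split; [exact: P_low1 | exact: P_low2 | exact: P_low3].
rewrite [Rpoly C n.+1 l]/(ep (Rpoly C n l)) ofp_ep.
have := Pe IH3; rewrite d00 add0r mulr0 subr0 => H3.
have := Pe IH2; rewrite d00 addr0 sub0r => H2.
have := Pe IH1; rewrite d00 add0r mulr0 subr0 => H1.
split=> //.
- have := lsubD sP (lsubZ (-1) sP IH2) H1.
  by rewrite symR_lin rcstN rcst1 !mulN1r addNr oppr0 !add0r.
- have := lsubD sP (lsubZ 2 sP IH3) H2.
  by rewrite symR_lin rcst_nat subrr !mulr0 !add0r.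
Qed.

Lemma P_poly k p : [/\ P (symR k (ofp p) 0 0), P (symR k 0 (ofp p) 0) & P (symR k 0 0 (ofp p))].
Proof.
(* The claim is made for all k at once, so that a factor N^j is absorbed by passing from k to k +
   j. *)
pose U : set {mpoly C[3]} := [set p | forall k, [/\ P (symR k (ofp p) 0 0), P (symR k 0 (ofp p) 0) & P (symR k 0 0 (ofp p))]].
suff : lspan (@Sset C) `<=` U by move/(_ p (solid_span p)).
apply: lspan_min.
  split=> [k'|a u v Uu Uv k']; first by rewrite ofp0 symR0; split; exact: lsub0 sP.
  have [u1 u2 u3] := Uu k'; have [v1 v2 v3] := Uv k'.
  have E : ofp (a *: u + v) = rcst a * ofp u + ofp v by rewrite ofpD -mul_mpolyC ofpM.
  rewrite E; have L := symR_lin k' a.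
  by split; [have := sP.2 a _ _ u1 v1 | have := sP.2 a _ _ u2 v2 | have := sP.2 a _ _ u3 v3];
    rewrite L !mulr0 !addr0.
move=> _ [j [n [l ->]]] k'.
have [h1 h2 h3] := P_Rp (k' + j%:Z) n l.
have E : N ^ (k' + j%:Z) = N ^ k' * ofp (Nm C ^+ j).
  by rewrite expfzDr ?N_neq0 // ofpX ofp_Nm NsE.
move: h1 h2 h3; rewrite !symRE E !mulr0 -!mulrA ofpM.
by move=> h1 h2 h3; split.
Qed.

Lemma P_sum k u v w : P (symR k u 0 0) -> P (symR k 0 v 0) -> P (symR k 0 0 w) ->
  P (symR k u v w).
Proof.
move=> h1 h2 h3.
have -> : symR k u v w = 1 *: symR k u 0 0 + (1 *: symR k 0 v 0 + symR k 0 0 w).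
  by rewrite !symR_lin rcst1 !(mul1r, addr0, add0r).
by apply: (sP.2 1 _ _ h1); exact: (sP.2 1 _ _ h2 h3).
Qed.

Lemma W_sub : W `<=` P.
Proof.
move=> F [FT FP]; have [p [a pE]] := FP 0 0; have [q [b qE]] := FP 0 1; have [s [c sE]] := FP 1 1.
(* A common denominator of the three entries. *)
pose k := - (a + b + c)%N%:Z.
have HF : F = symR k (ofp (p * Nm C ^+ (b + c))) (ofp ((- 'i)%:MP * q * Nm C ^+ (a + c))) (ofp (s * Nm C ^+ (a + b))).
  have Eq : rcst 'i * (N ^ k * ofp ((- 'i)%:MP * q * Nm C ^+ (a + c))) = F 0 1.
    rewrite qE ofpM ofpM ofpC ofpX ofp_Nm.
    rewrite (div_common _ b (a + c) (Ns_neq0 C)) -NsE /k.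
    rewrite (_ : (b + (a + c) = a + b + c)%N); last by lia.
    by rewrite -mulrA mulrCA [rcst 'i * _]mulrA -rcstM mulrN -expr2 sqrCi opprK rcst1 mul1r.
  apply: matrix2P; rewrite mxE ?ent2E /=.
  - rewrite pE ofpM ofpX ofp_Nm (div_common _ a (b + c) (Ns_neq0 C)) -NsE /k.
    by rewrite addnA.
  - by rewrite Eq.
  - by rewrite Eq -[in LHS]FT mxE.
  - rewrite sE ofpM ofpX ofp_Nm (div_common _ c (a + b) (Ns_neq0 C)) -NsE /k.
    by rewrite (_ : (c + (a + b) = a + b + c)%N) //; lia.
have [h1 _ _] := P_poly k (p * Nm C ^+ (b + c)).
have [_ h2 _] := P_poly k ((- 'i)%:MP * q * Nm C ^+ (a + c)).
have [_ _ h3] := P_poly k (s * Nm C ^+ (a + b)).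
rewrite HF; exact: P_sum h1 h2 h3.
Qed.

Lemma W_Pspan : W = P.
Proof. by apply/seteqP; split; [exact: W_sub | exact: Pspan_W]. Qed.
End WHalf.

(** * The given families of functions as spans of strings *)

Section Links.
Variable C : numClosedFieldType.
Local Notation V := (tens C 3).
Local Notation rho2 := (@rho2 C).
Local Notation e := (op_e rho2).
Local Notation lie := (@rho2_lie C setT).
Local Notation lab := (bool * int * nat)%type.

Lemma Cl_top k (l : nat) : iter (2 * l).+1 e (Cl C k l) = 0.
Proof.
rewrite (rscale (Cmx_str C k l (2 * l).+1) (C_nz C l)).
have -> : - l%:Z + (2 * l).+1%:Z = l.+1 by lia.
rewrite /Cmx; have -> : l%:Z + 1 = l.+1 by lia.
rewrite Bmx_top scaler0 sub0r.
suff -> : Nhalf k (Tmx C (l%:Z - 1) l.+1) = 0 by rewrite scaler0 oppr0 scaler0.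
case: l => [|l]; first exact: Tmx_neg.
have -> : l.+1%:Z - 1 = l by lia.
have -> : l.+2%:Z = l%:Z + 2 by lia.
exact: Tmx_top.
Qed.

Lemma lspan_str (F : int -> V) (l : nat) v (r : C) : r != 0 ->
  (forall i : nat, F (- l%:Z - 1 + i%:Z) = r *: iter i e v) ->
  lspan [set u | exists m, - l%:Z - 1 <= m <= l%:Z + 1 /\ u = F m] =
  lspan (string e v (2 * l).+2).
Proof.
move=> r0 FE; apply/seteqP; split.
  apply: lspan_mono => _ [m [lm ->]].
  have -> : m = - l%:Z - 1 + (absz (m + l%:Z + 1))%:Z by lia.
  rewrite FE; apply: (lsubZ _ (lspan_lsubspace _)); apply: lspan_gen.
  by exists (absz (m + l%:Z + 1)); split=> //; lia.
apply: lspan_mono => _ [i [iN ->]].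
rewrite (rscale (FE i) r0); apply: (lsubZ _ (lspan_lsubspace _)); apply: lspan_gen.
by exists (- l%:Z - 1 + i%:Z); split=> //; lia.
Qed.

Local Notation str a := (string e (lowv C a) (2 * a.2).+2).

Lemma lspan_Tset k (l : nat) : lspan (@Tset C k l) = lspan (str (true, k, l)).
Proof.
apply: (lspan_str (F := fun m => Nhalf k (Tmx C l m)) (cl_neq0 C l)) => i.
exact: Tmx_str.
Qed.
Lemma lspan_Mset k (l : nat) : lspan (@Mset C k (l%:Z + 1)) = lspan (str (false, k, l)).
Proof.
rewrite /Mset (_ : - (l%:Z + 1) = - l%:Z - 1); last by lia.
apply: (lspan_str (F := fun m => Nhalf k (Mmx C (l%:Z + 1) m)) (M_nz C l)) => i.
have -> : - l%:Z - 1 = - l.+1%:Z by lia.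
have -> : l%:Z + 1 = l.+1 by lia.
exact: Mmx_str.
Qed.

Definition labp (j : Kindex) : lab := (j.1.1, j.1.2, absz j.2).
(** [Kminus] puts M_(l+1) with the exponent k - 1/2, whence the shift of k. *)
Definition labm (j : Kindex) : lab :=
  (j.1.1, if j.1.1 then j.1.2 else j.1.2 - 1, absz j.2).

Lemma lspan_Kplus j : Dplus j -> lspan (@Kplus C j) = lspan (str (labp j)).
Proof.
case: j => [[b k] l] [/= k0 l0]; have lE : l = (absz l)%:Z by lia.
by case: b; rewrite /= {1}lE; [exact: lspan_Tset | exact: lspan_Mset].
Qed.
Lemma lspan_Kminus j : Dminus j -> lspan (@Kminus C j) = lspan (str (labm j)).
Proof.
case: j => [[b k] l] [/= l0 k0]; have lE : l = (absz l)%:Z by lia.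
by case: b {k0}; rewrite /= {1}lE; [exact: lspan_Tset | exact: lspan_Mset].
Qed.

Definition Dp : set lab := [set a | 0 <= a.1.2].
(** The labels below the lower bound of [allowed], just as [Dp] consists of those above the upper
    one. *)
Definition Dm : set lab := [set a | a.1.2 + a.2%:Z + 1 + (~~ a.1.1)%:R < 0].

Lemma labp_Dp : labp @` Dplus = Dp.
Proof.
apply/seteqP; split=> [_ [[[b k] l] [/= k0 l0] <-] //|[[b k] l] k0].
by exists (b, k, l%:Z).
Qed.
Lemma labm_Dm : labm @` Dminus = Dm.
Proof.
apply/seteqP; split=> [_ [[[b k] l] [/= l0 k0] <-]|[[b k] l]]; rewrite /Dm /labm /=.
  by case: b => /=; lia.
move=> H; exists (b, if b then k else k + 1, l%:Z); last by case: b H => /= _; rewrite ?addrK.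
by split=> //=; case: b H => /=; lia.
Qed.
Lemma labp_inj i j : Dplus i -> Dplus j -> labp i = labp j -> i = j.
Proof.
case: i j => [[b k] l] [[b' k'] l'] [/= _ l0] [/= _ l0'] [-> -> E].
by congr (_, _); lia.
Qed.
Lemma labm_inj i j : Dminus i -> Dminus j -> labm i = labm j -> i = j.
Proof.
case: i j => [[b k] l] [[b' k'] l'] [/= l0 _] [/= l0' _] [bb' kE E]; rewrite -bb' in kE *.
by congr (_, _, _); [case: b kE {bb'} => //; lia | lia].
Qed.

Lemma lspan_E : lspan (@E_gen C) = Pspan (C := C) true true.
Proof.
have sE := lspan_lsubspace (@E_gen C).
have sP := @PspanS C true true.
apply/seteqP; split.
  apply: lspan_min => // F [[[k ->]|[k [l [l0 [m [lm ->]]]]]]|[k [l [l0 kl [|]]]]].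
  (* M^0_0 is the zero matrix. *)
  - have := Mmx_str C k 0 0; rewrite oppr0 addr0 => ->.
    by rewrite mulr0 scale0r; exact: lsub0 sP.
  - have lE : l = (absz l)%:Z by lia.
    rewrite lE in lm *; have -> : m = - (absz l)%:Z + (absz (m + (absz l)%:Z))%:Z by lia.
    by rewrite Cmx_str; apply: (lsubZ _ sP); exact: PspanC.
  - have lE : l = (absz l)%:Z by lia.
    rewrite lE in kl * => -[m [lm ->]].
    have -> : m = - (absz l)%:Z - 1 + (absz (m + (absz l)%:Z + 1))%:Z by lia.
    rewrite Tmx_str; apply: (lsubZ _ sP).
    by apply: (@PspanT C true true (true, k, absz l)); rewrite /allowed /=; lia.
  - have lE : l = (absz l)%:Z by lia.
    rewrite lE in kl * => -[m [lm ->]].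
    have -> : m = - (absz l)%:Z + (absz (m + (absz l)%:Z))%:Z by lia.
    rewrite Mmx_str; case: (absz l) kl {lm lE} => [|n] kl.
      by rewrite mulr0 scale0r; exact: lsub0 sP.
    apply: (lsubZ _ sP).
    by apply: (@PspanT C true true (false, k, n)); rewrite /allowed /=; lia.
have str_iter a i : lspan (str a) `<=` lspan (@E_gen C) -> lspan (@E_gen C) (iter i e (lowv C a)).
  by apply; apply: (string_iter (op_e_lin lie)); exact: lowv_top.
apply: lspan_min => // F [[k [l [i ->]]]|[[[[] k] l] [i [aa ->]]]].
- have [il|il] := leqP i (2 * l).
    rewrite (rscale (Cmx_str C k l i) (C_nz C l)); apply: (lsubZ _ sE); apply: lspan_gen.
    left; right; exists k, l%:Z; split=> //; exists (- l%:Z + i%:Z); split=> //; lia.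
  rewrite -(subnK il) iterD Cl_top.
  have e0 : e 0 = 0 by have := e_Z (0 : C) (0 : V); rewrite !scale0r.
  by rewrite (iter_fix _ e0); exact: lsub0 sE.
- apply: str_iter; rewrite -lspan_Tset; apply: lspan_mono => G TG; apply: lspan_gen.
  by right; exists k, l%:Z; split=> //; [move: aa; rewrite /allowed /=; lia | left].
- apply: str_iter; rewrite -lspan_Mset; apply: lspan_mono => G MG; apply: lspan_gen.
  by right; exists k, (l%:Z + 1); split; [lia | move: aa; rewrite /allowed /=; lia | right].
Qed.
End Links.

(** * The quotient module *)

Section QuotientAction.
Variables (C : fieldType) (V : lmodType C) (S : set V) (g : set 'M[C]_(2 + 2)).
Variable act : 'M[C]_(2 + 2) -> V -> V.
Hypothesis sE : submodule g act (lspan S).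
Hypothesis lieV : lie_module g act setT.
Hypothesis gaddr : forall X Y, g X -> g Y -> g (X + Y).
Hypothesis gbr : forall X Y, g X -> g Y -> g (X *m Y - Y *m X).
Hypothesis gZ : forall (c : C) X, g X -> g (c *: X).
Hypothesis actZ : forall (c : C) X u, g X -> act (c *: X) u = c *: act X u.
Local Notation q := (qpi S).
Local Notation actq := (qact (S := S) act).

Lemma qpi_lin (a : C) u v : q (a *: u + v) = a *: q u + q v.
Proof. by rewrite qpiD qpiZ. Qed.

Lemma qpiZE (a : C) u : q (a *: u) = a *: q u.
Proof. exact: qpiZ. Qed.

Lemma qpi0 : q 0 = 0.
Proof. by have := qpiZE 0 0; rewrite !scale0r. Qed.

Lemma qpi_eq0 u : q u = 0 <-> lspan S u.
Proof. by rewrite -qpi0 qpi_eq subr0. Qed.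

Lemma qact_pi X u : g X -> actq X (q u) = q (act X u).
Proof.
move=> gX; rewrite /qact; apply/qpi_eq.
have [L _ _] := lieV.
have -> : act X (qrepr (q u)) - act X u = act X (qrepr (q u) - u).
  by rewrite addrC -scaleN1r -L // scaleN1r addrC.
by apply: sE.2 => //; apply/qpi_eq; rewrite qreprK.
Qed.

Lemma qact_lie : lie_module g actq setT.
Proof.
have [L1 L2 L3] := lieV; split.
- move=> X a u v gX; rewrite -[u]qreprK -[v]qreprK -qpi_lin !qact_pi //.
  by rewrite L1 // qpi_lin.
- by move=> X Y u gX gY; rewrite -[u]qreprK !qact_pi ?L2 ?qpiD //; exact: gaddr.
- move=> X Y u gX gY _; rewrite -[u]qreprK; move: (qrepr u) => v.
  by rewrite (qact_pi _ gY) (qact_pi _ gX) (qact_pi _ gX) (qact_pi _ gY) (L3 X Y v gX gY I) qpiD (qact_pi _ (gbr gX gY)).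
Qed.
Lemma qact_Z (c : C) X u : g X -> actq (c *: X) u = c *: actq X u.
Proof.
by move=> gX; rewrite -[u]qreprK !qact_pi ?actZ ?qpiZE //; exact: gZ.
Qed.
Lemma image_lspan (T : set V) : q @` lspan T = lspan (q @` T).
Proof.
apply/seteqP; split.
  move=> _ [u Tu <-].
  suff : lspan T `<=` [set v | lspan (q @` T) (q v)] by move/(_ u Tu).
  apply: lspan_min => [|v Tv]; last by apply: lspan_gen; exists v.
  split=> [|a v w /= vT wT]; rewrite /= ?qpi0 ?qpi_lin.
    exact: lsub0 (lspan_lsubspace _).
  exact: (lspan_lsubspace _).2.
apply: lspan_min => [|_ [v Tv <-]]; last by exists v => //; exact: lspan_gen.
split=> [|a _ _ [v vT <-] [w wT <-]].
  by exists 0; [exact: lsub0 (lspan_lsubspace _) | exact: qpi0].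
by exists (a *: v + w); [exact: (lspan_lsubspace T).2 | exact: qpi_lin].
Qed.
End QuotientAction.

Section Weights.
Variables (C : numClosedFieldType) (V : lmodType C).
Variable act : 'M[C]_(2 + 2) -> V -> V.
Hypothesis lieV : lie_module (@sp4 C) act setT.
Hypothesis actZ : forall (c : C) X u, sp4 X -> act (c *: X) u = c *: act X u.
Local Notation e := (op_e act).
Local Notation f := (op_f act).
Local Notation h := (op_h act).
Local Notation d := (op_d act).

(** [None] is d, [Some true] is h, [Some false] is the Casimir operator. In [wval] below, [dg] is
    the degree, 2l the highest weight of the string and i the position in it. *)
Definition wop (x : option bool) : V -> V :=
  if x is Some x' then if x' then h else casimir e f h else d.

Definition wval (dg : int) (l i : nat) (x : option bool) : C :=
  if x is Some x' then if x' then (2 * l)%:R - 2 * i%:R else (l * l.+1)%:R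
  else - 2 * dg%:~R - 2.

Lemma wop_lin x c u v : wop x (c *: u + v) = c *: wop x u + wop x v.
Proof.
have he := op_e_lin lieV; have hf := op_f_lin lieV; have hh := op_h_lin lieV.
case: x => [[]|] /=; [exact: hh | | exact: op_d_lin].
rewrite /casimir !hh hf he !(scalerDr, opprD, scalerN) !scalerA !(mulrC c).
by rewrite [RHS]addrACA; congr (_ + _); exact: addrACA.
Qed.

Lemma wop_string dg (l i : nat) v x : f v = 0 -> h v = (2 * l)%:R *: v ->
  d v = (- 2 * dg%:~R - 2) *: v ->
  wop x (iter i e v) = wval dg l i x *: iter i e v.
Proof.
move=> fv hv dv.
have he := op_e_lin lieV; have hh := op_h_lin lieV.
case: x => [[]|] /=.
- exact: (h_string he (o_he lieV actZ) hv).
- rewrite (casimir_string he hh (o_ef lieV actZ) (o_he lieV actZ) fv hv).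
  by congr (_ *: _); rewrite !natrM -natr1; field.
have -> : d (iter i e v) = iter i e (d v).
  by apply: (iter_comm (o_de lieV actZ)).
rewrite dv; elim: i => //= i ->; have := he (- 2 * dg%:~R - 2) (iter i e v) 0.
have e0 : e 0 = 0 by have := he (-1) 0 0; rewrite scaler0 addr0 scaleN1r addNr.
by rewrite e0 !addr0.
Qed.

(** l is determined by l (l + 1), the degree by the eigenvalue of d, and then i by that of h. *)
Lemma wval_inj dg l i dg' l' i' :
  (forall x, wval dg l i x = wval dg' l' i' x) -> [/\ dg = dg', l = l' & i = i'].
Proof.
move=> H.
have ll : l = l'.
  have /eqP := H (Some false); rewrite /= eqr_nat => /eqP E.
  have [//|L|L] := ltngtP l l'; nia.
have dd : dg = dg'.
  have /= := H None => /addIr E; apply/eqP; rewrite -(eqr_int C).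
  by apply/eqP; apply: (mulfI _ E); rewrite oppr_eq0 pnatr_eq0.
have ii : i = i'.
  have /= := H (Some true); rewrite ll => /addrI/oppr_inj E; apply/eqP; rewrite -(eqr_nat C).
  by apply/eqP; apply: (mulfI _ E); rewrite pnatr_eq0.
by [].
Qed.
End Weights.

Section LowestVectors.
Variable C : numClosedFieldType.
Local Notation K := (ratfun C 3).
Local Notation V := (tens C 3).
Local Notation rho2 := (@rho2 C).
Local Notation rcst := (@rcst C 3).
Local Notation e := (op_e rho2).
Local Notation lie := (@rho2_lie C setT).
Local Notation lab := (bool * int * nat)%type.
Local Notation x := (var C (0 : 'I_3)).
Local Notation y := (var C (1 : 'I_3)).
Local Notation t := (var C (2%:R : 'I_3)).
Local Notation N := (x * y + t * t).

Lemma symS_eq0 F : symS F = 0 :> V -> [/\ F.1.1 = 0, F.1.2 = 0 & F.2 = 0].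
Proof.
move=> /matrixP E; have := (E 0 0, E 0 1, E 1 1); rewrite !mxE ?ent2E /= => -[[-> E1 ->]].
split=> //; apply/eqP; move/eqP: E1; rewrite mulf_eq0 rcst_eq0 => /orP[|//].
by rewrite (negbTE (neq0Ci C)).
Qed.

Lemma mono_nz (k m : int) : N ^ k * y ^ m != 0.
Proof. by rewrite mulf_neq0 // expfz_neq0 ?N_neq0 // (@var_neq0 C 3 1). Qed.

Lemma lowv_neq0 a : lowv C a != 0.
Proof.
case: a => [[[] k] l]; apply/eqP => /symS_eq0[]; rewrite /= => /eqP E1 /eqP E2 _.
  by move: E1; rewrite mulf_eq0 (negbTE (mono_nz _ _)) oner_eq0.
by move: E2; rewrite mulf_eq0 (negbTE (mono_nz _ _)) oppr_eq0 (negbTE (@var_neq0 C 3 1)).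
Qed.

(** The last entry of T is zero, while that of C contains the odd factor 2k + 1. *)
Lemma lowv_notin_C (k : int) (l l' : nat) (c : C) : Tl C k l%:Z <> c *: Cl C k l'.
Proof.
move=> E; have : Tl C k l%:Z + (- c) *: Cl C k l' = 0 by rewrite E -scalerDl addrN scale0r.
rewrite symSZ symSD => /symS_eq0[/= E1 _ E2].
have c0 : rcst (- c) = 0.
  move: E2; rewrite mulr0 add0r => /eqP; rewrite mulf_eq0 => /orP[/eqP //|].
  rewrite mulf_eq0 (negbTE (mono_nz _ _)) /= mulf_eq0 (negbTE (@var_neq0 C 3 1)) orbF.
  rewrite mulf_eq0 (negbTE (@var_neq0 C 3 1)) orbF.
  have -> : 2 * k%:~R + 1 = rcst (2 * k%:~R + 1).
    by rewrite rcstD rcstM rcst_nat rcst_int rcst1.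
  have := k_odd C k (n := 1) isT; rewrite -(rcst_eq0 3) => /negbTE H.
  by move=> H0; rewrite H in H0.
move/eqP: E1; rewrite c0 mul0r addr0 mulf_eq0 (negbTE (mono_nz _ _)) /=.
by rewrite oner_eq0.
Qed.

Lemma lowv_wop a i z : wop rho2 z (iter i e (lowv C a)) =
  wval C (deg a) a.2.+1 i z *: iter i e (lowv C a).
Proof.
apply: (wop_string lie (@rho2_scale C)); [exact: lowv_f | | exact: lowv_d].
by rewrite lowv_h mulnS.
Qed.
Lemma Cl_wop k (l : nat) i z : wop rho2 z (iter i e (Cl C k l)) =
  wval C (2 * k + l%:Z) l i z *: iter i e (Cl C k l).
Proof.
apply: (wop_string lie (@rho2_scale C)); [exact: f_Cl | exact: Cl_h |].
by rewrite d_Cl intrD intrM.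
Qed.

(** Three applications of [lspan_eigen] reduce the generators of E to those with the same
    eigenvalues of d, Casimir and h. A generator from a T or M string would have the same label,
    which is not allowed. Among the C only C_(l+1) with the same k remains, and only beside T_l,
    since beside M_(l+1) the degrees differ in parity; this case is excluded by entries. *)
Lemma lowv_notin a : ~~ allowed true true a -> ~ lspan (@E_gen C) (lowv C a).
Proof.
move=> na; rewrite lspan_E => Ea.
have wE z : wop rho2 z (lowv C a) = wval C (deg a) a.2.+1 0 z *: lowv C a by exact: (lowv_wop a 0).
have SE z v : Pstr (C := C) true true v -> exists m, wop rho2 z v = m *: v.
  move=> [[k [l [i ->]]]|[b [i [_ ->]]]]; first by exists (wval C (2 * k + l%:Z) l i z); exact: Cl_wop.
  by exists (wval C (deg b) b.2.+1 i z); exact: lowv_wop.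
have E1 := lspan_eigen (wop_lin lie None) (SE None) (wE None) Ea.
have {}E1 := lspan_eigen (wop_lin lie (Some false)) (fun v (H : [set v | _] v) => SE (Some false) v (proj1 H)) (wE (Some false)) E1.
have E3 := lspan_eigen (wop_lin lie (Some true)) (fun v (H : [set v | _] v) => SE (Some true) v (proj1 (proj1 H))) (wE (Some true)) E1.
have eqz (v : V) (m m' : C) : v != 0 -> m *: v = m' *: v -> m = m'.
  move=> v0 E; have : (m - m') *: v = 0 by rewrite scalerBl E subrr.
  by move/eqP; rewrite scaler_eq0 (negbTE v0) orbF subr_eq0 => /eqP.
have {}E3 : lspan [set v | a.1.1 /\ v = Cl C a.1.2 a.2.+1] (lowv C a).
  move: E3; apply: lspan_min; first exact: lspan_lsubspace.
  move=> v [[[Sv v1] v2] v3].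
  have [->|v0] := eqVneq v 0; first exact: lsub0 (lspan_lsubspace _).
  apply: lspan_gen; case: Sv => [[k [l [i vE]]]|[b [i [bb vE]]]].
    have /wval_inj[D1 D2 D3] : forall z, wval C (2 * k + l%:Z) l i z = wval C (deg a) a.2.+1 0 z.
      move=> z; apply: (eqz v _ _ v0); rewrite {1}vE -Cl_wop -vE.
      by case: z => [[]|].
    rewrite vE D3 D2; move: D1; rewrite D2 /deg; case: (a.1.1) => /= D1; last by lia.
    by split=> //; congr (Cl C _ _); lia.
  have /wval_inj[D1 D2 D3] : forall z, wval C (deg b) b.2.+1 i z = wval C (deg a) a.2.+1 0 z.
    move=> z; apply: (eqz v _ _ v0); rewrite {1}vE -lowv_wop -vE.
    by case: z => [[]|].
  case/negP: na; suff <- : b = a by [].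
  case: b D1 D2 {bb vE} => [[tb kb] lb]; case: (a) => [[ta ka] la]; rewrite /deg /= => D1 [D2].
  rewrite D2 in D1 *; case: tb ta D1 => -[] /= D1; try by lia.
    by congr (_, _, _); lia.
  by congr (_, _, _); lia.
have [c Ec] : exists c, a.1.1 /\ lowv C a = c *: Cl C a.1.2 a.2.+1 \/ lowv C a = 0.
  move: E3; set G := (X in lspan X); case aE: (a.1.1).
    move=> E3; suff [c cE] : exists c, lowv C a = c *: Cl C a.1.2 a.2.+1 by exists c; left.
    move: (lowv C a) E3; apply: lspan_min => [|v [_ ->]]; last by exists 1; rewrite scale1r.
    split=> [|r u v [m ->] [n ->]]; first by exists 0; rewrite scale0r.
    by exists (r * m + n); rewrite scalerDl scalerA.
  move=> E3; exists 0; right; move: (lowv C a) E3; apply: lspan_min => [|v []]; last by rewrite aE.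
  exact: lsub_eq0.
case: Ec => [[a1 Ec]|E0]; last by have := lowv_neq0 a; rewrite E0 eqxx.
case: a a1 Ec {na Ea wE E1 E3} => [[[] k] l] //= _.
exact: lowv_notin_C.
Qed.

Lemma labelsP a : [\/ Dp a, Dm a | allowed true true a].
Proof.
case: a => [[b k] l]; rewrite /Dp /Dm /allowed /=.
have [k0|k0] := leP 0 k; first exact: Or31.
have [H|H] := ltP (k + l%:Z + 1 + (~~ b)%:R) 0; first exact: Or32.
by apply: Or33; lia.
Qed.
Lemma Dp_Dm a : Dp a -> Dm a -> False.
Proof. by case: a => [[[] k] l]; rewrite /Dp /Dm /=; lia. Qed.
Lemma Dp_allowed a : Dp a -> ~~ allowed true true a.
Proof. by case: a => [[[] k] l]; rewrite /Dp /allowed /=; lia. Qed.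
Lemma Dm_allowed a : Dm a -> ~~ allowed true true a.
Proof. by case: a => [[[] k] l]; rewrite /Dm /allowed /=; lia. Qed.
End LowestVectors.

Section Predecessor.
Variables (C : fieldType) (V : lmodType C) (F : int -> V).
(** The index l - 1 becomes a natural number: for l = 0 the coefficient vanishes, and the value of
    the predecessor does not matter. *)
Lemma scale_pred (l : nat) (r : C) : (l = 0%N -> r = 0) -> r *: F (l%:Z - 1) = r *: F l.-1.
Proof.
case: l => [|l] H; first by rewrite (H erefl) !scale0r.
by congr (_ *: F _); lia.
Qed.
Lemma scale_pred2 (l : nat) (r : C) : (l = 0%N -> r = 0) -> r *: F (l.+1%:Z - 1) = r *: F l.-1.+1.
Proof.
case: l => [|l] H; first by rewrite (H erefl) !scale0r.
by congr (_ *: F _); lia.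
Qed.
End Predecessor.

(* The moves between lowest weight vectors that b and c make available in an
   invariant subspace of the quotient. *)
Section Paths.
Variable P : bool * int * nat -> Prop.
Local Notation T k l := (P (true, k, l)).
Local Notation M k l := (P (false, k, l)).
Hypothesis bT : forall (k : int) (l : nat), T k l ->
  [/\ T (k - 1) l.+1, M (k - 1) l & (0 < l)%N -> k + l%:Z + 1 != 0 -> T k l.-1].
Hypothesis bM : forall (k : int) (l : nat), M k l ->
  [/\ M (k - 1) l.+1, k + l.+1%:Z + 1 != 0 -> T k l
    & (0 < l)%N -> k + l.+1%:Z + 1 != 0 -> M k l.-1].
Hypothesis cT : forall (k : int) (l : nat), T k l ->
  [/\ T k l.+1, M k l & (0 < l)%N -> k != -1 -> T (k + 1) l.-1].
Hypothesis cM : forall (k : int) (l : nat), M k l ->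
  [/\ M k l.+1, k != -1 -> T (k + 1) l & (0 < l)%N -> k != -1 -> M (k + 1) l.-1].

(** Induction on k, then on l: the third move of [bT] lowers l, and at l = 0 the path T_(k,0),
    M_(k-1,1), T_(k-1,0) lowers k. *)
Lemma path_plus_down k (l : nat) : 0 <= k -> T k l -> T 0 0%N.
Proof.
have H (n l' : nat) : T n%:Z l' -> T 0 0%N.
  elim: n l' => [|n IHn] l'; elim: l' => [|l' IHl] // /bT[_ HM HT].
  - by apply: IHl; apply: HT => //; lia.
  - move: HM; have -> : n.+1%:Z - 1 = n by lia.
    by move=> /bM[_ + _] => HM; apply: (IHn 0%N); apply: HM; lia.
  - by apply: IHl; apply: HT => //; lia.
by case: k => // n _; exact: H.
Qed.
Lemma path_plus_base a : Dp a -> P a -> T 0 0%N.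
Proof.
case: a => [[[] k] l]; rewrite /Dp /= => k0; first exact: path_plus_down.
by move=> /bM[_ H _]; apply: (path_plus_down k0); apply: H; lia.
Qed.
Lemma path_plus_up a : T 0 0%N -> Dp a -> P a.
Proof.
move=> H0; have HT (n l : nat) : T n%:Z l.
  elim: n l => [|n IHn]; elim=> [|l IHl] //; try by have [] := cT IHl.
  have [_ /cM[_ + _] _] := cT (IHn 0%N).
  by rewrite (_ : n%:Z + 1 = n.+1) => [H|]; [apply: H | ]; lia.
case: a => [[t k] l]; rewrite /Dp /=; case: k => // n _.
by case: t => //; have [] := cT (HT n l).
Qed.

(** Mirror image with the moves of c. With n = -k - l - 2, the third move of [cT] keeps n and lowers
    l; at l = 0 the detour through M lowers n. *)
Lemma path_minus_up k (l : nat) : k <= - l%:Z - 2 -> T k l -> T (- 2) 0%N.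
Proof.
have H (n l' : nat) : T (- (n%:Z + l'%:Z + 2)) l' -> T (- 2) 0%N.
  elim: n l' => [|n IHn]; elim=> [|l' IHl] //.
  - move=> /cT[_ _]; rewrite (_ : - _ + 1 = - (0%:Z + l'%:Z + 2)); last by lia.
    by move=> H; apply: IHl; apply: H => //; lia.
  - move=> /cT[_ /cM[_ + _] _].
    rewrite (_ : - _ + 1 = - (n%:Z + 0%:Z + 2)); last by lia.
    by move=> H; apply: (IHn 0%N); apply: H; lia.
  - move=> /cT[_ _]; rewrite (_ : - _ + 1 = - (n.+1%:Z + l'%:Z + 2)); last by lia.
    by move=> H; apply: IHl; apply: H => //; lia.
move=> kl; rewrite (_ : k = - ((absz (k + l%:Z + 2))%:Z + l%:Z + 2)); first exact: H.
by lia.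
Qed.
Lemma path_minus_base a : Dm a -> P a -> T (- 2) 0%N.
Proof.
case: a => [[[] k] l]; rewrite /Dm /= => k0; first by apply: path_minus_up; lia.
by move=> /cM[_ H _]; apply: (path_minus_up (k := k + 1) (l := l)); [lia | apply: H; lia].
Qed.
Lemma path_minus_down a : T (- 2) 0%N -> Dm a -> P a.
Proof.
move=> H0; have HT0 (n : nat) : T (- (n%:Z + 2)) 0%N.
  elim: n => [|n IHn] //; have [_ /bM[_ + _] _] := bT IHn.
  by rewrite (_ : - _ - 1 = - (n.+1%:Z + 2)) => [H|]; [apply: H | ]; lia.
have HT (l n : nat) : T (- (n%:Z + l%:Z + 2)) l.
  elim: l n => [|l IHl] n; first by rewrite addr0.
  have [+ _ _] := bT (IHl n).
  by rewrite (_ : - _ - 1 = - (n%:Z + l.+1%:Z + 2)) //; lia.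
case: a => [[[] k] l]; rewrite /Dm /= => k0.
  by rewrite (_ : k = - ((absz (k + l%:Z + 2))%:Z + l%:Z + 2)); [exact: HT | lia].
have [_ + _] := bT (HT l (absz (k + l%:Z + 3))).
by rewrite (_ : - _ - 1 = k) //; lia.
Qed.
End Paths.

Section QuotientModule.
Variable C : numClosedFieldType.
Local Notation V := (tens C 3).
Local Notation rho2 := (@rho2 C).
Local Notation S := (@E_gen C).
Local Notation Qt := (quot S).
Local Notation q := (qpi S).
Local Notation rhoq := (qact (S := S) rho2).
Local Notation e := (op_e rho2).
Local Notation f := (op_f rho2).
Local Notation h := (op_h rho2).
Local Notation d := (op_d rho2).
Local Notation b := (op_b rho2).
Local Notation c := (op_c rho2).
Local Notation eq := (op_e rhoq).
Local Notation fq := (op_f rhoq).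
Local Notation hq := (op_h rhoq).
Local Notation dq := (op_d rhoq).
Local Notation bq := (op_b rhoq).
Local Notation cq := (op_c rhoq).
Local Notation lie := (@rho2_lie C setT).
Local Notation rsc := (@rho2_scale C).
Local Notation lab := (bool * int * nat)%type.
Local Notation lowv := (lowv C).

Lemma E_submodule : submodule (@sp4 C) rho2 (lspan S).
Proof. by rewrite lspan_E; exact: Pspan_submodule. Qed.

Lemma rhoq_lie : lie_module (@sp4 C) rhoq setT.
Proof. exact: (qact_lie E_submodule lie (@sp4D C) (@sp4_bracket C)). Qed.
Lemma rhoq_scale (r : C) X u : sp4 X -> rhoq (r *: X) u = r *: rhoq X u.
Proof. exact: (qact_Z E_submodule lie (@sp4Z C) rsc). Qed.
Lemma rhoq_pi X u : sp4 X -> rhoq X (q u) = q (rho2 X u).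
Proof. exact: (qact_pi E_submodule lie). Qed.

Lemma eq_pi u : eq (q u) = q (e u).
Proof. by rewrite /op_e rhoq_pi ?qpiZE //; exact: eX_sp4. Qed.
Lemma fq_pi u : fq (q u) = q (f u).
Proof. by rewrite /op_f rhoq_pi ?qpiZE //; exact: fX_sp4. Qed.
Lemma hq_pi u : hq (q u) = q (h u). Proof. by apply: rhoq_pi; exact: hX_sp4. Qed.
Lemma dq_pi u : dq (q u) = q (d u). Proof. by apply: rhoq_pi; exact: dX_sp4. Qed.
Lemma bq_pi u : bq (q u) = q (b u). Proof. by apply: rhoq_pi; exact: bX_sp4. Qed.
Lemma cq_pi u : cq (q u) = q (c u). Proof. by apply: rhoq_pi; exact: cX_sp4. Qed.

Definition lowq (a : lab) : Qt := q (lowv a).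
Definition wq (p : lab * nat) : Qt := iter p.2 eq (lowq p.1).

Lemma wqE p : wq p = q (iter p.2 e (lowv p.1)).
Proof. by case: p => a; elim=> //= i; rewrite /wq /= => ->; exact: eq_pi. Qed.

Lemma lowq_f a : fq (lowq a) = 0.
Proof. by rewrite fq_pi lowv_f qpi0. Qed.
Lemma lowq_h a : hq (lowq a) = (2 * a.2).+2%:R *: lowq a.
Proof. by rewrite hq_pi lowv_h qpiZE. Qed.
Lemma lowq_d a : dq (lowq a) = (- 2 * (deg a)%:~R - 2) *: lowq a.
Proof. by rewrite dq_pi lowv_d qpiZE. Qed.
Lemma lowq_top a : iter (2 * a.2).+3 eq (lowq a) = 0.
Proof.
rewrite -[LHS]/(wq (a, (2 * a.2).+3)) wqE.
by rewrite -[X in q X]/(iter (2 * a.2).+3 e (lowv a)) lowv_top qpi0.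
Qed.
Lemma lowq_neq0 a : ~~ allowed true true a -> lowq a != 0.
Proof. by move=> /lowv_notin H; apply/eqP => E; apply: H; apply/qpi_eq0; exact: E. Qed.

Definition lamq (p : lab * nat) (z : option bool) : C := wval C (deg p.1) p.1.2.+1 p.2 z.

Lemma wq_eigen p : joint_eigen (wop rhoq) lamq p (wq p).
Proof.
move=> z; apply: (wop_string rhoq_lie rhoq_scale); [exact: lowq_f | | exact: lowq_d].
by rewrite lowq_h mulnS.
Qed.

(** For equal l the degrees of a T string and of an M string differ in parity. This is why, with C
    gone, the weights separate all labels of the quotient. *)
Lemma deg_inj a a' : deg a = deg a' -> a.2 = a'.2 -> a = a'.
Proof.
case: a a' => [[b1 k] l] [[b2 k'] l']; rewrite /deg /= => D ll; rewrite -ll in D *.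
have bb : b1 = b2 by case: b1 b2 D => -[] //= D; lia.
by rewrite -bb in D *; congr (_, _, _); lia.
Qed.

Lemma lamq_sep D : separated lamq D.
Proof.
move=> [a i] [a' i'] _ _ jk; apply: contrapT => H; case/eqP: jk.
have /wval_inj[D1 [D2] D3] : forall z, wval C (deg a) a.2.+1 i z = wval C (deg a') a'.2.+1 i' z.
  by move=> z; apply/eqP/negPn/negP => nz; apply: H; exists z.
by rewrite (deg_inj D1 D2) D3.
Qed.

Definition QD (D : set lab) : set (lab * nat) := [set p | D p.1 /\ (p.2 <= (2 * p.1.2).+2)%N].
Definition QS (D : set lab) : set Qt := lspan [set x | exists p, QD D p /\ x = wq p].

Lemma QS_sub D : lsubspace (QS D). Proof. exact: lspan_lsubspace. Qed.

Lemma QS_wq D p : D p.1 -> QS D (wq p).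
Proof.
move=> Dp; have [pN|pN] := leqP p.2 (2 * p.1.2).+2.
  by apply: lspan_gen; exists p.
rewrite /wq (string_eq0 (op_e_lin rhoq_lie) (lowq_top p.1) pN).
exact: lsub0 (QS_sub D).
Qed.

Lemma image_Pspan lo up D : (forall a, allowed lo up a <-> D a \/ allowed true true a) ->
  q @` Pspan (C := C) lo up = QS D.
Proof.
move=> HD; rewrite image_lspan; apply/seteqP; split.
  apply: lspan_min; first exact: QS_sub.
  move=> _ [_ [[k [l [i ->]]]|[a [i [/HD[Da|aa] ->]]]] <-].
  - have /qpi_eq0 -> : lspan S (iter i e (Cl C k l)) by rewrite lspan_E; exact: PspanC.
    exact: lsub0 (QS_sub D).
  - by have := QS_wq (p := (a, i)) Da; rewrite wqE.
  - have /qpi_eq0 -> : lspan S (iter i e (lowv a)) by rewrite lspan_E; exact: PspanT.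
    exact: lsub0 (QS_sub D).
apply: lspan_mono => _ [p [[Dp _] ->]]; rewrite wqE; apply: lspan_gen.
exists (iter p.2 e (lowv p.1)) => //; right; exists p.1, p.2; split=> //.
by apply/HD; left.
Qed.

Lemma QS_submodule lo up D : (forall a, allowed lo up a <-> D a \/ allowed true true a) ->
  submodule (@sp4 C) rhoq (QS D).
Proof.
move=> HD; split=> [|X u sX]; first exact: QS_sub.
rewrite -(image_Pspan HD) => -[v Pv <-]; rewrite rhoq_pi //.
by exists (rho2 X v) => //; apply: (Pspan_submodule C lo up).2.
Qed.

(** A nonzero common vector would, by [eigen_span_component], put a nonzero basis vector with label
    in D into the span of those with labels in D', which separation forbids. *)
Lemma QS_disj (D D' : set lab) u : (forall a, D a -> D' a -> False) -> QS D u -> QS D' u -> u = 0.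
Proof.
move=> DD Du D'u; apply/eqP; apply: contraT => u0.
have phiP := wop_lin rhoq_lie.
have clos z v : QS D' v -> QS D' (wop rhoq z v).
  apply: (lspan_lin (QS_sub D') (phiP z)) => _ [p [Dp ->]].
  rewrite wq_eigen; apply: (lsubZ _ (QS_sub D')); exact: QS_wq (proj1 Dp).
have [j [Dj Uj j0]] := eigen_span_component phiP (lamq_sep (D := QD D)) (QS_sub D') clos
  (fun p _ => wq_eigen p) Du D'u u0.
case/eqP: j0.
apply: (eigen_notin_span phiP (lamq_sep (D := QD D')) (fun p _ => wq_eigen p) (wq_eigen j) (@lamq_sep _) _ Uj).
by move=> [D'j _]; case: Dj => Dj _; exact: (DD j.1).
Qed.

Section Arrows.
Variable U : set Qt.
Hypothesis sU : submodule (@sp4 C) rhoq U.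
Let lU : lsubspace U := sU.1.
Let ops := submodule_ops sU.
Let eU u : U u -> U (eq u). Proof. by case: ops => H _ _ _ _; exact: H. Qed.
Let fU u : U u -> U (fq u). Proof. by case: ops => _ H _ _ _; exact: H. Qed.
Let hU u : U u -> U (hq u). Proof. by case: ops => _ _ H _ _; exact: H. Qed.
Let dU u : U u -> U (dq u). Proof. by case: ops => _ _ _ H _; exact: H. Qed.
Let bU u : U u -> U (bq u). Proof. by case: ops => _ _ _ _ [H _]; exact: H. Qed.
Let cU u : U u -> U (cq u). Proof. by case: ops => _ _ _ _ [_ H]; exact: H. Qed.

Lemma wopU z u : U u -> U (wop rhoq z u).
Proof.
move=> Uu; case: z => [[]|] /=; [exact: hU | | exact: dU].
rewrite /casimir; apply: (lsubB lU); last by apply: eU; exact: fU.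
by apply: (lsubD lU); apply: (lsubZ _ lU); do ?exact: hU; apply: hU; exact: hU.
Qed.

Lemma arrow_down p : (p.2 <= (2 * p.1.2).+2)%N -> U (wq p) -> U (lowq p.1).
Proof.
move=> pN; apply: (string_down (op_e_lin rhoq_lie) (o_ef rhoq_lie rhoq_scale)
  (o_he rhoq_lie rhoq_scale) (lowq_f p.1) (lowq_h p.1) lU fU pN).
Qed.

Lemma component3 p1 p2 p3 (c1 c2 c3 : C) : uniq [:: p1; p2; p3] ->
  U (c1 *: wq p1 + (c2 *: wq p2 + c3 *: wq p3)) ->
  [/\ U (c1 *: wq p1), U (c2 *: wq p2) & U (c3 *: wq p3)].
Proof.
move=> up Us; pose k p := if p == p1 then c1 else if p == p2 then c2 else c3.
have := up; rewrite /= !inE negb_or !andbT => /andP[/andP[n12 n13] n23].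
have k1 : k p1 = c1 by rewrite /k eqxx.
have k2 : k p2 = c2 by rewrite /k eq_sym (negbTE n12) eqxx.
have k3 : k p3 = c3 by rewrite /k eq_sym (negbTE n13) eq_sym (negbTE n23).
have sE : U (\sum_(p <- [:: p1; p2; p3]) k p *: wq p).
  by rewrite !big_cons big_nil addr0 k1 k2 k3.
have kE p : p \in [:: p1; p2; p3] -> setT p /\ joint_eigen (wop rhoq) lamq p (k p *: wq p).
  move=> _; split=> // z; rewrite (phiZ (wop_lin rhoq_lie)) wq_eigen !scalerA.
  by rewrite mulrC.
have H := eigen_component (wop_lin rhoq_lie) (lamq_sep (D := setT)) lU wopU up kE sE.
by rewrite -k1 -k2 -k3; split; apply: H; rewrite !inE eqxx ?orbT.
Qed.

(** The term in C dies in the quotient, which leaves a combination of vectors with separated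
    weights. *)
Lemma armT (u v1 v2 v3 vC : V) (r a1 a2 a3 a4 : C) : U (q u) -> lspan S vC ->
  r *: u = a1 *: v1 + (a2 *: v2 + (a3 *: v3 + a4 *: vC)) ->
  U (a1 *: q v1 + (a2 *: q v2 + a3 *: q v3)).
Proof.
move=> Uu /qpi_eq0 C0 E; have := lsubZ r lU Uu.
by rewrite -qpiZE E !qpiD !qpiZE C0 scaler0 addr0.
Qed.
Lemma armM (u v1 v2 v3 vC : V) (r a1 a2 a3 a4 : C) : U (q u) -> lspan S vC ->
  r *: u = a1 *: v1 + (a2 *: v2 + (a4 *: vC + a3 *: v3)) ->
  U (a1 *: q v1 + (a2 *: q v2 + a3 *: q v3)).
Proof. by move=> Uu SC; rewrite [a4 *: _ + _]addrC; exact: armT. Qed.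

Lemma S_Cl k (l i : nat) : lspan S (iter i e (Cl C k l)).
Proof. by rewrite lspan_E; exact: PspanC. Qed.

(** The three vectors have distinct weights, so each term lies in U by itself. Where its coefficient
    is nonzero, f leads back to the lowest vector, since 2 does not exceed the length of any
    string. *)
Lemma arrow3 p1 p2 p3 (c1 c2 c3 : C) : uniq [:: p1; p2; p3] ->
  (p1.2 <= 2)%N -> (p2.2 <= 2)%N -> (p3.2 <= 2)%N ->
  U (c1 *: q (iter p1.2 e (lowv p1.1)) + (c2 *: q (iter p2.2 e (lowv p2.1))
     + c3 *: q (iter p3.2 e (lowv p3.1)))) ->
  [/\ c1 != 0 -> U (lowq p1.1), c2 != 0 -> U (lowq p2.1) & c3 != 0 -> U (lowq p3.1)].
Proof.
rewrite -!wqE => up i1 i2 i3 /(component3 up)[H1 H2 H3].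
have H p (r : C) : (p.2 <= 2)%N -> U (r *: wq p) -> r != 0 -> U (lowq p.1).
  move=> i Up r0; apply: arrow_down; first by apply: leq_trans i _.
  exact: (lsubZr lU r0).
by split; [exact: (H _ _ i1 H1) | exact: (H _ _ i2 H2) | exact: (H _ _ i3 H3)].
Qed.

Lemma uniq3 (a1 a2 a3 : lab) : uniq [:: (a1, 2); (a2, 1%N); (a3, 0%N)].
Proof. by rewrite /= !inE !xpair_eqE !andbF. Qed.

Lemma nz_2k2l (k : int) (l n : nat) : odd n -> (2 * k%:~R + 2 * l%:Z%:~R + n%:R : C) != 0.
Proof.
move=> on; have -> : 2 * k%:~R + 2 * l%:Z%:~R = 2 * (k + l%:Z)%:~R :> C.
  by rewrite intrD mulrDr.
exact: k_odd.
Qed.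
Lemma nz_kl1 (k : int) (l : nat) : k + l%:Z + 1 != 0 -> (k%:~R + l%:Z%:~R + 1 : C) != 0.
Proof.
by move=> H; rewrite (_ : _ + 1 = (k + l%:Z + 1)%:~R) ?intr_eq0 // !intrD.
Qed.
Lemma nz_k1 (k : int) : k != -1 -> (k%:~R + 1 : C) != 0.
Proof.
move=> H; rewrite (_ : _ + 1 = (k + 1)%:~R); last by rewrite intrD.
by rewrite intr_eq0; apply: contraNneq H => H; apply/eqP; lia.
Qed.
Lemma nz_l (l : nat) : (0 < l)%N -> (l%:Z%:~R : C) != 0.
Proof. by case: l => // l _; exact: nz_lS. Qed.
Lemma nz_ll1 (l : nat) : (0 < l)%N -> (l.+1%:Z%:~R * l.+1%:Z%:~R - 1 : C) != 0.
Proof.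
case: l => // l _; rewrite (_ : _ - 1 = (l.+2%:Z * l.+2%:Z - 1)%:~R).
  by rewrite intr_eq0; apply/eqP; nia.
by rewrite intrB intrM.
Qed.
Lemma nz_2k1 (k : int) : (2 * k%:~R + 1 : C) != 0. Proof. exact: (k_odd C k (n := 1)). Qed.
Lemma nz_8 : (8 : C) != 0. Proof. by rewrite pnatr_eq0. Qed.
Lemma nz_m8 : (- 8 : C) != 0. Proof. by rewrite oppr_eq0 pnatr_eq0. Qed.
Lemma nz_N (r : C) : r != 0 -> - r != 0. Proof. by rewrite oppr_eq0. Qed.
Let n2k1 k := nz_N (nz_2k1 k).
Let nzz := (nz C, nz_2k1, nz_8, nz_m8, n2k1).

Lemma arrow_b_T k (l : nat) : U (lowq (true, k, l)) ->
  [/\ U (lowq (true, k - 1, l.+1)), U (lowq (false, k - 1, l))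
    & (0 < l)%N -> k + l%:Z + 1 != 0 -> U (lowq (true, k, l.-1))].
Proof.
move=> /bU; rewrite bq_pi => Ub; have E := @b_Tl C k l; cbv zeta in E.
rewrite (_ : l%:Z + 1 = l.+1) in E; last by lia.
rewrite (scale_pred (Tl C k)) in E; last by move=> ->; rewrite mulr0z mulr0 !mul0r.
have [H1 H2 H3] := arrow3 (uniq3 (true, k - 1, l.+1) (false, k - 1, l) (true, k, l.-1))
  isT isT isT (armT Ub (S_Cl k l 0) E).
split; [apply: H1 | apply: H2 | move=> l0 kl; apply: H3].
- by rewrite !mulf_neq0 ?nzz.
- by rewrite !mulf_neq0 ?nzz.
- by rewrite !mulf_neq0 ?nzz ?nz_l ?nz_kl1.
Qed.

Lemma arrow_b_M k (l : nat) : U (lowq (false, k, l)) ->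
  [/\ U (lowq (false, k - 1, l.+1)), k + l.+1%:Z + 1 != 0 -> U (lowq (true, k, l))
    & (0 < l)%N -> k + l.+1%:Z + 1 != 0 -> U (lowq (false, k, l.-1))].
Proof.
move=> /bU; rewrite bq_pi => Ub; have E := @b_Ml C k l.+1; cbv zeta in E.
rewrite (_ : l.+1%:Z + 1 = l.+2) in E; last by lia.
rewrite (scale_pred2 (Ml C k)) in E; last by move=> ->; rewrite mulr1z mulr1 subrr mulr0 mul0r.
rewrite (_ : l.+1%:Z - 1 = l) in E; last by lia.
have [H1 H2 H3] := arrow3 (uniq3 (false, k - 1, l.+1) (true, k, l) (false, k, l.-1))
  isT isT isT (armM Ub (S_Cl k l.+1 1) E).
split; [apply: H1 | move=> kl; apply: H2 | move=> l0 kl; apply: H3].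
- by rewrite !mulf_neq0 ?nzz.
- by rewrite !mulf_neq0 ?nzz ?nz_kl1.
- by rewrite !mulf_neq0 ?nzz ?nz_kl1 ?nz_ll1.
Qed.

Lemma arrow_c_T k (l : nat) : U (lowq (true, k, l)) ->
  [/\ U (lowq (true, k, l.+1)), U (lowq (false, k, l))
    & (0 < l)%N -> k != -1 -> U (lowq (true, k + 1, l.-1))].
Proof.
move=> /cU; rewrite cq_pi => Ub; have E := @c_Tl C k l; cbv zeta in E.
rewrite (_ : l%:Z + 1 = l.+1) in E; last by lia.
rewrite (scale_pred (Tl C (k + 1))) in E; last by move=> ->; rewrite mulr0z mulr0 !mul0r.
have [H1 H2 H3] := arrow3 (uniq3 (true, k, l.+1) (false, k, l) (true, k + 1, l.-1))
  isT isT isT (armT Ub (S_Cl (k + 1) l 0) E).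
split; [apply: H1 | apply: H2 | move=> l0 kl; apply: H3].
- by rewrite !mulf_neq0 ?nzz // oppr_eq0 nz_2k2l.
- by rewrite !mulf_neq0 ?nzz.
- by rewrite !mulf_neq0 ?nzz ?nz_l ?nz_k1.
Qed.

Lemma arrow_c_M k (l : nat) : U (lowq (false, k, l)) ->
  [/\ U (lowq (false, k, l.+1)), k != -1 -> U (lowq (true, k + 1, l))
    & (0 < l)%N -> k != -1 -> U (lowq (false, k + 1, l.-1))].
Proof.
move=> /cU; rewrite cq_pi => Ub; have E := @c_Ml C k l.+1; cbv zeta in E.
rewrite (_ : l.+1%:Z + 1 = l.+2) in E; last by lia.
rewrite (scale_pred2 (Ml C (k + 1))) in E; last by move=> ->; rewrite mulr1z mulr1 subrr mulr0 !mul0r.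
rewrite (_ : l.+1%:Z - 1 = l) in E; last by lia.
have [H1 H2 H3] := arrow3 (uniq3 (false, k, l.+1) (true, k + 1, l) (false, k + 1, l.-1))
  isT isT isT (armM Ub (S_Cl (k + 1) l.+1 1) E).
split; [apply: H1 | move=> kl; apply: H2 | move=> l0 kl; apply: H3].
- by rewrite !mulf_neq0 ?nzz // oppr_eq0 nz_2k2l.
- by rewrite !mulf_neq0 ?nzz ?nz_k1 ?nz_2k2l.
- by rewrite !mulf_neq0 ?nzz ?nz_k1 ?nz_ll1.
Qed.

Lemma plus_base a : Dp a -> U (lowq a) -> U (lowq (true, 0, 0%N)).
Proof. exact: (path_plus_base (P := fun a => U (lowq a)) arrow_b_T arrow_b_M). Qed.
Lemma plus_up a : U (lowq (true, 0, 0%N)) -> Dp a -> U (lowq a).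
Proof. exact: (path_plus_up (P := fun a => U (lowq a)) arrow_c_T arrow_c_M). Qed.
Lemma minus_base a : Dm a -> U (lowq a) -> U (lowq (true, - 2, 0%N)).
Proof. exact: (path_minus_base (P := fun a => U (lowq a)) arrow_c_T arrow_c_M). Qed.
Lemma minus_down a : U (lowq (true, - 2, 0%N)) -> Dm a -> U (lowq a).
Proof. exact: (path_minus_down (P := fun a => U (lowq a)) arrow_b_T arrow_b_M). Qed.
End Arrows.

Lemma QS_irreducible (D : set lab) lo up a0 : D a0 ->
  (forall a, D a -> ~~ allowed true true a) ->
  (forall a, allowed lo up a <-> D a \/ allowed true true a) ->
  (forall U a a', submodule (@sp4 C) rhoq U -> D a -> D a' -> U (lowq a) -> U (lowq a')) ->
  irreducible_module (@sp4 C) rhoq (QS D).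
Proof.
move=> Da0 Dna HD conn; split; first exact: QS_submodule HD.
  move=> E0; have : QS D (lowq a0) by exact: (QS_wq (p := (a0, 0%N))).
  by rewrite E0 => /eqP; rewrite (negbTE (lowq_neq0 (Dna a0 Da0))).
move=> U sU UD; have lU := sU.1.
have [[u Uu /eqP u0]|U0] := pselect (exists2 u, U u & u <> 0); last first.
  left; apply/seteqP; split=> u; last by move=> ->; exact: lsub0.
  by move=> Uu; apply: contrapT => u0; apply: U0; exists u.
right; apply/seteqP; split=> //.
have [p [[Dp pN] Up _]] := eigen_span_component (wop_lin rhoq_lie) (lamq_sep (D := QD D)) lU
  (wopU sU) (fun p _ => wq_eigen p) (UD _ Uu) Uu u0.
have Ul := arrow_down sU pN Up.
apply: lspan_min => // _ [p' [[Dp' _] ->]].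
have [eU _ _ _ _] := submodule_ops sU.
rewrite /wq; elim: (p'.2) => [|i IH] /=; last exact: eU.
exact: (conn U _ _ sU Dp Dp' Ul).
Qed.

Lemma allowed_plus a : allowed true false a <-> Dp a \/ allowed true true a.
Proof.
case: a => [[t k] l]; rewrite /allowed /Dp /= andbT; split=> [H|[|/andP[] //]]; last by lia.
by have [k0|k0] := leP 0 k; [left | right; rewrite H /=; lia].
Qed.
Lemma allowed_minus a : allowed false true a <-> Dm a \/ allowed true true a.
Proof.
case: a => [[t k] l]; rewrite /allowed /Dm /=; split=> [H|[|/andP[] //]]; last first.
  by case: t => /=; lia.
by have [k0|k0] := ltP (k + l%:Z + 1 + (~~ t)%:R) 0; [left | right; rewrite /= H].
Qed.
Lemma allowed_all a : allowed false false a <-> (Dp `|` Dm) a \/ allowed true true a.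
Proof.
split=> _; last by case: a => [[t k] l].
by case: (labelsP a) => H; [left; left | left; right | right].
Qed.

Lemma Qplus_irreducible : irreducible_module (@sp4 C) rhoq (QS Dp).
Proof.
apply: (@QS_irreducible Dp true false (true, 0, 0%N)) => //.
- exact: Dp_allowed.
- exact: allowed_plus.
- by move=> U a a' sU Da Da' Ua; apply: plus_up => //; exact: plus_base Da Ua.
Qed.
Lemma Qminus_irreducible : irreducible_module (@sp4 C) rhoq (QS Dm).
Proof.
apply: (@QS_irreducible Dm false true (true, - 2, 0%N)) => //.
- exact: Dm_allowed.
- exact: allowed_minus.
- by move=> U a a' sU Da Da' Ua; apply: minus_down => //; exact: minus_base Da Ua.
Qed.

Lemma quotient_dsum : dsum2 (q @` @W_half C) (QS Dp) (QS Dm).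
Proof.
split; [exact: QS_sub | exact: QS_sub | |].
  rewrite W_Pspan (image_Pspan allowed_all); apply/seteqP; split.
    apply: lspan_min => [|_ [p [[[Dpp|Dmp] pN] ->]]].
    - split=> [|r u v [u1 [u2 [Du1 Du2 ->]]] [v1 [v2 [Dv1 Dv2 ->]]]].
        by exists 0, 0; rewrite addr0; split=> //; exact: lsub0 (QS_sub _).
      exists (r *: u1 + v1), (r *: u2 + v2); rewrite scalerDr addrACA.
      by split=> //; [exact: (QS_sub Dp).2 | exact: (QS_sub Dm).2].
    - exists (wq p), 0; rewrite addr0; split=> //; first exact: QS_wq.
      exact: lsub0 (QS_sub _).
    - exists 0, (wq p); rewrite add0r; split=> //; last exact: QS_wq.
      exact: lsub0 (QS_sub _).
  move=> _ [u1 [u2 [Du1 Du2 ->]]]; apply: (lsubD (QS_sub _)).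
    by apply: (lspan_mono _ Du1) => _ [p [[Dp_ pN] ->]]; apply: QS_wq; left.
  by apply: (lspan_mono _ Du2) => _ [p [[Dm_ pN] ->]]; apply: QS_wq; right.
apply/seteqP; split=> [u [Du Du']|u ->]; last by split; exact: lsub0 (QS_sub _).
exact: (QS_disj Dp_Dm Du Du').
Qed.

Section KTypes.
Variables (DK : set Kindex) (K : Kindex -> set V) (lb : Kindex -> lab) (D : set lab).
Hypothesis lbD : lb @` DK = D.
Hypothesis lb_inj : forall i j, DK i -> DK j -> lb i = lb j -> i = j.
Hypothesis KE : forall j, DK j -> lspan (K j) = lspan (string e (lowv (lb j)) (2 * (lb j).2).+2).
Hypothesis Dna : forall a, D a -> ~~ allowed true true a.
Let lie_e := op_e_lin rhoq_lie.
Let ef := o_ef rhoq_lie rhoq_scale.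
Let he := o_he rhoq_lie rhoq_scale.

Lemma image_string a :
  q @` lspan (string e (lowv a) (2 * a.2).+2) = lspan (string eq (lowq a) (2 * a.2).+2).
Proof.
rewrite image_lspan; congr lspan; apply/seteqP; split.
  by move=> _ [_ [i [iN ->]] <-]; exists i; split=> //; rewrite -(wqE (a, i)).
move=> _ [i [iN ->]]; exists (iter i e (lowv a)); first by exists i.
by rewrite -(wqE (a, i)).
Qed.

Lemma image_K j : DK j -> q @` lspan (K j) = lspan (string eq (lowq (lb j)) (2 * (lb j).2).+2).
Proof. by move=> Dj; rewrite KE // image_string. Qed.

Lemma image_Ktypes : q @` lspan (\bigcup_(j in DK) K j) = QS D.
Proof.
apply/seteqP; split.
  rewrite image_lspan; apply: lspan_mono => _ [v [j Dj Kv] <-].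
  have : (q @` lspan (K j)) (q v) by exists v => //; exact: lspan_gen.
  rewrite image_K //; apply: lspan_mono => _ [i [iN ->]].
  by apply: lspan_gen; exists (lb j, i); split=> //; split=> //; rewrite -lbD; exists j.
rewrite image_lspan; apply: lspan_min => [|_ [[a i] [[/= + iN] ->]]]; first exact: lspan_lsubspace.
rewrite -lbD => -[j Dj ja].
suff : lspan (q @` K j) (wq (a, i)).
  by apply: lspan_mono => _ [v Kv <-]; apply: lspan_gen; exists v => //; exists j.
rewrite -image_lspan image_K // ja; apply: lspan_gen; exists i; split=> //.
Qed.

(** On a K-type h varies, but d ([z] true) and the Casimir operator ([z] false) are scalars; these
    two already separate the K-types, which yields the direct sum in [K_dsum]. *)
Lemma K_eigen j u z : DK j -> (q @` lspan (K j)) u ->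
  wop rhoq (if z then None else Some false) u = lamq (lb j, 0%N) (if z then None else Some false) *: u.
Proof.
move=> Dj; rewrite image_K //; set x := if z then _ else _.
suff : lspan (string eq (lowq (lb j)) (2 * (lb j).2).+2) `<=`
  [set u | wop rhoq x u = lamq (lb j, 0%N) x *: u] by move/(_ u).
have P := wop_lin rhoq_lie x.
apply: lspan_min => [|_ [i [iN ->]]]; last first.
  by have := wq_eigen (lb j, i) x; rewrite /wq /= => ->; rewrite /x; case: (z).
split=> [|r v w /= vE wE]; last by rewrite P vE wE scalerDr !scalerA mulrC.
have P0 := P (-1) 0 0; rewrite scaler0 addr0 scaleN1r addNr in P0.
by rewrite /= P0 scaler0.
Qed.

Lemma K_dsum : dsum DK (fun j => q @` lspan (K j)) (QS D).
Proof.
split.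
- by move=> j Dj; rewrite image_lspan; exact: lspan_lsubspace.
- rewrite -image_Ktypes image_lspan; apply/seteqP; split.
    apply: lspan_mono => _ [v [j Dj Kv] <-]; apply: lspan_gen; exists j => //.
    by exists v => //; exact: lspan_gen.
  apply: lspan_mono => _ [j Dj [v Kv <-]].
  have : (q @` lspan (K j)) (q v) by exists v.
  rewrite image_lspan; apply: lspan_mono => _ [w Kw <-]; apply: lspan_gen.
  by exists w => //; exists j.
move=> s u us uK u0.
pose phi (z : bool) := wop rhoq (if z then None else Some false).
pose lam (j : Kindex) (z : bool) := lamq (lb j, 0%N) (if z then None else Some false).
have sep : separated lam DK.
  move=> i j Di Dj ij; apply: contrapT => H; case/eqP: ij; apply: lb_inj => //.
  have /wval_inj[D1 [D2] _] : forall x, wval C (deg (lb i)) (lb i).2.+1 0 x = wval C (deg (lb j)) (lb j).2.+1 0 x.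
    have Hz z : lam i z = lam j z by apply/eqP/negPn/negP => nz; apply: H; exists z.
    case=> [[]|]; [| exact: (Hz false) | exact: (Hz true)].
    have /= := Hz false; rewrite /lam /lamq /= => /eqP; rewrite eqr_nat => /eqP E.
    have -> : (lb i).2 = (lb j).2 by have [//|L|L] := ltngtP (lb i).2 (lb j).2; nia.
    by [].
  exact: deg_inj.
apply: (eigen_independent (phi := phi) (lam := lam) _ sep us _ u0).
  by move=> z; exact: wop_lin rhoq_lie _.
by move=> j /uK[Dj Kj]; split=> // z; exact: K_eigen.
Qed.

Lemma K_irreducible j : DK j -> irreducible_module (@sp4_k C) rhoq (q @` lspan (K j)).
Proof.
move=> Dj; have lD : D (lb j) by rewrite -lbD; exists j.
have l0 := lowq_neq0 (Dna lD).
have fl := op_f_lin rhoq_lie; have hl := op_h_lin rhoq_lie.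
split.
- split=> [|X u kX]; first by rewrite image_lspan; exact: lspan_lsubspace.
  have KU x u' := @K_eigen j u' x Dj.
  have dU v : (q @` lspan (K j)) v -> (q @` lspan (K j)) (dq v).
    have L : lsubspace (q @` lspan (K j)) by rewrite image_lspan; exact: lspan_lsubspace.
    move=> Kv; rewrite (K_eigen true Dj Kv : dq v = _); exact: (lsubZ _ L).
  move: dU; rewrite image_K // => dU.
  apply: (sp4k_closed rhoq_lie rhoq_scale (lspan_lsubspace _) _ _ _ dU kX).
  + exact: (string_e lie_e (lowq_top _)).
  + exact: (string_f lie_e fl ef he (lowq_f _) (lowq_h _) (lowq_top _)).
  + exact: (string_h lie_e hl he (lowq_h _) (lowq_top _)).
- rewrite image_K // => E0.
  have : lspan (string eq (lowq (lb j)) (2 * (lb j).2).+2) (lowq (lb j)).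
    by apply: lspan_gen; exists 0%N.
  by rewrite E0 => /eqP; rewrite (negbTE l0).
move=> U sU; have [eU fU hU] := submodule_k_ops sU.
rewrite image_K //.
exact: (string_irreducible lie_e hl ef he (lowq_f _) (lowq_h _) sU.1 eU fU hU).
Qed.
End KTypes.
End QuotientModule.

(** * Isomorphisms of lowest weight modules *)

Section Gradation.
Variable C : numClosedFieldType.
Implicit Types X Y : 'M[C]_(2 + 2).

Definition sp4_b : set 'M[C]_(2 + 2) := [set X | [/\ sp4 X, ulsubmx X = 0 & dlsubmx X = 0]].
Definition sp4_c : set 'M[C]_(2 + 2) := [set X | [/\ sp4 X, ulsubmx X = 0 & ursubmx X = 0]].

Lemma sp4_dec X : sp4 X -> exists X1 X2 X3,
  [/\ sp4_b X1, @sp4_k C X2, sp4_c X3 & X = X1 + X2 + X3].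
Proof.
move=> sX; have [BT LT _] := sX.
exists (spm 0 (ursubmx X) 0), (spm (ulsubmx X) 0 0), (spm 0 0 (dlsubmx X)); split.
- by split; [apply: spm_sp4; rewrite ?trmx0 | exact: block_mxKul | exact: block_mxKdl].
- by split; [apply: spm_sp4; rewrite ?trmx0 | exact: block_mxKur | exact: block_mxKdl].
- by split; [apply: spm_sp4; rewrite ?trmx0 | exact: block_mxKul | exact: block_mxKur].
by rewrite {1}(spm_eta sX) spm_split [spm (ulsubmx X) 0 0 + _]addrC.
Qed.
Lemma sp4_kc X Y : @sp4_k C X -> sp4_c Y -> sp4_c (X *m Y - Y *m X).
Proof.
move=> [sX X1 X2] [sY Y1 Y2]; split; first exact: sp4_bracket.
  by rewrite ulsubB !ulsub_mul X1 X2 Y1 Y2 !(mul0mx, mulmx0, addr0, subr0).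
by rewrite ursubB !ursub_mul X1 Y1 Y2 !(mul0mx, mulmx0, addr0, subr0).
Qed.
Lemma sp4_bc X Y : sp4_b X -> sp4_c Y -> @sp4_k C (X *m Y - Y *m X).
Proof.
move=> [sX X1 X2] [sY Y1 Y2]; have [_ _ DX] := sX; have [_ _ DY] := sY.
rewrite X1 trmx0 oppr0 in DX; rewrite Y1 trmx0 oppr0 in DY.
split; first exact: sp4_bracket.
  by rewrite ursubB !ursub_mul X1 Y1 DX DY !(mul0mx, mulmx0, addr0, subr0).
by rewrite dlsubB !dlsub_mul X1 Y1 DX DY !(mul0mx, mulmx0, addr0, subr0).
Qed.
Lemma br_d_c X : sp4_c X -> dX C *m X - X *m dX C = (- 2) *: X.
Proof.
move=> [sX X1 X2]; rewrite (spm_eta sX) X1 X2 /dX /spm !mulmx_block scale_block_mx opp_block_mx add_block_mx.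
rewrite !(trmx0, oppr0, mulmx0, mul0mx, addr0, add0r, scaler0).
have -> : mx2 1 0 0 1 = 1%:M :> 'M[C]_2 by apply: matrix2P; rewrite !mxE ?ent2E.
rewrite trmx1 mulNmx mul1mx mulmx1; congr block_mx.
by rewrite scaleNr scaler_nat mulr2n opprD.
Qed.
Lemma br_d_b X : sp4_b X -> dX C *m X - X *m dX C = 2 *: X.
Proof.
move=> [sX X1 X2]; rewrite (spm_eta sX) X1 X2 /dX /spm !mulmx_block scale_block_mx opp_block_mx add_block_mx.
rewrite !(trmx0, oppr0, mulmx0, mul0mx, addr0, add0r, scaler0).
have -> : mx2 1 0 0 1 = 1%:M :> 'M[C]_2 by apply: matrix2P; rewrite !mxE ?ent2E.
rewrite trmx1 mulmxN mul1mx mulmx1 opprK; congr block_mx.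
by rewrite scaler_nat mulr2n.
Qed.
End Gradation.

Section LowestVector.
Variables (C : numClosedFieldType) (V : lmodType C).
Variable act : 'M[C]_(2 + 2) -> V -> V.

Definition sp4_act := lie_module (@sp4 C) act setT /\
  forall (c : C) X u, sp4 X -> act (c *: X) u = c *: act X u.

(** The eigenvalue of d in degree n, which reads the grading off the action: the block C raises the
    degree by one and the block B lowers it. *)
Definition dval (n : int) : C := - 2 * n%:~R - 2.

Definition graded_from (n0 : int) : set V :=
  lspan [set v | exists n, n0 <= n /\ op_d act v = dval n *: v].

(** For v nonzero, the start of a K-type of dimension 3 in degree 1. The models are N^(1/2) T_0 in
    the quotient and the constants in F+. *)
Definition lowest (v : V) := [/\ op_f act v = 0, op_h act v = 2%:R *: v,
  op_d act v = dval 1 *: v & iter 3 (op_e act) v = 0].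

Lemma dval_inj : injective dval.
Proof.
move=> m n /addIr E; apply/eqP; rewrite -(eqr_int C); apply/eqP.
by apply: (mulfI _ E); rewrite oppr_eq0 pnatr_eq0.
Qed.

Hypothesis sA : sp4_act.
Let lie := sA.1.

Lemma op_d_c X n u : sp4_c X -> op_d act u = dval n *: u ->
  op_d act (act X u) = dval (n + 1) *: act X u.
Proof.
move=> cX du; have [sX _ _] := cX.
rewrite {1}/op_d (act_br lie u (dX_sp4 C) sX) br_d_c // sA.2 // -/(op_d act u) du.
rewrite (act_Z lie) // -scalerDl; congr (_ *: _).
by rewrite /dval intrD; ring.
Qed.
Lemma op_d_b X n u : sp4_b X -> op_d act u = dval n *: u ->
  op_d act (act X u) = dval (n - 1) *: act X u.
Proof.
move=> cX du; have [sX _ _] := cX.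
rewrite {1}/op_d (act_br lie u (dX_sp4 C) sX) br_d_b // sA.2 // -/(op_d act u) du.
rewrite (act_Z lie) // -scalerDl; congr (_ *: _).
by rewrite /dval intrB; ring.
Qed.

Lemma graded_sub n0 : lsubspace (graded_from n0). Proof. exact: lspan_lsubspace. Qed.

Lemma graded_c n0 X u : sp4_c X -> graded_from n0 u -> graded_from (n0 + 1) (act X u).
Proof.
move=> cX; have [sX _ _] := cX.
apply: (lspan_lin (graded_sub _) (fun c u v => act_lin lie c u v sX)) => v [n [n0n dv]].
by apply: lspan_gen; exists (n + 1); split; [lia | exact: op_d_c].
Qed.

Lemma graded_eq0 n0 n u : n < n0 -> op_d act u = dval n *: u -> graded_from n0 u -> u = 0.
Proof.
move=> nn0 du gu.
have SE v : (exists m, n0 <= m /\ op_d act v = dval m *: v) -> exists r, op_d act v = r *: v.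
  by move=> [m [_ mE]]; exists (dval m).
have := lspan_eigen (op_d_lin lie) SE du gu; move: u {du gu}.
apply: lspan_min => [|v [[m [n0m dv]] dv']]; first exact: lsub_eq0.
apply/eqP; apply: contraT => v0.
have : (dval m - dval n) *: v = 0 by rewrite scalerBl -dv -dv' subrr.
move/eqP; rewrite scaler_eq0 (negbTE v0) orbF subr_eq0 => /eqP/dval_inj mn.
by move: n0m; rewrite mn leNgt nn0.
Qed.
End LowestVector.

Section LowestIso.
Variable C : numClosedFieldType.
Variables (V1 V2 : lmodType C).
Variables (act1 : 'M[C]_(2 + 2) -> V1 -> V1) (act2 : 'M[C]_(2 + 2) -> V2 -> V2).
Hypothesis (A1 : sp4_act act1) (A2 : sp4_act act2).
Variables (U1 : set V1) (U2 : set V2) (v1 : V1) (v2 : V2).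
Hypothesis (irr1 : irreducible_module (@sp4 C) act1 U1).
Hypothesis (irr2 : irreducible_module (@sp4 C) act2 U2).
Hypothesis (gr1 : U1 `<=` graded_from act1 1) (gr2 : U2 `<=` graded_from act2 1).
Hypothesis (Uv1 : U1 v1) (Uv2 : U2 v2) (v10 : v1 != 0) (v20 : v2 != 0).
Hypothesis (low1 : lowest act1 v1) (low2 : lowest act2 v2).

Definition act12 X (p : V1 * V2) : V1 * V2 := (act1 X p.1, act2 X p.2).

Lemma pairE (a : C) (u v : V1 * V2) : a *: u + v = (a *: u.1 + v.1, a *: u.2 + v.2).
Proof. by []. Qed.

Lemma act12_sp4 : sp4_act act12.
Proof.
have [[L1 D1 B1] Z1] := A1; have [[L2 D2 B2] Z2] := A2.
split; first split.
- by move=> X a u v gX; rewrite /act12 /= L1 // L2.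
- by move=> X Y u gX gY; rewrite /act12 /= D1 // D2.
- by move=> X Y u gX gY _; rewrite /act12 /= (B1 X Y _ gX gY I) (B2 X Y _ gX gY I).
by move=> c X u gX; rewrite /act12 /= Z1 // Z2.
Qed.
Let L12 := act12_sp4.1.
Let Z12 := act12_sp4.2.
Local Notation e := (op_e act12).
Local Notation f := (op_f act12).
Local Notation h := (op_h act12).
Local Notation d := (op_d act12).

Lemma iter_e12 i : iter i e (v1, v2) = (iter i (op_e act1) v1, iter i (op_e act2) v2).
Proof. by elim: i => //= i ->. Qed.

Lemma low12 : lowest act12 (v1, v2).
Proof.
have [f1 h1 d1 e1] := low1; have [f2 h2 d2 e2] := low2; split.
- by rewrite -[LHS]/(op_f act1 v1, op_f act2 v2) f1 f2.
- by rewrite -[LHS]/(op_h act1 v1, op_h act2 v2) h1 h2.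
- by rewrite -[LHS]/(op_d act1 v1, op_d act2 v2) d1 d2.
- by rewrite iter_e12 e1 e2.
Qed.

(** The string generated by (v1, v2) in the product module; its irreducibility makes it the graph of
    an isomorphism between the two lowest K-types. *)
Definition lowgraph : set (V1 * V2) := lspan (string e (v1, v2) 2).
Let sG : lsubspace lowgraph. Proof. exact: lspan_lsubspace. Qed.
Let ee := op_e_lin L12.
Let ff := op_f_lin L12.
Let hh := op_h_lin L12.
Let ef := o_ef L12 Z12.
Let he := o_he L12 Z12.

Lemma lowgraph_k X p : @sp4_k C X -> lowgraph p -> lowgraph (act12 X p).
Proof.
have [fv hv dv ev] := low12.
apply: (sp4k_closed L12 Z12 sG).
- exact: (string_e ee ev).
- exact: (string_f ee ff ef he fv hv ev).
- exact: (string_h ee hh he hv ev).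
- apply: (lspan_lin sG (op_d_lin L12)) => _ [i [iN ->]].
  rewrite (iter_comm (o_de L12 Z12)) dv.
  have eZ n (u : V1 * V2) : iter n e (dval C 1 *: u) = dval C 1 *: iter n e u.
    elim: n => //= n ->; exact: (phiZ (phi := fun _ : unit => e) (fun _ => ee) tt).
  by rewrite eZ; apply: (lsubZ _ sG); apply: lspan_gen; exists i.
Qed.

Lemma lowgraph_d p : lowgraph p -> d p = dval C 1 *: p.
Proof.
have [fv hv dv ev] := low12; have dl := op_d_lin L12.
move: p; apply: lspan_min => [|_ [i [iN ->]]].
  split=> [|a u v /= uE vE]; last by rewrite dl uE vE scalerDr !scalerA mulrC.
  have d0 := dl (-1) 0 0; rewrite scaler0 addr0 scaleN1r addNr in d0.
  by rewrite /= d0 scaler0.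
rewrite /= (iter_comm (o_de L12 Z12)) dv.
elim: i {iN} => //= i ->; exact: (phiZ (phi := fun _ : unit => e) (fun _ => ee) tt).
Qed.

(** The pairs with first member 0 form a stable subspace of an irreducible string, and not the whole
    of it because v1 is nonzero. *)
Lemma lowgraph_inj w : (lowgraph (0, w) -> w = 0).
Proof.
have [fv hv dv ev] := low12.
pose U := [set p | lowgraph p /\ p.1 = 0].
have sU : lsubspace U.
  split=> [|a u v [gu u0] [gv v0]]; first by split=> //; exact: lsub0 sG.
  by split; [exact: sG.2 | rewrite pairE /= u0 v0 scaler0 addr0].
have z1 X : sp4 X -> act1 X 0 = 0 by move=> sX; exact: act_0 A1.1 X sX.
have [||||U0|UG gw] := string_irreducible ee hh ef he fv hv sU.
- move=> u [gu u0]; split; first exact: (string_e ee ev).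
  by rewrite -[LHS]/(op_e act1 u.1) u0 /op_e z1 ?scaler0 //; exact: eX_sp4.
- move=> u [gu u0]; split; first exact: (string_f ee ff ef he fv hv ev).
  by rewrite -[LHS]/(op_f act1 u.1) u0 /op_f z1 ?scaler0 //; exact: fX_sp4.
- move=> u [gu u0]; split; first exact: (string_h ee hh he hv ev).
  by rewrite -[LHS]/(op_h act1 u.1) u0 /op_h z1 //; exact: hX_sp4.
- by move=> u [].
- move=> gw; have : U (0, w) by [].
  by rewrite U0 => -[].
have : U (v1, v2) by rewrite UG; apply: lspan_gen; exists 0%N.
by case=> _ /= v0; move: v10; rewrite v0 eqxx.
Qed.
Lemma lowgraph_inj' u : (lowgraph (u, 0) -> u = 0).
Proof.
have [fv hv dv ev] := low12.
pose U := [set p | lowgraph p /\ p.2 = 0].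
have sU : lsubspace U.
  split=> [|a x y [gx x0] [gy y0]]; first by split=> //; exact: lsub0 sG.
  by split; [exact: sG.2 | rewrite pairE /= x0 y0 scaler0 addr0].
have z2 X : sp4 X -> act2 X 0 = 0 by move=> sX; exact: act_0 A2.1 X sX.
have [||||U0|UG gw] := string_irreducible ee hh ef he fv hv sU.
- move=> x [gx x0]; split; first exact: (string_e ee ev).
  by rewrite -[LHS]/(op_e act2 x.2) x0 /op_e z2 ?scaler0 //; exact: eX_sp4.
- move=> x [gx x0]; split; first exact: (string_f ee ff ef he fv hv ev).
  by rewrite -[LHS]/(op_f act2 x.2) x0 /op_f z2 ?scaler0 //; exact: fX_sp4.
- move=> x [gx x0]; split; first exact: (string_h ee hh he hv ev).
  by rewrite -[LHS]/(op_h act2 x.2) x0 /op_h z2 //; exact: hX_sp4.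
- by move=> x [].
- move=> gw; have : U (u, 0) by [].
  by rewrite U0 => -[].
have : U (v1, v2) by rewrite UG; apply: lspan_gen; exists 0%N.
by case=> _ /= v0; move: v20; rewrite v0 eqxx.
Qed.

Let L1 : set V1 := [set u | exists w, lowgraph (u, w)].
Let L2 : set V2 := [set w | exists u, lowgraph (u, w)].
Let phi u : V2 := xget 0 [set w | lowgraph (u, w)].

Let phiG u : L1 u -> lowgraph (u, phi u).
Proof. by case=> w gw; exact (@xgetPex _ 0 [set w | lowgraph (u, w)] (ex_intro _ w gw)). Qed.
Let phi_uniq u w : lowgraph (u, w) -> phi u = w.
Proof.
move=> gw; have gphi : lowgraph (u, phi u) by apply: phiG; exists w.
have := sG.2 (-1) _ _ gw gphi; rewrite pairE /= scaleN1r addNr => /lowgraph_inj.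
by rewrite scaleN1r addrC => /eqP; rewrite subr_eq0 => /eqP.
Qed.

Lemma lowgraph_sub u w : lowgraph (u, w) -> U1 u /\ U2 w.
Proof.
have [[s1 g1] _ _] := irr1; have [[s2 g2] _ _] := irr2.
suff : lowgraph `<=` [set p | U1 p.1 /\ U2 p.2] by move/(_ (u, w)).
apply: lspan_min => [|_ [i [_ ->]]].
  split=> [|a p p' [? ?] [? ?]]; first by split; exact: lsub0.
  by split; [exact: s1.2 | exact: s2.2].
rewrite iter_e12 /=.
have [e1 _ _ _ _] := submodule_ops (conj s1 g1); have [e2 _ _ _ _] := submodule_ops (conj s2 g2).
by elim: i => //= i [? ?]; split; [exact: e1 | exact: e2].
Qed.

Theorem lowest_iso : isomorphic_modules (@sp4 C) act1 U1 act2 U2.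
Proof.
have [[s1 g1] _ _] := irr1; have [[s2 g2] _ _] := irr2.
have d1 u : L1 u -> op_d act1 u = dval C 1 *: u.
  by case=> w /lowgraph_d/(congr1 fst).
have d2 w : L2 w -> op_d act2 w = dval C 1 *: w.
  by case=> u /lowgraph_d/(congr1 snd).
(* The parts of higher degree are those of degree at least 2. Lowering the lowest K-type leads to
   degree 0, where both modules vanish. *)
apply: (@lowest_weight_iso C (@sp4 C) (@sp4_k C) (@sp4_b C) (@sp4_c C) V1 V2 act1 act2
  U1 L1 (graded_from act1 (1 + 1)) U2 L2 (graded_from act2 (1 + 1)) phi).
- by move=> X [].
- by move=> X [].
- by move=> X [].
- exact: sp4_dec.
- exact: sp4D.
- exact: sp4_kc.
- exact: sp4_bc.
- by have [[a b c] _] := A1; split=> // X Y u gX gY _; exact: c.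
- by have [[a b c] _] := A2; split=> // X Y u gX gY _; exact: c.
- exact: irr1.
- exact: irr2.
- by move=> u [w /lowgraph_sub[]].
- split=> [|a u v [w gu] [w' gv]]; first by exists 0; exact: lsub0 sG.
  by exists (a *: w + w'); have := sG.2 a _ _ gu gv; rewrite pairE.
- exact: graded_sub.
- exact: graded_sub.
- by move=> u /d1 du; apply: (graded_eq0 A1 _ du).
- move=> u Lu gphi; have gu := phiG Lu.
  have p0 : phi u = 0 by apply: (graded_eq0 A2 _ (d2 _ _) gphi) => //; exists u.
  by rewrite p0 in gu; exact: lowgraph_inj' gu.
- exists v1; last exact/eqP.
  by exists v2; apply: lspan_gen; exists 0%N.
- by move=> u Lu; exists u; exact: phiG.
- by move=> w [u /lowgraph_sub[]].
- move=> a u v Lu Lv; apply: phi_uniq.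
  by have := sG.2 a _ _ (phiG Lu) (phiG Lv); rewrite pairE.
- by move=> X u kX [w gw]; exists (act2 X w); exact: (lowgraph_k kX gw).
- by move=> X u kX Lu; apply: phi_uniq; exact: (lowgraph_k kX (phiG Lu)).
- move=> X u bX Lu; have [sX _ _] := bX.
  apply: (graded_eq0 A1 (n0 := 1) _ (op_d_b A1 bX (d1 _ Lu))) => //.
  by apply: gr1; apply: g1 => //; case: Lu => w /lowgraph_sub[].
- move=> X w bX Lw; have [sX _ _] := bX.
  apply: (graded_eq0 A2 (n0 := 1) _ (op_d_b A2 bX (d2 _ Lw))) => //.
  by apply: gr2; apply: g2 => //; case: Lw => u /lowgraph_sub[].
- by move=> X u cX /gr1; exact: graded_c.
- by move=> X u cX /gr2; exact: graded_c.
Qed.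
End LowestIso.

(** * Doubly regular functions *)

Section DoublyRegularSymbols.
Variable K : fieldType.
Variables (p : 'I_2 -> 'I_2 -> K -> K) (Z : 'M[K]_2).
Hypothesis pD : forall i j, derivation (p i j).
Hypothesis pC : forall i j k l x, p i j (p k l x) = p k l (p i j x).
Hypothesis pZ : forall i j k l, p i j (Z k l) = ((i == k) && (j == l))%:R.
Let d i j := p j i.
Implicit Types (A B L D f : 'M[K]_2).

(** The equation of nabla^+ in the first tensor factor: it exchanges the column index of the
    derivative with the index of f, the row index i being free. *)
Definition dreg f := forall i b, p i 1 (f 0 b) = p i 0 (f 1 b).
Definition pcst A := forall i j k l, p i j (A k l) = 0.

Lemma p_nuX L D i j k l : pcst L -> pcst D ->
  p i j (nuX Z L D k l) = L k i * (j == l)%:R.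
Proof.
move=> cL cD; rewrite /nuX; do 2!rewrite ?mxE ?sum2.
rewrite !(derD_add (pD _ _)) !(derD_mul (pD _ _)) !pZ cD !cL.
move: i j l; apply: ord2P; apply: ord2P; apply: ord2P; rewrite /=; ring.
Qed.

Lemma p_xiX A B L D i j k l : pcst A -> pcst B -> pcst L -> pcst D ->
  p i j (xiX Z A B L D k l) =
  (k == i)%:R * nuX Z L D j l + (Z *m L - A) k i * (j == l)%:R.
Proof.
move=> cA cB cL cD; rewrite /xiX /nuX; do 3!rewrite ?mxE ?sum2.
rewrite !(derDB (pD _ _)) !(derD_add (pD _ _)) !(derD_mul (pD _ _)).
do 3!rewrite ?mxE ?sum2.
rewrite !(derD_add (pD _ _)) !(derD_mul (pD _ _)) !pZ !cA !cB !cL !cD.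
move: i j k l; apply: ord2P; apply: ord2P; apply: ord2P; apply: ord2P; rewrite /=; ring.
Qed.

Section Act.
Variables (A B L D f : 'M[K]_2).
Hypothesis (cA : pcst A) (cB : pcst B) (cL : pcst L) (cD : pcst D).
Hypothesis (fs : f 1 0 = f 0 1) (fD : dreg f).
Let xi := xiX Z A B L D.
Let nu := nuX Z L D.
Let mu := Z *m L - A.

Lemma p_dv i j x : p i j (dv xi d x) = dv xi d (p i j x)
  + (nu j 0 * p i 0 x + nu j 1 * p i 1 x) + (mu 0 i * p 0 j x + mu 1 i * p 1 j x).
Proof.
rewrite /dv !sum2 /d !(derD_add (pD _ _)) !(derD_mul (pD _ _)) !p_xiX // -/nu -/mu.
rewrite !(pC i j).
by move: i j; apply: ord2P; apply: ord2P; rewrite /=; ring.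
Qed.

(** By [p_dv], passing a derivative through the field turns its column index by [nu], in accordance
    with the multiplier on f, and its row index by [mu], in which the equations are uniform. The
    terms where [nu] is differentiated agree on both sides because f is symmetric and the trace has
    coefficient 1. *)
Lemma dreg_Lop : dreg (Lop d 1 xi nu f).
Proof.
have D0 i : p i 1 (f 0 0) = p i 0 (f 0 1) by rewrite fD fs.
have D1 i : p i 1 (f 0 1) = p i 0 (f 1 1) by rewrite fD.
have pnu i j k l : p i j (nu k l) = L k i * (j == l)%:R by exact: p_nuX.
have dvD := dv_derivation (fun i j => pD j i).
have E c b : Lop d 1 xi nu f c b = dv xi d (f c b) + (nu 0 0 + nu 1 1) * f c b
   + (nu c 0 * f 0 b + nu c 1 * f 1 b) + (f c 0 * nu b 0 + f c 1 * nu b 1).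
  by rewrite /Lop /mxtrace; do 3!rewrite ?mxE ?sum2; rewrite mul1r.
move=> i b; rewrite !E !(derD_add (pD _ _)) !p_dv !(derD_mul (pD _ _)) !(derD_add (pD _ _)).
rewrite !pnu /=; move: b; apply: ord2P; rewrite ?fs !D0 !D1 ?fs; ring.
Qed.
End Act.

Definition euler x := \sum_i \sum_j Z i j * p i j x.

Lemma eulerE x : euler x = \sum_i \sum_j Z i j * p i j x. Proof. by []. Qed.

Lemma p_euler i j x : p i j (euler x) = euler (p i j x) + p i j x.
Proof.
rewrite /euler !sum2 !(derD_add (pD _ _)) !(derD_mul (pD _ _)) !pZ !(pC i j).
by move: i j; apply: ord2P; apply: ord2P; rewrite /=; ring.
Qed.

Lemma euler_casimir f c b : f 1 0 = f 0 1 -> dreg f ->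
  \sum_i \sum_j Lop d 1 (xiX Z 0 0 (delta_mx j i) 0) (nuX Z (delta_mx j i) 0)
    (map_mx (p i j) f) c b = euler (euler (f c b)) + 2 * euler (f c b).
Proof.
move=> fs fD.
have D0 i : p i 1 (f 0 0) = p i 0 (f 0 1) by rewrite fD fs.
have D1 i : p i 1 (f 0 1) = p i 0 (f 1 1) by rewrite fD.
(* The components of a doubly regular function are harmonic. *)
have S2 c' b' : p 0 0 (p 1 1 (f c' b')) = p 0 1 (p 1 0 (f c' b')).
  move: c' b'; apply: ord2P; apply: ord2P; rewrite ?fs.
  - by rewrite D0 pC -D0 pC.
  - by rewrite D1 pC -D1 pC.
  - by rewrite D1 pC -D1 pC.
  - by rewrite pC -D1 pC D1.
rewrite /xiX /nuX !(mul0mx, mulmx0, addr0, subr0).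
have eul x : euler (euler x) = Z 0 0 * (p 0 0 x + euler (p 0 0 x)) + Z 0 1 * (p 0 1 x + euler (p 0 1 x))
   + Z 1 0 * (p 1 0 x + euler (p 1 0 x)) + Z 1 1 * (p 1 1 x + euler (p 1 1 x)).
  by rewrite {1}/euler !sum2 !p_euler; ring.
rewrite eul /euler /Lop /mxtrace /dv /d; do 4!rewrite ?mxE ?sum2.
do 4!rewrite ?mxE ?sum2.
rewrite (pC 1 1 0 0) (pC 1 0 0 1) (pC 1 0 0 0) (pC 0 1 0 0) (pC 1 1 0 1) (pC 1 1 1 0).
rewrite ?S2; move: c b; apply: ord2P; apply: ord2P; rewrite /= ?fs ?D0 ?D1; try ring.
Qed.
End DoublyRegularSymbols.

Section PiDl.
Variable C : numClosedFieldType.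
Local Notation n4 := (2 * 2)%N.
Local Notation F4 := (ratfun C (2 * 2)).
Local Notation V := (tens C (2 * 2)).
Local Notation Zg := (@Zg C).
Local Notation pdz := (@pdz C).
Local Notation delg := (@delg C).
Local Notation cmx := (@cmx (2 * 2) C).
Local Notation rcst := (@rcst C (2 * 2)).
Local Notation pi := (@pi_dl C).

Lemma pi_dl_Lop_eq (K : fieldType) (t : 'I_2 -> 'I_2 -> K -> K) (Z A B L D f : 'M[K]_2) :
  - map_mx (dv (A *m Z) t) f - map_mx (dv B t) f
  + (map_mx (dv (Z *m L *m Z) t) f + \tr (L *m Z) *: f + L *m Z *m f + f *m (L *m Z)^T)
  + (map_mx (dv (Z *m D) t) f + \tr D *: f + D *m f + f *m D^T) =
  Lop t 1 (xiX Z A B L D) (nuX Z L D) f.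
Proof.
rewrite /Lop /xiX /nuX; apply/matrixP => i j; rewrite /mxtrace /dv.
do 5!rewrite ?mxE ?sum2.
ring.
Qed.

Definition xiG (X : 'M[C]_(2 + 2)) : 'M[F4]_2 := xiX Zg (cmx (ulsubmx X)) (cmx (ursubmx X)) (cmx (dlsubmx X)) (cmx (drsubmx X)).
Definition nuG (X : 'M[C]_(2 + 2)) : 'M[F4]_2 := nuX Zg (cmx (dlsubmx X)) (cmx (drsubmx X)).

Lemma pi_dl_Lop X (f : V) : pi X f = Lop delg 1 (xiG X) (nuG X) f.
Proof.
exact (pi_dl_Lop_eq delg Zg (cmx (ulsubmx X)) (cmx (ursubmx X)) (cmx (dlsubmx X)) (cmx (drsubmx X)) f).
Qed.

Lemma ZgE i j : Zg i j = var C (mxvec_index i j).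
Proof. by rewrite /Zg !mxE. Qed.
Lemma mxvec_index_eq i j k l : (@mxvec_index 2 2 i j == mxvec_index k l) = (i == k) && (j == l).
Proof. by rewrite /mxvec_index (inj_eq (@cast_ord_inj _ _ _)) (inj_eq enum_rank_inj) xpair_eqE. Qed.
Lemma pdz_der i j : derivation (pdz i j). Proof. exact: pd_derivation. Qed.
Lemma pdz_comm i j k l x : pdz i j (pdz k l x) = pdz k l (pdz i j x). Proof. exact: pd_comm. Qed.
Lemma pdz_rcst i j c : pdz i j (rcst c) = 0. Proof. exact: pd_rcst. Qed.
Lemma pdz_Zg i j k l : pdz i j (Zg k l) = ((i == k) && (j == l))%:R.
Proof. by rewrite ZgE /pdz pd_var mxvec_index_eq. Qed.
Lemma cmx_pcst A : pcst pdz (cmx A). Proof. by move=> i j k l; rewrite mxE pdz_rcst. Qed.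
Lemma cmx_cst4 A : cst_mx delg (cmx A). Proof. by move=> i j k l; rewrite mxE /delg pdz_rcst. Qed.
Lemma delg_der i j : derivation (delg i j). Proof. exact: pdz_der. Qed.
Lemma delg_comm i j k l x : delg i j (delg k l x) = delg k l (delg i j x). Proof. exact: pdz_comm. Qed.
Lemma delg_twisted i j : twisted_derivation (delg i j) (delg i j). Proof. exact: delg_der. Qed.
Lemma delg_1 i j : delg i j 1 = 0. Proof. exact: derD1 (delg_der i j). Qed.
Lemma delg_Zg (xi : 'M[F4]_2) : map_mx (dv xi delg) Zg = xi.
Proof.
apply/matrixP => k l; rewrite mxE /dv /delg !sum2 !pdz_Zg.
by move: k l; apply: ord2P; apply: ord2P; rewrite /= ?(mulr0, mulr1, addr0, add0r).
Qed.

Lemma pi_dl_lie g (U : set V) : lie_module g pi U.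
Proof.
split=> [X a u v _|X Y u _ _|X Y u _ _ _].
- rewrite !pi_dl_Lop !tens_scaleE.
  exact (@Lop_linear F4 _ _ _ delg_twisted (xiG X) (nuG X) _ u v (fun i j => pdz_rcst j i a)).
- rewrite !pi_dl_Lop /xiG /nuG ulsubD ursubD dlsubD drsubD !cmxD xiXD nuXD.
  exact (Lop_addX delg 1 (xiG X) (xiG Y) (nuG X) (nuG Y) u).
rewrite !pi_dl_Lop.
have E := nuX_act_comm delg_der delg_twisted delg_comm delg_1
  (cmx_cst4 (ulsubmx X)) (cmx_cst4 (ursubmx X)) (cmx_cst4 (dlsubmx X)) (cmx_cst4 (drsubmx X))
  (cmx_cst4 (ulsubmx Y)) (cmx_cst4 (ursubmx Y)) (cmx_cst4 (dlsubmx Y)) (cmx_cst4 (drsubmx Y))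
  (delg_Zg (xiG X)) (delg_Zg (xiG Y)) u.
have xE : xiG (X *m Y - Y *m X) = xiX Zg
  (cmx (ulsubmx X) *m cmx (ulsubmx Y) + cmx (ursubmx X) *m cmx (dlsubmx Y)
   - (cmx (ulsubmx Y) *m cmx (ulsubmx X) + cmx (ursubmx Y) *m cmx (dlsubmx X)))
  (cmx (ulsubmx X) *m cmx (ursubmx Y) + cmx (ursubmx X) *m cmx (drsubmx Y)
   - (cmx (ulsubmx Y) *m cmx (ursubmx X) + cmx (ursubmx Y) *m cmx (drsubmx X)))
  (cmx (dlsubmx X) *m cmx (ulsubmx Y) + cmx (drsubmx X) *m cmx (dlsubmx Y)
   - (cmx (dlsubmx Y) *m cmx (ulsubmx X) + cmx (drsubmx Y) *m cmx (dlsubmx X)))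
  (cmx (dlsubmx X) *m cmx (ursubmx Y) + cmx (drsubmx X) *m cmx (drsubmx Y)
   - (cmx (dlsubmx Y) *m cmx (ursubmx X) + cmx (drsubmx Y) *m cmx (drsubmx X))).
  rewrite /xiG ulsubB ursubB dlsubB drsubB !ulsub_mul !ursub_mul !dlsub_mul !drsub_mul.
  by rewrite !cmxB !cmxD !cmxM.
have nE : nuG (X *m Y - Y *m X) = nuX Zg
  (cmx (dlsubmx X) *m cmx (ulsubmx Y) + cmx (drsubmx X) *m cmx (dlsubmx Y)
   - (cmx (dlsubmx Y) *m cmx (ulsubmx X) + cmx (drsubmx Y) *m cmx (dlsubmx X)))
  (cmx (dlsubmx X) *m cmx (ursubmx Y) + cmx (drsubmx X) *m cmx (drsubmx Y)
   - (cmx (dlsubmx Y) *m cmx (ursubmx X) + cmx (drsubmx Y) *m cmx (drsubmx X))).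
  rewrite /nuG dlsubB drsubB !dlsub_mul !drsub_mul.
  by rewrite !cmxB !cmxD !cmxM.
rewrite xE nE; exact E.
Qed.

Lemma cmxZ4 c (A : 'M[C]_2) : cmx (c *: A) = rcst c *: cmx A.
Proof. by apply/matrixP => i j; rewrite !mxE rcstM. Qed.

Lemma pi_dl_scale (c : C) X (u : V) : pi (c *: X) u = c *: pi X u.
Proof.
rewrite !pi_dl_Lop tens_scaleE -Lop_scaleX.
have ur : ursubmx (c *: X) = c *: ursubmx X by apply/matrixP => i j; rewrite !mxE.
have dl : dlsubmx (c *: X) = c *: dlsubmx X by apply/matrixP => i j; rewrite !mxE.
have dr : drsubmx (c *: X) = c *: drsubmx X by apply/matrixP => i j; rewrite !mxE.
have ul : ulsubmx (c *: X) = c *: ulsubmx X by apply/matrixP => i j; rewrite !mxE.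
have -> : xiG (c *: X) = rcst c *: xiG X by rewrite /xiG ur dl dr ul !cmxZ4 xiX_scale.
have -> : nuG (c *: X) = rcst c *: nuG X by rewrite /nuG dl dr !cmxZ4 nuX_scale.
by [].
Qed.

Lemma pi_dl_sp4 : sp4_act pi.
Proof. by split=> [|c X u _]; [exact: pi_dl_lie | exact: pi_dl_scale]. Qed.

Lemma poly_add (x y : F4) : is_poly x -> is_poly y -> is_poly (x + y).
Proof. by move=> [p ->] [q ->]; exists (p + q); rewrite ofpD. Qed.
Lemma poly_mul (x y : F4) : is_poly x -> is_poly y -> is_poly (x * y).
Proof. by move=> [p ->] [q ->]; exists (p * q); rewrite ofpM. Qed.
Lemma poly_opp (x : F4) : is_poly x -> is_poly (- x).
Proof. by move=> [p ->]; exists (- p); rewrite ofpN. Qed.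
Lemma poly_rcst c : is_poly (rcst c). Proof. by exists c%:MP. Qed.
Lemma poly_Zg i j : is_poly (Zg i j). Proof. by exists 'X_(mxvec_index i j); rewrite ZgE. Qed.
Lemma poly_pdz i j (x : F4) : is_poly x -> is_poly (pdz i j x).
Proof. by move=> [p ->]; exists p^`M(mxvec_index i j); rewrite /pdz pd_ofp. Qed.
Definition poly_mx (f : 'M[F4]_2) := forall i j, is_poly (f i j).
Lemma polymx_add f g : poly_mx f -> poly_mx g -> poly_mx (f + g).
Proof. by move=> hf hg i j; rewrite mxE; exact: poly_add. Qed.
Lemma polymx_opp f : poly_mx f -> poly_mx (- f).
Proof. by move=> hf i j; rewrite mxE; exact: poly_opp. Qed.
Lemma polymx_mul f g : poly_mx f -> poly_mx g -> poly_mx (f *m g).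
Proof. by move=> hf hg i j; rewrite mxE sum2; apply: poly_add; apply: poly_mul. Qed.
Lemma polymx_tr f : poly_mx f -> poly_mx f^T. Proof. by move=> hf i j; rewrite mxE. Qed.
Lemma polymx_cmx A : poly_mx (cmx A). Proof. by move=> i j; rewrite mxE; exact: poly_rcst. Qed.
Lemma polymx_Zg : poly_mx Zg. Proof. exact: poly_Zg. Qed.
Lemma polymx_Lop xi nu f : poly_mx xi -> poly_mx nu -> poly_mx f -> poly_mx (Lop delg 1 xi nu f).
Proof.
move=> hx hn hf; apply: polymx_add; last by apply: polymx_mul => //; exact: polymx_tr.
apply: polymx_add; last exact: polymx_mul.
apply: polymx_add => i j.
  rewrite mxE /dv !sum2 /delg; by do 2!apply: poly_add; apply: poly_mul; first [exact: hx | apply: poly_pdz; exact: hf].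
by rewrite mxE mul1r /mxtrace sum2; apply: poly_mul; [apply: poly_add; exact: hn | exact: hf].
Qed.
Lemma polymx_xiG X : poly_mx (xiG X).
Proof.
have hZ := polymx_Zg; have hc := polymx_cmx.
apply: polymx_add; last by apply: polymx_opp.
apply: polymx_add; last by apply: polymx_opp; exact: polymx_mul.
by apply: polymx_add; do ?apply: polymx_mul.
Qed.
Lemma polymx_nuG X : poly_mx (nuG X).
Proof. by apply: polymx_add; [apply: polymx_mul; [exact: polymx_cmx | exact: polymx_Zg] | exact: polymx_cmx]. Qed.

Lemma two4_neq0 : (2 : F4) != 0.
Proof. by rewrite -(rcst_nat C n4 2) rcst_eq0 pnatr_eq0. Qed.

Lemma half_eq (K : fieldType) (x y : K) : (2 : K) != 0 -> (2 * x + - (2 * y) = 0) <-> (x = y).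
Proof.
move=> two; split=> [/eqP|->]; last by rewrite subrr.
by rewrite subr_eq0 => /eqP /(mulfI two).
Qed.
Lemma half_eqN (K : fieldType) (x y : K) : (2 : K) != 0 -> (- (2 * x) + 2 * y = 0) <-> (x = y).
Proof.
move=> two; rewrite addrC; split=> [/half_eq H|->]; last by rewrite subrr.
by rewrite H.
Qed.

(** For a symmetric tensor the equations in the two factors coincide, so one of them is kept. *)
Lemma FplusE (f : V) : Fplus f <-> [/\ (f : 'M_2)^T = f, poly_mx f & dreg pdz f].
Proof.
have tr1 b : (\sum_c nabla 1 c (f c b) = 0) <-> (pdz 0 1 (f 0 b) = pdz 0 0 (f 1 b)).
  by rewrite sum2; exact: half_eqN two4_neq0.
have tr0 b : (\sum_c nabla 0 c (f c b) = 0) <-> (pdz 1 1 (f 0 b) = pdz 1 0 (f 1 b)).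
  by rewrite sum2; exact: half_eq two4_neq0.
split=> [[fT fp f1 f2]|[fT fp fD]]; split=> //.
- by apply: ord2P => b; [apply/tr1; exact: f1 | apply/tr0; exact: f1].
- by apply: ord2P => b; [apply/tr0; exact: fD | apply/tr1; exact: fD].
- have fs a c : f a c = f c a by rewrite -{1}fT mxE.
  move=> a b; under eq_bigr => c _ do rewrite (fs a c).
  by move: b a; apply: ord2P => a; [apply/tr0; exact: fD | apply/tr1; exact: fD].
Qed.

Lemma Lop_sym (t : 'I_2 -> 'I_2 -> F4 -> F4) xi nu (f : 'M[F4]_2) : f^T = f ->
  (Lop t 1 xi nu f)^T = Lop t 1 xi nu f.
Proof.
move=> fT; rewrite /Lop !trD linearZ /= !trmx_mul trmxK fT map_trmx fT.
by rewrite -!addrA; congr (_ + (_ + _)); rewrite addrC.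
Qed.

Lemma Fplus_pi X (f : V) : Fplus f -> Fplus (pi X f).
Proof.
move=> /FplusE[fT fp fD]; apply/FplusE; rewrite pi_dl_Lop; split.
- exact: Lop_sym.
- by apply: polymx_Lop => //; [exact: polymx_xiG | exact: polymx_nuG].
have fs : f 1 0 = f 0 1 by rewrite -[in LHS]fT mxE.
exact (dreg_Lop pdz_der pdz_comm pdz_Zg (cmx_pcst (ulsubmx X)) (cmx_pcst (ursubmx X))
  (cmx_pcst (dlsubmx X)) (cmx_pcst (drsubmx X)) fs fD).
Qed.

Lemma Fplus_sub : lsubspace (@Fplus C).
Proof.
split=> [|a u v /FplusE[uT up uD] /FplusE[vT vp vD]]; apply/FplusE.
  split=> [|i j|i b]; first by rewrite trmx0.
    by rewrite mxE; exists 0; rewrite ofp0.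
  by rewrite !mxE (derD0 (pdz_der _ _)) (derD0 (pdz_der _ _)).
rewrite tens_addE tens_scaleE; split=> [|i j|i b].
- by apply/matrixP => i j; rewrite !mxE -{1}uT -{1}vT !mxE.
- rewrite !mxE; apply: poly_add => //; apply: poly_mul => //; exact: poly_rcst.
rewrite !mxE !(derD_add (pdz_der _ _)) !(derD_mul (pdz_der _ _)) !pdz_rcst uD vD !mul0r.
reflexivity.
Qed.
End PiDl.

Section ConstantAction.
Variable K : fieldType.
(** sp(4) has only symmetric blocks C, while [euler_casimir] sums over all of them. On a constant
    tensor the antisymmetric block acts as a sum of symmetric ones applied to other constant
    tensors. *)
Lemma JC_identity (a b c d p q s : K) :
  let Z := mx2 a b c d in
  let act L S := \tr (L *m Z) *: S + L *m Z *m S + S *m (L *m Z)^T in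
  act (mx2 0 1 (- 1) 0) (mx2 p q q s) =
  act (mx2 0 1 1 0) (mx2 p 0 0 (- s)) + act (mx2 1 0 0 0) (mx2 0 (- p) (- p) (- (2 * q)))
  + act (mx2 0 0 0 1) (mx2 (2 * q) s s 0).
Proof.
move=> Z act; rewrite /act /Z /mxtrace; apply: matrix2P;
  do 4!rewrite ?mxE ?sum2 ?ent2E; rewrite ?ent2E; ring.
Qed.
Lemma fA_identity (p q s : K) (A := mx2 0 1 0 0) (S := mx2 p q q s) :
  \tr (- A^T) *: S + (- A^T) *m S + S *m (- A^T)^T = mx2 0 (- p) (- p) (- (2 * q)).
Proof.
rewrite /A /S /mxtrace; apply: matrix2P; do 4!rewrite ?mxE ?sum2 ?ent2E; rewrite ?ent2E; ring.
Qed.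
Lemma eA_identity (p q s : K) (A := mx2 0 0 1 0) (S := mx2 p q q s) :
  \tr (- A^T) *: S + (- A^T) *m S + S *m (- A^T)^T = mx2 (- (2 * q)) (- s) (- s) 0.
Proof.
rewrite /A /S /mxtrace; apply: matrix2P; do 4!rewrite ?mxE ?sum2 ?ent2E; rewrite ?ent2E; ring.
Qed.
Lemma hA_identity (p q s : K) (A := mx2 1 0 0 (- 1)) (S := mx2 p q q s) :
  \tr (- A^T) *: S + (- A^T) *m S + S *m (- A^T)^T = mx2 (- (2 * p)) 0 0 (2 * s).
Proof.
rewrite /A /S /mxtrace; apply: matrix2P; do 4!rewrite ?mxE ?sum2 ?ent2E; rewrite ?ent2E; ring.
Qed.
Lemma dA_identity (p q s : K) (A := mx2 1 0 0 1) (S := mx2 p q q s) :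
  \tr (- A^T) *: S + (- A^T) *m S + S *m (- A^T)^T = (- 4) *: S.
Proof.
rewrite /A /S /mxtrace; apply: matrix2P; do 4!rewrite ?mxE ?sum2 ?ent2E; rewrite ?ent2E; ring.
Qed.
Lemma euler_lin (r a b c d a1 b1 c1 d1 a2 b2 c2 d2 : K) :
  a * (a1 - r * a2) + b * (b1 - r * b2) + (c * (c1 - r * c2) + d * (d1 - r * d2)) =
  a * a1 + b * b1 + (c * c1 + d * d1) - r * (a * a2 + b * b2 + (c * c2 + d * d2)).
Proof. ring. Qed.
Lemma euler_factor (m x e ee : K) :
  m * (m + 2) * x - (ee + 2 * e) = - (ee - m * e + (m + 2) * (e - m * x)).
Proof. ring. Qed.
End ConstantAction.

(** * Generation of F+ by its constants, and irreducibility *)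

Section FplusModule.
Variable C : numClosedFieldType.
Local Notation F4 := (ratfun C (2 * 2)).
Local Notation V := (tens C (2 * 2)).
Local Notation Zg := (@Zg C).
Local Notation pdz := (@pdz C).
Local Notation delg := (@delg C).
Local Notation cmx := (@cmx (2 * 2) C).
Local Notation rcst := (@rcst C (2 * 2)).
Local Notation pi := (@pi_dl C).
Local Notation Fp := (@Fplus C).
Local Notation pact := (@pi_dl_sp4 C).

Let cst S : V := cmx S.

Lemma pi_cst X S : pi X (cst S) =
  \tr (nuG X) *: (cmx S) + nuG X *m cmx S + cmx S *m (nuG X)^T.
Proof.
rewrite pi_dl_Lop /Lop mul1r.
have -> : map_mx (dv (xiG X) delg) (cst S) = 0.
  apply/matrixP => i j; rewrite !mxE; apply: dv_cst => k l.
  exact: (pdz_rcst).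
by rewrite add0r.
Qed.

Lemma cmx_tr (A : 'M[C]_2) : \tr (cmx A) = rcst (\tr A).
Proof. by rewrite /mxtrace !sum2 !mxE rcstD. Qed.

Lemma pi_A A S : pi (spm A 0 0) (cst S) =
  cst (\tr (- A^T) *: S + (- A^T) *m S + S *m (- A^T)^T).
Proof.
rewrite pi_cst /nuG /spm block_mxKdl block_mxKdr.
have -> : nuX Zg (cmx 0) (cmx (- A^T)) = cmx (- A^T).
  have -> : cmx 0 = 0 by apply/matrixP => i j; rewrite !mxE rcst0.
  by rewrite /nuX mul0mx add0r.
by rewrite /cst cmxD cmxD cmxZ4 !cmxM -cmxT cmx_tr.
Qed.

Lemma pi_C L S : pi (spm 0 0 L) (cst S) =
  \tr (cmx L *m Zg) *: cmx S + cmx L *m Zg *m cmx S + cmx S *m (cmx L *m Zg)^T.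
Proof.
rewrite pi_cst /nuG /spm block_mxKdl block_mxKdr.
suff -> : nuX Zg (cmx L) (cmx (- 0^T)) = cmx L *m Zg by [].
have -> : cmx (- 0^T) = 0 by apply/matrixP => i j; rewrite !mxE oppr0 rcst0.
by rewrite /nuX addr0.
Qed.

Lemma cmx_mx24 (a b c d : C) : cmx (mx2 a b c d) = mx2 (rcst a) (rcst b) (rcst c) (rcst d).
Proof. by apply: matrix2P; rewrite !mxE. Qed.

Lemma cst_J p q s : pi (spm 0 0 (mx2 0 1 (- 1) 0)) (cst (mx2 p q q s)) =
  pi (spm 0 0 (mx2 0 1 1 0)) (cst (mx2 p 0 0 (- s)))
  + pi (spm 0 0 (mx2 1 0 0 0)) (cst (mx2 0 (- p) (- p) (- (2 * q))))
  + pi (spm 0 0 (mx2 0 0 0 1)) (cst (mx2 (2 * q) s s 0)).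
Proof.
rewrite !pi_C !cmx_mx24 !rcstN rcst0 rcst1 rcstM rcst_nat.
have -> : Zg = mx2 (Zg 0 0) (Zg 0 1) (Zg 1 0) (Zg 1 1) by apply: matrix2P; rewrite [RHS]mxE.
exact: JC_identity.
Qed.

Lemma cst_inj S : cst S = 0 -> S = 0.
Proof.
move=> /matrixP E; apply/matrixP => i j; have := E i j; rewrite !mxE => /eqP.
by rewrite rcst_eq0 => /eqP.
Qed.
Lemma cst_lin (a : C) S T : a *: cst S + cst T = cst (a *: S + T).
Proof. by rewrite tens_addE tens_scaleE /cst cmxD cmxZ4. Qed.

Lemma Fplus_cst S : S^T = S -> Fp (cst S).
Proof.
move=> ST; apply/FplusE; split; first by rewrite /cst cmxT ST.
  exact: polymx_cmx.
by move=> i b; rewrite !mxE !pdz_rcst.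
Qed.

Lemma mderiv_eq0 n (p : {mpoly C[n]}) : (forall i, p^`M(i) = 0) -> p = (p@_0)%:MP.
Proof.
move=> dp; apply/eqP; rewrite -subr_eq0; apply/eqP.
apply: (mderiv_closed_eq0 (P := fun q => (forall i, q^`M(i) = 0) /\ q@_0 = 0)).
- by move=> q i [dq _]; rewrite dq; split=> [j|]; rewrite ?mderiv0 ?mcoeff0.
- by move=> c [_]; rewrite mcoeffC eqxx mulr1.
- split=> [i|]; first by rewrite mderivB mderivC subr0.
  by rewrite mcoeffB mcoeffC eqxx mulr1 subrr.
Qed.

Lemma index_pair (k : 'I_(2 * 2)) : exists i j, k = mxvec_index i j.
Proof. by case/mxvec_indexP: k => i j; exists i, j. Qed.

Lemma pdz_eq0 (x : F4) : is_poly x -> (forall i j, pdz i j x = 0) -> exists c, x = rcst c.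
Proof.
move=> [p ->] dx; exists p@_0; rewrite {1}(@mderiv_eq0 _ p) // => k.
have [i [j ->]] := index_pair k.
have := dx i j; rewrite /pdz pd_ofp => E; apply: (@ofp_inj C (2 * 2)); rewrite ofp0; exact: E.
Qed.

Definition dF i j (f : V) : V := map_mx (pdz i j) (f : 'M[F4]_2).

Lemma Fplus_const f : Fp f -> (forall i j, dF i j f = 0) -> exists2 S, S^T = S & f = cst S.
Proof.
move=> /FplusE[fT fp _] df.
have H a b : exists c, f a b = rcst c.
  apply: pdz_eq0 => // i j; have /matrixP/(_ a b) := df i j; rewrite !mxE; exact: id.
have [p pE] := H 0 0; have [q qE] := H 0 1; have [s sE] := H 1 1.
exists (mx2 p q q s); first by apply: matrix2P; rewrite !mxE.
rewrite /cst cmx_mx24; apply: matrix2P; rewrite [RHS]mxE ?ent2E //.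
by rewrite -fT mxE qE.
Qed.

Lemma pi_B B (f : V) : pi (spm 0 B 0) f =
  map_mx (fun x => - (\sum_i \sum_j rcst (B i j) * pdz i j x)) (f : 'M[F4]_2).
Proof.
rewrite pi_dl_Lop /xiG /nuG /spm block_mxKul block_mxKur block_mxKdl block_mxKdr.
have c0 : cmx 0 = 0 by apply/matrixP => i j; rewrite !mxE rcst0.
rewrite trmx0 oppr0 c0 /xiX /nuX !(mul0mx, mulmx0, addr0, add0r, subr0, sub0r).
rewrite /Lop mul1r mxtrace0 scale0r mul0mx trmx0 mulmx0 !addr0 dv_opp.
apply/matrixP => a b; rewrite !mxE /dv /delg; congr (- _).
by apply: eq_bigr => i _; apply: eq_bigr => j _; rewrite mxE.
Qed.

Lemma dF_pi i j f : dF i j f = pi (spm 0 (- delta_mx i j) 0) f.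
Proof.
rewrite pi_B; apply/matrixP => a b; rewrite !mxE.
rewrite (bigD1 i) //= (bigD1 j) //= !mxE !eqxx /= [X in _ + X + _]big1 ?addr0; last first.
  by move=> l lj; rewrite !mxE eqxx (negbTE lj) oppr0 rcst0 mul0r.
rewrite [X in _ + X]big1 ?addr0; first by rewrite rcstN rcst1 mulN1r opprK.
move=> k ki; rewrite big1 // => l _.
by rewrite !mxE (negbTE ki) oppr0 rcst0 mul0r.
Qed.
Lemma Fplus_dF i j f : Fp f -> Fp (dF i j f).
Proof. by rewrite dF_pi; exact: Fplus_pi. Qed.

(** Annihilation by all n-fold partial derivatives: for polynomials, degree below n, expressed
    inside the field of fractions. *)
Fixpoint Ks n (x : F4) : Prop :=
  if n is n'.+1 then forall i j, Ks n' (pdz i j x) else x = 0.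
Definition Kn n (f : V) := forall a b, Ks n (f a b).

Let pD i j := @pdz_der C i j.
Let pM c i j x : pdz i j (rcst c * x) = rcst c * pdz i j x.
Proof. by rewrite (derD_mul (pD _ _)) pdz_rcst mul0r add0r. Qed.
Local Notation euler := (euler pdz Zg).

Lemma Ks_lin n c x y : Ks n x -> Ks n y -> Ks n (rcst c * x + y).
Proof.
elim: n x y => [|n IH] x y /= Kx Ky; first by rewrite Kx Ky mulr0 addr0.
by move=> i j; rewrite (derD_add (pD _ _)) pM; exact: IH.
Qed.
Lemma Ks_0 n : Ks n 0.
Proof. by elim: n => //= n IH i j; rewrite (derD0 (pD _ _)). Qed.
Lemma Ks_add n x y : Ks n x -> Ks n y -> Ks n (x + y).
Proof. by move=> Kx Ky; rewrite -[x]mul1r -(rcst1 C (2 * 2)); exact: Ks_lin. Qed.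
Lemma Ks_scale n c x : Ks n x -> Ks n (rcst c * x).
Proof. by move=> Kx; rewrite -[_ * _]addr0; apply: Ks_lin => //; exact: Ks_0. Qed.
Lemma Ks_opp n x : Ks n x -> Ks n (- x).
Proof. by move=> Kx; rewrite -mulN1r -(rcst1 C (2 * 2)) -rcstN; exact: Ks_scale. Qed.
Lemma Ks_S n x : Ks n x -> Ks n.+1 x.
Proof.
elim: n x => [|n IH] x; first by move=> -> i j; rewrite /= (derD0 (pD _ _)).
by move=> Kx i j; apply: IH; exact: Kx.
Qed.
Lemma Ks_le n m x : (n <= m)%N -> Ks n x -> Ks m x.
Proof. by move=> /subnK <- Kx; elim: (m - n)%N => //= k; exact: Ks_S. Qed.
Lemma Ks_Zg n k l x : Ks n x -> Ks n.+1 (Zg k l * x).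
Proof.
elim: n x => [|n IH] x; first by move=> ->; rewrite mulr0; exact: Ks_0.
move=> Kx; suff H i j : Ks n.+1 (pdz i j (Zg k l * x)) by exact: H.
rewrite (derD_mul (pD _ _)) pdz_Zg; apply: Ks_add; last by apply: IH; exact: Kx.
case: (_ && _); [rewrite mul1r; exact: Kx | rewrite mul0r; exact: Ks_0].
Qed.
Lemma Ks_poly x : is_poly x -> exists n, Ks n x.
Proof.
move=> [p ->]; rewrite [p]mpolyE rmorph_sum.
elim/big_ind: _ => [|y z [n Ky] [m Kz]|m _]; first by exists 0%N.
  exists (n + m)%N; apply: Ks_add; [apply: (Ks_le _ Ky) | apply: (Ks_le _ Kz)].
    exact: leq_addr.
  exact: leq_addl.
rewrite -mul_mpolyC /= ofpM.
suff [n Kn] : exists n, Ks n (ofpoly 'X_[m]) by exists n; exact: Ks_scale.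
elim/mnm_ind: m => [|k m [n Kn]].
  by exists 1%N => i j; rewrite /= mpolyX0 ofp1 (derD1 (pD _ _)).
exists n.+1; rewrite mpolyXD ofpM; have [i [j ->]] := index_pair k.
by have := Ks_Zg i j Kn; rewrite ZgE.
Qed.
Lemma Kn_poly f : poly_mx f -> exists n, Kn n f.
Proof.
move=> fp; have [a Ka] := Ks_poly (fp 0 0); have [b Kb] := Ks_poly (fp 0 1).
have [c Kc] := Ks_poly (fp 1 0); have [d Kd] := Ks_poly (fp 1 1).
exists (a + b + c + d)%N; apply: ord2P; apply: ord2P.
- by apply: Ks_le Ka; lia.
- by apply: Ks_le Kb; lia.
- by apply: Ks_le Kc; lia.
- by apply: Ks_le Kd; lia.
Qed.

Lemma p_eulerE i j x : pdz i j (euler x) = euler (pdz i j x) + pdz i j x.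
Proof. exact (p_euler (@pdz_der C) (@pdz_comm C) (@pdz_Zg C) i j x). Qed.
Lemma euler0 : euler 0 = 0.
Proof. by rewrite !eulerE !sum2 !(derD0 (pD _ _)) !mulr0 !addr0. Qed.
Lemma Ks_euler n x : Ks n x -> Ks n (euler x).
Proof.
elim: n x => [|n IH] x; first by move=> ->; exact: euler0.
move=> Kx i j; rewrite p_eulerE; apply: Ks_add; [apply: IH; exact: Kx | exact: Kx].
Qed.
(** The Euler operator is multiplication by n on the homogeneous part of degree n, so the difference
    loses this part. *)
Lemma Ks_shift n x : Ks n.+1 x -> Ks n (euler x - rcst n%:R * x).
Proof.
elim: n x => [|n IH] x Kx.
  by rewrite /= !eulerE !sum2 !(Kx : forall i j, _ = 0) !mulr0 !addr0 rcst0 mul0r subr0.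
move=> i j; rewrite (derDB (pD _ _)) pM p_eulerE -natr1 rcstD rcst1 mulrDl mul1r.
have -> : euler (pdz i j x) + pdz i j x - (rcst n%:R * pdz i j x + pdz i j x) =
  euler (pdz i j x) - rcst n%:R * pdz i j x.
  by rewrite opprD addrACA subrr addr0.
by apply: IH; exact: Kx.
Qed.

Definition generated (U : set V) := [/\ lsubspace U, forall S, S^T = S -> U (cst S)
  & forall L u, L^T = L -> U u -> U (pi (spm 0 0 L) u)].
(** The smallest subspace that contains the constants and is stable under the symmetric blocks C. It
    contains F+, which gives both the grading of F+ and the last step of its irreducibility. *)
Definition U0 : set V := [set u | forall U, generated U -> U u].

Lemma U0_gen : generated U0.
Proof.
split=> [|S ST U [_ UC _]|L u LT Uu U gU]; last 2 first.
- exact: UC.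
- by have [_ _ UL] := gU; apply: UL => //; exact: Uu.
split=> [U [sU _ _]|a u v Uu Uv U gU]; first exact: lsub0.
by have [sU _ _] := gU; apply: sU.2; [exact: Uu | exact: Uv].
Qed.
Let sU0 : lsubspace U0. Proof. by have [] := U0_gen. Qed.

Lemma pi_lin X (a : C) u v : pi X (a *: u + v) = a *: pi X u + pi X v.
Proof. by have [H _ _] := pi_dl_lie setT (setT : set V); exact: H. Qed.
Lemma pi_add X Y u : pi (X + Y) u = pi X u + pi Y u.
Proof. by have [_ H _] := pi_dl_lie setT (setT : set V); exact: H. Qed.

Lemma pi_CC L L' u : pi (spm 0 0 L) (pi (spm 0 0 L') u) = pi (spm 0 0 L') (pi (spm 0 0 L) u).
Proof.
have [_ _ H] := pi_dl_lie setT (setT : set V).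
rewrite (H (spm 0 0 L) (spm 0 0 L') u I I I).
have -> : spm 0 0 L *m spm 0 0 L' - spm 0 0 L' *m spm 0 0 L = 0 *: (0 : 'M[C]_(2 + 2)).
  rewrite scale0r /spm !mulmx_block !(trmx0, oppr0, mulmx0, mul0mx, addr0, add0r).
  by rewrite subrr.
by rewrite pi_dl_scale scale0r addr0.
Qed.

Lemma symm_mx2 (S : 'M[C]_2) : S^T = S -> S = mx2 (S 0 0) (S 0 1) (S 0 1) (S 1 1).
Proof. by move=> ST; apply: matrix2P; rewrite [RHS]mxE ?ent2E // -{1}ST mxE. Qed.
Lemma mx2_sym (a b c : C) : (mx2 a b b c)^T = mx2 a b b c.
Proof. by apply: matrix2P; rewrite !mxE. Qed.

(** On constants this is [cst_J]. Operators of the block C commute, so the property passes to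
    everything generated from the constants. *)
Lemma U0_J u : U0 u -> U0 (pi (spm 0 0 (mx2 0 1 (- 1) 0)) u).
Proof.
have [_ UC UL] := U0_gen.
suff gU : generated [set v | U0 v /\ U0 (pi (spm 0 0 (mx2 0 1 (- 1) 0)) v)].
  by move=> /(_ _ gU)[].
split=> [|S ST|L v LT [Uv UJ]].
- split=> [|a v w [Uv Jv] [Uw Jw]]; first split; try exact: lsub0 sU0.
    have := pi_lin (spm 0 0 (mx2 0 1 (- 1) 0)) (-1) 0 0.
    by rewrite scaler0 addr0 scaleN1r addNr => ->; exact: lsub0 sU0.
  by split; [exact: sU0.2 | rewrite pi_lin; exact: sU0.2].
- split; first exact: UC.
  rewrite (symm_mx2 ST) cst_J; apply: (lsubD sU0); first apply: (lsubD sU0).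
  + by apply: UL; [exact: mx2_sym | apply: UC; exact: mx2_sym].
  + by apply: UL; [exact: mx2_sym | apply: UC; exact: mx2_sym].
  + by apply: UL; [exact: mx2_sym | apply: UC; exact: mx2_sym].
by split; [exact: UL | rewrite pi_CC; exact: UL].
Qed.

Lemma U0_C L u : U0 u -> U0 (pi (spm 0 0 L) u).
Proof.
move=> Uu; have [_ _ UL] := U0_gen.
have -> : spm 0 0 L = spm 0 0 (mx2 (L 0 0) ((L 0 1 + L 1 0) / 2) ((L 0 1 + L 1 0) / 2) (L 1 1))
   + ((L 0 1 - L 1 0) / 2) *: spm 0 0 (mx2 0 1 (- 1) 0).
  rewrite /spm scale_block_mx add_block_mx !(trmx0, oppr0, scaler0, addr0).
  by congr block_mx; apply: matrix2P; rewrite !mxE ?ent2E; field.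
rewrite pi_add pi_dl_scale; apply: (lsubD sU0); first by apply: UL => //; exact: mx2_sym.
by apply: (lsubZ _ sU0); exact: U0_J.
Qed.

Lemma euler_casimirE (f : V) c b : Fp f ->
  (\sum_i \sum_j pi (spm 0 0 (delta_mx j i)) (dF i j f) : 'M[F4]_2) c b =
  euler (euler (f c b)) + 2 * euler (f c b).
Proof.
move=> /FplusE[fT fp fD]; have fs : f 1 0 = f 0 1 by rewrite -[in LHS]fT mxE.
have E := euler_casimir (@pdz_der C) (@pdz_comm C) (@pdz_Zg C) c b fs fD.
rewrite -E !summxE; apply: eq_bigr => i _; rewrite summxE; apply: eq_bigr => j _.
rewrite pi_dl_Lop /xiG /nuG /spm block_mxKul block_mxKur block_mxKdl block_mxKdr.
have c0 : cmx 0 = 0 by apply/matrixP => k l; rewrite !mxE rcst0.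
rewrite trmx0 oppr0 c0.
have -> : cmx (delta_mx j i) = delta_mx j i.
  apply/matrixP => k l; rewrite !mxE; case: (_ && _); [exact: rcst1 | exact: rcst0].
by [].
Qed.

(** Induction on a bound m for the degree of f. The derivatives of f are in [U0] by induction, hence
    so is g = E (E + 2) f with E the Euler operator; and m (m + 2) f - g has lower degree because E
    (E + 2) - m (m + 2) = (E + m + 2)(E - m). *)
Lemma Fplus_U0 : Fp `<=` U0.
Proof.
have [_ UC _] := U0_gen; have sF := @Fplus_sub C.
suff H n : forall f, Fp f -> Kn n f -> U0 f.
  by move=> f Ff; have /FplusE[_ /Kn_poly[n Kf] _] := Ff; exact: (H n).
elim: n => [|n IH] f Ff Kf.
  have -> : f = 0 by apply/matrixP => a b; rewrite mxE; exact: Kf.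
  exact: lsub0 sU0.
case: n IH Kf => [|n] IH Kf.
  have [S ST ->] : exists2 S, S^T = S & f = cst S; last exact: UC.
  apply: Fplus_const => // i j; apply/matrixP => a b; rewrite !mxE; exact: Kf.
pose g : V := \sum_i \sum_j pi (spm 0 0 (delta_mx j i)) (dF i j f).
have Fg : Fp g.
  by apply: (lsub_sum sF) => i _; apply: (lsub_sum sF) => j _; apply: Fplus_pi; exact: Fplus_dF.
have Ug : U0 g.
  apply: (lsub_sum sU0) => i _; apply: (lsub_sum sU0) => j _; apply: U0_C.
  by apply: IH; [exact: Fplus_dF | move=> a b; rewrite mxE; exact: Kf].
set m : C := n.+1%:R.
have m0 : m * (m + 2) != 0 by rewrite mulf_neq0 ?pnatr_eq0 // /m -natrD pnatr_eq0.
apply: (lsubZr sU0 m0).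
have -> : (m * (m + 2)) *: f = ((m * (m + 2)) *: f - g) + g by rewrite subrK.
apply: (lsubD sU0) => //; apply: IH.
  by apply: (lsubB sF) => //; exact: (lsubZ _ sF).
move=> a b; have gE : g a b = euler (euler (f a b)) + 2 * euler (f a b).
  exact: euler_casimirE.
have -> : ((m * (m + 2)) *: f - g) a b =
  - (euler (euler (f a b) - rcst m * f a b) + rcst (m + 2) * (euler (f a b) - rcst m * f a b)).
  have eB x y : euler (x - rcst m * y) = euler x - rcst m * euler y.
    rewrite !eulerE !sum2 !(derDB (pD _ _)) !pM.
    exact: euler_lin.
  rewrite eB !mxE gE rcstM rcstD rcst_nat.
  exact: euler_factor.
apply: Ks_opp; apply: Ks_add; [apply: Ks_euler | apply: Ks_scale]; exact: Ks_shift.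
Qed.

Local Notation op_e := (op_e pi).
Local Notation op_f := (op_f pi).
Local Notation op_h := (op_h pi).
Local Notation op_d := (op_d pi).

Lemma pi_dX S : S^T = S -> op_d (cst S) = (- 4) *: cst S.
Proof.
move=> ST; rewrite op_dE /dX pi_A (symm_mx2 ST) dA_identity.
by rewrite /cst cmxZ4 tens_scaleE.
Qed.
Lemma cstZ (a : C) S : a *: cst S = cst (a *: S).
Proof. by rewrite /cst cmxZ4 tens_scaleE. Qed.
Lemma op_e_cst p q s : op_e (cst (mx2 p q q s)) = cst ('i *: mx2 (- (2 * q)) (- s) (- s) 0).
Proof. by rewrite op_eE /eX pi_A eA_identity cstZ. Qed.
Lemma op_f_cst p q s : op_f (cst (mx2 p q q s)) = cst ('i *: mx2 0 (- p) (- p) (- (2 * q))).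
Proof. by rewrite op_fE /fX pi_A fA_identity cstZ. Qed.
Lemma op_h_cst p q s : op_h (cst (mx2 p q q s)) = cst (mx2 (- (2 * p)) 0 0 (2 * s)).
Proof. by rewrite op_hE /hX pi_A hA_identity. Qed.

Definition low4 : V := cst (mx2 0 0 0 1).

Lemma lowest_low4 : lowest pi low4.
Proof.
have c0 : cst 0 = 0 by apply/matrixP => i j; rewrite !mxE rcst0.
split.
- by rewrite op_f_cst !(oppr0, mulr0) mx20 scaler0 c0.
- by rewrite op_h_cst cstZ mx2Z !(mulr0, oppr0).
- rewrite pi_dX ?mx2_sym //; congr (_ *: _).
  by rewrite /dval mulr1 -opprD -natrD.
rewrite /= op_e_cst !mx2Z !(mulr0, oppr0) op_e_cst !mx2Z !(mulr0, oppr0) op_e_cst !mx2Z.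
by rewrite !(mulr0, oppr0) mx20 c0.
Qed.

Lemma low4_neq0 : low4 != 0.
Proof.
apply/eqP => /cst_inj/matrixP/(_ 1 1); rewrite !mxE ?ent2E => /eqP.
by rewrite oner_eq0.
Qed.

Lemma Fplus_graded : Fp `<=` graded_from pi 1.
Proof.
move=> f /Fplus_U0; apply; split; first exact: graded_sub.
  move=> S ST; apply: lspan_gen; exists 1; split=> //; rewrite pi_dX //; congr (_ *: _).
  by rewrite /dval mulr1 -opprD -natrD.
move=> L u LT gu.
have cL : sp4_c (spm 0 0 L).
  by split; [apply: spm_sp4; rewrite ?trmx0 | exact: block_mxKul | exact: block_mxKur].
have := graded_c pact cL gu; apply: lspan_mono => v [n [n2 dv]].
by apply: lspan_gen; exists n; split=> //; lia.
Qed.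

Lemma Fplus_irreducible : irreducible_module (@sp4 C) pi Fp.
Proof.
have sF := @Fplus_sub C.
split.
- by split=> // X u _; exact: Fplus_pi.
- move=> F0; have := Fplus_cst (mx2_sym 0 0 1); rewrite F0 => E.
  by move: low4_neq0; rewrite /low4 E eqxx.
move=> U sU UF; have lU := sU.1.
have [eU fU _ _ _] := submodule_ops sU.
have [[u Uu /eqP u0]|U0_] := pselect (exists2 u, U u & u <> 0); last first.
  left; apply/seteqP; split=> u; last by move=> ->; exact: lsub0.
  by move=> Uu; apply: contrapT => u0; apply: U0_; exists u.
right; apply/seteqP; split=> //.
have BU B v : B^T = B -> U v -> U (pi (spm 0 B 0) v).
  by move=> BT; apply: sU.2; apply: spm_sp4; rewrite ?trmx0.
have step : exists S, [/\ S^T = S, S != 0 & U (cst S)].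
  have /FplusE[_ /Kn_poly[n Kn_u] _] := UF _ Uu.
  elim: n u Uu u0 Kn_u => [|n IH] v Uv v0 Kv.
    by case/eqP: v0; apply/matrixP => a b; rewrite mxE; exact: Kv.
  have KB B a b : Ks n (- (\sum_i \sum_j rcst (B i j) * pdz i j (v a b))).
    apply: Ks_opp; rewrite !sum2; do 2!apply: Ks_add; apply: Ks_scale; exact: Kv.
  (* The symmetric blocks B give the derivatives 00, 11 and the sum of 01 and 10. If these kill v,
     the regularity equations annihilate 01 and 10 separately, so v is constant; otherwise some B
     yields a nonzero vector of lower degree. *)
  have [all0|] := pselect (forall B, B^T = B -> pi (spm 0 B 0) v = 0).
    have Fv := UF _ Uv; have /FplusE[vT _ vD] := Fv.
    have vs : v 1 0 = v 0 1 by rewrite -[in LHS]vT mxE.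
    have H (p q s : C) a b : rcst p * pdz 0 0 (v a b) + rcst q * pdz 0 1 (v a b)
        + (rcst q * pdz 1 0 (v a b) + rcst s * pdz 1 1 (v a b)) = 0.
      have /matrixP/(_ a b) := all0 _ (mx2_sym p q s).
      rewrite pi_B !mxE !sum2 !mxE ?ent2E => /eqP; rewrite oppr_eq0 => /eqP; exact: id.
    have H00 a b : pdz 0 0 (v a b) = 0.
      by have := H 1 0 0 a b; rewrite rcst0 rcst1 !mul0r mul1r !addr0.
    have H11 a b : pdz 1 1 (v a b) = 0.
      by have := H 0 0 1 a b; rewrite rcst0 rcst1 !mul0r mul1r !add0r.
    have H01 a b : pdz 0 1 (v a b) + pdz 1 0 (v a b) = 0.
      by have := H 0 1 0 a b; rewrite rcst0 rcst1 !mul0r !mul1r add0r addr0.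
    have E01 b : pdz 0 1 (v 0 b) = 0 by rewrite vD H00.
    have E10 b : pdz 1 0 (v 1 b) = 0 by rewrite -vD H11.
    have E10' b : pdz 1 0 (v 0 b) = 0 by have := H01 0 b; rewrite E01 add0r.
    have E01' b : pdz 0 1 (v 1 b) = 0 by have := H01 1 b; rewrite E10 addr0.
    have [S ST vS] : exists2 S, S^T = S & v = cst S.
      apply: Fplus_const => // i j; apply/matrixP => a b; rewrite !mxE.
      move: i j a; apply: ord2P; apply: ord2P; apply: ord2P.
      - exact: (H00 0 b).
      - exact: (H00 1 b).
      - exact: (E01 b).
      - exact: (E01' b).
      - exact: (E10' b).
      - exact: (E10 b).
      - exact: (H11 0 b).
      - exact: (H11 1 b).
    exists S; rewrite -vS; split=> //; apply: contraNneq v0 => S0.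
    rewrite vS S0; apply/eqP; apply/matrixP => a b; rewrite !mxE; exact: rcst0.
  move=> /existsNP[B /not_implyP[BT /eqP B0]].
  apply: (IH (pi (spm 0 B 0) v)) => //; first exact: BU.
  by move=> a b; rewrite pi_B mxE; exact: KB.
have [S [ST S0 US]] := step.
have up p q s : U (cst (mx2 p q q s)) -> U (cst (mx2 (- (2 * q)) (- s) (- s) 0)).
  move=> /eU; rewrite op_e_cst -cstZ; exact: (lsubZr lU (neq0Ci C)).
have dn p q s : U (cst (mx2 p q q s)) -> U (cst (mx2 0 (- p) (- p) (- (2 * q)))).
  move=> /fU; rewrite op_f_cst -cstZ; exact: (lsubZr lU (neq0Ci C)).
have norm (r p q s : C) : r != 0 -> U (cst (mx2 (r * p) (r * q) (r * q) (r * s))) -> U (cst (mx2 p q q s)).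
  by move=> r0; rewrite -mx2Z -cstZ; exact: (lsubZr lU r0).
(* f moves the entries p to q to s up to nonzero factors, so a power of it turns a nonzero constant
   into the last basis tensor; e then gives the other two. *)
have U001 : U (cst (mx2 0 0 0 1)).
  move: S0 US; rewrite (symm_mx2 ST).
  set p := S 0 0; set q := S 0 1; set s := S 1 1 => S0 US.
  have [p0|p0] := eqVneq p 0; last first.
    have := dn _ _ _ (dn _ _ _ US); rewrite oppr0 => H.
    by apply: (norm (2 * p)); rewrite ?mulf_neq0 ?pnatr_eq0 // !mulr0 mulr1; move: H; rewrite mulrN opprK.
  have [q0|q0] := eqVneq q 0; last first.
    have := dn _ _ _ US; rewrite p0 oppr0 => H.
    by apply: (norm (- (2 * q))); rewrite ?oppr_eq0 ?mulf_neq0 ?pnatr_eq0 // !mulr0 mulr1.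
  have [s0|s0] := eqVneq s 0; first by move: S0; rewrite p0 q0 s0 mx20 eqxx.
  by apply: (norm s) => //; rewrite !mulr0 mulr1; move: US; rewrite p0 q0.
have U010 : U (cst (mx2 0 1 1 0)).
  have := up _ _ _ U001; rewrite mulr0 oppr0 => H; apply: (norm (- 1)).
    by rewrite oppr_eq0 oner_eq0.
  by rewrite mulr0 mulr1.
have U100 : U (cst (mx2 1 0 0 0)).
  have := up _ _ _ U010; rewrite mulr1 oppr0 => H; apply: (norm (- 2)).
    by rewrite oppr_eq0 pnatr_eq0.
  by rewrite !mulr0 mulr1.
move=> f /Fplus_U0; apply; split=> // [T TT|L v LT Uv]; last first.
  by apply: sU.2 => //; apply: spm_sp4; rewrite ?trmx0.
have -> : cst T = T 0 0 *: cst (mx2 1 0 0 0) + (T 0 1 *: cst (mx2 0 1 1 0) + T 1 1 *: cst (mx2 0 0 0 1)).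
  rewrite [T 1 1 *: _]cstZ !cst_lin; congr cst; rewrite {1}(symm_mx2 TT) !mx2Z; apply: matrix2P; rewrite !mxE ?ent2E; ring.
by apply: (lsubD lU); [exact: lsubZ | apply: (lsubD lU); exact: lsubZ].
Qed.
End FplusModule.

(** * Inversion and transposition *)

Section InversionSymbols.
Variable K : fieldType.
Implicit Types (Z W A B L D M : 'M[K]_2).
Definition adj2 Z : 'M[K]_2 := mx2 (Z 1 1) (- Z 0 1) (- Z 1 0) (Z 0 0).

Lemma adj2_inv Z W : Z *m W = 1%:M -> \det Z *: W = adj2 Z.
Proof.
move=> ZW; have H : adj2 Z *m Z = (\det Z)%:M.
  rewrite det2 /adj2; apply: matrix2P; rewrite !mxE !sum2 !mxE ?ent2E /=; ring.
by rewrite -[adj2 Z]mulmx1 -ZW mulmxA H mul_scalar_mx.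
Qed.

Lemma trB_trace M M' : \tr (M - M') = \tr M - \tr M'.
Proof. by rewrite /mxtrace !sum2 !mxE; ring. Qed.
Lemma trN_trace M : \tr (- M) = - \tr M.
Proof. by rewrite /mxtrace !sum2 !mxE; ring. Qed.
Lemma comm4 (a b c d e f g h : K) :
  a * b + c * d + (e * f + g * h) = b * a + d * c + (f * e + h * g).
Proof. ring. Qed.

Section Derivation.
Variable d : K -> K.
Hypothesis dD : derivation d.
Local Notation md := (map_mx d).

Lemma der_mulmx M M' : md (M *m M') = md M *m M' + M *m md M'.
Proof.
apply/matrixP => i j; rewrite !mxE !sum2 !mxE (derD_add dD) !(derD_mul dD); ring.
Qed.
Lemma der_scalemx (c : K) M : md (c *: M) = d c *: M + c *: md M.
Proof. by apply/matrixP => i j; rewrite !mxE (derD_mul dD). Qed.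
Lemma der_1mx : md (1%:M : 'M_2) = 0.
Proof.
apply/matrixP => i j; rewrite !mxE; case: (i == j); first exact: derD1.
exact: derD0.
Qed.
Lemma der_inv Z W : Z *m W = 1%:M -> md W = - (W *m md Z *m W).
Proof.
move=> ZW; have WZ := mulmx1C ZW.
have := der_mulmx Z W; rewrite ZW der_1mx => /(congr1 (mulmx W)).
rewrite mulmx0 mulmxDr !mulmxA WZ mul1mx => /eqP; rewrite eq_sym addrC addr_eq0 => /eqP ->.
by [].
Qed.
Lemma der_det Z W : Z *m W = 1%:M -> d (\det Z) = \det Z * \tr (W *m md Z).
Proof.
move=> ZW; have <- : \tr (adj2 Z *m md Z) = \det Z * \tr (W *m md Z).
  by rewrite -mxtraceZ scalemxAl adj2_inv.
rewrite det2 (derDB dD) !(derD_mul dD) /adj2 /mxtrace sum2; do 2!rewrite ?mxE ?sum2.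
rewrite ?ent2E; ring.
Qed.
Lemma der_trmx M : md M^T = (md M)^T. Proof. by apply/matrixP => i j; rewrite !mxE. Qed.

(* The inversion Z |-> Z^-1 exchanges the blocks (A, B) and (D, L). *)
Lemma inversion_Lop Z W A B L D (g g' : 'M[K]_2) (c := (\det Z)^-1) :
  \det Z != 0 -> Z *m W = 1%:M -> md Z = xiX Z D L B A -> md g = g' ->
  md (c *: (W *m g *m W^T)) + \tr (nuX Z B A) *: (c *: (W *m g *m W^T))
  + nuX Z B A *m (c *: (W *m g *m W^T)) + (c *: (W *m g *m W^T)) *m (nuX Z B A)^T =
  c *: (W *m (g' + \tr (nuX W L D) *: g + nuX W L D *m g + g *m (nuX W L D)^T) *m W^T).
Proof.
move=> Z0 ZW xiE gE; have WZ := mulmx1C ZW.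
set nu := nuX Z B A; set nu' := nuX W L D.
have WxW : W *m md Z *m W = B + A *m W - W *m D - W *m L *m W.
  rewrite xiE /xiX !(mulmxBr, mulmxDr, mulmxBl, mulmxDl, mulmxN, mulNmx) !mulmxA WZ !mul1mx.
  rewrite -!mulmxA ZW !mulmx1.
  by [].
(* Up to its own derivative, W = Z^-1 intertwines the multiplier at Z with the one at W. [dc] is the
   analogous relation for the factor 1 / det Z and the traces. *)
have dW : md W + nu *m W = W *m nu'.
  rewrite (der_inv ZW) WxW /nu /nu' /nuX mulmxDl mulmxDr -[B *m Z *m W]mulmxA ZW mulmx1 mulmxA.
  move: (A *m W) (W *m D) (W *m L *m W) => P Q R.
  by apply/matrixP => i j; rewrite !mxE; ring.
have dc : d c + \tr nu * c = c * \tr nu'.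
  rewrite /c (derDV dD) (der_det ZW).
  have -> : \tr (W *m md Z) = \tr nu - \tr nu'.
    have -> : W *m md Z = W *m md Z *m W *m Z by rewrite -mulmxA WZ mulmx1.
    rewrite WxW /nu /nu' /nuX !(mulmxBl, mulmxDl, mulNmx) -!mulmxA WZ !mulmx1.
    rewrite !(mxtraceD, trB_trace, trN_trace) [\tr (W *m (D *m Z))]mxtrace_mulC -[D *m Z *m W]mulmxA ZW mulmx1.
    rewrite [\tr (W *m L)]mxtrace_mulC; ring.
  by move: (\det Z) (\tr nu) (\tr nu') Z0 => x a b x0; field.
clearbody nu nu'.
rewrite der_scalemx der_mulmx der_mulmx gE der_trmx.
have -> : md W = W *m nu' - nu *m W by rewrite -dW addrK.
rewrite !trB !trmx_mul.
rewrite !(mulmxDl, mulmxDr, mulmxBl, mulmxBr, mulmxN, mulNmx) -!scalemxAl -!scalemxAr !mulmxA -!scalemxAl.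
move: dc; move: (\tr nu) (\tr nu') (d c) (W *m nu' *m g *m W^T) (nu *m W *m g *m W^T)
  (W *m g' *m W^T) (W *m g *m nu'^T *m W^T) (W *m g *m W^T *m nu^T) (W *m g *m W^T)
  => a b dcc M1 M2 M3 M4 M5 M6 dc.
apply/matrixP => i j; rewrite !mxE.
have -> : dcc = c * b - a * c by rewrite -dc addrK.
ring.
Qed.
End Derivation.
End InversionSymbols.

Lemma xi_swap (K : fieldType) (B AW WD WLW : 'M[K]_2) :
  - (B + AW - WD - WLW) = WLW + WD - AW - B.
Proof. by apply/matrixP => i j; rewrite !mxE; ring. Qed.

Lemma sub_addC (V : zmodType) (a b c d : V) : a + b - (c + d) = b + a - (d + c).
Proof. by rewrite [a + b]addrC [c + d]addrC. Qed.

Section SubstMatrix.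
Variable C : numClosedFieldType.
Local Notation F4 := (ratfun C (2 * 2)).
Local Notation V := (tens C (2 * 2)).
Local Notation Zg := (@Zg C).
Local Notation pdz := (@pdz C).
Local Notation delg := (@delg C).
Local Notation cmx := (@cmx (2 * 2) C).
Local Notation rcst := (@rcst C (2 * 2)).
Variable w : 'I_(2 * 2) -> F4.
Hypothesis wd : forall k, exists D, [/\ derivation D,
  forall c : C, D (rcst c) = 0 & forall j, D (w j) = (j == k)%:R].
Local Notation S := (rsubst w).
Local Notation mS := (map_mx S).

Lemma S_add x y : S (x + y) = S x + S y. Proof. exact (rsubst_add wd x y). Qed.
Lemma S_mul x y : S (x * y) = S x * S y. Proof. exact (rsubst_mul wd x y). Qed.
Lemma S_rcst c : S (rcst c) = rcst c. Proof. exact (rsubst_rcst wd c). Qed.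
Lemma S_1 : S 1 = 1. Proof. by rewrite -(rcst1 C (2 * 2)) S_rcst. Qed.
Lemma S_0 : S 0 = 0. Proof. by rewrite -(rcst0 C (2 * 2)) S_rcst. Qed.
Lemma S_opp x : S (- x) = - S x.
Proof. by rewrite -mulN1r S_mul -(rcst1 C (2 * 2)) -rcstN S_rcst rcstN rcst1 mulN1r. Qed.
Lemma S_inv x : S x^-1 = (S x)^-1.
Proof.
have [->|x0] := eqVneq x 0; first by rewrite invr0 S_0 invr0.
have E : S x * S x^-1 = 1 by rewrite -S_mul mulfV // S_1.
have Sx0 : S x != 0 by apply: contra_eq_neq E => ->; rewrite mul0r eq_sym oner_neq0.
by rewrite -[LHS]mul1r -(mulVf Sx0) -mulrA E mulr1.
Qed.
Lemma mS_add (M N : 'M[F4]_2) : mS (M + N) = mS M + mS N.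
Proof. by apply/matrixP => i j; rewrite !mxE S_add. Qed.
Lemma mS_opp (M : 'M[F4]_2) : mS (- M) = - mS M.
Proof. by apply/matrixP => i j; rewrite !mxE S_opp. Qed.
Lemma mS_mul (M N : 'M[F4]_2) : mS (M *m N) = mS M *m mS N.
Proof. by apply/matrixP => i j; rewrite !mxE !sum2 !mxE S_add !S_mul. Qed.
Lemma mS_scale c (M : 'M[F4]_2) : mS (c *: M) = S c *: mS M.
Proof. by apply/matrixP => i j; rewrite !mxE S_mul. Qed.
Lemma mS_tr (M : 'M[F4]_2) : mS M^T = (mS M)^T. Proof. by apply/matrixP => i j; rewrite !mxE. Qed.
Lemma mS_trace (M : 'M[F4]_2) : S (\tr M) = \tr (mS M).
Proof. by rewrite /mxtrace !sum2 S_add !mxE. Qed.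
Lemma mS_det (M : 'M[F4]_2) : S (\det M) = \det (mS M).
Proof. by rewrite !det2 S_add S_opp !S_mul !mxE. Qed.
Lemma mS_cmx A : mS (cmx A) = cmx A.
Proof. by apply/matrixP => i j; rewrite !mxE S_rcst. Qed.
Lemma mS_Zg i j : mS Zg i j = w (mxvec_index i j).
Proof. by rewrite mxE ZgE; exact (rsubst_var wd (mxvec_index i j)). Qed.
Lemma mS_xiX (A B L D : 'M[F4]_2) : mS (xiX Zg A B L D) = xiX (mS Zg) (mS A) (mS B) (mS L) (mS D).
Proof. by rewrite /xiX !(mS_add, mS_opp, mS_mul). Qed.
Lemma mS_nuX (L D : 'M[F4]_2) : mS (nuX Zg L D) = nuX (mS Zg) (mS L) (mS D).
Proof. by rewrite /nuX !(mS_add, mS_mul). Qed.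

Lemma sum_index (F : 'I_(2 * 2) -> F4) : \sum_k F k = \sum_i \sum_j F (mxvec_index i j).
Proof. by rewrite (reindex _ (curry_mxvec_bij 2 2)) /= pair_bigA; apply: eq_bigr => -[i j] _. Qed.

Lemma der_S (D : F4 -> F4) x : derivation D -> (forall c, D (rcst c) = 0) ->
  D (S x) = \sum_i \sum_j S (pdz i j x) * D (mS Zg i j).
Proof.
move=> dD Dc; rewrite (der_rsubst wd x dD Dc) sum_index.
by apply: eq_bigr => i _; apply: eq_bigr => j _; rewrite mS_Zg.
Qed.

Lemma dv_S (D : F4 -> F4) (xi : 'M[F4]_2) x : derivation D -> (forall c, D (rcst c) = 0) ->
  map_mx D (mS Zg) = mS xi -> D (S x) = S (dv xi delg x).
Proof.
move=> dD Dc E; rewrite (der_S x dD Dc) /dv /delg.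
have HE i j : D (mS Zg i j) = S (xi i j) by have /matrixP/(_ i j) := E; rewrite !mxE.
rewrite !sum2 !HE !S_add !S_mul.
by rewrite comm4.
Qed.

Lemma mS_Lop xi nu (f : 'M[F4]_2) : mS (Lop delg 1 xi nu f) =
  mS (map_mx (dv xi delg) f) + \tr (mS nu) *: mS f + mS nu *m mS f + mS f *m (mS nu)^T.
Proof. by rewrite /Lop mul1r !mS_add !mS_mul mS_scale mS_tr mS_trace. Qed.

Lemma S_closed (P : F4 -> Prop) : (forall c, P (rcst c)) ->
  (forall x y, P x -> P y -> P (x + y)) -> (forall x y, P x -> P y -> P (x * y)) ->
  (forall i j, P (mS Zg i j)) -> forall p, P (S (ofpoly p)).
Proof.
move=> Pc Pa Pm Pw p; rewrite [p]mpolyE rmorph_sum.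
elim/big_rec: _ => [|m y _ Py]; first by rewrite S_0 -(rcst0 C (2 * 2)).
rewrite S_add; apply: (Pa _ _ _ Py); rewrite /= -mul_mpolyC ofpM S_mul S_rcst.
apply: (Pm _ _ (Pc _)).
elim/mnm_ind: m => [|k m IH]; first by rewrite mpolyX0 ofp1 S_1 -(rcst1 C (2 * 2)).
rewrite mpolyXD ofpM S_mul; apply: (Pm _ _ _ IH).
have [i [j ->]] := index_pair k.
by have := Pw i j; rewrite mxE ZgE.
Qed.
End SubstMatrix.

Section Inversion.
Variable C : numClosedFieldType.
Local Notation F4 := (ratfun C (2 * 2)).
Local Notation V := (tens C (2 * 2)).
Local Notation Zg := (@Zg C).
Local Notation Ng := (@Ng C).
Local Notation pdz := (@pdz C).
Local Notation delg := (@delg C).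
Local Notation cmx := (@cmx (2 * 2) C).
Local Notation rcst := (@rcst C (2 * 2)).
Local Notation pi := (@pi_dl C).
Local Notation Fp := (@Fplus C).
Local Notation Fm := (@Fminus C).
Local Notation W := (invmx Zg).

Definition detg : {mpoly C[2 * 2]} :=
  'X_(mxvec_index 0 0) * 'X_(mxvec_index 1 1) - 'X_(mxvec_index 0 1) * 'X_(mxvec_index 1 0).
Lemma NgE : Ng = ofpoly detg.
Proof. by rewrite /Ng det2 !ZgE /detg ofpB !ofpM. Qed.
Lemma Ng_neq0 : Ng != 0.
Proof.
apply/eqP => N0.
have Z0 : Zg 0 0 != 0 by rewrite ZgE (@var_neq0 C (2 * 2)).
have : pdz 1 1 Ng = Zg 0 0.
  rewrite /Ng det2 (derDB (@pdz_der C _ _)) !(derD_mul (@pdz_der C _ _)) !pdz_Zg /=.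
  by rewrite !(mul0r, mulr0, mulr1, add0r, subr0).
by rewrite N0 (derD0 (@pdz_der C _ _)) => /esym/eqP; rewrite (negbTE Z0).
Qed.
Lemma Zg_unit : Zg \in unitmx.
Proof. by rewrite unitmxE unitfE Ng_neq0. Qed.
Lemma ZW : Zg *m W = 1%:M. Proof. exact: mulmxV Zg_unit. Qed.
Lemma WZ : W *m Zg = 1%:M. Proof. exact: mulVmx Zg_unit. Qed.

Local Notation wi := (fun k : 'I_(2 * 2) => mxvec W 0 k).
Lemma wiE i j : wi (mxvec_index i j) = W i j. Proof. exact: mxvecE. Qed.

Lemma dv_der (xi : 'M[F4]_2) : derivation (dv xi delg).
Proof. exact (dv_derivation (@delg_der C) xi). Qed.
Lemma dv_rcst (xi : 'M[F4]_2) c : dv xi delg (rcst c) = 0.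
Proof. by apply: dv_cst => i j; exact: pdz_rcst. Qed.

Lemma dv_W (xi : 'M[F4]_2) : map_mx (dv xi delg) W = - (W *m xi *m W).
Proof. by rewrite (der_inv (dv_der xi) ZW) delg_Zg. Qed.

(** Since d(Z^-1) = -Z^-1 xi Z^-1, the field xi = -Z E_ab Z is dual to the entry (a, b) of Z^-1. *)
Lemma wi_dual : forall k, exists D, [/\ derivation D,
  forall c : C, D (rcst c) = 0 & forall j, D (wi j) = (j == k)%:R].
Proof.
move=> k; have [a [b ->]] := index_pair k.
exists (dv (- (Zg *m delta_mx a b *m Zg)) delg); split; [exact: dv_der | exact: dv_rcst |].
move=> l; have [i [j ->]] := index_pair l; rewrite wiE.
have /matrixP/(_ i j) := dv_W (- (Zg *m delta_mx a b *m Zg)); rewrite mxE => ->.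
rewrite mulmxN mulNmx opprK !mulmxA WZ mul1mx -mulmxA ZW mulmx1 mxE mxvec_index_eq.
by [].
Qed.
Local Notation S := (rsubst wi).
Local Notation mS := (map_mx S).

Lemma mS_Z : mS Zg = W.
Proof. by apply/matrixP => i j; rewrite (mS_Zg wi_dual) wiE. Qed.
Lemma mS_W : mS W = Zg.
Proof.
have : mS Zg *m mS W = 1%:M.
  rewrite -(mS_mul wi_dual) ZW; apply/matrixP => i j; rewrite !mxE.
  by case: (i == j); [exact (S_1 wi_dual) | exact (S_0 wi_dual)].
rewrite mS_Z => /(congr1 (mulmx Zg)); rewrite mulmxA ZW mul1mx mulmx1; exact: id.
Qed.
Lemma S_N : S Ng = Ng^-1.
Proof.
rewrite (mS_det wi_dual) mS_Z; apply: (mulIf Ng_neq0).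
by rewrite -det_mulmx WZ det1 mulVf // Ng_neq0.
Qed.

Lemma S_S x : S (S x) = x.
Proof.
have SD := S_add wi_dual; have SM := S_mul wi_dual; have S1 := S_1 wi_dual.
apply: (rmorph_rat_eq (f := fun x => S (S x)) (g := id)) => //.
- by move=> u v; rewrite !SD.
- by move=> u v; rewrite !SM.
- by rewrite !S1.
- by move=> c; rewrite !(S_rcst wi_dual).
move=> k; have [i [j ->]] := index_pair k.
have /matrixP/(_ i j) := mS_W; rewrite mxE => E1.
have /matrixP/(_ i j) := mS_Z; rewrite mxE => E2.
by rewrite -ZgE E2 E1.
Qed.

(** The transformation that defines F-. As an involution it exchanges F+ and F-, once the
    denominators are seen to be powers of N. *)
Definition J (f : V) : V := Ng^-1 *: (W *m at_inv f *m W^T).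

Lemma J_J f : J (J f) = f.
Proof.
rewrite /J /at_inv -/mS (mS_scale wi_dual) !(mS_mul wi_dual) mS_tr mS_W.
rewrite (S_inv wi_dual) S_N invrK.
have -> : mS (mS (f : 'M_2)) = f by apply/matrixP => i j; rewrite !mxE S_S.
rewrite -scalemxAr -scalemxAl scalerA mulVf ?Ng_neq0 // scale1r.
rewrite !mulmxA WZ mul1mx -mulmxA -trmx_mul WZ trmx1 mulmx1.
by [].
Qed.

(** Conjugation by the permutation of the two blocks, the counterpart of Z |-> Z^-1 on the Lie
    algebra. It exchanges the blocks B and C and so reverses the grading. *)
Definition theta (X : 'M[C]_(2 + 2)) : 'M[C]_(2 + 2) :=
  block_mx (drsubmx X) (dlsubmx X) (ursubmx X) (ulsubmx X).

Lemma J_pi X f : pi (theta X) (J f) = J (pi X f).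
Proof.
have xE : xiG (theta X) = xiX Zg (cmx (drsubmx X)) (cmx (dlsubmx X)) (cmx (ursubmx X)) (cmx (ulsubmx X)).
  by rewrite /xiG /theta block_mxKul block_mxKur block_mxKdl block_mxKdr.
have nE : nuG (theta X) = nuX Zg (cmx (ursubmx X)) (cmx (ulsubmx X)).
  by rewrite /nuG /theta block_mxKdl block_mxKdr.
set d := dv (xiG (theta X)) delg.
have mx : mS (xiG X) = xiX W (cmx (ulsubmx X)) (cmx (ursubmx X)) (cmx (dlsubmx X)) (cmx (drsubmx X)).
  by rewrite /xiG (mS_xiX wi_dual) !(mS_cmx wi_dual) mS_Z.
have mn : mS (nuG X) = nuX W (cmx (dlsubmx X)) (cmx (drsubmx X)).
  by rewrite /nuG (mS_nuX wi_dual) !(mS_cmx wi_dual) mS_Z.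
have dS x : d (S x) = S (dv (xiG X) delg x).
  apply: (dv_S wi_dual x (dv_der _) (dv_rcst _)); rewrite mS_Z dv_W mx xE /xiX.
  rewrite !(mulmxBr, mulmxDr, mulmxBl, mulmxDl, mulmxN, mulNmx) !mulmxA WZ !mul1mx.
  rewrite -!mulmxA ZW !mulmx1; exact: xi_swap.
have gE : map_mx d (at_inv f) = mS (map_mx (dv (xiG X) delg) (f : 'M_2)).
  by apply/matrixP => i j; rewrite !mxE dS.
have E := inversion_Lop (dv_der (xiG (theta X))) Ng_neq0 ZW (etrans (delg_Zg (xiG (theta X))) xE) gE.
have H := mS_Lop wi_dual (xiG X) (nuG X) f; rewrite mn in H.
rewrite pi_dl_Lop [pi X f]pi_dl_Lop nE.
refine (etrans _ (etrans E _)); first by rewrite /Lop mul1r.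
by rewrite -H.
Qed.

Lemma thetaK X : theta (theta X) = X.
Proof. by rewrite /theta block_mxKul block_mxKur block_mxKdl block_mxKdr submxK. Qed.
Lemma theta_sp4 X : sp4 X -> sp4 (theta X).
Proof.
case=> BT LT DE; split; rewrite /theta ?block_mxKul ?block_mxKur ?block_mxKdl ?block_mxKdr //.
by rewrite DE trN trmxK opprK.
Qed.
Lemma thetaD X Y : theta (X + Y) = theta X + theta Y.
Proof. by rewrite /theta ulsubD ursubD dlsubD drsubD add_block_mx. Qed.
Lemma thetaZ c X : theta (c *: X) = c *: theta X.
Proof.
have ur : ursubmx (c *: X) = c *: ursubmx X by apply/matrixP => i j; rewrite !mxE.
have dl : dlsubmx (c *: X) = c *: dlsubmx X by apply/matrixP => i j; rewrite !mxE.
have dr : drsubmx (c *: X) = c *: drsubmx X by apply/matrixP => i j; rewrite !mxE.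
have ul : ulsubmx (c *: X) = c *: ulsubmx X by apply/matrixP => i j; rewrite !mxE.
by rewrite /theta ur dl dr ul scale_block_mx.
Qed.
Lemma theta_br X Y : theta (X *m Y - Y *m X) = theta X *m theta Y - theta Y *m theta X.
Proof.
rewrite /theta ulsubB ursubB dlsubB drsubB !ulsub_mul !ursub_mul !dlsub_mul !drsub_mul.
rewrite !mulmx_block opp_block_mx add_block_mx.
have E (a b c d a' b' c' d' : 'M[C]_2) : a = a' -> b = b' -> c = c' -> d = d' ->
    block_mx a b c d = block_mx a' b' c' d' by move=> -> -> -> ->.
apply: E; exact: sub_addC.
Qed.

Local Notation PI := (is_poly_inv Ng).
Lemma PI4_ofp p : PI (ofpoly p).
Proof. by exists p, 0%N; rewrite expr0 divr1. Qed.
Lemma PI4_mul u v : PI u -> PI v -> PI (u * v).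
Proof.
move=> [p [a ->]] [q [b ->]]; exists (p * q), (a + b)%N.
by rewrite ofpM exprD invfM mulrACA.
Qed.
Lemma PI4_add u v : PI u -> PI v -> PI (u + v).
Proof.
move=> [p [a ->]] [q [b ->]]; exists (p * detg ^+ b + q * detg ^+ a), (a + b)%N.
rewrite ofpD !ofpM !ofpX -NgE.
exact (div_sum (ofpoly p) (ofpoly q) a b Ng_neq0).
Qed.
Lemma PI4_N : PI Ng^-1.
Proof. by exists 1, 1%N; rewrite ofp1 mul1r expr1. Qed.
Lemma PI4_W i j : PI (W i j).
Proof.
have /matrixP/(_ i j) := adj2_inv ZW; rewrite mxE => E.
have -> : W i j = Ng^-1 * adj2 Zg i j by rewrite -E mulrA mulVf ?Ng_neq0 // mul1r.
apply: PI4_mul; first exact: PI4_N.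
have pZ k l : is_poly (Zg k l) by exact: poly_Zg.
have [p ->] : is_poly (adj2 Zg i j); last exact: PI4_ofp.
rewrite mxE; move: i j {E}; apply: ord2P; apply: ord2P; rewrite ?ent2E.
- exact: pZ.
- exact: poly_opp.
- exact: poly_opp.
- exact: pZ.
Qed.
Lemma PI4_S x : is_poly x -> PI (S x).
Proof.
move=> [p ->]; apply: (S_closed wi_dual (P := PI)).
- by move=> c; exact: PI4_ofp.
- exact: PI4_add.
- exact: PI4_mul.
- by move=> i j; rewrite mS_Z; exact: PI4_W.
Qed.

Lemma J_sym (f : V) : (f : 'M_2)^T = f -> (J f : 'M_2)^T = J f.
Proof.
move=> fT; rewrite /J linearZ /= !trmx_mul trmxK mulmxA /at_inv -mS_tr fT.
by [].
Qed.

Lemma J_Fplus f : Fp f -> Fm (J f).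
Proof.
move=> Ff; have /FplusE[fT fp _] := Ff; split; first exact: J_sym.
  move=> i j; rewrite /J !mxE; apply: PI4_mul; first exact: PI4_N.
  rewrite sum2; have HS a b : PI (at_inv f a b) by rewrite mxE; exact: PI4_S.
  have HW a : PI ((W *m at_inv f) i a).
    by rewrite mxE sum2; apply: PI4_add; apply: PI4_mul => //; exact: PI4_W.
  apply: PI4_add; apply: PI4_mul; rewrite ?HW //; rewrite mxE; exact: PI4_W.
by rewrite -/(J (J f)) J_J.
Qed.
Lemma J_Fminus f : Fm f -> Fp (J f). Proof. by case. Qed.

Lemma J_lin (a : C) u v : J (a *: u + v) = a *: J u + J v.
Proof.
rewrite tens_addE tens_scaleE /J /at_inv (mS_add wi_dual) (mS_scale wi_dual) (S_rcst wi_dual).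
rewrite mulmxDr mulmxDl scalerDr -!scalemxAr -!scalemxAl !scalerA mulrC -scalerA.
by [].
Qed.

Lemma Fminus_submodule : submodule (@sp4 C) pi Fm.
Proof.
have sF := @Fplus_sub C; split; first split.
- have := J_Fplus (lsub0 sF); have := J_lin (-1) 0 0.
  by rewrite scaler0 addr0 scaleN1r addNr => ->.
- move=> a u v Fu Fv; rewrite -[u]J_J -[v]J_J -J_lin; apply: J_Fplus.
  by apply: sF.2; exact: J_Fminus.
move=> X u sX Fu; rewrite -[X]thetaK -[u]J_J J_pi; apply: J_Fplus; apply: Fplus_pi.
exact: J_Fminus.
Qed.
End Inversion.

Section Transposition.
Variable C : numClosedFieldType.
Local Notation F4 := (ratfun C (2 * 2)).
Local Notation V := (tens C (2 * 2)).
Local Notation Zg := (@Zg C).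
Local Notation Ng := (@Ng C).
Local Notation W := (invmx Zg).
Local Notation pdz := (@pdz C).
Local Notation delg := (@delg C).
Local Notation cmx := (@cmx (2 * 2) C).
Local Notation rcst := (@rcst C (2 * 2)).
Local Notation pi := (@pi_dl C).
Local Notation pidr := (@pi_dr C).
Local Notation wt := (fun k : 'I_(2 * 2) => mxvec Zg^T 0 k).
Local Notation wi := (fun k : 'I_(2 * 2) => mxvec W 0 k).
Local Notation T := (rsubst wt).
Local Notation mT := (map_mx T).

Lemma ZgT i j : Zg^T i j = Zg j i. Proof. by rewrite mxE. Qed.
Lemma wtE i j : wt (mxvec_index i j) = Zg j i.
Proof. by rewrite [LHS]mxvecE ZgT. Qed.

Lemma wt_dual : forall k, exists D, [/\ derivation D,
  forall c : C, D (rcst c) = 0 & forall j, D (wt j) = (j == k)%:R].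
Proof.
move=> k; have [a [b ->]] := index_pair k.
exists (pdz b a); split; [exact: pdz_der | by move=> c; exact: pdz_rcst |].
move=> l; have [i [j ->]] := index_pair l; rewrite wtE pdz_Zg mxvec_index_eq.
by rewrite andbC ![_ == a]eq_sym ![_ == b]eq_sym.
Qed.

Lemma mT_Z : mT Zg = Zg^T.
Proof. by apply/matrixP => i j; rewrite (mS_Zg wt_dual) wtE ZgT. Qed.

Lemma T_T x : T (T x) = x.
Proof.
have SD := S_add wt_dual; have SM := S_mul wt_dual; have S1 := S_1 wt_dual.
apply: (rmorph_rat_eq (f := fun x => T (T x)) (g := id)) => //.
- by move=> u v; rewrite !SD.
- by move=> u v; rewrite !SM.
- by rewrite !S1.
- by move=> c; rewrite !(S_rcst wt_dual).
move=> k; have [i [j ->]] := index_pair k.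
have E a b : T (Zg a b) = Zg b a by have /matrixP/(_ a b) := mT_Z; rewrite !mxE.
by rewrite -ZgE !E.
Qed.

Lemma mT_W : mT W = W^T.
Proof.
have : mT W *m mT Zg = 1%:M.
  rewrite -(mS_mul wt_dual) (WZ C); apply/matrixP => i j; rewrite !mxE.
  by case: (i == j); [exact (S_1 wt_dual) | exact (S_0 wt_dual)].
rewrite mT_Z => /(congr1 (mulmx^~ W^T)).
by rewrite /= -mulmxA -trmx_mul (WZ C) trmx1 mulmx1 mul1mx.
Qed.

Lemma T_S x : T (rsubst wi x) = rsubst wi (T x).
Proof.
have SD := S_add wt_dual; have SM := S_mul wt_dual; have S1 := S_1 wt_dual.
have SD' := S_add (@wi_dual C); have SM' := S_mul (@wi_dual C); have S1' := S_1 (@wi_dual C).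
apply: (rmorph_rat_eq (f := fun x => T (rsubst wi x)) (g := fun x => rsubst wi (T x))).
- by move=> u v; rewrite SD' SD.
- by move=> u v; rewrite SM' SM.
- by rewrite S1' S1.
- by move=> u v; rewrite SD SD'.
- by move=> u v; rewrite SM SM'.
- by rewrite S1 S1'.
- by move=> c; rewrite (S_rcst (@wi_dual C)) !(S_rcst wt_dual) (S_rcst (@wi_dual C)).
move=> k; have [i [j ->]] := index_pair k; rewrite -ZgE.
have E a b : T (Zg a b) = Zg b a by have /matrixP/(_ a b) := mT_Z; rewrite !mxE.
have E' a b : rsubst wi (Zg a b) = W a b by have /matrixP/(_ a b) := mS_Z C; rewrite mxE.
have E'' a b : T (W a b) = W b a by have /matrixP/(_ a b) := mT_W; rewrite !mxE.
by rewrite E E' E'' E'.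
Qed.

Lemma T_N : T Ng = Ng.
Proof. by rewrite (mS_det wt_dual) mT_Z det_tr. Qed.

(** The substitution of Z^T for Z. Rows and columns are both encoded by 2 x 2 matrices, so the
    tensor itself is kept. *)
Definition tau (f : V) : V := mT (f : 'M_2).

Lemma tauK f : tau (tau f) = f.
Proof. by apply/matrixP => i j; rewrite !mxE T_T. Qed.
Lemma tau_lin (a : C) u v : tau (a *: u + v) = a *: tau u + tau v.
Proof. by rewrite tens_addE tens_scaleE /tau (mS_add wt_dual) (mS_scale wt_dual) (S_rcst wt_dual). Qed.

Lemma pi_dr_Lop_eq (K : fieldType) (t : 'I_2 -> 'I_2 -> K -> K) (Z A B L D g : 'M[K]_2) :
  - (map_mx (dv (A *m Z) t) g + \tr A *: g) - (A^T *m g + g *m A) - map_mx (dv B t) g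
  + (map_mx (dv (Z *m L *m Z) t) g + \tr (Z *m L) *: g + (Z *m L)^T *m g + g *m (Z *m L))
  + map_mx (dv (Z *m D) t) g =
  Lop t 1 (xiX Z A B L D) ((Z *m L)^T - A^T) g.
Proof.
rewrite /Lop /xiX; apply/matrixP => i j; rewrite /mxtrace /dv.
do 5!rewrite ?mxE ?sum2.
ring.
Qed.

(** Here membership in sp(4) is essential: with D = -A^T and L symmetric, the multiplier (Z L)^T -
    A^T of [pi_dr] becomes that of [pi_dl] at Z^T. *)
Lemma pi_dr_Lop X (g : V) : sp4 X ->
  pidr X g = Lop delg 1 (xiG X) (nuX Zg^T (cmx (dlsubmx X)) (cmx (drsubmx X))) g.
Proof.
case=> _ LT DE.
have -> : nuX Zg^T (cmx (dlsubmx X)) (cmx (drsubmx X)) =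
    (Zg *m cmx (dlsubmx X))^T - (cmx (ulsubmx X))^T.
  have LT' : (cmx (dlsubmx X))^T = cmx (dlsubmx X) by rewrite cmxT LT.
  by rewrite /nuX DE cmxN -cmxT trmx_mul LT'.
exact (pi_dr_Lop_eq delg Zg (cmx (ulsubmx X)) (cmx (ursubmx X)) (cmx (dlsubmx X)) (cmx (drsubmx X)) g).
Qed.

Lemma xiX_tr (K : fieldType) (Z A B L : 'M[K]_2) : B^T = B -> L^T = L ->
  (xiX Z A B L (- A^T))^T = xiX Z^T A B L (- A^T).
Proof.
move=> BT LT; rewrite /xiX mulmxN !(trB, trD, trN, trmx_mul) trmxK BT LT mulmxA mulmxN.
by congr (_ - _); rewrite -!addrA; congr (_ + _); rewrite addrC.
Qed.

Lemma mT_xiG X : sp4 X -> mT (xiG X) = (xiG X)^T.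
Proof.
case=> BT LT DE; rewrite /xiG (mS_xiX wt_dual) !(mS_cmx wt_dual) mT_Z DE cmxN -cmxT.
by rewrite xiX_tr // cmxT ?BT ?LT.
Qed.

Lemma tau_pi X f : sp4 X -> pidr X (tau f) = tau (pi X f).
Proof.
move=> sX; rewrite pi_dr_Lop // pi_dl_Lop /tau.
have mn : mT (nuG X) = nuX Zg^T (cmx (dlsubmx X)) (cmx (drsubmx X)).
  by rewrite /nuG (mS_nuX wt_dual) !(mS_cmx wt_dual) mT_Z.
have H := mS_Lop wt_dual (xiG X) (nuG X) f; rewrite mn in H.
refine (etrans _ (esym H)); rewrite /Lop mul1r.
have -> : map_mx (dv (xiG X) delg) (mT (f : 'M_2)) = mT (map_mx (dv (xiG X) delg) (f : 'M_2)).
  apply/matrixP => i j; rewrite !mxE.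
  apply: (dv_S wt_dual (f i j) (dv_der _) (dv_rcst _)).
  by rewrite mT_Z der_trmx delg_Zg mT_xiG.
by [].
Qed.

Lemma T_poly x : is_poly x -> is_poly (T x).
Proof.
move=> [p ->]; apply: (S_closed wt_dual (P := @is_poly C (2 * 2))).
- exact: poly_rcst.
- exact: poly_add.
- exact: poly_mul.
- by move=> i j; rewrite mT_Z mxE; exact: poly_Zg.
Qed.
Lemma T_poly_inv x : is_poly_inv Ng x -> is_poly_inv Ng (T x).
Proof.
move=> [p [k ->]]; have [q qE] : is_poly (T (ofpoly p)) by apply: T_poly; exists p.
exists q, k; rewrite (S_mul wt_dual) (S_inv wt_dual) qE.
suff -> : T (Ng ^+ k) = Ng ^+ k by [].
elim: k => [|k IH]; first by rewrite expr0 (S_1 wt_dual).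
by rewrite exprS (S_mul wt_dual) IH T_N.
Qed.
Lemma pdz_T i j x : pdz i j (T x) = T (pdz j i x).
Proof.
rewrite (der_S wt_dual x (@pdz_der C i j) (fun c => @pdz_rcst C i j c)) mT_Z !sum2 !ZgT !pdz_Zg.
by move: i j; apply: ord2P; apply: ord2P; rewrite /= ?(mulr0, mulr1, addr0, add0r).
Qed.

Lemma GplusE (g : V) : Gplus g <-> [/\ (g : 'M_2)^T = g, poly_mx g &
  forall i b, pdz 1 i (g 0 b) = pdz 0 i (g 1 b)].
Proof.
have two := two4_neq0 C.
have tr1 b : (\sum_c nabla c 1 (g c b) = 0) <-> (pdz 1 0 (g 0 b) = pdz 0 0 (g 1 b)).
  by rewrite sum2; exact (half_eqN (pdz 1 0 (g 0 b)) (pdz 0 0 (g 1 b)) two).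
have tr0 b : (\sum_c nabla c 0 (g c b) = 0) <-> (pdz 1 1 (g 0 b) = pdz 0 1 (g 1 b)).
  by rewrite sum2; exact (half_eq (pdz 1 1 (g 0 b)) (pdz 0 1 (g 1 b)) two).
split=> [[gT gp g1 g2]|[gT gp gD]]; split=> //.
- by apply: ord2P => b; [apply/tr1; exact: g1 | apply/tr0; exact: g1].
- by apply: ord2P => b; [apply/tr0; exact: gD | apply/tr1; exact: gD].
- have gs a c : g a c = g c a by rewrite -{1}gT mxE.
  move=> a b; under eq_bigr => c _ do rewrite (gs a c).
  by move: b a; apply: ord2P => a; [apply/tr0; exact: gD | apply/tr1; exact: gD].
Qed.

Lemma tau_sym (f : V) : (f : 'M_2)^T = f -> (tau f : 'M_2)^T = tau f.
Proof. by move=> fT; apply/matrixP => i j; rewrite !mxE -{1}fT mxE. Qed.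

Lemma tau_Fplus f : Fplus f -> Gplus (tau f).
Proof.
move=> /FplusE[fT fp fD]; apply/GplusE; split; first exact: tau_sym.
  by move=> i j; rewrite mxE; exact: T_poly.
by move=> i b; rewrite !mxE !pdz_T fD.
Qed.
Lemma tau_Gplus g : Gplus g -> Fplus (tau g).
Proof.
move=> /GplusE[gT gp gD]; apply/FplusE; split; first exact: tau_sym.
  by move=> i j; rewrite mxE; exact: T_poly.
by move=> i b; rewrite !mxE !pdz_T gD.
Qed.

Lemma tau_J f : tau (J f) = Ng^-1 *: (W^T *m at_inv (tau f) *m W).
Proof.
rewrite /tau /J (mS_scale wt_dual) !(mS_mul wt_dual) mS_tr mT_W trmxK (S_inv wt_dual) T_N.
suff -> : mT (at_inv f) = at_inv (tau f) by [].
apply/matrixP => i j; rewrite [LHS]mxE [at_inv f i j]mxE [RHS]mxE [tau f i j]mxE.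
exact (T_S (f i j)).
Qed.

Lemma tau_Fminus f : Fminus f -> Gminus (tau f).
Proof.
move=> [fT fp fF]; split; first exact: tau_sym.
  by move=> i j; rewrite mxE; exact: T_poly_inv.
by rewrite -tau_J; exact: tau_Fplus.
Qed.
Lemma tau_Gminus g : Gminus g -> Fminus (tau g).
Proof.
move=> [gT gp gG]; split; first exact: tau_sym.
  by move=> i j; rewrite mxE; exact: T_poly_inv.
rewrite -/(J (tau g)) -[J (tau g)]tauK tau_J tauK; exact: tau_Gplus.
Qed.

Lemma tau_iso (U U' : set V) : submodule (@sp4 C) pi U ->
  (forall f, U f -> U' (tau f)) -> (forall g, U' g -> U (tau g)) ->
  isomorphic_modules (@sp4 C) pi U pidr U'.
Proof.
move=> sU UU' U'U; split=> //; split.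
  split; first split.
  - have := UU' _ (lsub0 sU.1); have := tau_lin (-1) 0 0.
    by rewrite scaler0 addr0 scaleN1r addNr => ->.
  - move=> a u v Uu Uv; rewrite -[u]tauK -[v]tauK -tau_lin; apply: UU'.
    by apply: sU.1.2; exact: U'U.
  move=> X u sX Uu; rewrite -[u]tauK tau_pi //; apply: UU'.
  by apply: sU.2 => //; exact: U'U.
exists tau; split=> [|a u v _ _|X u sX _].
- split=> [u /UU' //|u v _ _ E|v /U'U Uv]; first by rewrite -[u]tauK E tauK.
  by exists (tau v) => //; exact: tauK.
- exact: tau_lin.
- by rewrite tau_pi.
Qed.
End Transposition.

(** * Twisting by the inversion, and the isomorphisms of the two summands with F+ and F- *)

Section Twist.
Variables (C : numClosedFieldType) (V : lmodType C).
Variable act : 'M[C]_(2 + 2) -> V -> V.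
Hypothesis sA : sp4_act act.
Definition twist (X : 'M[C]_(2 + 2)) : V -> V := act (theta X).

Lemma twist_sp4 : sp4_act twist.
Proof.
have [[L D B] Z] := sA; split; first split.
- by move=> X a u v sX; apply: L; exact: theta_sp4.
- by move=> X Y u sX sY; rewrite /twist thetaD D //; exact: theta_sp4.
- by move=> X Y u sX sY _; rewrite /twist theta_br (B (theta X) (theta Y) u (theta_sp4 sX) (theta_sp4 sY) I).
- by move=> c X u sX; rewrite /twist thetaZ Z //; exact: theta_sp4.
Qed.
Lemma twist_submodule U : submodule (@sp4 C) twist U <-> submodule (@sp4 C) act U.
Proof.
split=> -[sU H]; split=> // X u sX; last by apply: H; exact: theta_sp4.
by have := H (theta X) u (theta_sp4 sX); rewrite /twist thetaK.
Qed.
Lemma twist_irreducible U : irreducible_module (@sp4 C) act U -> irreducible_module (@sp4 C) twist U.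
Proof.
by move=> [/twist_submodule sU U0 H]; split=> // U' /twist_submodule; exact: H.
Qed.
Lemma theta_A A : theta (spm A 0 0) = (- 1) *: spm A^T 0 0 :> 'M[C]_(2 + 2).
Proof.
rewrite /theta /spm block_mxKul block_mxKur block_mxKdl block_mxKdr scale_block_mx trmxK.
by rewrite !scaler0 !scaleN1r opprK.
Qed.
Lemma twist_A A u : twist (spm A 0 0) u = - act (spm A^T 0 0) u.
Proof.
have [_ Z] := sA; rewrite /twist theta_A Z ?scaleN1r //.
by apply: spm_sp4; rewrite trmx0.
Qed.
Lemma twist_e u : op_e twist u = - op_f act u.
Proof. by rewrite /op_e /op_f /eX /fX twist_A mx2T scalerN. Qed.
Lemma twist_f u : op_f twist u = - op_e act u.
Proof. by rewrite /op_e /op_f /eX /fX twist_A mx2T scalerN. Qed.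
Lemma twist_h u : op_h twist u = - op_h act u.
Proof. by rewrite /op_h /hX twist_A mx2T. Qed.
Lemma twist_d u : op_d twist u = - op_d act u.
Proof. by rewrite /op_d /dX twist_A mx2T. Qed.
End Twist.

Section QuotientIso.
Variable C : numClosedFieldType.
Local Notation S := (@E_gen C).
Local Notation rho2 := (@rho2 C).
Local Notation rhoq := (qact (S := S) rho2).
Local Notation pi := (@pi_dl C).
Local Notation lowq := (lowq C).
Local Notation wq := (wq C).
Local Notation eq := (op_e rhoq).

Lemma rhoq_sp4 : sp4_act rhoq.
Proof. by split=> [|c X u]; [exact: rhoq_lie | exact: rhoq_scale]. Qed.

Lemma wq_d p : op_d rhoq (wq p) = (- 2 * (deg p.1)%:~R - 2) *: wq p.
Proof. exact (wq_eigen C p None). Qed.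

Lemma Qplus_iso : isomorphic_modules (@sp4 C) rhoq (QS (@Dp)) pi (@Fplus C).
Proof.
have D0 : Dp (true, 0, 0%N) by [].
apply: (lowest_iso rhoq_sp4 (pi_dl_sp4 C) (v1 := lowq (true, 0, 0%N)) (v2 := low4 C)).
- exact: Qplus_irreducible.
- exact: Fplus_irreducible.
- apply: lspan_min; first exact: graded_sub.
  move=> _ [p [[Dpp _] ->]]; apply: lspan_gen; exists (deg p.1); split; last exact: wq_d.
  by case: p Dpp => -[[t k] l] i; rewrite /Dp /deg /=; lia.
- exact: Fplus_graded.
- exact: (QS_wq (p := ((true, 0, 0%N), 0%N)) D0).
- by apply: Fplus_cst; exact: mx2_sym.
- by apply: lowq_neq0; exact: Dp_allowed.
- exact: low4_neq0.
- split; [exact: lowq_f | exact: (lowq_h C (true, 0, 0%N)) | exact: (lowq_d C (true, 0, 0%N)) |].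
  exact: (lowq_top C (true, 0, 0%N)).
- exact: lowest_low4.
Qed.

Lemma opp_iter3 (V : lmodType C) (f : V -> V) u : (forall v, f (- v) = - f v) ->
  f (f (f u)) = 0 -> iter 3 (fun v => - f v) u = 0.
Proof. by move=> fN f0; rewrite /= !fN opprK f0 oppr0. Qed.
Lemma lower3 (V : lmodType C) (f : V -> V) (v w u : V) (r s : C) :
  (forall r v, f (r *: v) = r *: f v) -> f v = r *: w -> f w = s *: u -> f u = 0 ->
  f (f (f v)) = 0.
Proof. by move=> fZ fv fw fu; rewrite fv fZ fw !fZ fu !scaler0. Qed.

(** The label of N^(-3/2) T_0, in the top degree -3 of the second summand. The twist negates d,
    which turns degree n into -n - 2 and hence -3 into 1, and it exchanges e and f up to sign, so
    the vector to start from is the other end [v0] of the string. *)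
Let a0 : bool * int * nat := (true, - 2, 0%N).
Let v0 := iter 2 eq (lowq a0).

Lemma lowest_twist : lowest (twist rhoq) v0.
Proof.
have lie := rhoq_lie C; have sc := @rhoq_scale C.
have ee := op_e_lin lie; have ff := op_f_lin lie.
have F := f_string ee (o_ef lie sc) (o_he lie sc) (lowq_f C a0) (lowq_h C a0).
have fN v : op_f rhoq (- v) = - op_f rhoq v.
  by rewrite -scaleN1r (phiZ (phi := fun _ : unit => op_f rhoq) (fun _ => ff) tt) scaleN1r.
have fZ r v : op_f rhoq (r *: v) = r *: op_f rhoq v.
  exact: (phiZ (phi := fun _ : unit => op_f rhoq) (fun _ => ff) tt).
split.
- by rewrite (twist_f rhoq_sp4) -[X in - X]/(iter 3 eq (lowq a0)) (lowq_top C a0) oppr0.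
- rewrite (twist_h rhoq_sp4) /v0 (h_string ee (o_he lie sc) (lowq_h C a0)) -scaleNr; congr (_ *: _).
  by rewrite /=; ring.
- rewrite (twist_d rhoq_sp4) (wq_d (a0, 2)) -scaleNr; congr (_ *: _).
  by rewrite /dval /deg /=; ring.
rewrite (eq_iter (twist_e rhoq_sp4)).
exact (opp_iter3 fN (lower3 fZ (F 1%N) (F 0%N) (lowq_f C a0))).
Qed.

Lemma Qminus_twist_iso : isomorphic_modules (@sp4 C) (twist rhoq) (QS (@Dm)) pi (@Fplus C).
Proof.
have D0 : Dm a0 by [].
have lie := rhoq_lie C; have sc := @rhoq_scale C.
apply: (lowest_iso (twist_sp4 rhoq_sp4) (pi_dl_sp4 C) (v1 := v0) (v2 := low4 C)).
- by apply: twist_irreducible; exact: Qminus_irreducible.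
- exact: Fplus_irreducible.
- apply: lspan_min; first exact: graded_sub.
  move=> _ [p [[Dpp _] ->]]; apply: lspan_gen; exists (- deg p.1 - 2); split.
    by case: p Dpp => -[[[] k] l] i; rewrite /Dm /deg /=; lia.
  rewrite (twist_d rhoq_sp4) wq_d -scaleNr; congr (_ *: _).
  by rewrite /dval intrB intrN; ring.
- exact: Fplus_graded.
- exact: (QS_wq (p := (a0, 2)) D0).
- by apply: Fplus_cst; exact: mx2_sym.
- apply: (string_neq0 (op_e_lin lie) (op_f_lin lie) (o_ef lie sc) (o_he lie sc) (lowq_f C a0) (lowq_h C a0)) => //.
  by apply: lowq_neq0; exact: Dm_allowed.
- exact: low4_neq0.
- exact: lowest_twist.
- exact: lowest_low4.
Qed.

(** [J] intertwines [pi_dl] with its twist by [theta], so following the isomorphism onto F+ by [J]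
    removes the twist and ends in F-. *)
Lemma Qminus_iso : isomorphic_modules (@sp4 C) rhoq (QS (@Dm)) pi (@Fminus C).
Proof.
have [sQ [sF [f [[fF finj fsurj] flin fact]]]] := Qminus_twist_iso.
split; first exact/twist_submodule.
split; first exact: Fminus_submodule.
exists (fun u => J (f u)); split=> [|a u v Uu Uv|X u sX Uu].
- split=> [u Uu|u v Uu Uv E|w Fw].
  + by apply: J_Fplus; exact: fF.
  + have E' : J (J (f u)) = J (J (f v)) := congr1 (@J C) E.
    exact (finj u v Uu Uv (etrans (esym (J_J (f u))) (etrans E' (J_J (f v))))).
  + have [u Uu fu] := fsurj (J w) (J_Fminus Fw).
    exists u; first exact: Uu.
    rewrite fu; exact: J_J.
- by rewrite flin // J_lin.
- have := fact (theta X) u (theta_sp4 sX) Uu; rewrite /twist thetaK => ->.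
  by rewrite -J_pi thetaK.
Qed.
End QuotientIso.

Theorem theorem97 (R : realType) :
  let C : numClosedFieldType := R[i] in
  let sp : set 'M[C]_(2 + 2) := @sp4 C in
  let W : set (tens C 3) := @W_half C in
  let E : set (tens C 3) := lspan (@E_gen C) in
  (* the quotient map, and the induced action on the quotient, by E *)
  let q : tens C 3 -> quot (@E_gen C) := qpi (@E_gen C) in
  let rhoq := qact (S := @E_gen C) (@rho2 C) in
  let Qplus := q @` lspan (\bigcup_(j in Dplus) @Kplus C j) in
  let Qminus := q @` lspan (\bigcup_(j in Dminus) @Kminus C j) in
  [/\ E `<=` W /\ submodule sp (@rho2 C) E,
      dsum2 (q @` W) Qplus Qminus,
      irreducible_module sp rhoq Qplus /\ irreducible_module sp rhoq Qminus,
      has_Ktypes rhoq Dplus (fun j => q @` lspan (@Kplus C j)) Qplus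
      /\ has_Ktypes rhoq Dminus (fun j => q @` lspan (@Kminus C j)) Qminus
    & [/\ isomorphic_modules sp rhoq Qplus (@pi_dl C) (@Fplus C),
          isomorphic_modules sp (@pi_dl C) (@Fplus C) (@pi_dr C) (@Gplus C),
          isomorphic_modules sp rhoq Qminus (@pi_dl C) (@Fminus C)
        & isomorphic_modules sp (@pi_dl C) (@Fminus C) (@pi_dr C) (@Gminus C)]].
Proof.
move=> C sp W E q rhoq Qplus Qminus.
have QpE : Qplus = QS Dp := image_Ktypes labp_Dp (@lspan_Kplus C).
have QmE : Qminus = QS Dm := image_Ktypes labm_Dm (@lspan_Kminus C).
rewrite QpE QmE; split.
- split; last exact: E_submodule.
  by rewrite /E lspan_E; exact: Pspan_W.
- exact: quotient_dsum.
- by split; [exact: Qplus_irreducible | exact: Qminus_irreducible].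
- split; split.
  + exact: (K_dsum labp_Dp labp_inj (@lspan_Kplus C)).
  + exact: (K_irreducible labp_Dp (@lspan_Kplus C) Dp_allowed).
  + exact: (K_dsum labm_Dm labm_inj (@lspan_Kminus C)).
  + exact: (K_irreducible labm_Dm (@lspan_Kminus C) Dm_allowed).
split.
- exact: Qplus_iso.
- apply: tau_iso; [|exact: tau_Fplus | exact: tau_Gplus].
  by have [] := Fplus_irreducible C.
- exact: Qminus_iso.
- apply: tau_iso; [exact: Fminus_submodule | exact: tau_Fminus | exact: tau_Gminus].
Qed.
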